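(* Let $\Lambda\subset(0,\infty)$ be finite or countable. a) Each irreducible unitary representation of $\mathbb I_\Lambda$ is induced from an irreducible representation $\nu$ of some group $\mathbb I^\bullet\{\mathrm B_j\}$ which is trivial on the subgroup $\mathbb I\{\mathrm B_j\}$, where $\{\mathrm B_j\}=\{\mathrm B^{\epsilon_x}(x,r_x)\}_{x\in X}$ is the collection of balls of a labeled finite subset $X\subset\mathbb U_\Lambda$. b) Two irreducible representations obtained in this way are equivalent if and only if the corresponding configurations of balls are $\mathbb I_\Lambda$-equivalent and (under the resulting identification of the finite groups) the corresponding representations of $\mathbb I^\bullet\{\mathrm B_j\}/\mathbb I\{\mathrm B_j\}$ are equivalent. c) The group $\mathbb I_\Lambda$ has type $I$. d) Any unitary representation of $\mathbb I_\Lambda$ is a direct integral of irreducible representations.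
   Context: An ultrametric space is a metric space with $d(x,z)\le\max(d(x,y),d(y,z))$; its spectrum is its set of nonzero distances. $\mathbb U_\Lambda$ is the ultrametric Urysohn space: the unique (up to isometry) complete separable ultrametric space with spectrum $\Lambda$ such that for any finite ultrametric spaces $X\subset Y$ with spectra in $\Lambda$, each isometric embedding $X\to\mathbb U_\Lambda$ extends to an isometric embedding $Y\to\mathbb U_\Lambda$. $\mathbb I_\Lambda$ is the group of all bijective isometries of $\mathbb U_\Lambda$ with the topology of pointwise convergence (a Polish group). Unitary representations are continuous homomorphisms to the unitary group (strong operator topology) of a separable Hilbert space. A group has type $I$ if for every unitary representation the von Neumann algebra generated by its operators is of type $I$. Balls: $\mathrm B^c(a,r)=\{x:d(a,x)\le r\}$, $\mathrm B^o(a,r)=\{x:d(a,x)<r\}$. Let $\Lambda^{+0}=\Lambda$ if $0$ is a limit point of $\Lambda$ and $\Lambda^{+0}=\Lambda\cup\{0\}$ otherwise; let $\Lambda^\circ$ be the set of limits $r\in\mathbb R$ of strictly increasing sequences in $\Lambda$. A $\Lambda$-perfect pair is $(c,r)$ with $r\in\Lambda^{+0}$, or $(o,r)$ with $r\in\Lambda^\circ$; if $\Lambda$ is unbounded, $(o,\infty)$ is also allowed, $\mathrm B^o(a,\infty)=\mathbb U_\Lambda$. Labeling: let $X\subset\mathbb U_\Lambda$ be a nonempty finite subset and $d_x=\min_{y\in X,y\ne x}d(x,y)$ ($d_x=\infty$ if $X=\{x\}$). A labeling of $X$ assigns to each $x\in X$ a $\Lambda$-perfect pair $(\epsilon_x,r_x)$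 with $r_x<d_x$ if $\epsilon_x=c$ and $r_x\le d_x$ if $\epsilon_x=o$. The balls $\mathrm B^{\epsilon_x}(x,r_x)$ are then pairwise disjoint. $\mathbb I\{\mathrm B^{\epsilon_x}(x,r_x)\}\subset\mathbb I_\Lambda$ is the subgroup of isometries sending each of these balls to itself; $\mathbb I^\bullet\{\mathrm B^{\epsilon_x}(x,r_x)\}$ is the subgroup of isometries sending the union $\bigcup_{x\in X}\mathrm B^{\epsilon_x}(x,r_x)$ to itself. Both are open; the first is normal of finite index in the second, and the quotient is isomorphic to the group of isometries of $X$ preserving the labeling. Two configurations are $\mathbb I_\Lambda$-equivalent if some $g\in\mathbb I_\Lambda$ sends the union of the balls of one to the union of the balls of the other; conjugation by $g$ then identifies the corresponding groups $\mathbb I^\bullet$ and $\mathbb I$ and their finite quotients. For an open subgroup $H$ of a separable topological group $G$ and a unitary representation $\nu$ of $H$ in $V$, the induced representation $\mathrm{Ind}_H^G(\nu)$ acts by right translations in the Hilbert space of functions $F:G\to V$ with $F(hg)=\nu(h)F(g)$ for $h\in H$ and $\sum_{Hg\in H\backslash G}\|F(g)\|^2<\infty$. *)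

(* Defs.v *)
From HB Require Import structures.
From mathcomp Require Import all_boot all_order all_algebra.
From mathcomp Require Import sesquilinear complex.
From mathcomp Require Import all_classical all_reals all_analysis.

Set Implicit Arguments.
Unset Strict Implicit.
Unset Printing Implicit Defensive.

Import Order.TTheory GRing.Theory Num.Theory.
Import numFieldNormedType.Exports.

Local Open Scope classical_set_scope.
Local Open Scope ring_scope.

Definition separable_space (T : topologicalType) : Prop :=
  exists2 D : set T, countable D & dense D.

Section urysohn.
Context {R : realType}.

Definition ultrametric (T : Type) (d : T -> T -> R) : Prop :=
  [/\ forall x y, 0 <= d x y,
      forall x y, d x y = 0 <-> x = y,
      forall x y, d x y = d y x &
      forall x y z, d x z <= Num.max (d x y) (d y z)].

Definition dist_spectrum (T : Type) (d : T -> T -> R) : set R :=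
  [set r | r != 0 /\ exists x y, d x y = r].

(* The subset X may be empty, which forces U to be nonempty. *)
Definition is_urysohn (L : set R) (U : metricType R) : Prop :=
  [/\ ultrametric (@mdist R U),
      dist_spectrum (@mdist R U) = L,
      (forall F : set_system U, ProperFilter F -> cauchy F ->
        exists x : U, F --> x),
      separable_space U &
      forall (Y : finType) (d : Y -> Y -> R) (X : {set Y})
          (f : {x | x \in X} -> U),
        ultrametric d -> dist_spectrum d `<=` L ->
        (forall x y, mdist (f x) (f y) = d (val x) (val y)) ->
        exists g : Y -> U,
          (forall x y, mdist (g x) (g y) = d x y) /\
          forall x, g (val x) = f x].

End urysohn.

HB.mixin Record isTopologicalGroup G of Topological G & Group G := {
  mulg_continuous : continuous (fun p : G * G => (p.1 * p.2)%g) ;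
  invg_continuous : continuous (fun g : G => (g^-1)%g)
}.

#[short(type="topologicalGroupType")]
HB.structure Definition TopologicalGroup :=
  {G of Topological G & Group G & isTopologicalGroup G}.

Section isometry_group.
Context {R : realType} (U : metricType R).

Definition is_isometry (f : U -> U) : Prop :=
  bijective f /\ forall x y, mdist (f x) (f y) = mdist x y.

Record isom := Isom { isom_fun :> U -> U ; isomP : is_isometry isom_fun }.

Lemma isom_eq (f g : isom) : (forall x, f x = g x) -> f = g.
Proof.
case: f g => [f fP] [g gP] /= /funext fg.
by case: _ / fg gP => gP; congr Isom; exact: Prop_irrelevance.
Qed.

Lemma is_isometry_id : is_isometry id.
Proof. by split => //; exists id. Qed.

Lemma is_isometry_comp (f g : isom) : is_isometry (f \o g).
Proof.
case: f g => [f [fb fd]] [g [gb gd]]; split; first exact: bij_comp.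
by move=> x y /=; rewrite fd gd.
Qed.

Lemma isom_inv_ex (f : isom) :
  {h : isom | (forall x, h (f x) = x) /\ (forall x, f (h x) = x)}.
Proof.
apply: cid; case: f => [f [[h hK Kh] fd]].
suff hP : is_isometry h by exists (Isom hP).
by split; [exists f | move=> x y; rewrite -fd !Kh].
Qed.

HB.instance Definition _ := gen_eqMixin isom.
HB.instance Definition _ := gen_choiceMixin isom.

Definition isom1 : isom := Isom is_isometry_id.
Definition isomM (f g : isom) : isom := Isom (is_isometry_comp f g).
Definition isomV (f : isom) : isom := sval (isom_inv_ex f).

Lemma isomVK (f : isom) x : isomV f (f x) = x.
Proof. by have [] := svalP (isom_inv_ex f). Qed.

Lemma isomKV (f : isom) x : f (isomV f x) = x.
Proof. by have [] := svalP (isom_inv_ex f). Qed.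

Lemma isomMA : associative isomM.
Proof. by move=> f g h; exact: isom_eq. Qed.

Lemma isom1M : left_id isom1 isomM.
Proof. by move=> f; exact: isom_eq. Qed.

Lemma isomM1 : right_id isom1 isomM.
Proof. by move=> f; exact: isom_eq. Qed.

Lemma isomVM : left_inverse isom1 isomV isomM.
Proof. by move=> f; apply: isom_eq => x /=; rewrite isomVK. Qed.

Lemma isomMV : right_inverse isom1 isomV isomM.
Proof. by move=> f; apply: isom_eq => x /=; rewrite isomKV. Qed.

HB.instance Definition _ :=
  isGroup.Build isom isomMA isom1M isomM1 isomVM isomMV.

HB.instance Definition _ :=
  Topological.copy isom
    (initial_topology (isom_fun : isom -> {ptws U -> U})).

Lemma cvg_isomP (F : set_system isom) (f : isom) : Filter F ->
  F --> f <-> forall x, (fun g : isom => g x) @ F --> f x.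
Proof.
move=> FF; split=> [Ff x|Ff].
  have : {ptws, (isom_fun @ F) --> (isom_fun f : U -> U)}.
    exact: cvg_comp Ff (@initial_continuous _ _ _ f).
  by move=> /pointwise_cvgP; exact.
have Fptws : {ptws, isom_fun @ F --> isom_fun f} by apply/pointwise_cvgP.
move=> A /= [_ [[B Bop <-] Bf BA]].
have : nbhs (isom_fun f : {ptws U -> U}) B by exact: open_nbhs_nbhs.
by move=> /Fptws FB; exact: (filterS BA FB).
Qed.

Lemma cvg_isom_dist (F : set_system isom) (f : isom) (x : U) (e : R) :
  Filter F -> 0 < e -> F --> f ->
  \forall g \near F, mdist (f x) (isom_fun g x) < e.
Proof.
move=> FF e0 /cvg_isomP/(_ x)/metricType_numDomainType.cvgrPdist_lt.
exact.
Qed.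

Lemma isom_mul_continuous : continuous (fun p : isom * isom => (p.1 * p.2)%g).
Proof.
move=> [f g]; apply/cvg_isomP => x.
apply/metricType_numDomainType.cvgrPdist_lt => e e0.
suff: \forall p \near (nbhs f, nbhs g),
    mdist (isom_fun f (isom_fun g x)) (isom_fun p.1 (isom_fun p.2 x)) < e.
  exact.
have e20 : 0 < e / 2 by rewrite divr_gt0.
have near_f := @cvg_isom_dist (nbhs f) f (g x) _ _ e20 (@cvg_id _ _).
have near_g := @cvg_isom_dist (nbhs g) g x _ _ e20 (@cvg_id _ _).
exists ([set h : isom | mdist (f (g x)) (isom_fun h (g x)) < e / 2],
        [set h : isom | mdist (g x) (isom_fun h x) < e / 2]) => /=.
  by split; [exact: near_f | exact: near_g].
move=> [h k] /= [hfg kg].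
rewrite (le_lt_trans (metric_triangle _ (h (g x)) _))//.
by rewrite [e]splitr ltrD// (isomP h).2.
Qed.

Lemma isom_inv_continuous : continuous (fun f : isom => (f^-1)%g).
Proof.
move=> f; apply/(cvg_isomP _ (fmap_filter _ (nbhs_filter f))) => x.
apply/metricType_numDomainType.cvgrPdist_lt => e e0.
apply: filterS (@cvg_isom_dist (nbhs f) f (isomV f x) _ _ e0 (@cvg_id _ _)).
move=> g /=; rewrite isomKV -{1}(isomP (isomV g)).2 isomVK metric_sym.
exact.
Qed.

HB.instance Definition _ :=
  isTopologicalGroup.Build isom isom_mul_continuous isom_inv_continuous.

End isometry_group.

(* The inner product is linear in its first argument. *)
HB.mixin Record CompleteNormedModule_isHilbert (R : realType) V
    of CompleteNormedModule R[i] V := {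
  ip : {dot V for (@Num.conj R[i])} ;
  ip_norm : forall v : V, `|v| ^+ 2 = ip v v
}.

#[short(type="hilbertType")]
HB.structure Definition Hilbert (R : realType) :=
  {V of CompleteNormedModule R[i] V & CompleteNormedModule_isHilbert R V}.

Section operators.
Context {R : realType}.
Implicit Types V W : hilbertType R.

(* The squared norm as an element of R; the library norm lies in R[i]. *)
Definition sqnorm V (v : V) : R := complex.Re (ip v v).

Definition linear_subspace V (S : set V) : Prop :=
  S 0 /\ forall (a : R[i]) u v, S u -> S v -> S (a *: u + v).

Definition lspan V (s : nat -> V) : set V :=
  [set v | exists n (c : nat -> R[i]), v = \sum_(i < n) c i *: s i].

Definition unitary_op V W (T : V -> W) : Prop :=
  [/\ linear T, range T = setT & forall u v, ip (T u) (T v) = ip u v].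

Definition bounded_op V : set (V -> V) := [set T | linear T /\ continuous T].

Definition adjoint_op V (S T : V -> V) : Prop :=
  forall u v, ip (S u) v = ip u (T v).

Definition commutant V (M : set (V -> V)) : set (V -> V) :=
  [set T | bounded_op T /\ forall S, M S -> S \o T = T \o S].

Definition von_neumann_algebra V (M : set (V -> V)) : Prop :=
  [/\ M `<=` @bounded_op V,
      (forall S T, M S -> bounded_op T -> adjoint_op S T -> M T) &
      commutant (commutant M) = M].

Definition von_neumann_generated V (M : set (V -> V)) : set (V -> V) :=
  smallest (@von_neumann_algebra V) M.

Definition projection_in V (M : set (V -> V)) (p : V -> V) : Prop :=
  [/\ M p, p \o p = p & adjoint_op p p].

Definition central_projection V (M : set (V -> V)) (p : V -> V) : Prop :=
  projection_in M p /\ forall S, M S -> S \o p = p \o S.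

Definition abelian_projection V (M : set (V -> V)) (p : V -> V) : Prop :=
  projection_in M p /\
  forall S T, M S -> M T ->
    (p \o S \o p) \o (p \o T \o p) = (p \o T \o p) \o (p \o S \o p).

Definition type_I_algebra V (M : set (V -> V)) : Prop :=
  forall z, central_projection M z -> z <> cst 0 ->
    exists e, [/\ abelian_projection M e, e <> cst 0 & z \o e = e].

End operators.

(* A representation of a subgroup H of G is given by a function on G of which
   only the values on H matter; representations of G itself are those with
   H = setT. *)
Section representations.
Context {R : realType} {G : topologicalGroupType}.
Implicit Types (H : set G) (V W : hilbertType R).

Definition unitary_rep H V (rho : G -> V -> V) : Prop :=
  [/\ separable_space V,
      (forall g, H g -> unitary_op (rho g)),
      rho 1%g = id,
      (forall g h, H g -> H h -> rho (g * h)%g = rho g \o rho h) &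
      forall v, {within H, continuous (fun g => rho g v)}].

Definition irreducible_rep H V (rho : G -> V -> V) : Prop :=
  [/\ unitary_rep H rho,
      (exists v : V, v <> 0) &
      forall S : set V, closed S -> linear_subspace S ->
        (forall g v, H g -> S v -> S (rho g v)) ->
        S = [set 0] \/ S = setT].

Definition equivalent_rep H V W (rho : G -> V -> V) (sigma : G -> W -> W) :
    Prop :=
  exists T : V -> W, unitary_op T /\
    forall g v, H g -> T (rho g v) = sigma g (T v).

Definition right_cosets H : set (set G) :=
  [set [set (h * g)%g | h in H] | g in setT].

(* The sum of `|F g|^2 over the right cosets H g; for F in [induced_space] it
   does not depend on the representative chosen by [xget] in each coset. *)
Definition coset_sqnorm H V (F : G -> V) : \bar R :=
  (\esum_(K in right_cosets H) (sqnorm (F (xget 1%g K)))%:E)%E.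

Definition induced_space H V (nu : G -> V -> V) : set (G -> V) :=
  [set F | (forall h g, H h -> F (h * g)%g = nu h (F g)) /\
           (coset_sqnorm H F < +oo)%E].

(* rho is unitarily equivalent, via Phi, to the right translation action of G
   on the Hilbert space [induced_space H nu]. *)
Definition is_induced H V (nu : G -> V -> V) W (rho : G -> W -> W) : Prop :=
  exists Phi : W -> G -> V,
    [/\ linear Phi,
        range Phi = induced_space H nu,
        (forall w, coset_sqnorm H (Phi w) = (sqnorm w)%:E) &
        forall g w x, Phi (rho g w) x = Phi w (x * g)%g].

End representations.

Definition type_I_group (R : realType) (G : topologicalGroupType) : Prop :=
  forall (W : hilbertType R) (rho : G -> W -> W),
    unitary_rep setT rho -> type_I_algebra (von_neumann_generated (range rho)).

Definition standard_borel (R : realType) (d : measure_display)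
    (Z : measurableType d) : Prop :=
  exists f : Z -> R,
    [/\ injective f, measurable_fun setT f &
        forall A : set Z, measurable A -> measurable (f @` A)].

Section direct_integral.
Context {R : realType} {d : measure_display} {Z : measurableType d}.
Variables (mu : {measure set Z -> \bar R}) (K : Z -> hilbertType R).
Local Notation section := (forall z, K z).

Definition measurable_complex (f : Z -> R[i]) : Prop :=
  measurable_fun setT (fun z => complex.Re (f z)) /\
  measurable_fun setT (fun z => complex.Im (f z)).

(* S is the set of measurable sections of the field K of Hilbert spaces. *)
Record measurable_field (S : set section) : Prop := MeasurableField {
  field_linear : forall (a : R[i]) s t, S s -> S t ->
    S (fun z => a *: s z + t z) ;
  field_norm : forall s, S s -> measurable_fun setT (fun z => sqnorm (s z)) ;
  field_maximal : forall t : section,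
    (forall s, S s -> measurable_complex (fun z => ip (t z) (s z))) -> S t ;
  field_total : exists s : nat -> section,
    (forall n, S (s n)) /\ forall z, closure (lspan (s ^~ z)) = setT
}.

Definition square_integrable (S : set section) : set section :=
  [set s | S s /\ (\int[mu]_z (sqnorm (s z))%:E < +oo)%E].

(* rho is unitarily equivalent, via Phi, to the direct integral of the pi z;
   elements of the direct integral are square integrable measurable sections
   up to equality almost everywhere. *)
Definition is_direct_integral (G : topologicalGroupType) (S : set section)
    (pi : forall z, G -> K z -> K z) (W : hilbertType R) (rho : G -> W -> W) :
    Prop :=
  [/\ measurable_field S,
      (forall g s, S s -> S (fun z => pi z g (s z))) &
      exists Phi : W -> section,
        [/\ forall w, square_integrable S (Phi w),
            (forall (a : R[i]) u v,
              {ae mu, forall z, Phi (a *: u + v) z = a *: Phi u z + Phi v z}),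
            (forall s, square_integrable S s ->
              exists w, {ae mu, forall z, Phi w z = s z}),
            (forall w, (\int[mu]_z (sqnorm (Phi w z))%:E = (sqnorm w)%:E)%E) &
            forall g w, {ae mu, forall z, Phi (rho g w) z = pi z g (Phi w z)}]].

End direct_integral.

Definition direct_integral_of_irreducibles (R : realType)
    (G : topologicalGroupType) (W : hilbertType R) (rho : G -> W -> W) : Prop :=
  exists (d : measure_display) (Z : measurableType d)
      (mu : {sigma_finite_measure set Z -> \bar R})
      (K : Z -> hilbertType R) (S : set (forall z, K z))
      (pi : forall z, G -> K z -> K z),
    [/\ standard_borel R Z, forall z, irreducible_rep setT (pi z) &
        is_direct_integral mu S pi rho].

Variant ball_kind := closed_ball_kind | open_ball_kind.

Section labelings.
Context {R : realType} (L : set R) (U : metricType R).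

Definition spectrum_with0 : set R :=
  [set r | L r \/ (r = 0 /\ ~ limit_point L 0)].

Definition increasing_limits : set R :=
  [set r | exists u : R^nat,
    [/\ increasing_seq u, (forall n, L (u n)) & u @ \oo --> r]].

Definition perfect_pair (e : ball_kind) (r : \bar R) : Prop :=
  match e with
  | closed_ball_kind => exists2 t, spectrum_with0 t & r = t%:E
  | open_ball_kind => (exists2 t, increasing_limits t & r = t%:E) \/
                      (~ has_ubound L /\ r = +oo%E)
  end.

Definition kball (e : ball_kind) (a : U) (r : \bar R) : set U :=
  match e with
  | closed_ball_kind => [set x | ((mdist a x)%:E <= r)%E]
  | open_ball_kind => [set x | ((mdist a x)%:E < r)%E]
  end.

(* This is +oo when X = [set x]. *)
Definition min_dist (X : set U) (x : U) : \bar R :=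
  ereal_inf [set (mdist x y)%:E | y in X `\ x].

(* The labels of points outside of the support are irrelevant. *)
Record labeled_set := LabeledSet {
  label_support : set U ;
  label_kind : U -> ball_kind ;
  label_radius : U -> \bar R ;
  support_finite : finite_set label_support ;
  support_nonempty : label_support !=set0 ;
  label_perfect : forall x, label_support x ->
    perfect_pair (label_kind x) (label_radius x) ;
  label_lt : forall x, label_support x ->
    match label_kind x with
    | closed_ball_kind => (label_radius x < min_dist label_support x)%E
    | open_ball_kind => (label_radius x <= min_dist label_support x)%E
    end
}.

Definition label_ball (B : labeled_set) (x : U) : set U :=
  kball (label_kind B x) x (label_radius B x).

Definition balls_union (B : labeled_set) : set U :=
  \bigcup_(x in label_support B) label_ball B x.

Definition ball_stabilizer (B : labeled_set) : set (isom U) :=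
  [set g : isom U | forall x, label_support B x ->
    g @` label_ball B x = label_ball B x].

Definition union_stabilizer (B : labeled_set) : set (isom U) :=
  [set g : isom U | g @` balls_union B = balls_union B].

(* Representations of the finite quotient of the union stabilizer by the ball
   stabilizer are those of the union stabilizer trivial on the latter. *)
Definition ball_rep (B : labeled_set) (V : hilbertType R)
    (nu : isom U -> V -> V) : Prop :=
  irreducible_rep (union_stabilizer B) nu /\
  forall g, ball_stabilizer B g -> nu g = id.

End labelings.

(* Main.v *)
From HB Require Import structures.
From mathcomp Require Import all_boot all_order all_algebra all_fingroup.
From mathcomp Require Import sesquilinear complex ring lra.
From mathcomp Require Import all_classical all_reals all_analysis measurable_realfun.
Require Import Defs.

Set Implicit Arguments.
Unset Strict Implicit.
Unset Printing Implicit Defensive.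

Import Order.TTheory GRing.Theory Num.Theory.
Import numFieldNormedType.Exports.

Local Open Scope classical_set_scope.
Local Open Scope ring_scope.

(* Write P x m for the projection onto the vectors fixed by the isometries that
   move each centre x_i by at most m_i. By ultrahomogeneity two such projections
   in general position are independent, so that, for a minimal number of centres,
   a representation has a nonzero corner e on which the P x m commute and every
   e rho(g) e is a scalar multiple of some P x m e.

   In an irreducible representation each P x m is 0 or 1 on e; the radii m with
   value 1 form an ideal, which is the same as a labeling of the centres, and the
   representation is induced from the stabilizer of the corresponding balls. Two
   induced representations are equivalent only if each configuration of balls has
   a translate inside the other, which forces the configurations to agree.

   In general the algebra cut down to e is abelian, whence type I. A sequence of
   binary digits that satisfies the relations among the P x m on a vector xi = e xi
   determines an ideal of radii, hence an irreducible representation in l^2 of the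
   cosets; the spectral measure of xi on digit sequences integrates these to the
   cyclic space of xi, and countably many such cyclic spaces exhaust a separable
   representation. *)

(** * Hilbert space geometry *)

(** In general the group carries no Haar measure, so projections onto fixed vectors are obtained as
    elements of least norm in closed convex hulls of orbits. Independence is a product formula:
    [P x r] times [P y s] is [P y t], where [t] is the maximum of [s] and the distance by which
    [stab x r] can move each [y j]. When the number of centres is minimal, radii that do not
    separate the centres make one of them redundant and give 0; for the others the formula becomes
    the pointwise maximum of radii.

    The obstacle is the finite symmetry. An isometric permutation of the centres may or may not be
    visible to the projections [P x m]. The corner is therefore cut until each permutation is either
    invisible or separated by some [m]; the invisible isometric ones form a group [F], whose group
    algebra contributes a minimal projection [b]. The coefficients of [b] are the scalars in
    [e rho(g) e], and up to normalisation they occur again in an explicit model on l^2 of cosets.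
    Equality of these two matrix coefficients, point by point, is what makes the direct integral an
    isometry. *)

Section hilbert_geometry.
Context {R : realType}.
Implicit Types V W : hilbertType R.
Local Notation C := R[i].
Local Notation "a %:C" := (real_complex_def (Phant _) a) : ring_scope.

Section one_space.
Context {V : hilbertType R}.
Implicit Types (u v w : V) (a : R).

Lemma ipDl u v w : ip (u + v) w = ip u w + ip v w.
Proof. by rewrite linearDl. Qed.
Lemma ipDr u v w : ip u (v + w) = ip u v + ip u w.
Proof. by rewrite linearDr. Qed.
Lemma ipZl (c : C) u w : ip (c *: u) w = c * ip u w.
Proof. by rewrite linearZl_LR. Qed.
Lemma ipZr (c : C) u w : ip u (c *: w) = c^*%C * ip u w.
Proof. by rewrite linearZr_LR. Qed.
Lemma ipC u w : ip u w = (ip w u)^*%C.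
Proof. by rewrite (@hermC _ _ _ _ (@ip R V)) /= expr0 mul1r. Qed.
Lemma ip0l w : ip (0 : V) w = 0.
Proof. by rewrite linear0l. Qed.
Lemma ip0r w : ip w (0 : V) = 0.
Proof. by rewrite linear0r. Qed.
Lemma ipNl u w : ip (- u) w = - ip u w.
Proof. by rewrite linearNl. Qed.
Lemma ipNr u w : ip u (- w) = - ip u w.
Proof. by rewrite linearNr. Qed.
Lemma ipBl u v w : ip (u - v) w = ip u w - ip v w.
Proof. by rewrite ipDl ipNl. Qed.
Lemma ipBr u v w : ip u (v - w) = ip u v - ip u w.
Proof. by rewrite ipDr ipNr. Qed.
Lemma ip_suml (I : Type) (r : seq I) (P : pred I) (F : I -> V) w :
  ip (\sum_(i <- r | P i) F i) w = \sum_(i <- r | P i) ip (F i) w.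
Proof. by apply: (big_morph (ip^~ w)) => [u v|]; rewrite ?ipDl ?ip0l. Qed.
Lemma ip_sumr (I : Type) (r : seq I) (P : pred I) (F : I -> V) w :
  ip w (\sum_(i <- r | P i) F i) = \sum_(i <- r | P i) ip w (F i).
Proof. by apply: (big_morph (ip w)) => [u v|]; rewrite ?ipDr ?ip0r. Qed.

(** Minimisation and limits take place over [R]; [ip_eq] recovers the complex inner product from
    this real one, because its imaginary part is the real inner product with ['i *: v]. *)
Definition rip u v : R := complex.Re (ip u v).

Lemma ripC u v : rip u v = rip v u.
Proof. by rewrite /rip ipC; case: (ip v u). Qed.
Lemma ripDl u v w : rip (u + v) w = rip u w + rip v w.
Proof. by rewrite /rip ipDl raddfD. Qed.
Lemma ripDr u v w : rip u (v + w) = rip u v + rip u w.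
Proof. by rewrite /rip ipDr raddfD. Qed.
Lemma ripNl u w : rip (- u) w = - rip u w.
Proof. by rewrite /rip ipNl raddfN. Qed.
Lemma ripNr u w : rip u (- w) = - rip u w.
Proof. by rewrite /rip ipNr raddfN. Qed.
Lemma ripBl u v w : rip (u - v) w = rip u w - rip v w.
Proof. by rewrite ripDl ripNl. Qed.
Lemma ripBr u v w : rip u (v - w) = rip u v - rip u w.
Proof. by rewrite ripDr ripNr. Qed.
Lemma rip0l w : rip 0 w = 0. Proof. by rewrite /rip ip0l. Qed.
Lemma rip0r w : rip w 0 = 0. Proof. by rewrite /rip ip0r. Qed.
Lemma ripZl a u w : rip (a%:C *: u) w = a * rip u w.
Proof. by rewrite /rip ipZl; case: (ip u w) => x y /=; rewrite mul0r subr0. Qed.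
Lemma ripZr a u w : rip u (a%:C *: w) = a * rip u w.
Proof. by rewrite ripC ripZl ripC. Qed.
Lemma rip_suml (I : Type) (r : seq I) (P : pred I) (F : I -> V) w :
  rip (\sum_(i <- r | P i) F i) w = \sum_(i <- r | P i) rip (F i) w.
Proof. by apply: (big_morph (rip^~ w)) => [u v|]; rewrite ?ripDl ?rip0l. Qed.

Lemma Im_ip u v : complex.Im (ip u v) = rip u ('i%C *: v).
Proof. by rewrite /rip ipZr; case: (ip u v) => x y /=; ring. Qed.

Lemma ip_self v : ip v v = (sqnorm v)%:C.
Proof.
rewrite /sqnorm; have := ipC v v; case: (ip v v) => x y [] h; congr (_ +i* _)%C.
by move/eqP: h; rewrite -addr_eq0 -mulr2n mulrn_eq0 /= => /eqP.
Qed.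

Lemma sqnorm_rip v : sqnorm v = rip v v. Proof. by []. Qed.

Lemma sqnorm_ge0 v : 0 <= sqnorm v.
Proof. by rewrite -lecR -ip_self -ip_norm exprn_ge0. Qed.

Lemma sqnorm_eq0 v : (sqnorm v == 0) = (v == 0).
Proof.
apply/eqP/eqP => [h|->]; last by rewrite sqnorm_rip rip0l.
have : `|v| ^+ 2 = 0 by rewrite ip_norm ip_self h.
by move/eqP; rewrite sqrf_eq0 normr_eq0 => /eqP.
Qed.

Lemma sqnorm0 : sqnorm (0 : V) = 0. Proof. by apply/eqP; rewrite sqnorm_eq0. Qed.

Lemma sqnorm_gt0 v : (0 < sqnorm v) = (v != 0).
Proof. by rewrite lt0r sqnorm_ge0 andbT sqnorm_eq0. Qed.

Lemma sqnormD u v : sqnorm (u + v) = sqnorm u + 2 * rip u v + sqnorm v.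
Proof. by rewrite !sqnorm_rip !ripDl !ripDr (ripC v u); ring. Qed.

Lemma sqnormN v : sqnorm (- v) = sqnorm v.
Proof. by rewrite !sqnorm_rip ripNl ripNr opprK. Qed.

Lemma sqnormB u v : sqnorm (u - v) = sqnorm u - 2 * rip u v + sqnorm v.
Proof. by rewrite sqnormD sqnormN ripNr; ring. Qed.

Lemma parallelogram u v :
  sqnorm (u + v) + sqnorm (u - v) = 2 * sqnorm u + 2 * sqnorm v.
Proof. by rewrite sqnormD sqnormB; ring. Qed.

Lemma sqnormZ (c : C) v :
  sqnorm (c *: v) = (complex.Re c ^+ 2 + complex.Im c ^+ 2) * sqnorm v.
Proof.
rewrite /sqnorm ipZl ipZr ip_self; case: c => x y /=; ring.
Qed.

Lemma sqnormZr a v : sqnorm (a%:C *: v) = a ^+ 2 * sqnorm v.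
Proof. by rewrite sqnormZ /= expr0n addr0. Qed.

Lemma CauchySchwarz u v : rip u v ^+ 2 <= sqnorm u * sqnorm v.
Proof.
have [->|v0] := eqVneq v 0; first by rewrite rip0r sqnorm0 mulr0 expr0n.
have v1 : 0 < sqnorm v by rewrite sqnorm_gt0.
have := sqnorm_ge0 ((sqnorm v)%:C *: u - (rip u v)%:C *: v).
rewrite sqnormB !sqnormZr ripZl ripZr => h.
have : 0 <= sqnorm v * (sqnorm u * sqnorm v - rip u v ^+ 2) by nra.
by rewrite pmulr_rge0// subr_ge0.
Qed.

Definition hn v : R := Num.sqrt (sqnorm v).

Lemma hn_ge0 v : 0 <= hn v. Proof. exact: sqrtr_ge0. Qed.
Lemma hn_sqr v : hn v ^+ 2 = sqnorm v.
Proof. by rewrite sqr_sqrtr// sqnorm_ge0. Qed.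
Lemma hn0 : hn 0 = 0. Proof. by rewrite /hn sqnorm0 sqrtr0. Qed.
Lemma hn_eq0 v : (hn v == 0) = (v == 0).
Proof. by rewrite -sqnorm_eq0 -hn_sqr sqrf_eq0. Qed.
Lemma hn_gt0 v : (0 < hn v) = (v != 0).
Proof. by rewrite lt0r hn_ge0 andbT hn_eq0. Qed.
Lemma hnN v : hn (- v) = hn v. Proof. by rewrite /hn sqnormN. Qed.
Lemma hnB u v : hn (u - v) = hn (v - u). Proof. by rewrite -hnN opprB. Qed.

Lemma CauchySchwarz_hn u v : `|rip u v| <= hn u * hn v.
Proof.
rewrite -ler_sqr ?nnegrE ?mulr_ge0 ?hn_ge0// real_normK ?num_real//.
by rewrite exprMn !hn_sqr CauchySchwarz.
Qed.

Lemma hnD u v : hn (u + v) <= hn u + hn v.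
Proof.
rewrite -ler_sqr ?nnegrE ?addr_ge0 ?hn_ge0// hn_sqr sqnormD sqrrD !hn_sqr.
have := CauchySchwarz_hn u v; rewrite ler_norml => /andP[_].
by rewrite mulr2n; lra.
Qed.

Lemma hn_tri u v w : hn (u - w) <= hn (u - v) + hn (v - w).
Proof. by rewrite -(subrKA v u); exact: hnD. Qed.

Definition cmod (c : C) : R := Num.sqrt (complex.Re c ^+ 2 + complex.Im c ^+ 2).

Lemma hnZ (c : C) v : hn (c *: v) = cmod c * hn v.
Proof. by rewrite /hn sqnormZ sqrtrM// addr_ge0// sqr_ge0. Qed.

Lemma normE v : `|v| = (hn v)%:C.
Proof.
apply/eqP; rewrite -(@eqrXn2 _ 2)//; last by rewrite lecR hn_ge0.
by rewrite ip_norm ip_self -hn_sqr rmorphXn.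
Qed.

Lemma rip_self0 v : (forall u, rip v u = 0) -> v = 0.
Proof. by move=> h; apply/eqP; rewrite -sqnorm_eq0 sqnorm_rip h. Qed.

(** Balls of a normed module over [R[i]] have radii in [R[i]], but a positive element of [R[i]] has
    imaginary part zero, so real radii describe the same neighbourhoods. *)
Lemma nbhs_hn v (A : set V) :
  nbhs v A <-> exists2 e : R, 0 < e & forall w, hn (v - w) < e -> A w.
Proof.
split=> [/nbhs_ballP[e /= e0 eA]|[e e0 eA]].
  case: e e0 eA => e e' /= /[dup] e0; rewrite ltcE /= => /andP[/eqP e'0 e1] eA.
  exists e => // w h; apply: eA; rewrite -ball_normE /= normE e'0.
  by rewrite [X in _ < X](_ : _ = e%:C)// ltcR.
apply/nbhs_ballP; exists e%:C => /=; first by rewrite ltcR.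
by move=> w; rewrite -ball_normE /= normE ltcR => /eA.
Qed.

Lemma closed_hn (S : set V) : closed S <->
  forall v, (forall e : R, 0 < e -> exists2 w, S w & hn (v - w) < e) -> S v.
Proof.
split=> [cS v h|h].
  apply: cS => A /nbhs_hn[e e0 eA].
  by have [w Sw /eA Aw] := h _ e0; exists w.
move=> v cv; apply: h => e e0.
have /cv[w [Sw /= wv]] : nbhs v [set w | hn (v - w) < e].
  by apply/nbhs_hn; exists e.
by exists w.
Qed.

Definition seq_lim (u : nat -> V) v :=
  forall e : R, 0 < e -> exists N, forall n, (N <= n)%N -> hn (u n - v) < e.

Lemma seq_cauchy_lim (u : nat -> V) :
  (forall e : R, 0 < e -> exists N, forall m n, (N <= m)%N -> (N <= n)%N ->
     hn (u m - u n) < e) -> exists v, seq_lim u v.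
Proof.
move=> h.
have : cauchy (u @ \oo).
  apply/cauchy_ballP => e /= e0; rewrite near_simpl.
  case: e e0 => e e'; rewrite ltcE /= => /andP[/eqP -> e0].
  have [N hN] := h _ e0.
  exists ([set n | (N <= n)%N], [set n | (N <= n)%N]).
    by split; exists N.
  by move=> [m n] /= [hm hn']; rewrite -ball_normE /= normE ltcR hN.
move=> /cauchy_cvg /cvg_ex[v /= uv]; exists v => e e0.
have : nbhs v [set w | hn (v - w) < e] by apply/nbhs_hn; exists e.
move=> /uv[N _ hN]; exists N => n Nn.
by rewrite hnB; exact: (hN n).
Qed.

Lemma seq_lim_closed (S : set V) (u : nat -> V) v : closed S -> (forall n, S (u n)) ->
  seq_lim u v -> S v.
Proof.
move=> /closed_hn cS Su uv; apply: cS => e /uv[N hN].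
by exists (u N) => //; rewrite hnB; exact: hN.
Qed.

Lemma seq_lim_rip (u : nat -> V) v w : seq_lim u v ->
  forall e : R, 0 < e -> exists N, forall n, (N <= n)%N -> `|rip (u n) w - rip v w| < e.
Proof.
move=> uv e e0.
have h0 : 0 < hn w + 1 by rewrite ltr_wpDl// hn_ge0.
have [N hN] := uv _ (divr_gt0 e0 h0); exists N => n /hN.
rewrite ltr_pdivlMr// => h; rewrite -ripBl.
apply: (le_lt_trans (CauchySchwarz_hn _ _)); apply: le_lt_trans h.
by rewrite ler_wpM2l ?hn_ge0// lerDl.
Qed.

Lemma hn_le_lt0 v : (forall e : R, 0 < e -> hn v < e) -> v = 0.
Proof.
move=> h; apply/eqP; apply: contraT; rewrite -hn_gt0 => /h.
by rewrite ltxx.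
Qed.

End one_space.

Lemma ip_eq V W (u v : V) (u' v' : W) : rip u v = complex.Re (ip u' v') ->
  rip u ('i%C *: v) = complex.Re (ip u' ('i%C *: v')) -> ip u v = ip u' v'.
Proof.
move=> h; rewrite -Im_ip => h'; apply/eqP; rewrite eq_complex -/(rip _ _) h h'.
by rewrite !ipZr; case: (ip u' v') => x y /=; apply/andP; split; apply/eqP; ring.
Qed.

Lemma separable_hn V (s : nat -> V) :
  (forall v e, 0 < e -> exists n, hn (v - s n) < e) -> separable_space V.
Proof.
move=> h; exists (range s); first exact: card_image_le.
move=> O [v Ov] oO; have : nbhs v O by exact: open_nbhs_nbhs.
move=> /nbhs_hn[e e0 eO]; have [n /eO Osn] := h v e e0.
by exists (s n); split => //; exists n.
Qed.

Lemma separable_seq V : separable_space V ->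
  exists s : nat -> V, forall v e, 0 < e -> exists n, hn (v - s n) < e.
Proof.
move=> [D cD dD].
have D0 : D !=set0.
  by have := dD setT; case=> [||x []]; [exists 0|exact: openT|exists x].
have [s Ds] : exists s : nat -> V, D `<=` range s.
  have [d Dd] := D0.
  case/pfcard_geP : cD => [D00|[f]].
    by exists (fun=> 0); rewrite D00.
  exists f; exact: surj.
exists s => v e e0.
have [||w [/= vw /Ds[n _ nw]]] := dD [set w | hn (v - w) < e].
- by exists v => /=; rewrite subrr hn0.
- rewrite openE => w /= vw; apply/nbhs_hn.
  exists (e - hn (v - w)); rewrite ?subr_gt0// => x wx.
  by apply: (le_lt_trans (hn_tri _ w _)); lra.
- by exists n; rewrite nw.
Qed.

End hilbert_geometry.
Arguments seq_lim {R V}.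

Section linear_maps.
Context {K : nzRingType} {V W : lmodType K} (f : V -> W).
Hypothesis fl : linear f.
Let fL : {linear V -> W} := HB.pack f (GRing.isLinear.Build K V W *:%R f fl).
Lemma lin0 : f 0 = 0. Proof. exact: (linear0 fL). Qed.
Lemma linD u v : f (u + v) = f u + f v. Proof. exact: (linearD fL). Qed.
Lemma linB u v : f (u - v) = f u - f v. Proof. exact: (linearB fL). Qed.
Lemma linZ a u : f (a *: u) = a *: f u. Proof. exact: (linearZZ fL). Qed.
Lemma lin_sum (I : Type) (r : seq I) (P : pred I) (F : I -> V) :
  f (\sum_(i <- r | P i) F i) = \sum_(i <- r | P i) f (F i).
Proof. exact: (linear_sum fL). Qed.
End linear_maps.

Lemma invn_lt (R : realType) (e : R) : 0 < e -> exists N, forall n, (N <= n)%N -> n.+1%:R^-1 < e.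
Proof.
move=> e0; exists (Num.truncn e^-1) => n Nn.
rewrite -[e]invrK ltf_pV2 ?posrE ?invr_gt0//.
have := truncnS_gt e^-1; move/lt_le_trans; apply.
by rewrite ler_nat ltnS.
Qed.

Section projections.
Context {R : realType}.
Implicit Types V W : hilbertType R.
Local Notation C := R[i].
Local Notation "a %:C" := (real_complex_def (Phant _) a) : ring_scope.

Definition mid V (u v : V) : V := (2^-1)%:C *: (u + v).

(** Closure under midpoints is enough for the parallelogram argument, and it passes through the
    two-case induction on hulls below. *)
Definition midconvex V (S : set V) := forall u v, S u -> S v -> S (mid u v).

Lemma mid_linear V W (f : V -> W) u v : linear f -> f (mid u v) = mid (f u) (f v).
Proof. by move=> fl; rewrite /mid (linZ fl) (linD fl). Qed.

Lemma midxx V (u : V) : mid u u = u.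
Proof.
rewrite /mid -mulr2n -[u *+ 2](scaler_nat 2) scalerA -(rmorph_nat (real_complex R) 2).
by rewrite -rmorphM /= mulVf ?pnatr_eq0// rmorph1 scale1r.
Qed.

Lemma rip_mid V (u v w : V) : rip (mid u v) w = 2^-1 * (rip u w + rip v w).
Proof. by rewrite ripZl ripDl. Qed.

(** By the parallelogram law a minimising sequence is Cauchy. The inequality for [m] is the
    variational characterisation of the point nearest to 0; it is tested on the dyadic points [x n]
    of the segment from [m] to [c], which midpoint convexity provides. *)
Lemma min_norm V (S : set V) : closed S -> S !=set0 -> midconvex S ->
  exists2 m, S m & forall c, S c -> sqnorm m <= rip m c.
Proof.
move=> cS [s0 Ss0] mS; pose E := [set sqnorm c | c in S]; pose d := inf E.
have hE : has_inf E by split; [exists (sqnorm s0), s0|exists 0 => _ [c _ <-]; exact: sqnorm_ge0].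
have dle c : S c -> d <= sqnorm c.
  by move=> Sc; apply: ge_inf; [case: hE|exists c].
have close u v : S u -> S v ->
    sqnorm (u - v) <= 2 * (sqnorm u - d) + 2 * (sqnorm v - d).
  move=> Su Sv; have := dle _ (mS _ _ Su Sv); rewrite sqnormZr => h.
  by have := parallelogram u v; nra.
have ex (n : nat) : exists c, S c /\ sqnorm c < d + n.+1%:R^-1.
  have n0 : 0 < n.+1%:R^-1 :> R by rewrite invr_gt0.
  by have [_ [c Sc <-] h] := inf_adherent n0 hE; exists c.
have [u uP] := choice ex.
have [m um] : exists m, seq_lim u m.
  apply: seq_cauchy_lim => e e0.
  have [N hN] := @invn_lt R (e ^+ 2 / 4) (divr_gt0 (exprn_gt0 2 e0) (ltr0Sn R 3)).
  exists N => i j /hN hi /hN hj; have [Si si] := uP i; have [Sj sj] := uP j.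
  rewrite -ltr_sqr ?nnegrE ?hn_ge0 ?(ltW e0)// hn_sqr.
  have := close _ _ Si Sj; move: (sqnorm _) (sqnorm _) (sqnorm _) si sj.
  by move: (i.+1%:R^-1) (j.+1%:R^-1) (e ^+ 2) hi hj => a b c ha hb x y z; lra.
have Sm : S m by apply: seq_lim_closed um => // n; case: (uP n).
have close' c : S c -> sqnorm (m - c) <= 2 * (sqnorm m - d) + 2 * (sqnorm c - d).
  by move=> Sc; exact: close.
have md : sqnorm m = d.
  apply/eqP; rewrite eq_le dle// andbT; apply/ler_addgt0Pr => e e0.
  have h0 : 0 < 2 * hn m + 1 by rewrite ltr_wpDl// mulr_ge0 ?hn_ge0.
  have [N hN] := um _ (divr_gt0 e0 (mulr_gt0 (ltr0Sn R 1) h0)).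
  have [N' hN'] := @invn_lt R (e / 2) (divr_gt0 e0 (ltr0Sn R 1)).
  have [_ sn] := uP (maxn N N').
  have := hN' _ (leq_maxr N N'); have := hN _ (leq_maxl N N').
  move: (u _) sn => c sc; rewrite ltr_pdivlMr ?mulr_gt0// => hc hd.
  have := CauchySchwarz_hn m (c - m); rewrite ripBr -sqnorm_rip ler_norml => /andP[h _].
  have := sqnorm_ge0 (c - m); rewrite sqnormB ripC.
  have := hn_ge0 m; have := hn_ge0 (c - m); move: hc h; move: (hn (c - m)) (hn m) (rip m c).
  by move: (sqnorm c) (sqnorm m) ((maxn N N').+1%:R^-1) sc hd => a b f sc hd x y z; nra.
exists m => // c Sc; rewrite leNgt; apply/negP => lt.
pose x := fix x n := if n is k.+1 then mid m (x k) else c.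
have Sx n : S (x n) by elim: n => //= n IH; exact: mS.
have xE n : x n = m + (2^-1 ^+ n)%:C *: (c - m).
  elim: n => [|n IH] /=; first by rewrite expr0 scale1r addrC subrK.
  rewrite IH /mid addrA scalerDr -mulr2n scalerA -rmorphM /= exprS; congr (_ + _).
  rewrite mulr2n; exact: midxx.
have : forall n, 0 <= 2 * rip m (c - m) + 2^-1 ^+ n * sqnorm (c - m).
  move=> n; have := dle _ (Sx n); rewrite -md xE sqnormD ripZr sqnormZr.
  have : 0 < (2^-1 : R) ^+ n by rewrite exprn_gt0.
  by move: (_ ^+ n) => t; nra.
rewrite ripBr -sqnorm_rip => h.
have [n hn] : exists n, (2^-1 : R) ^+ n * sqnorm (c - m) < 2 * (sqnorm m - rip m c).
  have := @cvg_geometric R (sqnorm (c - m)) 2^-1.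
  rewrite ger0_norm// invf_lt1// ltr1n => /(_ isT) /cvgrPdist_lt.
  have e0 : 0 < 2 * (sqnorm m - rip m c) by lra.
  move=> /(_ _ e0)[N _ /(_ N (leqnn _))]; rewrite sub0r normrN => hN.
  exists N; apply: le_lt_trans hN; rewrite /= /geometric /= mulrC.
  exact: ler_norm.
by have := h n; lra.
Qed.

Definition closed_subspace V (S : set V) := closed S /\ linear_subspace S.

Lemma subspace0 V (S : set V) : linear_subspace S -> S 0. Proof. by case. Qed.
Lemma subspaceZ V (S : set V) (a : C) u : linear_subspace S -> S u -> S (a *: u).
Proof. by move=> [S0 h] Su; rewrite -[_ *: _]addr0; exact: h. Qed.
Lemma subspaceD V (S : set V) u v : linear_subspace S -> S u -> S v -> S (u + v).
Proof. by move=> [S0 h] Su Sv; rewrite -[u]scale1r; exact: h. Qed.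
Lemma subspaceN V (S : set V) u : linear_subspace S -> S u -> S (- u).
Proof. by move=> h Su; rewrite -scaleN1r; exact: subspaceZ. Qed.
Lemma subspaceB V (S : set V) u v : linear_subspace S -> S u -> S v -> S (u - v).
Proof. by move=> h Su Sv; apply: subspaceD => //; exact: subspaceN. Qed.
(** A total function: the default 0 is taken only when no such [p] exists, which [hprojP] rules out
    for a closed subspace. *)
Definition hproj V (S : set V) (v : V) : V :=
  xget 0 [set p | S p /\ forall s, S s -> rip (v - p) s = 0].

(** The element of least norm of the coset [v - S] is orthogonal to [S]: the inequality of
    [min_norm], used in the directions [t] and [- t], leaves only equality. *)
Lemma hprojP V (S : set V) v : closed_subspace S ->
  S (hproj S v) /\ forall s, S s -> rip (v - hproj S v) s = 0.
Proof.
move=> [cS lS]; rewrite /hproj; case: xgetP => [//|/forallNP h]; exfalso.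
pose T := [set v - s | s in S].
have [||x|m [s Ss sm] hm] := @min_norm V T.
- apply/closed_hn => w hw; exists (v - w); last by rewrite subKr.
  move/closed_hn : cS; apply=> e /hw[_ [s Ss <-]] h'; exists s => //.
  by rewrite addrAC hnB.
- by exists (v - 0), 0 => //; exact: subspace0.
- move=> _ [s Ss <-] [t St <-]; exists (mid s t).
    by apply: subspaceZ => //; exact: subspaceD.
  by rewrite -{1}[v]midxx /mid -scalerBr opprD addrACA.
apply: h; exists s; split => // t St.
have k a : S a -> rip m a <= 0.
  move=> Sa; have : T (m - a).
    by exists (s + a); [exact: subspaceD|rewrite -sm opprD addrA].
  by move/hm; rewrite ripBr -sqnorm_rip; lra.
rewrite sm; apply/eqP; rewrite eq_le k//=.
by have := k _ (subspaceN lS St); rewrite ripNr oppr_le0.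
Qed.

Section one_subspace.
Context {V : hilbertType R} (S : set V) (hS : closed_subspace S).
Let lS : linear_subspace S := hS.2.

Lemma hproj_in v : S (hproj S v). Proof. by have [] := hprojP v hS. Qed.

Lemma hproj_rip v s : S s -> rip (hproj S v) s = rip v s.
Proof.
by have [_ h] := hprojP v hS; move=> /h; rewrite ripBl => /eqP; rewrite subr_eq0 => /eqP.
Qed.

Lemma hproj_unique v p : S p -> (forall s, S s -> rip p s = rip v s) -> hproj S v = p.
Proof.
move=> Sp h; apply/eqP; rewrite -subr_eq0 -sqnorm_eq0 sqnorm_rip ripBl.
rewrite hproj_rip ?h ?subrr//; apply: subspaceB => //; exact: hproj_in.
Qed.

Lemma hproj_id v : S v -> hproj S v = v.
Proof. by move=> Sv; exact: hproj_unique. Qed.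

Lemma hproj_idem v : hproj S (hproj S v) = hproj S v.
Proof. by apply: hproj_id; exact: hproj_in. Qed.

Lemma hproj_linear : linear (hproj S).
Proof.
move=> a u v; apply: hproj_unique.
  by apply: lS.2; exact: hproj_in.
move=> s Ss; rewrite !ripDl hproj_rip//; congr (_ + _).
have rZ (w w' : V) : rip (a *: w) w' = rip w (a^*%C *: w').
  by rewrite /rip ipZl ipZr conjcK.
by rewrite !rZ hproj_rip//; exact: subspaceZ.
Qed.

Lemma hproj_adj u v : ip (hproj S u) v = ip u (hproj S v).
Proof.
have h w x : rip (hproj S w) x = rip w (hproj S x).
  rewrite -(hproj_rip w (hproj_in x)) ripC -(hproj_rip x (hproj_in w)) ripC.
  by [].
apply: ip_eq; first exact: h.
by rewrite -(linZ hproj_linear); exact: h.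
Qed.

Lemma sqnorm_hproj v : sqnorm v = sqnorm (hproj S v) + sqnorm (v - hproj S v).
Proof.
have := sqnormD (v - hproj S v) (hproj S v); rewrite subrK => ->.
rewrite ripBl hproj_rip; last exact: hproj_in.
by rewrite subrr mulr0 addr0 addrC.
Qed.

Lemma hn_hproj v : hn (hproj S v) <= hn v.
Proof. by rewrite ler_wsqrtr// (sqnorm_hproj v) lerDl sqnorm_ge0. Qed.

Lemma hproj_eq0 v : (forall s, S s -> rip v s = 0) -> hproj S v = 0.
Proof. by move=> h; apply: hproj_unique => [|s /h ->]; [exact: lS.1|rewrite rip0l]. Qed.

Lemma hproj_sqnorm_id v : sqnorm v <= sqnorm (hproj S v) -> hproj S v = v.
Proof.
rewrite {1}sqnorm_hproj gerDl => h; apply/esym/eqP; rewrite -subr_eq0 -sqnorm_eq0.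
by rewrite eq_le h sqnorm_ge0.
Qed.

End one_subspace.

Lemma hproj_sub V (S S' : set V) v : closed_subspace S -> closed_subspace S' ->
  S `<=` S' -> hproj S' (hproj S v) = hproj S v /\ hproj S (hproj S' v) = hproj S v.
Proof.
move=> hS hS' SS'; split.
  by apply: hproj_id => //; apply: SS'; exact: hproj_in.
apply: hproj_unique => //; first exact: hproj_in.
by move=> s Ss; rewrite hproj_rip// hproj_rip//; exact: SS'.
Qed.

Lemma hproj_unitary V W (T : V -> W) (S : set V) (S' : set W) v :
  closed_subspace S -> closed_subspace S' ->
  linear T -> (forall u v, rip (T u) (T v) = rip u v) -> S' = T @` S ->
  hproj S' (T v) = T (hproj S v).
Proof.
move=> hS hS' Tl Ti S'E; apply: hproj_unique => //.
  by rewrite S'E; exists (hproj S v) => //; exact: hproj_in.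
by rewrite S'E => _ [s Ss <-]; rewrite !Ti hproj_rip.
Qed.

Lemma closure_subspace V (S : set V) : linear_subspace S ->
  closed_subspace [set v | forall e : R, 0 < e -> exists2 s, S s & hn (v - s) < e].
Proof.
move=> lS; split.
  apply/closed_hn => v h e e0.
  have e2 : 0 < e / 2 by rewrite divr_gt0.
  have [w /(_ _ e2)[s Ss ws] vw] := h _ e2; exists s => //.
  by apply: (le_lt_trans (hn_tri _ w _)); lra.
split=> [e e0|a u v hu hv e e0]; first by exists 0; [exact: subspace0|rewrite subrr hn0].
have a0 : 0 < cmod a + 1 by rewrite ltr_wpDl// sqrtr_ge0.
have e2 : 0 < e / 2 by rewrite divr_gt0.
have [s Ss us] := hu _ (divr_gt0 e2 a0); have [t St vt] := hv _ e2.
exists (a *: s + t); first exact: lS.2.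
rewrite opprD addrACA -scalerBr; apply: (le_lt_trans (hnD _ _)).
rewrite hnZ; rewrite ltr_pdivlMr// in us.
have := hn_ge0 (u - s); have : 0 <= cmod a by exact: sqrtr_ge0.
nra.
Qed.

End projections.

Section hulls.
Context {R : realType} {V : hilbertType R}.
Implicit Types (O S : set V) (u v : V).

(** Dyadic convex combinations, generated by midpoints, so that properties of hulls have an
    induction with two cases; the closure [cl_hull] is the closed convex hull. *)
Inductive mid_hull O : V -> Prop :=
| mid_hull_in v of O v : mid_hull O v
| mid_hull_mid u v of mid_hull O u & mid_hull O v : mid_hull O (mid u v).

Definition cl_hull O : set V :=
  [set v | forall e : R, 0 < e -> exists2 s, mid_hull O s & hn (v - s) < e].

Lemma mid_hull_cl O v : mid_hull O v -> cl_hull O v.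
Proof. by move=> Ov e e0; exists v => //; rewrite subrr hn0. Qed.

Lemma cl_hull_closed O : closed (cl_hull O).
Proof.
apply/closed_hn => v h e e0; have e2 : 0 < e / 2 by rewrite divr_gt0.
have [w /(_ _ e2)[s Ss ws] vw] := h _ e2; exists s => //.
by apply: (le_lt_trans (hn_tri _ w _)); lra.
Qed.

Lemma cl_hull_mid O : midconvex (cl_hull O).
Proof.
move=> u v hu hv e e0.
have [s Ss us] := hu _ e0; have [t St vt] := hv _ e0.
exists (mid s t); first exact: mid_hull_mid.
rewrite /mid -scalerBr hnZ /cmod /= expr0n addr0 sqrtr_sqr ger0_norm ?invr_ge0//.
rewrite opprD addrACA; have := hnD (u - s) (v - t).
by move: (hn (u - s)) (hn (v - t)) (hn _) us vt => x y z; lra.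
Qed.

Lemma cl_hull_sub O S : closed S -> midconvex S -> O `<=` S -> cl_hull O `<=` S.
Proof.
move=> /closed_hn cS mS OS v Ov; apply: cS => e /Ov[s Os vs]; exists s => //.
by elim: Os {vs} => [w /OS//|x y _ Sx _ Sy]; exact: mS.
Qed.

Lemma sub_mid_hull O S : O `<=` S -> mid_hull O `<=` mid_hull S.
Proof.
move=> OS v; elim=> [w /OS|x y _ hx _ hy]; first exact: mid_hull_in.
exact: mid_hull_mid.
Qed.

Lemma mid_hull_rip O (w : V) (c : R) :
  (forall v, O v -> rip v w = c) -> forall v, mid_hull O v -> rip v w = c.
Proof.
by move=> h v; elim=> [x /h//|x y _ hx _ hy]; rewrite rip_mid hx hy; lra.
Qed.

End hulls.

Definition subgroup_set (G : groupType) (H : set G) :=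
  [/\ H 1%g, (forall g h, H g -> H h -> H (g * h)%g) & forall g, H g -> H (g^-1)%g].

(** * Vectors fixed by a subgroup *)

Section representation.
Context {R : realType} {G : topologicalGroupType} {V : hilbertType R}.
Context (rho : G -> V -> V) (hrho : unitary_rep setT rho).
Implicit Types (H : set G) (g h : G) (u v : V).

Lemma rep_linear g : linear (rho g).
Proof. by case: hrho => _ /(_ g I)[]. Qed.
Lemma rep_ip g u v : ip (rho g u) (rho g v) = ip u v.
Proof. by case: hrho => _ /(_ g I)[]. Qed.
Lemma rep_rip g u v : rip (rho g u) (rho g v) = rip u v.
Proof. by rewrite /rip rep_ip. Qed.
Lemma rep1 v : rho 1%g v = v.
Proof. by case: hrho => _ _ ->. Qed.
Lemma repM g h v : rho (g * h)%g v = rho g (rho h v).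
Proof. by case: hrho => _ _ _ ->. Qed.
Lemma repK g v : rho (g^-1)%g (rho g v) = v.
Proof. by rewrite -repM mulVg rep1. Qed.
Lemma repVK g v : rho g (rho (g^-1)%g v) = v.
Proof. by rewrite -repM mulgV rep1. Qed.
Lemma rep_adj g u v : ip (rho g u) v = ip u (rho (g^-1)%g v).
Proof. by rewrite -(rep_ip g u) repVK. Qed.
Lemma rep_radj g u v : rip (rho g u) v = rip u (rho (g^-1)%g v).
Proof. by rewrite /rip rep_adj. Qed.
Lemma rep_sqnorm g v : sqnorm (rho g v) = sqnorm v.
Proof. by rewrite !sqnorm_rip rep_rip. Qed.
Lemma rep_hn g v : hn (rho g v) = hn v.
Proof. by rewrite /hn rep_sqnorm. Qed.

Lemma rep_near1 v (e : R) : 0 < e -> nbhs 1%g [set g | hn (rho g v - v) < e].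
Proof.
move=> e0; have [_ _ _ _ /(_ v)] := hrho.
move=> /(_ 1%g) h.
have : nbhs (rho 1%g v) [set w | hn (w - v) < e].
  by rewrite rep1; apply/nbhs_hn; exists e => // w; rewrite hnB.
by move=> /h; rewrite nbhs_subspaceT.
Qed.

Definition fixed H : set V := [set v | forall h, H h -> rho h v = v].

Lemma fixed_closed H : closed_subspace (fixed H).
Proof.
split; last first.
  split=> [h _|a u v hu hv h Hh]; first exact: lin0 (rep_linear h).
  by rewrite rep_linear hu// hv.
apply/closed_hn => v hv h Hh; apply/eqP; rewrite -subr_eq0; apply/eqP/hn_le_lt0 => e e0.
have e2 : 0 < e / 2 by rewrite divr_gt0.
have [w wF vw] := hv _ e2; apply: (le_lt_trans (hn_tri _ w _)).
rewrite -{1}(wF h Hh) -(linB (rep_linear h)) rep_hn.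
by rewrite (hnB w); lra.
Qed.

Definition fixproj H := hproj (fixed H).

Lemma fixproj_in H v h : H h -> rho h (fixproj H v) = fixproj H v.
Proof. by move=> Hh; apply: (hproj_in (fixed_closed H)). Qed.

Lemma fixproj_id H v : fixed H v -> fixproj H v = v.
Proof. by move=> Hv; apply: hproj_id => //; exact: fixed_closed. Qed.

Lemma fixproj_linear H : linear (fixproj H).
Proof. by apply: hproj_linear; exact: fixed_closed. Qed.

Lemma fixproj_adj H u v : ip (fixproj H u) v = ip u (fixproj H v).
Proof. by apply: hproj_adj; exact: fixed_closed. Qed.

Lemma fixproj_radj H u v : rip (fixproj H u) v = rip u (fixproj H v).
Proof. by rewrite /rip fixproj_adj. Qed.

Lemma fixproj_hn H v : hn (fixproj H v) <= hn v.
Proof. by apply: hn_hproj; exact: fixed_closed. Qed.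

Lemma fixprojK H h v : H (h^-1)%g -> fixproj H (rho h v) = fixproj H v.
Proof.
move=> Hh; apply: hproj_unique; [exact: fixed_closed|exact: hproj_in (fixed_closed H) _|].
move=> s sF; rewrite rep_radj sF// hproj_rip//; exact: fixed_closed.
Qed.

Lemma fixproj_sub H K v : H `<=` K ->
  fixproj H (fixproj K v) = fixproj K v /\ fixproj K (fixproj H v) = fixproj K v.
Proof.
move=> HK; apply: hproj_sub; [exact: fixed_closed|exact: fixed_closed|].
by move=> w wK h /HK/wK.
Qed.

Lemma fixproj_conj H K g v : (forall x, K x <-> H (g^-1 * x * g)%g) ->
  fixproj K (rho g v) = rho g (fixproj H v).
Proof.
move=> HK; apply: hproj_unitary; [exact: fixed_closed|exact: fixed_closed|
  exact: rep_linear|by move=> *; rewrite rep_rip|].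
apply/seteqP; split=> [w wK|_ [w wH <-] h /HK Hh].
  exists (rho (g^-1)%g w); last by rewrite repVK.
  by move=> h Hh; rewrite -repM -[in RHS](wK (g * h * g^-1)%g) ?repM ?repK// HK !mulgA mulVg mul1g -mulgA mulVg mulg1.
by rewrite -{2}(wH _ Hh) -[RHS]repM !mulgA mulgV mul1g repM.
Qed.

Section hull.
Context {H : set G} (hH : subgroup_set H).

Definition orbit_set v : set V := [set rho h v | h in H].

Lemma fixproj_cl_hull v w : cl_hull (orbit_set v) w -> fixproj H w = fixproj H v.
Proof.
move=> hw; apply/eqP; rewrite -subr_eq0; apply/eqP/hn_le_lt0 => e /hw[s Os ws].
have <- : fixproj H s = fixproj H v.
  elim: Os {ws} => [_ [h Hh <-]|x y _ hx _ hy].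
    by apply: fixprojK; case: hH => _ _; exact.
  by rewrite mid_linear; [rewrite hx hy midxx|exact: fixproj_linear].
rewrite -(linB (@fixproj_linear H)); exact: le_lt_trans (fixproj_hn _ _) ws.
Qed.

(** The Alaoglu-Birkhoff mean ergodic theorem: the element of least norm of the closed convex hull
    of an orbit is unique, hence fixed, and all vectors of the hull have the same projection
    ([fixproj_cl_hull]). *)
Lemma fixproj_hull v : cl_hull (orbit_set v) (fixproj H v).
Proof.
have [H1 HM HV] := hH.
have [|||m mC hm] := @min_norm R V (cl_hull (orbit_set v)).
- exact: cl_hull_closed.
- by exists v; apply/mid_hull_cl/mid_hull_in; exists 1%g => //; rewrite rep1.
- exact: cl_hull_mid.
have mF : fixed H m.
  move=> h Hh; apply/eqP; rewrite -subr_eq0 -sqnorm_eq0 eq_le sqnorm_ge0 andbT.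
  rewrite sqnormB rep_sqnorm ripC; suff /hm : cl_hull (orbit_set v) (rho h m) by lra.
  move=> e /mC[s Os ms]; exists (rho h s); last by rewrite -(linB (rep_linear h)) rep_hn.
  elim: Os {ms} => [_ [k Hk <-]|x y _ hx _ hy].
    by apply: mid_hull_in; exists (h * k)%g; [exact: HM|rewrite repM].
  by rewrite mid_linear; [exact: mid_hull_mid|exact: rep_linear].
by rewrite -(fixproj_cl_hull mC) fixproj_id.
Qed.

(** A closed ball around [v] is convex, so it contains the hull of the orbit and with it the
    projection. *)
Lemma fixproj_near v (e : R) : (forall h, H h -> hn (rho h v - v) <= e) ->
  hn (fixproj H v - v) <= e.
Proof.
move=> he; have := fixproj_hull v.
apply: (@cl_hull_sub _ _ _ [set w | hn (w - v) <= e]) => [||_ [h Hh <-]]; last exact: he.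
  apply/closed_hn => w hw /=; apply/ler_addgt0Pr => d /hw[x xe wx].
  by apply: (le_trans (hn_tri _ x _)); rewrite addrC lerD// ltW.
move=> x y /= xe ye; rewrite -[in X in X <= _](midxx v) /mid -scalerBr hnZ /cmod /= expr0n addr0.
rewrite sqrtr_sqr ger0_norm ?invr_ge0// opprD addrACA.
have := hnD (x - v) (y - v).
by move: (hn (x - v)) (hn (y - v)) (hn _) xe ye => a b c; lra.
Qed.

(** The projection is a limit of averages over [H], and averages pass through an operator that
    commutes with [H]. *)
Lemma fixproj_comm (T : V -> V) v : bounded_op T ->
  (forall h u, H h -> T (rho h u) = rho h (T u)) ->
  T (fixproj H v) = fixproj H (T v).
Proof.
move=> [Tl Tc] Th.
have : fixproj H (T (fixproj H v)) = fixproj H (T v).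
  have := fixproj_hull v.
  apply: (@cl_hull_sub _ _ _ [set w | fixproj H (T w) = fixproj H (T v)]).
  - apply: (@closed_comp _ _ T [set x | fixproj H x = fixproj H (T v)]) => [x _|]; first exact: Tc.
    apply/closed_hn => x hx /=; apply/eqP; rewrite -subr_eq0; apply/eqP/hn_le_lt0 => e.
    move=> /hx[y /= <- xy]; rewrite -(linB (@fixproj_linear H)).
    exact: le_lt_trans (fixproj_hn _ _) xy.
  - move=> x y /= hx hy; rewrite (mid_linear _ _ Tl) (mid_linear _ _ (@fixproj_linear H)).
    by rewrite hx hy midxx.
  - move=> _ [h Hh <-] /=; rewrite Th// fixprojK//; by case: hH => _ _; exact.
move=> E; rewrite -[RHS]E; apply/esym/fixproj_id => h Hh.
by rewrite -Th// fixproj_in.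
Qed.

(* The vectors [rho h v] with [h] in general position are nearly orthogonal
   over the fixed space, so that [fixproj H v] is approximated by midpoints of
   such vectors and has squared norm [c]. *)
Lemma fixproj_generic v g (c : R) :
  (forall Q : seq G, (forall q, q \in Q -> H q \/ exists2 h, H h & q = (g * h)%g) ->
    exists2 h, H h & forall q, q \in Q -> rip (rho q v) (rho h v) = c) ->
  rho g (fixproj H v) = fixproj H v.
Proof.
move=> hQ; set u := fixproj H v; have [H1 HM HV] := hH.
pose gen (Q : seq G) h := H h /\ forall q, q \in Q -> rip (rho q v) (rho h v) = c.
pose good (Q : seq G) := forall q, q \in Q -> H q \/ exists2 h, H h & q = (g * h)%g.
have genP Q : good Q -> exists h, gen Q h by move=> /hQ[h Hh hh]; exists h.
(* An average [s] of translates involves finitely many group elements [Q]. A vector [rho h v] in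
   general position to all of them has inner product [c] with [s] as well, because the weights of an
   average sum to 1. *)
have supp s : mid_hull (orbit_set v) s -> exists2 Q : seq G, (forall q, q \in Q -> H q) &
   forall f h, (forall q, q \in Q -> rip (rho (f * q)%g v) (rho h v) = c) ->
     rip (rho f s) (rho h v) = c.
  elim=> [_ [k Hk <-]|x y _ [Q QH hx] _ [Q' QH' hy]].
    exists [:: k] => [q|f h]; first by rewrite inE => /eqP ->.
    by move=> /(_ k); rewrite inE eqxx -repM; exact.
  exists (Q ++ Q') => [q|f h hq]; first by rewrite mem_cat => /orP[/QH|/QH'].
  rewrite (mid_linear _ _ (rep_linear f)) rip_mid hx ?hy; last 2 first.
  - by move=> q qQ; apply: hq; rewrite mem_cat qQ orbT.
  - by move=> q qQ; apply: hq; rewrite mem_cat qQ.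
  lra.
have rip_close (x y z : V) (e : R) : hn (x - y) < e -> `|rip x z - rip y z| <= e * hn z.
  move=> xy; rewrite -ripBl; apply: (le_trans (CauchySchwarz_hn _ _)).
  by rewrite ler_wpM2r ?hn_ge0// ltW.
have eps0 (a b : R) : (forall e, 0 < e -> `|a - b| <= e * (hn v + hn u + 1)) -> a = b.
  move=> h; apply/eqP; rewrite -subr_eq0 -normr_eq0; apply/eqP/le_anti.
  rewrite normr_ge0 andbT; apply/ler_addgt0Pr => e e0; rewrite add0r.
  have w0 : 0 < hn v + hn u + 1 by rewrite ltr_wpDl// addr_ge0 ?hn_ge0.
  by have := h _ (divr_gt0 e0 w0); rewrite divfK// gt_eqF.
have hv0 := hn_ge0 v; have hu0 := hn_ge0 u.
have uc : sqnorm u = c.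
  apply: eps0 => e e0; have [s Os us] := fixproj_hull v e0.
  have [Q QH hs] := supp _ Os; have [|h [Hh hq]] := genP Q; first by move=> q /QH; left.
  have <- : rip u (rho h v) = sqnorm u.
    rewrite ripC rep_radj fixproj_in; last exact: HV.
    by rewrite /u sqnorm_rip fixproj_radj /fixproj (hproj_idem (fixed_closed H)).
  rewrite -(hs 1%g h) ?rep1; last by move=> q qQ; rewrite mul1g; exact: hq.
  apply: (le_trans (rip_close _ _ _ _ us)).
  by rewrite rep_hn ler_wpM2l ?(ltW e0)//; lra.
(* [u] already lies in the hull of the translates in general position to [Q]: the least vector [m]
   of that smaller hull has squared norm at most [c], which is [sqnorm u], and projects to [u], so
   it equals [u]. *)
have uQ Q : good Q -> cl_hull [set rho h v | h in gen Q] u.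
  move=> gQ; have [h0 gh0] := genP _ gQ.
  set O := [set _ | _ in _]; have OH : O `<=` orbit_set v.
    by move=> _ [h [Hh _] <-]; exists h.
  have [|||m mC hm] := @min_norm R V (cl_hull O).
  - exact: cl_hull_closed.
  - by exists (rho h0 v); apply/mid_hull_cl/mid_hull_in; exists h0.
  - exact: cl_hull_mid.
  have mu : fixproj H m = u.
    by apply: fixproj_cl_hull => e /mC[s Os ms]; exists s => //; exact: sub_mid_hull Os.
  have mc : sqnorm m <= c.
    apply/ler_addgt0Pr => e e0.
    have w0 : 0 < hn v + 1 by rewrite ltr_wpDl// hn_ge0.
    have [s Os ms] := mC _ (divr_gt0 e0 w0).
    have [Q' QH' hs] := supp _ (sub_mid_hull OH Os).
    have [|h [Hh hq]] := genP (Q ++ Q').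
      by move=> q; rewrite mem_cat => /orP[/gQ//|/QH']; left.
    apply: (le_trans (hm (rho h v) _)).
      apply/mid_hull_cl/mid_hull_in; exists h => //; split=> // q qQ.
      by apply: hq; rewrite mem_cat qQ.
    have := rip_close _ _ (rho h v) _ ms; rewrite -{1}[s]rep1 (hs 1%g h); last first.
      by move=> q qQ; rewrite mul1g; apply: hq; rewrite mem_cat qQ orbT.
    rewrite rep_hn => /ler_normlP[_]; rewrite -mulrA => k.
    have : e * ((hn v + 1)^-1 * hn v) <= e.
      by rewrite ler_piMr ?(ltW e0)// mulrC ler_pdivrMr//; lra.
    lra.
  suff <- : m = u by [].
  by rewrite -mu; apply/esym/hproj_sqnorm_id; [exact: fixed_closed|rewrite -/(fixproj H) mu uc].
(* [u] is approximated twice: by [s], and by an average [s'] of translates in general position to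
   the elements [g q] for [q] in the support of [s]. Then [rho g s] and [s'] have inner product
   exactly [c]. *)
have gu : rip (rho g u) u = c.
  apply: eps0 => e e0.
  have e2 : 0 < e / 2 by rewrite divr_gt0.
  have [s Os us] := fixproj_hull v e2; have [Q QH hs] := supp _ Os.
  have gQ : good [seq (g * q)%g | q <- Q].
    by move=> _ /mapP[q /QH Hq ->]; right; exists q.
  have [s' Os' us'] := uQ _ gQ _ e2.
  have hss : rip (rho g s) s' = c.
    rewrite ripC; apply: (mid_hull_rip _ Os') => _ [h [Hh hq] <-].
    by rewrite ripC; apply: hs => q qQ; apply: hq; exact: map_f.
  have h1 := rip_close (rho g u) (rho g s) s' (e / 2).
  have h2 := rip_close u s' (rho g u) (e / 2) us'.
  have s'v : hn s' <= hn v.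
    elim: Os' {hss h1 h2 us'} => [_ [h _ <-]|x y _ hx _ hy]; first by rewrite rep_hn.
    rewrite /mid hnZ /cmod /= expr0n addr0 sqrtr_sqr ger0_norm ?invr_ge0//.
    by have := hnD x y; lra.
  rewrite -(linB (rep_linear g)) rep_hn in h1; have := h1 us.
  rewrite hss; move: h2; rewrite rep_hn (ripC u) (ripC s') => h2 h3.
  rewrite -(subrKA (rip (rho g u) s')); apply: (le_trans (ler_normD _ _)).
  by move: s'v hu0 hv0 e0 h2 h3; move: (`|_|) (`|_|) (hn s') (hn v) (hn u) => a b p q r; nra.
apply/eqP; rewrite -subr_eq0 -sqnorm_eq0 sqnormB rep_sqnorm gu uc; apply/eqP; ring.
Qed.

End hull.
End representation.

Lemma le_max_trans (R : realDomainType) (x a b r : R) :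
  x <= Num.max a b -> a <= r -> b <= r -> x <= r.
Proof. by move=> h ar br; rewrite (le_trans h)// ge_max ar. Qed.

(** The ultrametric inequalities for a point [p], a copy of [w] and a copy of [c], when the copies
    keep their mutual distance [wc] and lie at distances [max wp Kw] and [max cp Kc] from [p]. *)
Lemma max_copy (R : realDomainType) (wp wc cp Kw Kc : R) :
  wp <= Num.max wc cp -> wc <= Num.max wp cp -> cp <= Num.max wc wp ->
  Kw <= Num.max Kc wc -> Kc <= Num.max Kw wc ->
  [/\ Num.max wp Kw <= Num.max wc (Num.max cp Kc),
      Num.max cp Kc <= Num.max (Num.max wp Kw) wc &
      wc <= Num.max (Num.max wp Kw) (Num.max cp Kc)].
Proof.
move=> h1 h2 h3 h4 h5; split; rewrite ?ge_max; do ?[apply/andP; split];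
  [apply: (le_max_trans h1)|apply: (le_max_trans h4)|apply: (le_max_trans h3)|
   apply: (le_max_trans h5)|apply: (le_max_trans h2)];
  by rewrite !le_max lexx ?orbT.
Qed.

(** * The ultrametric Urysohn space *)

Section urysohn_geometry.
Context {R : realType} {L : set R} {U : metricType R}.
Hypothesis (Lpos : forall r : R, L r -> 0 < r) (LU : is_urysohn L U).
Local Notation d := (@mdist R U).
Local Notation max := Num.max.
Implicit Types (x y z : U) (r s t : R).

Lemma ud_ge0 x y : 0 <= d x y. Proof. by case: LU => -[]. Qed.
Lemma ud_eq0 x y : d x y = 0 <-> x = y. Proof. by case: LU => -[]. Qed.
Lemma udxx x : d x x = 0. Proof. exact/ud_eq0. Qed.
Lemma udC x y : d x y = d y x. Proof. by case: LU => -[]. Qed.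
Lemma ud_tri y x z : d x z <= max (d x y) (d y z). Proof. by case: LU => -[]. Qed.

Lemma ud_tri_le y x z r : d x y <= r -> d y z <= r -> d x z <= r.
Proof. by move=> h k; rewrite (le_trans (ud_tri y x z))// ge_max h. Qed.

Lemma ud_iso y x z : d x y < d y z -> d x z = d y z.
Proof.
move=> h; apply/le_anti; rewrite (ud_tri_le (ltW h))//=.
have := ud_tri x y z; rewrite le_max (udC y x) => /orP[|//].
by move/(lt_le_trans h); rewrite ltxx.
Qed.

(** Contains every value of the metric; in contrast with [spectrum_with0], 0 always belongs to
    it. *)
Definition L0 : set R := [set r | r = 0 \/ L r].

Lemma L0_ge0 r : L0 r -> 0 <= r.
Proof. by case=> [->//|/Lpos/ltW]. Qed.

Lemma ud_L0 x y : L0 (d x y).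
Proof.
have [->|h] := eqVneq (d x y) 0; [by left|right].
by case: LU => _ <- _ _ _; split => //; exists x, y.
Qed.

Lemma L0_max r s : L0 r -> L0 s -> L0 (max r s).
Proof. by move=> hr hs; case: (leP r s). Qed.

Lemma ud_inhab : exists x : U, True.
Proof.
have noX (x : {x | x \in (finset.set0 : {set unit})}) : False by case: x => x; rewrite inE.
have [|||g _] := (let: And5 _ _ _ _ h := LU in h) unit (fun _ _ => 0) finset.set0
    (fun x : {x | x \in finset.set0} => match noX x with end).
- split=> [//|[] []|//|x y z]; [by split|by rewrite maxxx].
- by move=> r [r0 [_ [_ h]]]; rewrite h eqxx in r0.
- by move=> x; case: (noX x).
- by exists (g tt).
Qed.

(** If some prescribed distance is 0, the listed point itself is a solution. Otherwise the distances
    define a one-point extension of the finite space of listed points, with [None] as the new point,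
    and the extension property applies. *)
Lemma one_point (S : seq (U * R)) :
  (forall p q, p \in S -> q \in S ->
     p.2 <= max q.2 (d p.1 q.1) /\ d p.1 q.1 <= max p.2 q.2) ->
  (forall p, p \in S -> L0 p.2) -> exists u, forall p, p \in S -> d u p.1 = p.2.
Proof.
move=> hS h0.
have [[p pS p0]|nz] := pselect (exists2 p, p \in S & p.2 = 0).
  exists p.1 => q qS; have [h1 h2] := hS p q pS qS; have [h3 h4] := hS q p qS pS.
  have q0 := L0_ge0 (h0 _ qS); have dd := ud_ge0 p.1 q.1.
  move: h2 h3; rewrite p0 (udC q.1) !(max_idPr _)// => h2 h3.
  by apply/le_anti; rewrite h2 h3.
have [u0 _] := ud_inhab; pose A := undup [seq p.1 | p <- S].
have phiP (a : seq_sub A) : exists s, (val a, s) \in S.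
  by have := valP a; rewrite mem_undup => /mapP[[x s] xS /= ->]; exists s.
have [phi phiE] := choice phiP.
have phi0 a : 0 < phi a.
  rewrite lt0r (L0_ge0 (h0 _ (phiE a))) andbT; apply/eqP => h.
  by apply: nz; exists (val a, phi a).
have hh a b := hS _ _ (phiE a) (phiE b).
pose Y : finType := option (seq_sub A).
pose dY (y y' : Y) := match y, y' with
  | Some a, Some b => d (val a) (val b) | Some a, None => phi a
  | None, Some b => phi b | None, None => 0 end.
have dYu : ultrametric dY.
  split.
  - by move=> [a|] [b|] //=; [exact: ud_ge0|exact: ltW|exact: ltW].
  - move=> [a|] [b|] //=; split => //.
    + by move/ud_eq0 => /val_inj ->.
    + by move=> [->]; exact: udxx.
    + by move=> h; have := phi0 a; rewrite h ltxx.
    + by move=> h; have := phi0 b; rewrite h ltxx.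
  - by move=> [a|] [b|] //=; exact: udC.
  - move=> [a|] [b|] [c|] //=.
    + exact: ud_tri.
    + by have [h _] := hh a b; rewrite maxC.
    + by have [_ h] := hh a c.
    + by rewrite le_max lexx.
    + by have [h _] := hh c b; rewrite udC.
    + by rewrite maxxx ltW.
    + by rewrite le_max lexx orbT.
pose X : {set Y} := finset (fun y : Y => y != None).
have XS (x : {x | x \in X}) : exists a, val x = Some a.
  by have := valP x; rewrite inE; case: (val x) => // a _; exists a.
pose f (y : {y | y \in X}) : U := if val y is Some a then val a else u0.
have [||g [gd gf]] := (let: And5 _ _ _ _ h := LU in h) Y dY X f dYu.
- move=> r [r0 [[a|] [[b|]]]] /= dr; last by rewrite dr eqxx in r0.
  + by case: LU => _ <- _ _ _; split => //; exists (val a), (val b).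
  + by move: r0; rewrite -dr; case: (h0 _ (phiE a)) => //= ->; rewrite eqxx.
  + by move: r0; rewrite -dr; case: (h0 _ (phiE b)) => //= ->; rewrite eqxx.
- by move=> x y; rewrite /f; have [a ->] := XS x; have [b ->] := XS y.
exists (g None) => p pS.
have pA : p.1 \in A by rewrite mem_undup map_f.
have aX : Some (SeqSub pA) \in X by rewrite inE.
have pE : f (exist (fun y : Y => y \in X) _ aX) = p.1 by [].
rewrite -pE -gf gd /=.
have [h1 h2] := hS _ _ (phiE (SeqSub pA)) pS; have [h3 h4] := hS _ _ pS (phiE (SeqSub pA)).
move: h1 h3; rewrite /= udxx maxC (max_idPr _) ?(L0_ge0 (h0 _ pS))// => h1.
by rewrite maxC (max_idPr _) ?(ltW (phi0 _))// => h3; apply/le_anti; rewrite h1.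
Qed.

(* Every point of [ws] is pushed away from the finite set [P], as far as a ball
   of radius [K w] around it allows. *)
Lemma generic_copy (P ws : seq U) (K : U -> R) : (forall w, L0 (K w)) ->
  (forall w w', K w <= max (K w') (d w w')) ->
  exists m : U -> U, (forall w p, w \in ws -> p \in P -> d (m w) p = max (d w p) (K w)) /\
    (forall w w', w \in ws -> w' \in ws -> d (m w) (m w') = d w w').
Proof.
move=> K0 KL; elim: ws => [|w ws [m [mP mm]]]; first by exists id.
have [wws|wws] := boolP (w \in ws).
  by exists m; split=> [v p|v v']; rewrite !inE;
    [case/predU1P => [->|vw]|case/predU1P => [->|vw] /predU1P[->|vw']];
    do ?[exact: mP|exact: mm].
(* The copy of [w] has to keep the distances to the copies already made and to lie at distance
   [max (d w p) (K w)] from each [p]. *)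
pose S := [seq (p, max (d w p) (K w)) | p <- P] ++ [seq (m v, d w v) | v <- ws].
have [|p|u hu] := @one_point S.
- have cop a b : b \in P -> a \in ws ->
    [/\ max (d w b) (K w) <= max (d w a) (d (m a) b),
        d (m a) b <= max (max (d w b) (K w)) (d w a) &
        d w a <= max (max (d w b) (K w)) (d (m a) b)].
    move=> bP aws; rewrite mP//; apply: max_copy; [exact: ud_tri| | | |].
    + by rewrite (udC a); exact: ud_tri.
    + by rewrite (udC w a); exact: ud_tri.
    + exact: KL.
    + by rewrite (udC w); exact: KL.
  move=> p q; rewrite !mem_cat => /orP[/mapP[a aP ->]|/mapP[a aP ->]]
    /orP[/mapP[b bP ->]|/mapP[b bP ->]] /=.
  + have h1 := ud_tri b w a; have h2 := ud_tri w a b; rewrite (udC b a) in h1; rewrite (udC a w) in h2.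
    split; last by apply: (le_max_trans h2); rewrite !le_max lexx ?orbT.
    by rewrite ge_max; apply/andP; split;
      [apply: (le_max_trans h1)|]; rewrite !le_max lexx ?orbT.
  + by have [h1 h2 _] := cop _ _ aP bP; rewrite (udC a).
  + have [_ h1 h2] := cop _ _ bP aP; split=> //.
    by rewrite maxC.
  + rewrite mm//; split; last by rewrite (le_trans (ud_tri w _ _))// (udC a).
    by rewrite (le_trans (ud_tri b _ _))// (udC b).
- by rewrite mem_cat => /orP[/mapP[a aP ->]|/mapP[a aP ->]] /=;
    [apply: L0_max => //|]; exact: ud_L0.
exists (fun v => if v == w then u else m v); split=> [v p|v v']; rewrite !inE.
  case: eqVneq => [-> _ pP|_ /= vw]; last exact: mP.
  by have /= := hu (p, max (d w p) (K w)); apply; rewrite mem_cat map_f.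
case: (eqVneq v w) => [->|_]; case: (eqVneq v' w) => [->|_] /=.
- by rewrite !udxx.
- move=> _ vw; have /= := hu (m v', d w v'); apply.
  by rewrite mem_cat (map_f (fun v => (m v, d w v)))// orbT.
- move=> vw _; rewrite udC (udC v); have /= := hu (m v, d w v); apply.
  by rewrite mem_cat (map_f (fun v => (m v, d w v)))// orbT.
- exact: mm.
Qed.

Lemma ud_dense_seq : exists s : nat -> U, forall x (e : R), 0 < e -> exists n, d x (s n) < e.
Proof.
have [D cD dD] : separable_space U by case: LU.
have D0 : D !=set0.
  by have := dD setT; case=> [||x []]; [by have [u0 _] := ud_inhab; exists u0|exact: openT|exists x].
have [s Ds] : exists s : nat -> U, D `<=` range s.
  have [a Da] := D0.
  case/pfcard_geP : cD => [D00|[f]]; first by exists (fun=> a); rewrite D00.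
  exists f; exact: surj.
exists s => x e e0.
have [||w [/= xw /Ds[n _ nw]]] := dD [set w | d x w < e].
- by exists x; rewrite /= udxx.
- rewrite openE => w /= xw; apply/nbhs_ballP; exists (e - d x w); rewrite /= ?subr_gt0//.
  move=> v; rewrite ballEmdist /= => wv.
  have := metric_triangle x w v; lra.
- by exists n; rewrite nw.
Qed.

Lemma ud_complete (u : nat -> U) : (forall e : R, 0 < e -> exists N, forall m n,
    (N <= m)%N -> (N <= n)%N -> d (u m) (u n) < e) ->
  exists x, forall e : R, 0 < e -> exists N, forall n, (N <= n)%N -> d x (u n) < e.
Proof.
move=> h.
have [|x ux] := (let: And5 _ _ h _ _ := LU in h) (u @ \oo) _.
  apply/cauchy_ballP => e /= /h[N hN]; rewrite near_simpl.
  exists ([set n | (N <= n)%N], [set n | (N <= n)%N]); first by split; exists N.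
  by move=> [m n] /= [hm hn']; rewrite ballEmdist /= hN.
exists x => e e0; have : nbhs x (ball x e) by exact: nbhsx_ballx.
move=> /ux[N _ hN]; exists N => n /hN; by rewrite /= ballEmdist.
Qed.

(** The images of approximations to [x] form a Cauchy sequence because [P] is isometric; [y] is
    their limit. *)
Lemma extend_pairs (P : set (U * U)) x :
  (forall p q, P p -> P q -> d p.1 q.1 = d p.2 q.2) ->
  (forall x (e : R), 0 < e -> exists2 p, P p & d x p.1 < e) ->
  exists y, forall p, P p -> d x p.1 = d y p.2.
Proof.
move=> Piso Pd.
have ex (n : nat) : exists p, P p /\ d x p.1 < n.+1%:R^-1.
  by have [|p] := Pd x n.+1%:R^-1; [rewrite invr_gt0|exists p].
have [a aP] := choice ex.
have [|y hy] := @ud_complete (fun n => (a n).2).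
  move=> e /invn_lt[N hN]; exists N => m n hm hn'.
  have [Pm am] := aP m; have [Pn an] := aP n; rewrite -Piso//.
  apply: (le_lt_trans (ud_tri x _ _)).
  by rewrite gt_max (udC _ x) (lt_trans am) ?hN// (lt_trans an) ?hN.
exists y => p Pp; apply/le_anti/andP; split; apply/ler_addgt0Pr => e e0;
  have e2 : 0 < e / 2 by [rewrite divr_gt0 |];
  have [N hN] := invn_lt e2; have [M hM] := hy _ e2;
  have [Pn an] := aP (maxn N M); have := hM _ (leq_maxr N M); have := hN _ (leq_maxl N M) => h1 h2;
  have e3 := Piso _ _ Pn Pp; have an' := lt_trans an h1.
- have := metric_triangle x (a (maxn N M)).1 p.1.
  have := metric_triangle (a (maxn N M)).2 y p.2; rewrite e3 (udC _ y); lra.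
- have := metric_triangle y (a (maxn N M)).2 p.2.
  have := metric_triangle (a (maxn N M)).1 x p.1; rewrite e3 (udC _ x); lra.
Qed.

(** Ultrahomogeneity of the complete space: a back-and-forth along a dense sequence enlarges the
    finite partial isometry to one with dense domain and dense range, and completeness extends that
    to a bijection. *)
Lemma extend_isom (S : seq (U * U)) :
  (forall p q, p \in S -> q \in S -> d p.1 q.1 = d p.2 q.2) ->
  exists g : isom U, forall p, p \in S -> g p.1 = p.2.
Proof.
pose pi (S : seq (U * U)) := forall p q, p \in S -> q \in S -> d p.1 q.1 = d p.2 q.2.
pose sw (p : U * U) := (p.2, p.1).
have piS T : pi T -> pi (map sw T).
  by move=> h _ _ /mapP[p pT ->] /mapP[q qT ->] /=; rewrite h.
have [u0 _] := ud_inhab.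
have ext (Tx : seq (U * U) * U) : exists y, pi Tx.1 -> pi ((Tx.2, y) :: Tx.1).
  case: Tx => T x /=; have [hT|] := pselect (pi T); last by exists u0.
  have [|p|y hy] := @one_point [seq (p.2, d x p.1) | p <- T].
  - move=> _ _ /mapP[p pT ->] /mapP[q qT ->] /=; rewrite -hT//; split.
      by rewrite (le_trans (ud_tri q.1 _ _))// (udC q.1).
    by rewrite (le_trans (ud_tri x _ _))// (udC p.1).
  - by move=> /mapP[q qT ->]; exact: ud_L0.
  exists y => _ p q; rewrite !inE => /predU1P[->|pT] /predU1P[->|qT] /=.
  - by rewrite !udxx.
  - by have /= -> := hy _ (map_f (fun p => (p.2, d x p.1)) qT).
  - by rewrite udC (udC _ y); have /= -> := hy _ (map_f (fun p => (p.2, d x p.1)) pT).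
  - exact: hT.
have [e eP] := choice ext => hS.
have [s sd] := ud_dense_seq.
(* One round puts [s n] into the domain and, with the pairs swapped, into the range. *)
pose step n T := let T1 := (s n, e (T, s n)) :: T in (e (map sw T1, s n), s n) :: T1.
have swK T : map sw (map sw T) = T.
  by rewrite -map_comp; elim: T => //= -[a b] T ->.
have stepP n T : pi T -> pi (step n T).
  move=> hT; have h1 := eP (T, s n) hT; have := eP (_, s n) (piS _ h1).
  by move=> /piS /=; rewrite swK.
pose F := fix F n := if n is k.+1 then step k (F k) else S.
have Fpi n : pi (F n) by elim: n => //= n IH; exact: stepP.
have Fmono m n p : (m <= n)%N -> p \in F m -> p \in F n.
  elim: n => [|n IH]; first by rewrite leqn0 => /eqP ->.
  by rewrite leq_eqVlt => /predU1P[->//|/IH h /h]; rewrite /= !inE => ->; rewrite !orbT.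
pose P : set (U * U) := [set p | exists n, p \in F n].
have Piso p q : P p -> P q -> d p.1 q.1 = d p.2 q.2.
  move=> [m pm] [n qn]; apply: (Fpi (maxn m n)); apply: Fmono; [| exact: pm| | exact: qn];
  by rewrite ?leq_maxl ?leq_maxr.
have Pd1 x (a : R) : 0 < a -> exists2 p, P p & d x p.1 < a.
  move=> /(sd x)[n hn]; exists (s n, e (F n, s n)) => //; exists n.+1.
  by rewrite /= !inE eqxx orbT.
have Pd2 x (a : R) : 0 < a -> exists2 p, P p & d x p.2 < a.
  move=> /(sd x)[n hn]; 
  exists (e (map sw ((s n, e (F n, s n)) :: F n), s n), s n) => //.
  by exists n.+1; rewrite /= inE eqxx.
have [f fP] := choice (fun x => extend_pairs x Piso Pd1).
have swP p : P p -> P (sw (sw p)) by case: p.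
have [f' fP'] : exists f', forall y p, P p -> d y p.2 = d (f' y) p.1.
  have h y : exists x, forall p, P p -> d y p.2 = d x p.1.
    have [||x hx] := @extend_pairs [set p | P (sw p)] y.
    - by move=> p q /= hp hq; exact: (esym (Piso _ _ hp hq)).
    - by move=> z a /(Pd2 z)[p Pp h]; exists (sw p) => //=; exact: swP.
    - by exists x => p Pp; exact: (hx (sw p) (swP _ Pp)).
  by have [f' hf'] := choice h; exists f'.
have eq_near x y : (forall p, P p -> d x p.2 = d y p.2) -> x = y.
  move=> h; apply/ud_eq0/le_anti; rewrite ud_ge0 andbT; apply/ler_addgt0Pr => a.
  move=> /(Pd2 x)[p Pp xp]; rewrite add0r; apply: (ud_tri_le (ltW xp)).
  by rewrite udC -h// ltW.
have eq_near1 x y : (forall p, P p -> d x p.1 = d y p.1) -> x = y.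
  move=> h; apply/ud_eq0/le_anti; rewrite ud_ge0 andbT; apply/ler_addgt0Pr => a.
  move=> /(Pd1 x)[p Pp xp]; rewrite add0r; apply: (ud_tri_le (ltW xp)).
  by rewrite udC -h// ltW.
have fiso : is_isometry f.
  split; first exists f'.
  - by move=> x; apply: eq_near1 => p Pp; rewrite -fP'// -fP.
  - by move=> y; apply: eq_near => p Pp; rewrite -fP// -fP'.
  - move=> x y; apply/le_anti/andP; split; apply/ler_addgt0Pr => a a0;
      have a2 : 0 < a / 2 by [rewrite divr_gt0|];
      have [p Pp xp] := Pd1 x _ a2; have hx := fP x _ Pp; have hy := fP y _ Pp.
    + have := metric_triangle (f x) p.2 (f y); rewrite (udC p.2) -hx -hy.
      have := metric_triangle y x p.1; rewrite (udC y x); lra.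
    + have := metric_triangle x p.1 y; rewrite (udC p.1) hx hy.
      have := metric_triangle (f y) (f x) p.2; rewrite (udC (f y) (f x)) -hx; lra.
exists (Isom fiso) => p pS /=; have Pp : P p by exists 0.
apply: eq_near => q Pq; rewrite -fP//; exact: Piso.
Qed.

End urysohn_geometry.

(** * Stabilizers of centres up to radii, and the independence of their projections *)

Section stabilizers.
Context {R : realType} {L : set R} {U : metricType R}.
Hypothesis (Lpos : forall r : R, L r -> 0 < r) (LU : is_urysohn L U).
Local Notation d := (@mdist R U).
Local Notation max := Num.max.
Local Notation G := (isom U).

Definition stab n (x : 'I_n -> U) (m : 'I_n -> R) : set G :=
  [set g : G | forall i, d (g (x i)) (x i) <= m i].

Lemma isomME (g h : G) a : (g * h)%g a = g (h a). Proof. by []. Qed.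
Lemma isomVE (g : G) a : (g^-1)%g (g a) = a. Proof. exact: isomVK. Qed.
Lemma isomEV (g : G) a : g ((g^-1)%g a) = a. Proof. exact: isomKV. Qed.
Lemma isom_dist (g : G) a b : d (g a) (g b) = d a b.
Proof. by case: (isomP g). Qed.
Lemma isom_distV (g : G) a b : d ((g^-1)%g a) b = d a (g b).
Proof. by rewrite -(isom_dist g) isomEV. Qed.

Lemma stab_subgroup n (x : 'I_n -> U) m : (forall i, 0 <= m i) -> subgroup_set (stab x m).
Proof.
move=> m0; split=> [i|g h Hg Hh i|g Hg i].
- by rewrite (ud_eq0 LU _ _).2.
- rewrite isomME; apply: (ud_tri_le LU) (Hg i).
  by rewrite isom_dist.
- by rewrite isom_distV (udC LU).
Qed.

Lemma stab_mono n (x : 'I_n -> U) m m' : (forall i, m i <= m' i) -> stab x m `<=` stab x m'.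
Proof. by move=> mm g Hg i; apply: le_trans (mm i). Qed.

Section independence.
Variables (p q : nat) (x : 'I_p.+1 -> U) (r : 'I_p.+1 -> R) (y : 'I_q -> U) (s : 'I_q -> R).
Hypotheses (r0 : forall i, L0 (L := L) (r i)) (s0 : forall j, 0 <= s j).
Hypothesis sep : forall j j', j != j' -> s j < d (y j) (y j').

Let km w i := max (r i) (d w (x i)).
Definition closest w : 'I_p.+1 := [arg min_(i < ord0) km w i]%O.
(** The least value of [max (r i) (d w (x i))] over [i]. No element of [stab x r] moves [w] farther
    ([stab_reach]), and suitable elements carry it at least that far from any finite set
    ([stab_generic]). *)
Definition reach w := max (r (closest w)) (d w (x (closest w))).

Lemma reach_le w i : reach w <= max (r i) (d w (x i)).
Proof.
by rewrite /reach /closest; case: (arg_minP (km w) (isT : xpredT ord0)) => j _; exact.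
Qed.

Lemma reach_L0 w : L0 (L := L) (reach w).
Proof. by apply: L0_max => //; exact: ud_L0. Qed.

Lemma reach_lip w w' : reach w <= max (reach w') (d w w').
Proof.
apply: (le_trans (reach_le w (closest w'))); rewrite ge_max; apply/andP; split.
  by rewrite !le_max lexx.
by rewrite (le_trans (ud_tri LU w' _ _))// ge_max !le_max !lexx ?orbT.
Qed.

Lemma stab_reach h w : stab x r h -> d (h w) w <= reach w.
Proof.
move=> hH; apply: (ud_tri_le LU (y := h (x (closest w)))).
  by rewrite isom_dist le_max lexx orbT.
apply: (ud_tri_le LU (y := x (closest w))); first by rewrite (le_trans (hH _))// le_max lexx.
by rewrite (udC LU) le_max lexx orbT.
Qed.

(** A generic copy of the centres and of the points [y j], pushed away by [reach], extends to an
    isometry. The centres are added to the set from which the copies are pushed: this prescribes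
    their displacement, which stays within [r]. *)
Lemma stab_generic (P : seq U) : exists2 h, stab x r h &
  forall j a, a \in P -> reach (y j) <= d (h (y j)) a.
Proof.
pose X := [seq x i | i <- enum 'I_p.+1]; pose Y := [seq y j | j <- enum 'I_q].
have Xi i : x i \in X by rewrite map_f// mem_enum.
have Yj j : y j \in Y by rewrite map_f// mem_enum.
have [m [mP mm]] := generic_copy Lpos LU (P ++ X) (X ++ Y) reach_L0 reach_lip.
have [|h hE] := extend_isom Lpos LU (S := [seq (w, m w) | w <- X ++ Y]).
  by move=> _ _ /mapP[w wS ->] /mapP[w' wS' ->] /=; rewrite mm.
have hm w : w \in X ++ Y -> h w = m w by move=> /(map_f (fun w => (w, m w)))/hE.
exists h => [i|j a aP].
  rewrite hm ?mem_cat ?Xi// mP ?mem_cat ?Xi ?orbT// (udxx LU) ge_max (L0_ge0 Lpos (r0 i))/=.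
  by rewrite (le_trans (reach_le _ i))// (udxx LU) ge_max lexx (L0_ge0 Lpos (r0 i)).
by rewrite hm ?mem_cat ?Yj ?orbT// mP ?mem_cat ?Yj ?aP ?orbT// le_max lexx orbT.
Qed.

Let t j := max (s j) (reach (y j)).

Lemma stab_sub_reach : stab x r `<=` stab y t.
Proof. by move=> h Hh j; rewrite le_max stab_reach ?orbT. Qed.

(** If [s j] exceeds [reach (y j)], an element of [stab y t] may move [y j] farther than [reach],
    and its distances to a generic configuration are not determined. Replacing [g (y j)] by [y j] is
    then a change within [s j], which vectors fixed by [stab y s] do not see. *)
Let z (g : G) j := if s j < reach (y j) then g (y j) else y j.

Lemma shift_iso g j j' : stab y t g -> d (z g j) (z g j') = d (y j) (y j').
Proof.
move=> Hg; have [->|jj] := eqVneq j j'; first by rewrite !(udxx LU).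
have aux i i' : i != i' -> reach (y i) <= s i -> d (y i) (g (y i')) = d (y i) (y i').
  move=> ii /max_idPl E; rewrite -(isom_dist g (y i) (y i')); apply: (ud_iso LU); rewrite isom_dist.
  by rewrite (udC LU) (le_lt_trans (Hg i))// /t E sep.
rewrite /z; case: ltP => h; case: ltP => h' //; first by rewrite isom_dist.
  by rewrite (udC LU) aux ?(udC LU (y j))// eq_sym.
exact: aux.
Qed.

Lemma shift_close g j : stab y t g -> d (z g j) (g (y j)) <= s j.
Proof.
move=> Hg; rewrite /z; case: ltP => h; first by rewrite (udxx LU).
by rewrite (udC LU) (le_trans (Hg j))// /t (max_idPl h).
Qed.

(** The right-hand side involves neither [g] nor [h]: all pairs of a shifted and a generic
    configuration are isometric to each other. *)
Lemma shift_generic g h j j' : stab y t g -> stab x r h ->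
  reach (y j') <= d (h (y j')) (z g j) ->
  d (z g j) (h (y j')) = max (d (y j) (y j')) (reach (y j')).
Proof.
move=> Hg Hh far; case: leP => c; last first.
  have jj : j' != j.
    by apply: contraTneq c => ->; rewrite (udxx LU) -leNgt; exact/(L0_ge0 Lpos)/reach_L0.
  have hj := stab_reach (y j') Hh.
  rewrite /z; case: ltP => h1; last first.
    rewrite (udC LU (y j) (h _)) (udC LU (y j) (y j')); apply: (ud_iso LU).
    by rewrite (le_lt_trans hj)// (udC LU).
  rewrite -(isom_dist g (y j) (y j')) (udC LU (g (y j)) (h _)) (udC LU (g (y j)) (g _)); apply: (ud_iso LU).
  rewrite isom_dist; apply: (@le_lt_trans _ _ (t j')).
    apply: (ud_tri_le LU (y := y j')); first by rewrite le_max hj orbT.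
    by rewrite (udC LU); exact: Hg.
  by rewrite gt_max sep// (udC LU).
apply/le_anti; rewrite (udC LU) far andbT (udC LU).
apply: (ud_tri_le LU (y := y j)).
  apply: (@le_trans _ _ (reach (y j))); last first.
    by apply: (le_trans (reach_lip _ (y j'))); rewrite ge_max lexx.
  rewrite /z; case: ltP => h1; last by rewrite (udxx LU); exact/(L0_ge0 Lpos)/reach_L0.
  by rewrite (le_trans (Hg j))// /t (max_idPr (ltW h1)).
by apply: (ud_tri_le LU c); rewrite (udC LU) stab_reach.
Qed.

Context {V : hilbertType R} (rho : G -> V -> V) (hrho : unitary_rep setT rho).

(** An isometry [k] takes the pair formed by the points [y j] and one generic image under [h0] to
    the pair of [f] and [h]. Hence [rho f v] and [rho h v] have a constant inner product, and
    [fixproj_generic] applies. *)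
Lemma fixproj_indep_fixed v g : fixed rho (stab y s) v -> stab y t g ->
  rho g (fixproj rho (stab x r) v) = fixproj rho (stab x r) v.
Proof.
move=> vF Hg; have [h0 Hh0 far0] := stab_generic [seq y j | j <- enum 'I_q].
have [t1 tM _] : subgroup_set (stab y t).
  by apply: stab_subgroup => j; rewrite le_max s0.
have xS : subgroup_set (stab x r) by apply: stab_subgroup => i; exact: (L0_ge0 Lpos).
apply: (fixproj_generic hrho xS (c := rip v (rho h0 v))) => Q hQ.
have QS f : f \in Q -> stab y t f.
  by case/hQ => [/stab_sub_reach//|[h /stab_sub_reach Hh ->]]; exact: tM.
have [h Hh far] := stab_generic [seq z f j | f <- Q, j <- enum 'I_q].
exists h => // f fQ; have Hf := QS f fQ.
have D0 j j' : d (y j) (h0 (y j')) = max (d (y j) (y j')) (reach (y j')).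
  have z1 i : z 1%g i = y i by rewrite /z; case: ifP.
  by rewrite -{1}(z1 j) shift_generic// z1; apply: far0; rewrite map_f// mem_enum.
have D1 j j' : d (z f j) (h (y j')) = max (d (y j) (y j')) (reach (y j')).
  by rewrite shift_generic//; apply: far; apply/allpairsP; exists (f, j); rewrite mem_enum.
have [|k kE] := extend_isom Lpos LU (S := [seq (y j, z f j) | j <- enum 'I_q] ++
    [seq (h0 (y j), h (y j)) | j <- enum 'I_q]).
  move=> a b; rewrite !mem_cat => /orP[/mapP[j _ ->]|/mapP[j _ ->]]
    /orP[/mapP[j' _ ->]|/mapP[j' _ ->]] /=; rewrite ?isom_dist//.
  - by rewrite shift_iso.
  - by rewrite D0 D1.
  - by rewrite (udC LU) D0 (udC LU (h _)) D1.
have k1 j : k (y j) = z f j.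
  by have := kE (y j, z f j); apply; rewrite mem_cat (map_f (fun j => (y j, z f j))) ?mem_enum.
have k2 j : k (h0 (y j)) = h (y j).
  have := kE (h0 (y j), h (y j)); apply.
  by rewrite mem_cat (map_f (fun j => (h0 (y j), h (y j)))) ?mem_enum ?orbT.
have -> : rho f v = rho k v.
  rewrite -{1}(vF (f^-1 * k)%g); first by rewrite -(repM hrho) mulgA mulgV mul1g.
  by move=> j; rewrite isomME isom_distV k1 shift_close.
have -> : rho h v = rho k (rho h0 v).
  rewrite -{1}(vF (h^-1 * (k * h0))%g).
    by rewrite -!(repM hrho) mulgA mulgV mul1g.
  by move=> j; rewrite isomME isom_distV isomME k2 (udxx LU).
by rewrite rep_rip.
Qed.

(** Both [stab x r] and [stab y s] lie in [stab y t], so the vectors fixed by the latter are fixed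
    by the two others; the point is that the product takes its values among them. *)
Theorem fixproj_indep v :
  fixproj rho (stab x r) (fixproj rho (stab y s) v) = fixproj rho (stab y t) v.
Proof.
have ts : stab y s `<=` stab y t by apply: stab_mono => j; rewrite le_max lexx.
have vF : fixed rho (stab y s) (fixproj rho (stab y s) v).
  by move=> g Hg; exact: fixproj_in.
have [_ h1] := fixproj_sub hrho (fixproj rho (stab y s) v) stab_sub_reach.
have [_ h2] := fixproj_sub hrho v ts.
rewrite -h2 -h1; apply/esym/fixproj_id => // g Hg; exact: fixproj_indep_fixed.
Qed.

End independence.

(** The reason for adjoining 0 to the spectrum when it is not a limit point: arbitrarily small radii
    are available in both cases. *)
Lemma small_radius (e : R) : 0 < e -> exists2 t, spectrum_with0 L t & t < e.
Proof.
move=> e0; have [h|h] := pselect (limit_point L 0); last by exists 0 => //; right.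
have [|t [_ Lt /=]] := h [set t | t < e].
  by apply: open_nbhs_nbhs; split => //; exact: open_lt.
by exists t => //; left.
Qed.

Lemma spectrum_with0_L0 t : spectrum_with0 L t -> L0 (L := L) t.
Proof. by case=> [|[]]; [right|left]. Qed.

Lemma nbhs1_stab (A : set G) : nbhs (1%g : G) A ->
  exists n (x : 'I_n.+1 -> U) (r : 'I_n.+1 -> R),
    (forall i, spectrum_with0 L (r i)) /\ stab x r `<=` A.
Proof.
pose F : set_system G := [set A | exists n (x : 'I_n.+1 -> U) (r : 'I_n.+1 -> R),
    (forall i, spectrum_with0 L (r i)) /\ stab x r `<=` A].
suff : F --> (1%g : G) by apply.
have FF : Filter F.
  split=> [|A1 A2 [n [x [r [hr xA]]]] [n' [x' [r' [hr' xA']]]]|A1 A2 AA [n [x [r [hr xA]]]]].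
  - have [u0 _] := ud_inhab LU; have [t ht _] := small_radius ltr01.
    by exists 0, (fun=> u0), (fun=> t).
  - pose pick T (a : 'I_n.+1 -> T) (b : 'I_n'.+1 -> T) (i : 'I_(n.+1 + n'.+1)) :=
      match fintype.split i with inl j => a j | inr j => b j end.
    have pl T (a : 'I_n.+1 -> T) b j : pick T a b (lshift _ j) = a j.
      by rewrite /pick; case: split_ordP => k /eqP; rewrite (eq_lshift, eq_lrshift) // => /eqP ->.
    have pr T (a : 'I_n.+1 -> T) b j : pick T a b (rshift _ j) = b j.
      by rewrite /pick; case: split_ordP => k /eqP; rewrite (eq_rshift, eq_rlshift) // => /eqP ->.
    exists (n + n'.+1)%N, (pick _ x x'), (pick _ r r'); split.
      by move=> i; rewrite /pick; case: fintype.split.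
    move=> g Hg; split; [apply: xA => i|apply: xA' => i].
      by have := Hg (lshift _ i); rewrite !pl.
    by have := Hg (rshift n.+1 i); rewrite !pr.
  - by exists n, x, r; split=> // g /xA /AA.
apply/cvg_isomP => a; apply/metricType_numDomainType.cvgrPdist_lt => e e0.
have [t ht te] := small_radius e0.
exists 0, (fun=> a), (fun=> t); split=> // g /(_ ord0) Hg /=.
by rewrite (udC LU) (le_lt_trans Hg).
Qed.

(** A radius 0 that is not in [L] occurs only if 0 is not a limit point of [L]; then distances below
    some [e] vanish, and fixing a point is an open condition. *)
Lemma stab_nbhs1 n (x : 'I_n -> U) (r : 'I_n -> R) :
  (forall i, spectrum_with0 L (r i)) -> nbhs (1%g : G) (stab x r).
Proof.
move=> hr; have h i : nbhs (1%g : G) [set g : G | d (g (x i)) (x i) <= r i].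
  have [e e0 he] : exists2 e, 0 < e & forall a, L0 (L := L) a -> a < e -> a <= r i.
    case: (hr i) => [/Lpos r0|[-> nl]]; first by exists (r i) => // a _ /ltW.
    apply: contrapT => ne; apply: nl => A /nbhs_ballP[e /= e0 eA].
    have [[a [a0 ae ah]]|k] := pselect (exists a, [/\ L0 (L := L) a, a < e & ~ a <= 0]).
      have La : L a by case: a0 ah => // ->; rewrite lexx.
      exists a; split=> //; first by rewrite gt_eqF// Lpos.
      by apply: eA; rewrite -ball_normE /= sub0r normrN gtr0_norm// Lpos.
    exfalso; apply: ne; exists e => // a a0 ae.
    by apply: contrapT => al; apply: k; exists a.
  apply: filterS (@cvg_isom_dist _ _ (nbhs (1%g : G)) 1%g (x i) e _ e0 (@cvg_id _ _)).
  move=> g /= hg; apply: he; first exact: ud_L0.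
  by rewrite (udC LU).
exact: (filter_forall _ h).
Qed.

Section density.
Context {V : hilbertType R} (rho : G -> V -> V) (hrho : unitary_rep setT rho).

Lemma fixproj_stab_dense v (e : R) : 0 < e -> exists n (x : 'I_n.+1 -> U) (r : 'I_n.+1 -> R),
  (forall i, spectrum_with0 L (r i)) /\ hn (fixproj rho (stab x r) v - v) < e.
Proof.
move=> e0; have e2 : 0 < e / 2 by rewrite divr_gt0.
have [n [x [r [hr xA]]]] := nbhs1_stab (rep_near1 hrho v e2).
exists n, x, r; split=> //; apply: (@le_lt_trans _ _ (e / 2)); last by lra.
apply: (fixproj_near hrho); last by move=> h /xA /ltW.
by apply: stab_subgroup => i; apply/(L0_ge0 Lpos)/spectrum_with0_L0.
Qed.

End density.
End stabilizers.

(** * The group algebra of a finite group *)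

Section group_algebra.
Context {R : realType} {gT : finGroupType}.
Local Notation C := R[i].
Local Notation A := {ffun gT -> C^o}.
Implicit Types (a b c : A) (s t u : gT) (L J : {vspace A}).

(** [conv] is convolution, [ashift s] is left multiplication by the point mass at [s], and [astar]
    is the involution that becomes the adjoint in a unitary representation. *)
Definition conv a b : A := [ffun t => \sum_s a s * b (s^-1 * t)%g].
Definition ashift s a : A := [ffun t => a (s^-1 * t)%g].
Definition astar a : A := [ffun t => (a t^-1%g)^*%C].

Lemma conv_shift a b : conv a b = \sum_s a s *: ashift s b.
Proof.
by apply/ffunP => t; rewrite !ffunE sum_ffunE; apply: eq_bigr => s _; rewrite !ffunE.
Qed.

Lemma conv_linearl b : linear (conv^~ b).
Proof.
move=> k a c; apply/ffunP => t; rewrite !ffunE scaler_sumr -big_split /=.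
by apply: eq_bigr => s _; rewrite !ffunE mulrDl -scalerAl.
Qed.

Lemma conv_linearr a : linear (conv a).
Proof.
move=> k b c; apply/ffunP => t; rewrite !ffunE scaler_sumr -big_split /=.
by apply: eq_bigr => s _; rewrite !ffunE mulrDr -scalerAr.
Qed.

Lemma convA a b c : conv a (conv b c) = conv (conv a b) c.
Proof.
apply/ffunP => t; rewrite !ffunE.
transitivity (\sum_s \sum_u a s * (b (s^-1 * u)%g * c (u^-1 * t)%g)).
  apply: eq_bigr => s _; rewrite ffunE mulr_sumr (reindex_inj (mulgI s^-1)%g) /=.
  by apply: eq_bigr => u _; rewrite invMg invgK -!mulgA (mulgA s) mulgV mul1g.
rewrite exchange_big; apply: eq_bigr => u _; rewrite ffunE mulr_suml.
by apply: eq_bigr => s _; rewrite mulrA.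
Qed.

Lemma ashift_conv s a b : ashift s (conv a b) = conv (ashift s a) b.
Proof.
apply/ffunP => t; rewrite !ffunE (reindex_inj (mulgI s^-1)%g) /=.
by apply: eq_bigr => u _; rewrite ffunE invMg invgK -!mulgA (mulgA s) mulgV mul1g.
Qed.

Lemma astarK a : astar (astar a) = a.
Proof. by apply/ffunP => t; rewrite !ffunE invgK conjcK. Qed.

Lemma astar_conv a b : astar (conv a b) = conv (astar b) (astar a).
Proof.
apply/ffunP => t; rewrite !ffunE rmorph_sum (reindex_inj (mulgI t^-1)%g) /=.
by apply: eq_bigr => s _; rewrite !ffunE rmorphM mulrC !invMg !invgK mulgK.
Qed.

(** Evaluation at 1 is a trace, faithful by [conv_star1] and [sum_conj_eq0]; it identifies the
    scalar in [alg_projection]. *)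
Lemma conv1_trace a b : conv a b 1%g = conv b a 1%g.
Proof.
rewrite !ffunE (reindex_inj invg_inj) /=; apply: eq_bigr => s _.
by rewrite mulrC !mulg1 invgK.
Qed.

Lemma conv_star1 a : conv a (astar a) 1%g = \sum_s a s * (a s)^*%C.
Proof. by rewrite ffunE; apply: eq_bigr => s _; rewrite ffunE mulg1 invgK. Qed.

Lemma sum_conj_eq0 a : \sum_s a s * (a s)^*%C = 0 -> a = 0.
Proof.
have h s : 0 <= a s * (a s)^*%C by rewrite mul_conjC_ge0.
move=> /eqP; rewrite psumr_eq0 => [/allP k|s _]; last exact: h.
apply/ffunP => s; rewrite ffunE; have /= := k s (mem_index_enum s).
by rewrite mul_conjC_eq0 => /eqP.
Qed.

Definition left_ideal L := forall s a, a \in L -> ashift s a \in L.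

Lemma left_ideal_conv L a b : left_ideal L -> b \in L -> conv a b \in L.
Proof.
move=> lL bL; rewrite conv_shift; apply: memv_suml => s _; apply: memvZ; exact: lL.
Qed.

Let rc b : 'End(A) := linfun (HB.pack (conv^~ b)
  (GRing.isLinear.Build C A A *:%R (conv^~ b) (conv_linearl b)) : {linear A -> A}).

Let rcE b a : rc b a = conv a b. Proof. by rewrite lfunE. Qed.

Lemma left_ideal_img L b : left_ideal L -> left_ideal (rc b @: L)%VS.
Proof.
move=> lL s _ /memv_imgP[a aL ->]; rewrite rcE ashift_conv -rcE.
by apply: memv_img; exact: lL.
Qed.

Let kerE b (k : C) a : (a \in lker (rc b - k *: \1%VF)) = (conv a b == k *: a).
Proof. by rewrite memv_ker add_lfunE opp_lfunE scale_lfunE id_lfunE rcE subr_eq0. Qed.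

Lemma left_ideal_eq L b (k : C) : left_ideal L ->
  left_ideal (L :&: lker (rc b - k *: \1%VF))%VS.
Proof.
move=> lL s a; rewrite !memv_cap !kerE => /andP[/lL -> /= /eqP h]; apply/eqP.
by rewrite -ashift_conv h; apply/ffunP => t; rewrite !ffunE.
Qed.

Lemma eigenvector L (f : 'End(A)) : (f @: L <= L)%VS -> L != 0%VS ->
  exists k : C, exists2 x, x \in L & (x != 0) && (f x == k *: x).
Proof.
move=> fL L0; pose X := vbasis L; have Xb : basis_of L X by exact: vbasisP.
pose M : 'M[C]_(\dim L) := \matrix_(i, j) coord X j (f X`_i).
have [|k /eigenvalueP[v vM v0]] := @eigenvalue_closed C _ M; first by rewrite lt0n dimv_eq0.
have XL (i : 'I_(\dim L)) : X`_i \in L by apply: (basis_mem Xb); rewrite mem_nth// size_tuple.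
pose x := \sum_i v ord0 i *: X`_i; exists k, x.
  by apply: memv_suml => i _; apply: memvZ.
apply/andP; split.
  apply: contraNneq v0 => x0; apply/eqP/rowP => i; rewrite mxE.
  by have /freeP := basis_free Xb; apply.
rewrite linear_sum /=; apply/eqP.
transitivity (\sum_i \sum_j (v ord0 i * M i j) *: X`_j).
  apply: eq_bigr => i _; rewrite linearZ /= [f _](coord_basis Xb); last first.
    by apply: (subvP fL); exact: memv_img.
  by rewrite scaler_sumr; apply: eq_bigr => j _; rewrite scalerA mxE.
rewrite exchange_big scaler_sumr; apply: eq_bigr => j _ /=.
rewrite -scaler_suml scalerA; congr (_ *: _).
by have /rowP/(_ j) := vM; rewrite !mxE => <-.
Qed.

(* Brauer's lemma: a minimal left ideal among those not contained in [J] is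
   generated by a self-adjoint idempotent [b], and it meets [J] trivially, so
   that right multiplication by [b * s * b] has an eigenvector in it. *)
Lemma minimal_projection J : left_ideal J -> (forall a b, a \in J -> conv a b \in J) ->
  (forall a, conv (astar a) a \in J -> a \in J) -> J != fullv ->
  exists b, [/\ b \notin J, conv b b = b, astar b = b &
    forall s, exists k : C, conv b (ashift s b) = k *: b].
Proof.
move=> lJ rJ sJ Jf.
pose P L := left_ideal L /\ ~~ (L <= J)%VS.
have exn : exists n, `[< exists2 L, P L & \dim L = n >].
  exists (\dim {:A}); apply/asboolP; exists fullv => //; split; last first.
      by apply: contra Jf => h; rewrite eqEsubv subvf h.
  by move=> s a _; exact: memvf.
case: (ex_minnP exn) => n /asboolP[L [lL LJ] Ln] Lmin.
have Leq L' : P L' -> (L' <= L)%VS -> L' = L.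
  move=> PL' L'L; apply/eqP; rewrite eqEdim L'L Ln; apply: Lmin.
  by apply/asboolP; exists L'.
have PN L' a : left_ideal L' -> a \in L' -> a \notin J -> P L'.
  by move=> lL' aL' aJ; split=> //; apply: contra aJ => /subvP; exact.
have [a aL aJ] : exists2 a, a \in L & a \notin J.
  by apply/subvPn.
(* A self-adjoint element of [L] outside [J], whose square is outside [J] as well. *)
pose s := conv (astar a) a.
have sL : s \in L by exact: left_ideal_conv.
have ss : astar s = s by rewrite astar_conv astarK.
have sJ' : s \notin J by apply: contra aJ; exact: sJ.
have s2J : conv s s \notin J by rewrite -{1}ss; apply: contra sJ'; exact: sJ.
have rcL b : b \in L -> (rc b @: L <= L)%VS.
  by move=> bL; apply/subvP => _ /memv_imgP[c cL ->]; rewrite rcE; exact: left_ideal_conv.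
(* Minimality: [L s] is a left ideal inside [L] that is not contained in [J]. Counting dimensions,
   right multiplication by [s] is injective on [L]. *)
have Ls : (rc s @: L)%VS = L.
  apply: Leq; last exact: rcL.
  apply: (@PN _ (conv s s)) => //; first exact: left_ideal_img.
  by rewrite -rcE; exact: memv_img.
have s_inj c : c \in L -> conv c s = 0 -> c = 0.
  move=> cL cs; apply/eqP; rewrite -memv0.
  have := limg_ker_dim (rc s) L; rewrite Ls => /eqP; rewrite -{2}[\dim L]add0n eqn_add2r dimv_eq0.
  by move/eqP <-; rewrite memv_cap cL memv_ker rcE cs eqxx.
(* A solution of [b s = s] in [L] is a right unit of [L]; written as [c s], it turns out to be
   self-adjoint. *)
have [b bL bs] : exists2 b, b \in L & conv b s = s.
  by move: sL; rewrite -{1}Ls => /memv_imgP[b bL bs]; exists b => //; rewrite -rcE.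
have [c cL cs] : exists2 c, c \in L & conv c s = b.
  by move: (bL); rewrite -{1}Ls => /memv_imgP[c cL cs]; exists c => //; rewrite -rcE.
have bb : conv b b = b.
  apply/eqP; rewrite -subr_eq0; apply/eqP/s_inj.
    by apply: memvB => //; exact: left_ideal_conv.
  by rewrite (linB (conv_linearl s)) -convA bs bs subrr.
have sb : conv s (astar b) = s by rewrite -{1}ss -astar_conv bs ss.
have bstar : astar b = b.
  have h : conv b (astar b) = b by rewrite -{1}cs -convA sb cs.
  by rewrite -{1}h astar_conv astarK h.
rewrite bstar in sb.
have Lb x : x \in L -> conv x b = x.
  by rewrite -{1}Ls => /memv_imgP[y yL ->]; rewrite rcE -convA sb.
have bJ : b \notin J by apply: contra sJ' => h; rewrite -bs; exact: rJ.
(* Let [t] be the product of [astar x] and [x], and [K] the kernel of right multiplication by [t] on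
   [L]. If [K] were inside [J], so would be [L], the sum of [K] and [L t]. Hence [K] is [L] by
   minimality, the square of [t] is 0, and [t] and [x] vanish. *)
have LJ0 x : x \in L -> x \in J -> x = 0.
  move=> xL xJ; pose t := conv (astar x) x.
  have tt : astar t = t by rewrite astar_conv astarK.
  have tJ : t \in J by exact: left_ideal_conv.
  have tL : t \in L by exact: left_ideal_conv.
  pose K := (L :&: lker (rc t - 0 *: \1%VF))%VS.
  have K0 y : (y \in K) = (y \in L) && (conv y t == 0).
    by rewrite memv_cap kerE scale0r.
  have KL : K = L.
    apply: Leq; last exact: capvSl.
    split; first exact: left_ideal_eq.
    apply: contra LJ => KJ.
    have dK := limg_ker_dim (rc t) L.
    have E : (K + rc t @: L)%VS = L.
      apply/eqP; rewrite eqEdim subv_add capvSl rcL//=.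
      rewrite dimv_disjoint_sum; first by rewrite -dK /K scale0r subr0.
      apply/eqP; rewrite -subv0; apply/subvP => y; rewrite memv_cap K0 => /andP[/andP[yL /eqP yt]].
      case/memv_imgP => z zL yz; rewrite yz rcE in yt *; rewrite memv0.
      have : conv (conv z t) (astar (conv z t)) = 0.
        by rewrite astar_conv tt convA yt (lin0 (conv_linearl _)).
      move/ffunP/(_ 1%g); rewrite conv_star1 ffunE => /sum_conj_eq0 ->.
      by [].
    rewrite -E subv_add KJ /=; apply/subvP => _ /memv_imgP[z zL ->]; rewrite rcE.
    exact: left_ideal_conv.
  have : t \in K by rewrite KL.
  rewrite K0 => /andP[_ /eqP /ffunP/(_ 1%g)]; rewrite -{2}tt conv_star1 ffunE => /sum_conj_eq0 t0.
  have : conv (astar x) (astar (astar x)) = 0 by rewrite astarK.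
  move/ffunP/(_ 1%g); rewrite conv_star1 ffunE => /sum_conj_eq0 x0.
  by rewrite -[x]astarK x0; apply/ffunP => u; rewrite !ffunE conjc0.
exists b; split=> // u; pose y := conv b (ashift u b).
have yL : y \in L by apply: left_ideal_conv => //; exact: lL.
have L0 : L != 0%VS by apply: contraNneq bJ => L0; move: bL; rewrite L0 memv0 => /eqP ->; exact: mem0v.
have [k [x xL /andP[x0 /eqP xk]]] := eigenvector (rcL _ yL) L0.
(* The solutions of [conv a y = k *: a] in [L] form a left ideal that contains [x], which is nonzero
   and hence outside [J]. By minimality this ideal is all of [L] and contains [b]. *)
exists k; suff : b \in (L :&: lker (rc y - k *: \1%VF))%VS.
  rewrite memv_cap bL kerE => /eqP <-.
  by rewrite convA bb.
suff -> : (L :&: lker (rc y - k *: \1%VF))%VS = L by [].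
apply: Leq; last exact: capvSl.
apply: (@PN _ x); first exact: left_ideal_eq.
  by rewrite memv_cap xL kerE /=; apply/eqP; rewrite -rcE.
by apply: contra x0 => /(LJ0 _ xL) ->.
Qed.

End group_algebra.

(** * Corners *)

Section orthogonal_projections.
Context {R : realType} {V : hilbertType R}.
Implicit Types (p q : V -> V) (u v : V).

Definition isproj p :=
  [/\ linear p, forall v, p (p v) = p v & forall u v, ip (p u) v = ip u (p v)].

Lemma isproj_linear p : isproj p -> linear p. Proof. by case. Qed.
Lemma isproj_idem p v : isproj p -> p (p v) = p v. Proof. by case. Qed.
Lemma isproj_adj p u v : isproj p -> ip (p u) v = ip u (p v). Proof. by case. Qed.
Lemma isproj_radj p u v : isproj p -> rip (p u) v = rip u (p v).
Proof. by move=> hp; rewrite /rip isproj_adj. Qed.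

Lemma isproj_hn p v : isproj p -> hn (p v) <= hn v.
Proof.
move=> hp; have [-> |h] := eqVneq (hn (p v)) 0; first exact: hn_ge0.
have h0 : 0 < hn (p v) by rewrite lt0r h hn_ge0.
rewrite -(ler_pM2l h0) -expr2 hn_sqr sqnorm_rip (isproj_radj _ _ hp) (isproj_idem _ hp).
rewrite ripC -(isproj_idem v hp); apply: le_trans (ler_norm _) _.
by rewrite isproj_idem//; exact: CauchySchwarz_hn.
Qed.

Lemma contraction_continuous (W : hilbertType R) (f : V -> W) : linear f ->
  (forall v, hn (f v) <= hn v) -> continuous f.
Proof.
move=> fl fc v A /nbhs_hn[e e0 eA]; apply/nbhs_hn; exists e => // w vw.
by apply: eA; rewrite -(linB fl); exact: le_lt_trans (fc _) vw.
Qed.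

Lemma isproj_bounded p : isproj p -> bounded_op p.
Proof.
move=> hp; split; first exact: isproj_linear.
by apply: contraction_continuous => [|v]; [exact: isproj_linear|exact: isproj_hn].
Qed.

Lemma isproj_comp p q : isproj p -> isproj q -> (forall v, p (q v) = q (p v)) ->
  isproj (p \o q).
Proof.
move=> hp hq pq; split=> [a u v|v|u v] /=.
- by rewrite (isproj_linear hq) (isproj_linear hp).
- by rewrite -pq (isproj_idem _ hq) isproj_idem.
- by rewrite (isproj_adj _ _ hp) (isproj_adj _ _ hq) pq.
Qed.

Lemma isproj_sub p q : isproj p -> isproj q -> (forall v, p (q v) = q (p v)) ->
  isproj (fun v => p v - q (p v)).
Proof.
move=> hp hq pq; split=> [a u v|v|u v].
- rewrite (isproj_linear hp) (isproj_linear hq) scalerBr opprD !addrA; congr (_ - _).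
  by rewrite addrAC.
- rewrite (linB (isproj_linear hp)) (linB (isproj_linear hq)) !pq !isproj_idem//.
  by rewrite subrr subr0.
- rewrite ipBl ipBr !(isproj_adj _ _ hq) !(isproj_adj _ _ hp).
  by rewrite pq.
Qed.

Lemma isproj_hproj (S : set V) : closed_subspace S -> isproj (hproj S).
Proof.
by move=> hS; split=> [|v|u v]; [exact: hproj_linear|exact: hproj_idem|exact: hproj_adj].
Qed.

End orthogonal_projections.

Section corner.
Context {R : realType} {L : set R} {U : metricType R}.
Hypothesis (Lpos : forall r : R, L r -> 0 < r) (LU : is_urysohn L U).
Local Notation d := (@mdist R U).
Local Notation max := Num.max.
Local Notation G := (isom U).
Local Notation C := R[i].
Context {V : hilbertType R} (rho : G -> V -> V) (hrho : unitary_rep setT rho).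
Context (z : V -> V) (hz : isproj z) (zG : forall g v, z (rho g v) = rho g (z v)).

Definition spec n (m : 'I_n -> R) := forall i, spectrum_with0 L (m i).
Definition sep n (x : 'I_n -> U) (m : 'I_n -> R) :=
  forall i j, i != j -> m i < d (x i) (x j).
Definition isoperm n (x : 'I_n -> U) (s : 'S_n) :=
  forall i j, d (x (s i)) (x (s j)) = d (x i) (x j).
Definition maxf n (m m' : 'I_n -> R) := fun i => max (m i) (m' i).
(** The radii to which [P x r rho(g) P x r] reduces, up to an isometry realising [s], when [g]
    carries each [x j] near [x (s^-1 j)]; see [corner_formula]. *)
Definition shift_radius n (x : 'I_n -> U) (r : 'I_n -> R) (g : G) (s : 'S_n) :=
  fun j => max (r j) (max (r (s^-1%g j)) (d (g (x j)) (x (s^-1%g j)))).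

Local Notation P x m := (fixproj rho (stab x m)).

Lemma spec_max s t : spectrum_with0 L s -> L0 (L := L) t -> spectrum_with0 L (max s t).
Proof.
move=> hs ht; case: leP => // st; case: ht => [t0|]; last by left.
by rewrite t0; case: hs => [/Lpos s0|[_ h]]; [move: st; rewrite t0 leNgt s0|right].
Qed.

Lemma spec_L0 n (m : 'I_n -> R) i : spec m -> L0 (L := L) (m i).
Proof. by move=> /(_ i)/spectrum_with0_L0. Qed.

Lemma spec_ge0 n (m : 'I_n -> R) i : spec m -> 0 <= m i.
Proof. by move=> /spec_L0/(L0_ge0 Lpos). Qed.

Lemma spec_maxf n (m m' : 'I_n -> R) : spec m -> spec m' -> spec (maxf m m').
Proof. by move=> hm hm' i; apply: spec_max => //; exact: spec_L0. Qed.

Lemma spec_perm n (m : 'I_n -> R) (s : 'S_n) : spec m -> spec (m \o s).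
Proof. by move=> hm i; exact: hm. Qed.

Lemma spec_shift n (x : 'I_n -> U) r g s : spec r -> spec (shift_radius x r g s).
Proof.
move=> hr i; apply: spec_max => //; apply: L0_max; first exact: spec_L0.
exact: ud_L0.
Qed.

Lemma isoperm_exists n (x : 'I_n -> U) (s : 'S_n) : isoperm x s ->
  exists h : G, forall j, h (x j) = x (s^-1%g j).
Proof.
move=> hs; have [|h hh] := extend_isom Lpos LU (S := [seq (x j, x (s^-1%g j)) | j <- enum 'I_n]).
  by move=> _ _ /mapP[i _ ->] /mapP[j _ ->] /=; rewrite -[RHS]hs !permKV.
by exists h => j; have := hh (x j, x (s^-1%g j)); apply; rewrite map_f// mem_enum.
Qed.

Lemma fixproj_z n (x : 'I_n -> U) m v : spec m -> z (P x m v) = P x m (z v).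
Proof.
move=> hm; apply: (fixproj_comm hrho); [|exact: isproj_bounded|by move=> *; exact: zG].
by apply: (stab_subgroup LU) => i; exact: spec_ge0.
Qed.

(** Since [x j] is within [m i] of [x i], moving [x j] by at most [m j <= m i] forces [x i] to move
    by at most [m i]: the condition at [x i] is redundant. *)
Lemma stab_lift n (x : 'I_n.+1 -> U) (m : 'I_n.+1 -> R) i j : i != j ->
  m j <= m i -> d (x i) (x j) <= m i -> stab x m = stab (x \o lift i) (m \o lift i).
Proof.
move=> ij mji dij; apply/seteqP; split=> g Hg k; first exact: Hg.
have [i' -> |-> ] := unliftP i k; first exact: Hg.
have [j' jE|jE] := unliftP i j; last by rewrite jE eqxx in ij.
apply: (ud_tri_le LU (y := g (x j))); first by rewrite isom_dist.
apply: (ud_tri_le LU (y := x j)); last by rewrite (udC LU).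
by apply: le_trans mji; rewrite jE; exact: Hg.
Qed.

Section minimal.
Variables (n : nat).
Hypothesis minn : forall k (x : 'I_k.+1 -> U) m v, (k < n)%N -> spec m -> z (P x m v) = 0.
Variable (x : 'I_n.+1 -> U).
Local Notation Q m := (fun v => z (P x m v)).

Lemma fixproj_nsep (y : 'I_n.+1 -> U) m v : spec m -> ~ sep y m -> z (P y m v) = 0.
Proof.
rewrite /sep => hm /existsNP[i /existsNP[j /not_implyP[ij /negP]]]; rewrite -leNgt => h.
wlog mji : i j ij h / m j <= m i.
  move=> wl; have [/wl|/ltW mij] := leP (m j) (m i); first exact.
  by apply: (wl j i) => //; [rewrite eq_sym|rewrite (udC LU) (le_trans h)].
have n0 : (0 < n)%N.
  rewrite lt0n; apply: contraNN ij => /eqP n0; rewrite -val_eqE /=.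
  have : (i <= 0)%N by rewrite -n0 leq_ord.
  have : (j <= 0)%N by rewrite -n0 leq_ord.
  by rewrite !leqn0 => /eqP -> /eqP ->.
case: n n0 minn y m i j hm ij h mji => // k _ mk y m i j hm ij h mji.
by rewrite (stab_lift ij mji h) mk// => l; exact: hm.
Qed.

Lemma reach_sep m j : spec m -> sep x m -> reach x m (x j) = m j.
Proof.
move=> hm sm; apply/le_anti/andP; split.
  by apply: (le_trans (reach_le _ _ _ j)); rewrite (udxx LU) ge_max lexx spec_ge0.
rewrite /reach le_max; set c := closest _ _ _.
by have [->|cj] := eqVneq c j; rewrite ?lexx// (ltW (sm j c _)) ?orbT// eq_sym.
Qed.

(** For separated radii the reach of [x j] is [m j], which turns the product formula of
    [fixproj_indep] into a maximum; for unseparated radii both sides vanish. *)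
Lemma fixproj_max m m' v : spec m -> spec m' ->
  z (P x m (P x m' v)) = z (P x (maxf m m') v).
Proof.
move=> hm hm'; have [sm|nm] := pselect (sep x m); last first.
  rewrite !fixproj_nsep//; first exact: spec_maxf.
  by apply: contra_not nm => h i j ij; apply: le_lt_trans (h i j ij); rewrite le_max lexx.
have [sm'|nm'] := pselect (sep x m'); last first.
  rewrite fixproj_z// fixproj_nsep// fixproj_nsep ?(lin0 (@fixproj_linear _ _ _ _ hrho _))//.
    exact: spec_maxf.
  by apply: contra_not nm' => h i j ij; apply: le_lt_trans (h i j ij); rewrite le_max lexx orbT.
rewrite (fixproj_indep Lpos LU) //; [|by move=> i; exact: spec_L0|by move=> i; exact: spec_ge0].
congr (z (fixproj _ (stab _ _) _)); apply/funext => j.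
by rewrite reach_sep// /maxf maxC.
Qed.

Lemma Q_proj m : spec m -> isproj (Q m).
Proof.
move=> hm; apply: (isproj_comp hz (isproj_hproj (fixed_closed hrho _))) => v.
exact: fixproj_z.
Qed.

Lemma Q_comm m m' v : spec m -> spec m' -> Q m (Q m' v) = Q m' (Q m v).
Proof.
move=> hm hm' /=; rewrite -!fixproj_z// !(isproj_idem _ hz) !fixproj_max//.
by congr (z (fixproj _ (stab _ _) _)); apply/funext => j; rewrite /maxf maxC.
Qed.

Lemma rho_Q (h : G) (s : 'S_n.+1) m v : (forall j, h (x j) = x (s^-1%g j)) -> spec m ->
  rho h (Q m v) = Q (m \o s) (rho h v).
Proof.
move=> hh hm /=; rewrite -zG; congr z; apply/esym/(fixproj_conj hrho) => k.
split=> Hk j; first by rewrite !isomME isom_distV hh; have := Hk (s^-1%g j); rewrite /= permKV.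
by have := Hk (s j); rewrite !isomME isom_distV hh permK.
Qed.

Section shift.
Variable (r : 'I_n.+1 -> R).
Hypotheses (hr : spec r) (sr : sep x r).
Local Notation sh g s := (shift_radius x r g s).

(** [g (x j)] is near the two centres that [s] and [s'] assign to it; if these differed, their
    distance would be at most the larger of the two shift radii at [j], against separation. *)
Lemma perm_unique g (s s' : 'S_n.+1) : isoperm x s -> isoperm x s' ->
  sep x (sh g s) -> sep x (sh g s') -> s = s'.
Proof.
have aux (t t' : 'S_n.+1) j : isoperm x t -> sep x (sh g t) ->
    sh g t' j <= sh g t j -> t^-1%g j = t'^-1%g j.
  move=> ht st le; apply/eqP; apply: contraT => ne.
  have : t (t'^-1%g j) != j by apply: contra ne => /eqP E; rewrite -{1}E permK.
  rewrite eq_sym => /st; rewrite ltNge => /negP[].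
  rewrite -{1}[j](permKV t) ht; apply: (ud_tri_le LU (y := g (x j))).
    by rewrite (udC LU) !le_max lexx !orbT.
  by apply: le_trans le; rewrite !le_max lexx !orbT.
move=> hs hs' ss ss'; apply: invg_inj; apply/permP => j.
have [h|/ltW h] := leP (sh g s j) (sh g s' j); last exact: aux.
exact/esym/aux.
Qed.

(** By independence the left-hand side is [rho g (P x t v)], where [t j] measures how near [g (x j)]
    comes to the centres. If [t] is separated, passing to the closest centre is an isometric
    permutation, and [rho g] agrees with [rho h] on vectors fixed by [stab x t]. Otherwise the
    projection vanishes under [z]. *)
Lemma corner_formula g :
  (exists s : 'S_n.+1, [/\ isoperm x s, sep x (sh g s) &
     forall (h : G) v, (forall j, h (x j) = x (s^-1%g j)) ->
       P x r (rho g (P x r v)) = rho h (P x (sh g s) v)]) \/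
  ((forall s : 'S_n.+1, isoperm x s -> ~ sep x (sh g s)) /\
   forall v, z (P x r (rho g (P x r v))) = 0).
Proof.
pose c j := closest x r (g (x j)).
pose t j := max (r j) (reach x r (g (x j))).
have ht : spec t.
  by move=> j; apply: spec_max => //; apply: (reach_L0 LU) => i; exact: spec_L0.
have PP v : P x r (rho g (P x r v)) = rho g (P x t v).
  rewrite -(fixproj_conj hrho (K := stab (g \o x) r)); last first.
    by move=> k; split=> Hk j; have := Hk j; rewrite !isomME isom_distV.
  rewrite (fixproj_indep Lpos LU) //; last 3 first.
  - by move=> i; exact: spec_L0.
  - by move=> i; exact: spec_ge0.
  - by move=> i j ij; rewrite /= isom_dist; exact: sr.
  apply: (fixproj_conj hrho) => k.
  by split=> Hk j; have := Hk j; rewrite !isomME isom_distV.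
have [st|nst] := pselect (sep x t); last first.
  right; split=> [s hs ss|v]; last first.
    by rewrite PP zG fixproj_nsep// (lin0 (rep_linear hrho g)).
  apply: nst => i j ij; apply: le_lt_trans (ss i j ij).
  rewrite ge_max; apply/andP; split; first by rewrite le_max lexx.
  by apply: (le_trans (reach_le x r _ (s^-1%g i))); rewrite le_max lexx orbT.
left; have ct j : d (g (x j)) (x (c j)) <= t j by rewrite !le_max lexx !orbT.
have ciso i j : i != j -> d (x (c i)) (x (c j)) = d (x i) (x j).
  move=> ij; rewrite -[in RHS](isom_dist g).
  have ti := st i j ij; have tj := st j i; rewrite eq_sym ij (udC LU) in tj; have {}tj := tj isT.
  have E1 : d (x (c i)) (g (x j)) = d (g (x i)) (g (x j)).
    by apply: (ud_iso LU); rewrite (udC LU) (le_lt_trans (ct i))// isom_dist.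
  rewrite -E1 (udC LU (x (c i)) (x (c j))) (udC LU (x (c i)) (g _)); apply: (ud_iso LU).
  rewrite (udC LU (x (c j)) _) (udC LU (g (x j)) (x (c i))) E1 isom_dist.
  exact: le_lt_trans (ct j) tj.
have cinj : injective c.
  move=> i j cij; apply/eqP; apply: contraT => ij; have := ciso i j ij.
  rewrite cij (udxx LU) => /esym h; have := st i j ij; rewrite h ltNge.
  by rewrite /t le_max spec_ge0.
pose s := ((perm cinj)^-1)%g.
have sV j : s^-1%g j = c j by rewrite invgK permE.
have shE : sh g s = t.
  by apply/funext => j; rewrite /shift_radius sV.
exists s; rewrite shE; split=> //.
  move=> i j; have [->|ij] := eqVneq i j; first by rewrite !(udxx LU).
  by rewrite -ciso ?(inj_eq perm_inj)// -!sV !permK.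
move=> h v hh; rewrite PP -[in RHS](fixproj_in hrho (H := stab x t) v (h := (h^-1 * g)%g)).
  by rewrite -(repM hrho) mulgA mulgV mul1g.
by move=> j; rewrite isomME isom_distV hh sV.
Qed.

End shift.
End minimal.
End corner.

(** A subspace of maximal dimension inside [S] is all of [S]. This turns the kernel of a
    representation of the group algebra into a subspace. *)
Lemma vspace_of_pred (K : fieldType) (A : vectType K) (S : A -> Prop) :
  S 0 -> (forall k u v, S u -> S v -> S (k *: u + v)) ->
  exists J : {vspace A}, forall a, a \in J <-> S a.
Proof.
move=> S0 Sl; pose ok (J : {vspace A}) := forall a, a \in J -> S a.
have exn : exists n, `[< exists2 J, ok J & \dim J = n >].
  by exists 0; apply/asboolP; exists 0%VS; [move=> a; rewrite memv0 => /eqP ->|rewrite dimv0].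
have bnd n : `[< exists2 J, ok J & \dim J = n >] -> (n <= \dim {:A})%N.
  by move=> /asboolP[J _ <-]; apply: dimvS; exact: subvf.
case: (ex_maxnP exn bnd) => n /asboolP[J okJ Jn] Jmax; exists J => a; split=> [/okJ//|Sa].
have okJa : ok (J + <[a]>)%VS.
  move=> _ /memv_addP[u uJ [_ /vlineP[k ->] ->]]; rewrite addrC; apply: Sl => //; exact: okJ.
suff -> : J = (J + <[a]>)%VS by apply: (subvP (addvSr _ _)); exact: memv_line.
apply/eqP; rewrite eqEdim addvSl Jn; apply: Jmax.
by apply/asboolP; exists (J + <[a]>)%VS.
Qed.

Section corner_existence.
Context {R : realType} {L : set R} {U : metricType R}.
Hypothesis (Lpos : forall r : R, L r -> 0 < r) (LU : is_urysohn L U).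
Local Notation d := (@mdist R U).
Local Notation G := (isom U).
Local Notation C := R[i].
Context {V : hilbertType R} (rho : G -> V -> V) (hrho : unitary_rep setT rho).
Context (z : V -> V) (hz : isproj z) (zG : forall g v, z (rho g v) = rho g (z v)).
Local Notation P x m := (fixproj rho (stab x m)).
Local Notation spec := (spec (L := L)).

(** The scalar by which [b] compresses a symmetry: [b] times [s] times [b] is this multiple of [b].
    For [s] in [F], [subg F s] is [s] itself. *)
Definition corner_phi n (F : {group 'S_n}) (b : {ffun subg_of F -> C^o}) (s : 'S_n) : C :=
  b (subg F s)^-1%g / b 1%g.

(* On a corner [e] the operators [e rho(g) e] are multiples of the commuting
   projections [P x m e], and the finite group [F] of symmetries of [x] acts on
   it through the minimal projection [b] of its group algebra. *)
Record corner n (x : 'I_n.+1 -> U) (r : 'I_n.+1 -> R) (F : {group 'S_n.+1})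
    (b : {ffun subg_of F -> C^o}) (e : V -> V) : Prop := Corner {
  corner_proj : isproj e;
  corner_neq0 : exists v, e v <> 0;
  corner_z : forall v, z (e v) = e v;
  corner_spec : spec r;
  corner_r : forall v, P x r (e v) = e v;
  corner_comm : forall m v, spec m -> P x m (e v) = e (P x m v);
  corner_max : forall m m' v, spec m -> spec m' ->
    P x m (P x m' (e v)) = P x (maxf m m') (e v);
  corner_nsep : forall m v, spec m -> ~ sep x m -> P x m (e v) = 0;
  corner_isoperm : forall s, s \in F -> isoperm x s;
  corner_perm : forall s m v, s \in F -> spec m -> P x m (e v) = P x (m \o s) (e v);
  corner_nperm : forall s : 'S_n.+1, isoperm x s -> s \notin F -> exists m, spec m /\
    ((forall v, P x m (e v) = e v /\ P x (m \o s) (e v) = 0) \/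
     (forall v, P x m (e v) = 0 /\ P x (m \o s) (e v) = e v));
  corner_b : [/\ b <> 0, conv b b = b, astar b = b &
    forall s, conv b (ashift s b) = (b s^-1%g / b 1%g : C) *: b];
  corner_rho : forall g,
    (exists s, [/\ s \in F, sep x (shift_radius x r g s) &
      forall v, e (rho g (e v)) = corner_phi b s *: P x (shift_radius x r g s) (e v)]) \/
    ((forall s, s \in F -> ~ sep x (shift_radius x r g s)) /\
     forall v, e (rho g (e v)) = 0);
  corner_commutant : forall T : V -> V, bounded_op T ->
    (forall g v, T (rho g v) = rho g (T v)) -> (forall v, T (z v) = z (T v)) ->
    forall v, T (e v) = e (T v)
}.

Lemma rho_eq_on n (x : 'I_n.+1 -> U) r (h h' : G) w : spec r ->
  (forall j, h (x j) = h' (x j)) -> P x r w = w -> rho h w = rho h' w.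
Proof.
move=> hr hh <-; rewrite -[in RHS](fixproj_in hrho (H := stab x r) w (h := (h'^-1 * h)%g)).
  by rewrite -(repM hrho) mulgA mulgV mul1g.
by move=> j; rewrite isomME isom_distV hh (udxx LU) (spec_ge0 Lpos).
Qed.

Section shrink.
Variables (n : nat) (x : 'I_n.+1 -> U) (r : 'I_n.+1 -> R).
Hypothesis minn : forall k (x : 'I_k.+1 -> U) m v, (k < n)%N -> spec m -> z (P x m v) = 0.
Hypotheses (hr : spec r) (r0 : exists v, z (P x r v) <> 0).
Local Notation Q m := (fun v => z (P x m v)).
Local Notation N := n.+1.

(** A cut is carried out for all permutations at once: [E s] is the conjugate of [E 1] by an
    isometry realising [s] ([cut_op_rho]), so that the effect of a symmetry on the range of [E 1]
    can be compared with that range ([cut_op_sym]). *)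
Inductive cut_op : ('S_N -> V -> V) -> Prop :=
| cut_base : cut_op (fun s => Q (r \o s))
| cut_in E m of spec m & cut_op E : cut_op (fun s v => Q (m \o s) (E s v))
| cut_out E m of spec m & cut_op E : cut_op (fun s v => E s v - Q (m \o s) (E s v)).

Let QP m : spec m -> isproj (Q m). Proof. exact: Q_proj. Qed.
Let QC m m' v : spec m -> spec m' -> Q m (Q m' v) = Q m' (Q m v).
Proof. exact: Q_comm. Qed.
Let rQ (s : 'S_N) (h : G) m v : (forall j, h (x j) = x (s^-1%g j)) -> spec m ->
  rho h (z (P x m v)) = z (P x (m \o s) (rho h v)).
Proof. by move=> hh hm; exact: (rho_Q hrho zG v hh hm). Qed.
Let QB m v w : spec m -> Q m (v - w) = Q m v - Q m w.
Proof. by move=> hm; rewrite -(linB (isproj_linear (QP hm))). Qed.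

Lemma cut_op_proj E : cut_op E -> forall s,
  isproj (E s) /\ forall k v, spec k -> Q k (E s v) = E s (Q k v).
Proof.
elim=> {E} [s|E m hm _ IH s|E m hm _ IH s].
- by split=> [|k v hk]; [apply: QP; exact: spec_perm|rewrite QC//; exact: spec_perm].
- have [pE cE] := IH s; have hms := spec_perm s hm; split=> [|k v hk].
    by apply: (isproj_comp (QP hms) pE) => v; exact: cE.
  by rewrite QC// cE.
- have [pE cE] := IH s; have hms := spec_perm s hm; split=> [|k v hk].
    by apply: (isproj_sub pE (QP hms)) => v; rewrite cE.
  by rewrite QB// QC// cE.
Qed.

Lemma cut_op_rho E : cut_op E -> forall (s : 'S_N) (h : G) v,
  (forall j, h (x j) = x (s^-1%g j)) -> rho h (E 1%g v) = E s (rho h v).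
Proof.
move=> hE s h v hh; elim: hE v => {E} [v|E m hm _ IH v|E m hm _ IH v].
- rewrite (rQ _ hh)//; last exact: spec_perm.
  by congr (z (fixproj _ (stab _ _) _)); apply/funext => j /=; rewrite perm1.
- rewrite (rQ _ hh)//; last exact: spec_perm.
  by rewrite IH; congr (z (fixproj _ (stab _ _) _)); apply/funext => j /=; rewrite perm1.
- rewrite (linB (rep_linear hrho h)) (rQ _ hh)//; last exact: spec_perm.
  by rewrite IH; congr (_ - z (fixproj _ (stab _ _) _)); apply/funext => j /=; rewrite perm1.
Qed.

Lemma cut_op_commutant E : cut_op E -> forall T : V -> V, bounded_op T ->
    (forall g v, T (rho g v) = rho g (T v)) -> (forall v, T (z v) = z (T v)) ->
    forall s v, T (E s v) = E s (T v).
Proof.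
move=> hE T bT Trho Tz s.
have TQ m v : spec m -> T (Q m v) = Q m (T v).
  move=> hm; rewrite Tz (fixproj_comm hrho)//.
  by apply: (stab_subgroup LU) => i; exact: (spec_ge0 Lpos).
elim: hE => {E} [v|E m hm _ IH v|E m hm _ IH v].
- by rewrite TQ//; exact: spec_perm.
- by rewrite TQ ?IH//; exact: spec_perm.
- by rewrite (linB bT.1) TQ ?IH//; exact: spec_perm.
Qed.

Lemma cut_op_rz E : cut_op E -> forall v, z (E 1%g v) = E 1%g v /\ P x r (E 1%g v) = E 1%g v.
Proof.
have r1 : r \o (1%g : 'S_N) = r by apply/funext => j /=; rewrite perm1.
have PP v : P x r (P x r v) = P x r v by rewrite /fixproj (hproj_idem (fixed_closed hrho _)).
have Pr v w : P x r v = v -> P x r w = w -> P x r (v - w) = v - w.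
  by move=> hv hw; rewrite (linB (@fixproj_linear _ _ _ _ hrho _)) hv hw.
have Pm m v : spec m -> z v = v -> P x r v = v -> P x r (Q m v) = Q m v.
  move=> hm zv rv; have := QC v hr hm; rewrite /= rv zv -(fixproj_z Lpos LU hrho hz zG)//.
  by rewrite (isproj_idem _ hz).
elim=> {E} [v|E m hm _ IH v|E m hm _ IH v].
- rewrite r1; split; first by rewrite (isproj_idem _ hz).
  by rewrite -(fixproj_z Lpos LU hrho hz zG)// PP.
- have [h1 h2] := IH v; split; first by rewrite (isproj_idem _ hz).
  by apply: Pm => //; exact: spec_perm.
- have [h1 h2] := IH v; rewrite (linB (isproj_linear hz)) h1 (isproj_idem _ hz); split=> //.
  by apply: Pr => //; apply: Pm => //; exact: spec_perm.
Qed.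

Lemma cut_op_sym E : cut_op E -> forall (s : 'S_N) A,
  (forall m, spec m -> Q m A = Q (m \o s) A) -> E s A = E 1%g A.
Proof.
move=> hE s A hA; have m1 (m : 'I_N -> R) : m \o (1%g : 'S_N) = m.
  by apply/funext => j /=; rewrite perm1.
elim: hE => {E} [|E m hm hE IH|E m hm hE IH].
- by rewrite m1 -hA.
- have [_ cE] := cut_op_proj hE 1%g.
  by rewrite IH m1 !cE// -?hA//; exact: spec_perm.
- have [_ cE] := cut_op_proj hE 1%g.
  by rewrite IH m1 !cE// -?hA//; exact: spec_perm.
Qed.

(** The permutations are treated one at a time. If [Q m] and [Q (m \o s)] differ on the range of
    [E 1], one of them times the complement of the other is nonzero there, and cutting down to it
    separates [s]. The alternatives reached for other permutations persist under further cuts. *)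
Lemma cut_op_exists : exists2 E, cut_op E & (exists v, E 1%g v <> 0) /\
  forall s : 'S_N, (forall m v, spec m -> Q m (E 1%g v) = Q (m \o s) (E 1%g v)) \/
    exists2 m, spec m & (forall v, Q m (E 1%g v) = E 1%g v /\ Q (m \o s) (E 1%g v) = 0) \/
      (forall v, Q m (E 1%g v) = 0 /\ Q (m \o s) (E 1%g v) = E 1%g v).
Proof.
have m1 (m : 'I_N -> R) : m \o (1%g : 'S_N) = m by apply/funext => j /=; rewrite perm1.
suff h (ts : seq 'S_N) : exists2 E, cut_op E & (exists v, E 1%g v <> 0) /\
  forall s, s \in ts -> (forall m v, spec m -> Q m (E 1%g v) = Q (m \o s) (E 1%g v)) \/
    exists2 m, spec m & (forall v, Q m (E 1%g v) = E 1%g v /\ Q (m \o s) (E 1%g v) = 0) \/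
      (forall v, Q m (E 1%g v) = 0 /\ Q (m \o s) (E 1%g v) = E 1%g v).
  have [E hE [E0 hs]] := h (enum 'S_N); exists E => //; split=> // s.
  by apply: hs; rewrite mem_enum.
elim: ts => [|s ts [E hE [E0 IH]]].
  by exists (fun s => Q (r \o s)); [exact: cut_base|split; [rewrite m1|]].
have [pE cE] := cut_op_proj hE 1%g.
have Eid v : E 1%g (E 1%g v) = E 1%g v by exact: isproj_idem.
have [eqm|] := pselect (forall m v, spec m -> Q m (E 1%g v) = Q (m \o s) (E 1%g v)).
  by exists E => //; split=> // t; rewrite inE => /predU1P[->|/IH//]; left.
move=> /existsNP[m /existsNP[v /not_implyP[hm ne]]]; have hms := spec_perm s hm.
have keep E' : cut_op E' -> (forall v, E' 1%g v = E 1%g (E' 1%g v)) ->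
  forall t, t \in ts -> (forall m v, spec m -> Q m (E' 1%g v) = Q (m \o t) (E' 1%g v)) \/
    exists2 m, spec m & (forall v, Q m (E' 1%g v) = E' 1%g v /\ Q (m \o t) (E' 1%g v) = 0) \/
      (forall v, Q m (E' 1%g v) = 0 /\ Q (m \o t) (E' 1%g v) = E' 1%g v).
  move=> hE' E'E t /IH[k|[k hk k']]; first by left=> l w hl; rewrite E'E k.
  right; exists k => //; case: k' => k'; [left|right] => w;
    have [h1 h2] := k' (E' 1%g w); rewrite E'E h1 h2 -E'E //.
pose E1 := fun (t : 'S_N) w => Q (m \o t) (E t w - Q (m \o s \o t) (E t w)).
pose E2 := fun (t : 'S_N) w => Q (m \o s \o t) (E t w - Q (m \o t) (E t w)).
have hE1 : cut_op E1 by apply: (cut_in hm); exact: (cut_out hms).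
have hE2 : cut_op E2 by apply: (cut_in hms); exact: (cut_out hm).
have EB u w : E 1%g (u - w) = E 1%g u - E 1%g w by rewrite (linB (isproj_linear pE)).
have QI k u : spec k -> Q k (Q k u) = Q k u by move=> hk; exact: (isproj_idem _ (QP hk)).
have fin E' : cut_op E' -> (forall v, E' 1%g v = E 1%g (E' 1%g v)) ->
   ((forall w, Q m (E' 1%g w) = E' 1%g w /\ Q (m \o s) (E' 1%g w) = 0) \/
      (forall w, Q m (E' 1%g w) = 0 /\ Q (m \o s) (E' 1%g w) = E' 1%g w)) ->
   (exists v, E' 1%g v <> 0) -> exists2 E, cut_op E & (exists v, E 1%g v <> 0) /\
  forall t, t \in s :: ts -> (forall m v, spec m -> Q m (E 1%g v) = Q (m \o t) (E 1%g v)) \/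
    exists2 m, spec m & (forall v, Q m (E 1%g v) = E 1%g v /\ Q (m \o t) (E 1%g v) = 0) \/
      (forall v, Q m (E 1%g v) = 0 /\ Q (m \o t) (E 1%g v) = E 1%g v).
  move=> hE' E'E h E'0; exists E' => //; split=> // t; rewrite inE => /predU1P[->|].
    by right; exists m.
  exact: keep.
have [[w E1w]|noE1] := pselect (exists w, E1 1%g w <> 0).
  apply: (fin E1) => //; last by exists w.
    by move=> u; rewrite /E1 !m1 -cE// EB -cE// Eid.
  left=> u; rewrite /E1 !m1 QI//; split=> //.
  by rewrite QC// QB// QI// subrr (lin0 (isproj_linear (QP hm))).
have [[w E2w]|noE2] := pselect (exists w, E2 1%g w <> 0).
  apply: (fin E2) => //; last by exists w.
    by move=> u; rewrite /E2 !m1 -cE// EB -cE// Eid.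
  right=> u; rewrite /E2 !m1 QI//; split=> //.
  by rewrite QC// QB// QI// subrr (lin0 (isproj_linear (QP hms))).
exfalso; apply: ne.
have h1 : E1 1%g v = 0 by apply: contrapT => h; apply: noE1; exists v.
have h2 : E2 1%g v = 0 by apply: contrapT => h; apply: noE2; exists v.
move: h1 h2; rewrite /E1 /E2 !m1 !QB// => /eqP; rewrite subr_eq0 => /eqP e1 /eqP.
by rewrite subr_eq0 => /eqP e2; rewrite e1 QC// -e2.
Qed.

End shrink.
End corner_existence.

Lemma rip_inj {R : realType} {V : hilbertType R} (u v : V) :
  (forall w, rip u w = rip v w) -> u = v.
Proof.
move=> h; apply/eqP; rewrite -subr_eq0; apply/eqP/rip_self0 => w.
by rewrite ripBl h subrr.
Qed.

Lemma ip_inj {R : realType} {V : hilbertType R} (u v : V) :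
  (forall w, ip u w = ip v w) -> u = v.
Proof. by move=> h; apply: rip_inj => w; rewrite /rip h. Qed.

Section corner_existence.
Context {R : realType} {L : set R} {U : metricType R}.
Hypothesis (Lpos : forall r : R, L r -> 0 < r) (LU : is_urysohn L U).
Local Notation d := (@mdist R U).
Local Notation G := (isom U).
Local Notation C := R[i].
Context {V : hilbertType R} (rho : G -> V -> V) (hrho : unitary_rep setT rho).
Local Notation P x m := (fixproj rho (stab x m)).
Local Notation spec := (spec (L := L)).

Section group_action.
Variables (n : nat) (x : 'I_n.+1 -> U) (r : 'I_n.+1 -> R) (hr : spec r).
Variables (F : {group 'S_n.+1}) (hh : 'S_n.+1 -> G) (E : V -> V).
Hypothesis hhP : forall s, s \in F -> forall j, hh s (x j) = x (s^-1%g j).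
Hypotheses (pE : isproj E) (rE : forall v, P x r (E v) = E v).
Hypothesis hhE : forall s v, s \in F -> rho (hh s) (E v) = E (rho (hh s) v).
Local Notation A := {ffun subg_of F -> C^o}.
Implicit Types (a b : A) (s t : subg_of F).

Let u s := rho (hh (sgval s)).
Let uE s v : u s (E v) = E (u s v). Proof. exact: hhE (valP s). Qed.
Let u_lin s : linear (u s). Proof. exact: rep_linear. Qed.

(** The chosen isometries [hh s] need not multiply as the permutations do, but the products agree on
    the centres, and vectors of the range of [E] see only the images of the centres
    ([rho_eq_on]). *)
Let uM s t v : u s (u t (E v)) = u (s * t)%g (E v).
Proof.
rewrite /u -(repM hrho); apply: (rho_eq_on Lpos LU hrho hr _ (rE v)) => j.
rewrite isomME !hhP ?(valP s) ?(valP t) ?(valP (s * t)%g)//.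
by congr (x _); rewrite /= invMg permM.
Qed.

Let u1 v : u 1%g (E v) = E v.
Proof.
rewrite /u -[RHS](rep1 hrho); apply: (rho_eq_on Lpos LU hrho hr _ (rE v)) => j.
by rewrite hhP ?group1// invg1 perm1.
Qed.

Let uV s v : rho (hh (sgval s))^-1%g (E v) = u (s^-1)%g (E v).
Proof.
apply: (rho_eq_on Lpos LU hrho hr _ (rE v)) => j.
rewrite hhP ?(valP (s^-1)%g)// invgK.
by rewrite -{1}[j](permK (sgval s)) -(hhP (valP s)) isomVE.
Qed.

Definition alg_op a v := \sum_s a s *: u s (E v).

Lemma alg_op_linear v : linear (alg_op^~ v).
Proof.
move=> k a b; rewrite /alg_op scaler_sumr -big_split; apply: eq_bigr => s _.
by rewrite !ffunE scalerDl scalerA.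
Qed.

Lemma alg_op_linearr a : linear (alg_op a).
Proof.
move=> k v w; rewrite /alg_op scaler_sumr -big_split; apply: eq_bigr => s _.
by rewrite (isproj_linear pE) u_lin scalerDr !scalerA mulrC.
Qed.

Lemma alg_op_in a v : E (alg_op a v) = alg_op a v.
Proof.
rewrite /alg_op (lin_sum (isproj_linear pE)); apply: eq_bigr => s _.
by rewrite (linZ (isproj_linear pE)) uE (isproj_idem _ pE).
Qed.

Lemma alg_op_E a v : alg_op a (E v) = alg_op a v.
Proof. by apply: eq_bigr => s _; rewrite (isproj_idem _ pE). Qed.

Lemma alg_op_shift s a v : alg_op (ashift s a) v = u s (alg_op a v).
Proof.
rewrite /alg_op (lin_sum (u_lin s)) (reindex_inj (mulgI s)) /=; apply: eq_bigr => t _.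
by rewrite (linZ (u_lin s)) uM ffunE mulgA mulVg mul1g.
Qed.

Lemma alg_op_conv a b v : alg_op (conv a b) v = alg_op a (alg_op b v).
Proof.
rewrite conv_shift (lin_sum (alg_op_linear v)); apply: eq_bigr => s _.
by rewrite (linZ (alg_op_linear v)) alg_op_shift alg_op_in.
Qed.

Lemma alg_op_adj a v w : ip (alg_op a v) w = ip v (alg_op (astar a) w).
Proof.
rewrite /alg_op ip_suml ip_sumr [RHS](reindex_inj invg_inj) /=; apply: eq_bigr => s _.
rewrite ipZl ipZr ffunE invgK conjcK; congr (_ * _).
by rewrite uE (isproj_adj _ _ pE) /u (rep_adj hrho) uV.
Qed.

Lemma alg_op_delta v : alg_op [ffun s => (s == 1%g)%:R] v = E v.
Proof.
rewrite /alg_op (bigD1 1%g)//= ffunE eqxx scale1r u1 big1 ?addr0// => s s1.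
by rewrite ffunE (negPf s1) scale0r.
Qed.

(** [J] is the kernel of the representation of the group algebra on the range of [E];
    [minimal_projection] yields [b] outside it. The scalar is found by evaluation at 1 and the trace
    property. *)
Lemma alg_projection : (exists v, E v <> 0) -> exists b : A,
  [/\ isproj (alg_op b), exists v, alg_op b v <> 0 & [/\ b <> 0, conv b b = b, astar b = b &
    forall s, conv b (ashift s b) = (b s^-1%g / b 1%g : C) *: b]].
Proof.
move=> [v0 Ev0].
have [||J JP] := @vspace_of_pred C A (fun a => forall v, alg_op a v = 0).
- by move=> v; exact: lin0 (alg_op_linear v).
- by move=> k a b ha hb v; rewrite (alg_op_linear v) ha hb scaler0 addr0.
have [||||b [bJ bb bs bm]] := @minimal_projection R (subg_of F) J.
- move=> s a /JP aJ; apply/JP => v; rewrite alg_op_shift aJ; exact: lin0 (u_lin s).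
- by move=> a b /JP aJ; apply/JP => v; rewrite alg_op_conv.
- move=> a /JP aJ; apply/JP => v; apply/eqP; rewrite -sqnorm_eq0 /sqnorm.
  by rewrite alg_op_adj -alg_op_conv aJ ip0r.
- apply/eqP => Jf; apply: Ev0; rewrite -alg_op_delta.
  by have /JP : [ffun s => (s == 1%g)%:R] \in J by rewrite Jf memvf.
have b0 : b <> 0 by move=> b0; move: bJ; rewrite b0 mem0v.
exists b; split.
- split=> [|v|v w]; first exact: alg_op_linearr.
    by rewrite -alg_op_conv bb.
  by rewrite alg_op_adj bs.
- apply: contrapT => h; move/negP : bJ; apply; apply/JP => v.
  by apply: contrapT => hv; apply: h; exists v.
split=> // s; have [k bk] := bm s; rewrite bk; congr (_ *: _).
have b1 : b 1%g != 0.
  apply: contra_notN b0 => /eqP; rewrite -{1}bb -{2}bs conv_star1.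
  exact: sum_conj_eq0.
apply: (mulIf b1); rewrite divfK//.
have /ffunP/(_ 1%g) := bk; rewrite conv1_trace -ashift_conv bb !ffunE mulg1.
by move=> ->.
Qed.

End group_action.

Lemma corner_exists (z : V -> V) : isproj z ->
  (forall g v, z (rho g v) = rho g (z v)) -> (exists v, z v <> 0) ->
  exists n (x : 'I_n.+1 -> U) r (F : {group 'S_n.+1}) (b : {ffun subg_of F -> C^o}) e,
    corner (L := L) rho z x r b e.
Proof.
move=> hz zG [v0 zv0].
(* Projections of small stabilizers approximate the identity, so some of them survive under [z];
   [n.+1] will be the least number of centres for which this happens. *)
have exn : exists n, `[< exists (x : 'I_n.+1 -> U) r v, spec r /\ z (P x r v) <> 0 >].
  have e0 : 0 < hn (z v0) by rewrite hn_gt0; apply/eqP.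
  have [n [x [r [hr close]]]] := fixproj_stab_dense Lpos LU hrho v0 e0.
  exists n; apply/asboolP; exists x, r, v0; split=> // h0.
  have := isproj_hn (P x r v0 - v0) hz.
  by rewrite (linB (isproj_linear hz)) h0 sub0r hnN leNgt close.
case: (ex_minnP exn) => n /asboolP[x [r [v1 [hr zv1]]]] nmin.
have minn k (y : 'I_k.+1 -> U) m v : (k < n)%N -> spec m -> z (P y m v) = 0.
  move=> kn hm; apply: contrapT => h; move: kn; rewrite ltnNge => /negP; apply.
  by apply: nmin; apply/asboolP; exists y, m, v.
have sr : sep x r.
  by apply: contrapT => h; apply: zv1; apply: (fixproj_nsep LU minn).
have [EE hE [E0 Esym]] := cut_op_exists Lpos LU hrho hz zG minn hr (ex_intro _ v1 zv1).
have [E EEq] : exists E, EE 1%g = E by exists (EE 1%g).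
rewrite EEq in E0 Esym.
have := cut_op_proj Lpos LU hrho hz zG minn hr hE 1%g; rewrite EEq => -[pE cE].
have zE v : z (E v) = E v by have [] := cut_op_rz Lpos LU hrho hz zG minn hr hE v; rewrite EEq.
have rE v : P x r (E v) = E v by have [] := cut_op_rz Lpos LU hrho hz zG minn hr hE v; rewrite EEq.
have commE (T : V -> V) : bounded_op T -> (forall g v, T (rho g v) = rho g (T v)) ->
    (forall v, T (z v) = z (T v)) -> forall v, T (E v) = E (T v).
  by move=> bT Trho Tz v; rewrite -EEq (cut_op_commutant Lpos LU hrho hr hE bT Trho Tz).
have Ez v : E (z v) = E v.
  by rewrite -[RHS]zE (commE z (isproj_bounded hz))// => w; rewrite isproj_idem.
have Plin m : linear (P x m) by exact: fixproj_linear.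
have QE m v : spec m -> z (P x m (E v)) = P x m (E v).
  by move=> hm; rewrite (fixproj_z Lpos LU hrho hz zG)// zE.
have PE m v : spec m -> P x m (E v) = E (P x m v).
  by move=> hm; rewrite -QE// cE// Ez.
have ex s : exists g : G, isoperm x s -> forall j, g (x j) = x (s^-1%g j).
  have [h|h] := pselect (isoperm x s); last by exists 1%g.
  by have [g hg] := isoperm_exists Lpos LU h; exists g.
have [hh hhP] := choice ex.
(* The symmetries that the projections do not see on the range of [E]; [Esym] separates every other
   isometric permutation by some [m]. *)
pose inF (s : 'S_n.+1) :=
  isoperm x s /\ forall m v, spec m -> P x m (E v) = P x (m \o s) (E v).
have Fgrp : group_set [set s | `[< inF s >]]%SET.
  apply/group_setP; split=> [|s t]; rewrite !finset.in_set.
    apply/asboolP; split=> [i j|m v _]; first by rewrite !perm1.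
    by congr (fixproj _ (stab _ _) _); apply/funext => j /=; rewrite perm1.
  move=> /asboolP[s1 s2] /asboolP[t1 t2]; apply/asboolP; split=> [i j|m v hm].
    by rewrite !permM t1 s1.
  rewrite t2// s2; last exact: spec_perm.
  by congr (fixproj _ (stab _ _) _); apply/funext => j /=; rewrite permM.
pose F : {group 'S_n.+1} := Group Fgrp.
have FP s : s \in F -> inF s by rewrite finset.in_set => /asboolP.
have Eip u w : ip (E u) w = ip u (E w) by exact: isproj_adj.
(* For [s] in [F] the operators [EE s] and [E] agree on the range of [E] by [cut_op_sym]; passing to
   adjoints removes the inner [E]. *)
have EE1 s (h : G) v : s \in F -> (forall j, h (x j) = x (s^-1%g j)) ->
    E (rho h (E v)) = E (rho h v).
  move=> /FP[_ s2] hs; rewrite -[in E v]EEq (cut_op_rho hrho zG hr hE _ hs).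
  have [pEs _] := cut_op_proj Lpos LU hrho hz zG minn hr hE s.
  apply: ip_inj => w; rewrite !Eip (isproj_adj _ _ pEs).
  have := cut_op_sym Lpos LU hrho hz zG minn hr hE (s := s) (A := E w).
  rewrite EEq (isproj_idem _ pE) => -> // m hm; have hms := spec_perm s hm.
  by rewrite (QE m w hm) (QE (m \o s) w hms) s2.
have hhE s v : s \in F -> rho (hh s) (E v) = E (rho (hh s) v).
  move=> sF; have [s1 _] := FP _ sF; rewrite -(EE1 _ _ _ sF (hhP s s1)).
  apply: ip_inj => w; rewrite Eip !(rep_adj hrho) !Eip; congr (ip v _); apply/esym.
  apply: (EE1 s^-1%g); first by rewrite groupV.
  by move=> j; rewrite invgK -{1}[j](permK s) -(hhP s s1) isomVE.
have hhF s : s \in F -> forall j, hh s (x j) = x (s^-1%g j).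
  by move=> /FP[s1 _]; exact: hhP.
have [|b [pe [w0 ew0] [b0 bb bs bm]]] := alg_projection hr hhF pE rE hhE.
  by case: E0 => v; exists v.
pose e := alg_op hh E b.
have eE v : e v = E (e v) by rewrite /e (alg_op_in pE hhE).
have Ee v : e (E v) = e v by exact: alg_op_E.
have er v : e (P x r v) = e v by rewrite -Ee -PE// rE Ee.
have ez v : e (z v) = e v by rewrite -Ee Ez Ee.
have re v : P x r (e v) = e v by rewrite eE rE.
have PeE m v : spec m -> P x m (e v) = e (P x m v).
  move=> hm; rewrite /e /alg_op (lin_sum (Plin m)); apply: eq_bigr => s _.
  rewrite (linZ (Plin m)); congr (_ *: _); have sF := valP s; have [_ s2] := FP _ sF.
  rewrite hhE// s2// -PE// -QE; last exact: spec_perm.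
  have /= rQ := rho_Q hrho zG (E v) (hhF _ sF) hm.
  by rewrite -hhE// -rQ QE// PE.
exists n, x, r, F, b, e; split=> //.
- by exists w0.
- by move=> v; rewrite eE zE.
- move=> m m' v hm hm'; have hmm := spec_maxf Lpos hm hm'.
  have ze w : z (e w) = e w by rewrite eE zE.
  have := fixproj_max Lpos LU hrho hz zG minn x (e v) hm hm'.
  by rewrite (PeE m' v hm') (PeE m _ hm) (PeE _ v hmm) !ze.
- by move=> m v hm hs; rewrite eE -QE// (fixproj_nsep LU minn).
- by move=> s /FP[].
- by move=> s m v /FP[_ h] hm; rewrite eE h.
- move=> s s1 sF; have [h|[m hm h]] := Esym s.
    case/negP: sF; rewrite finset.in_set; apply/asboolP; split=> // m v hm.
    by rewrite -(QE m v hm) -(QE (m \o s) v (spec_perm s hm)) h.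
  exists m; split=> //; have hms := spec_perm s hm.
  by case: h => h; [left|right] => v; have := h (e v);
    rewrite (QE m _ hm) (QE (m \o s) _ hms) -eE.
- move=> g; have [[s [s1 ss fs]]|[h1 h2]] := corner_formula Lpos LU hrho zG minn hr sr g.
    have shs : spec (shift_radius x r g s) by exact: spec_shift.
    have fe v : e (rho g (e v)) = e (rho (hh s) (P x (shift_radius x r g s) (e v))).
      by rewrite -er -[X in rho g X]re (fs (hh s))//; exact: hhP.
    have [sF|sF] := boolP (s \in F).
      left; exists s; split=> // v; rewrite fe PeE//; set w := P x _ v.
      have -> : hh s = hh (sgval (subg F s)) by rewrite subgK.
      have := alg_op_shift hr hhF rE (subg F s) b w; rewrite -/e => <-.
      have := alg_op_conv hr hhF pE rE hhE b (ashift (subg F s) b) w; rewrite -/e => <-.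
      by rewrite bm (linZ (alg_op_linear hh E _)).
    right; split=> [s' s'F ss'|v].
      have [s'1 _] := FP _ s'F; case/negP: sF.
      by rewrite (perm_unique LU s1 s'1 ss ss').
    (* A permutation outside [F] contributes nothing: [rho (hh s)] carries [Q m] to [Q (m \o s)],
       and on the range of [E] one of these is 1 and the other 0. *)
    suff Es w : E (rho (hh s) (E w)) = 0.
      by rewrite fe PeE// (eE (P x _ v)) -Ee Es; exact: lin0 (isproj_linear pe).
    have [h|[m hm h]] := Esym s.
      case/negP: sF; rewrite finset.in_set; apply/asboolP; split=> // m u hm.
      by rewrite -(QE m u hm) -(QE (m \o s) u (spec_perm s hm)) h.
    have hms := spec_perm s hm; have /= rQ u := rho_Q hrho zG u (hhP s s1) hm.
    case: h => h; have [h1 h2] := h w.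
      rewrite -h1 rQ -cE//; have [_] := h (rho (hh s) (E w)).
      by [].
    have [_ h3] := h (rho (hh s) (E w)); rewrite -h3 cE// -rQ h1.
    by rewrite (lin0 (rep_linear hrho _)) (lin0 (isproj_linear pE)).
  right; split=> [s /FP[s1 _]|v]; first exact: h1.
  by rewrite -er -ez -[X in rho g X]re h2; exact: lin0 (isproj_linear pe).
- move=> T bT Trho Tz v; rewrite /e /alg_op (lin_sum bT.1); apply: eq_bigr => s _.
  by rewrite (linZ bT.1) Trho commE.
Qed.

End corner_existence.

(** * Type I *)

Section commutants.
Context {R : realType} {V : hilbertType R}.
Implicit Types (S T p : V -> V) (X : set (V -> V)).

Lemma bounded_op_comp S T : bounded_op S -> bounded_op T -> bounded_op (S \o T).
Proof.
move=> [Sl Sc] [Tl Tc]; split=> [a u v /=|]; first by rewrite Tl Sl.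
by move=> v; apply: continuous_comp; [exact: Tc|exact: Sc].
Qed.

Lemma closed_subspace_preim T (A : set V) : bounded_op T -> closed_subspace A ->
  closed_subspace [set v | A (T v)].
Proof.
move=> [Tl Tc] [Ac [A0 Al]]; split; last first.
  by split=> /= [|a u v Su Sv]; rewrite ?(lin0 Tl)// Tl; exact: Al.
by apply: (@closed_comp _ _ T A) => // v _; exact: Tc.
Qed.

Lemma closed_subspace_bigcap (I : Type) (A : I -> set V) :
  (forall i, closed_subspace (A i)) -> closed_subspace [set v | forall i, A i v].
Proof.
move=> hA; split; last first.
  split=> [i|a u v hu hv i]; first exact: subspace0 (hA i).2.
  by apply: (hA i).2.2; [exact: hu|exact: hv].
have -> : [set v | forall i, A i v] = \bigcap_(i in setT) A i.
  by apply/seteqP; split=> [v hv i _|v hv i]; [exact: hv|exact: hv].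
by apply: closed_bigI => i _; exact: (hA i).1.
Qed.

Lemma closed_subspace_eq S : bounded_op S -> closed_subspace [set v | S v = v].
Proof.
move=> [Sl Sc]; split; last by split=> /= [|a u v hu hv]; rewrite ?(lin0 Sl)// Sl hu hv.
apply/closed_hn => v hv; apply/eqP; rewrite -subr_eq0; apply/eqP/hn_le_lt0 => e e0.
have /nbhs_hn[k k0 hk] : nbhs v [set w | hn (S v - S w) < e / 2].
  by apply: (Sc v [set w | hn (S v - w) < e / 2]); apply/nbhs_hn; exists (e / 2); rewrite ?divr_gt0.
have [|w Sw vw] := hv (Num.min k (e / 2)); first by rewrite lt_min k0 divr_gt0.
move: vw; rewrite lt_min => /andP[vk ve]; apply: le_lt_trans (hn_tri _ (S w) _) _.
by rewrite [e]splitr ltrD//; [exact: hk|rewrite Sw hnB].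
Qed.

Lemma commutant_sub X X' : X `<=` X' -> commutant X' `<=` commutant X.
Proof. by move=> XX T [bT hT]; split=> // S /XX; exact: hT. Qed.

Lemma sub_commutant2 X : X `<=` @bounded_op R V -> X `<=` commutant (commutant X).
Proof. by move=> Xb S XS; split=> [|T [_ /(_ _ XS)->]//]; exact: Xb. Qed.

(** Applied to the projections that commute with a representation, it confines the generated von
    Neumann algebra to operators reduced by every invariant subspace. *)
Lemma vN_commutant X : X `<=` @bounded_op R V -> (forall p, X p -> adjoint_op p p) ->
  von_neumann_algebra (commutant X).
Proof.
move=> Xb Xa; split=> [S []//|S T [bS hS] bT ST|].
  split=> // p Xp; apply/funext => v /=; apply: ip_inj => w.
  rewrite (Xa p)// ipC -ST -[S _]/((S \o p) w) -hS//= (Xa p)// ST -ipC.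
  by [].
apply/seteqP; split; last by apply: sub_commutant2 => S [].
by apply: commutant_sub; exact: sub_commutant2.
Qed.

End commutants.

Section invariant_projection.
Context {R : realType} {G : topologicalGroupType} {V : hilbertType R}.
Context (rho : G -> V -> V) (hrho : unitary_rep setT rho).

Lemma rep_bounded g : bounded_op (rho g).
Proof.
split; first exact: rep_linear.
by apply: contraction_continuous => [|v]; [exact: rep_linear|rewrite (rep_hn hrho)].
Qed.

Lemma hproj_invariant (A : set V) g v : closed_subspace A ->
  (forall g v, A v -> A (rho g v)) -> hproj A (rho g v) = rho g (hproj A v).
Proof.
move=> hA Ag; apply: hproj_unitary => //; first exact: rep_linear.
  by move=> *; exact: rep_rip.
apply/seteqP; split=> [w Aw|_ [w Aw <-]]; last exact: Ag.
by exists (rho g^-1%g w); [exact: Ag|rewrite (repVK hrho)].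
Qed.

End invariant_projection.

Section type_I.
Context {R : realType} {L : set R} {U : metricType R}.
Hypothesis (Lpos : forall r : R, L r -> 0 < r) (LU : is_urysohn L U).
Local Notation G := (isom U).
Local Notation C := R[i].
Context {V : hilbertType R} (rho : G -> V -> V) (hrho : unitary_rep setT rho).
Local Notation P x m := (fixproj rho (stab x m)).
Local Notation spec := (spec (L := L)).

Section abelian.
Variables (z : V -> V) (n : nat) (x : 'I_n.+1 -> U) (r : 'I_n.+1 -> R).
Variables (F : {group 'S_n.+1}) (b : {ffun subg_of F -> C^o}) (e : V -> V).
Hypothesis (hc : corner (L := L) rho z x r b e).

Let pe := corner_proj hc.
Let el : linear e := isproj_linear pe.
Let ee v : e (e v) = e v. Proof. exact: isproj_idem. Qed.
Let Pl m : linear (P x m). Proof. exact: fixproj_linear. Qed.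

(** What commutativity of the corner asks of an operator: it is reduced by every invariant
    projection, as all elements of the generated von Neumann algebra are. *)
Definition block (S : V -> V) := bounded_op S /\
  forall p, isproj p -> (forall g v, p (rho g v) = rho g (p v)) -> forall v, S (p v) = p (S v).

Lemma corner_rho_cases g : exists c : C, exists2 t, spec t &
  forall v, e (rho g (e v)) = c *: P x t (e v).
Proof.
have [[s [sF ss h]]|[_ h]] := corner_rho hc g.
  by exists (corner_phi b s), (shift_radius x r g s) => //; exact: spec_shift (corner_spec hc).
by exists 0, r => [|v]; [exact: corner_spec hc|rewrite scale0r].
Qed.

(* The vectors all of whose translates have [e]-part in the range of [P x m]
   form an invariant subspace, whose projection is reduced by the block. *)
Lemma block_P S m v : block S -> spec m -> e (S (e (P x m v))) = P x m (e (S (e v))).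
Proof.
move=> [bS hS] hm.
have bP : bounded_op (P x m) by exact: isproj_bounded (isproj_hproj (fixed_closed hrho _)).
pose A := [set w | forall g, P x m (e (rho g w)) = e (rho g w)].
have hA : closed_subspace A.
  apply: closed_subspace_bigcap => g.
  apply: (@closed_subspace_preim _ _ (e \o rho g) _ _ (closed_subspace_eq bP)).
  by apply: bounded_op_comp; [exact: isproj_bounded|exact: rep_bounded].
have Ag g w : A w -> A (rho g w) by move=> hw h; rewrite -(repM hrho).
have AP w : A (e (P x m w)).
  move=> g; have [c [t ht ->]] := corner_rho_cases g; rewrite (linZ (Pl m)); congr (_ *: _).
  rewrite -(corner_comm hc _ hm) (corner_max hc)// (corner_max hc)//; last exact: spec_maxf.
  by congr (fixproj _ (stab _ _) _); apply/funext => j; rewrite /maxf maxCA maxxx.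
have pA := isproj_hproj hA.
have Ae w : e (hproj A w) = P x m (e (hproj A w)).
  by have := hproj_in hA w 1%g; rewrite !(rep1 hrho).
have eA w : P x m (e w) = hproj A (e w).
  apply: ip_inj => u; rewrite (isproj_adj _ _ pA) (isproj_adj _ _ pe) Ae.
  rewrite [in RHS](corner_comm hc _ hm) -[RHS](isproj_adj _ _ pe) -[RHS](fixproj_adj hrho).
  by rewrite -[RHS](isproj_adj _ _ pA) (corner_comm hc _ hm) (hproj_id hA (AP w)).
have eA' w : e (hproj A w) = P x m (e w).
  apply: ip_inj => u; rewrite (isproj_adj _ _ pe) (isproj_adj _ _ pA) -eA.
  by rewrite -(fixproj_adj hrho) -(isproj_adj _ _ pe) (corner_comm hc _ hm).
rewrite -(corner_comm hc _ hm) eA hS ?eA'// => g w.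
exact: hproj_invariant.
Qed.

(** Linear combinations of the [P x m], each paired with its adjoint, so that on the corner they are
    seen to be normal ([comb_normal]). *)
Inductive comb : (V -> V) -> (V -> V) -> Prop :=
| comb_P m of spec m : comb (P x m) (P x m)
| comb_lin (k : C) a a' c c' of comb a a' & comb c c' :
    comb (fun v => k *: a v + c v) (fun v => k^*%C *: a' v + c' v).

Lemma comb_linear a a' : comb a a' -> linear a /\ linear a'.
Proof.
elim=> [m hm|k {}a {}a' c c' _ [la la'] _ [lc lc']]; first by split; exact: Pl.
by split=> h u v; rewrite ?la ?lc ?la' ?lc' !scalerDr !scalerA [h * _]mulrC addrACA.
Qed.

Lemma comb_adj a a' : comb a a' -> forall u v, ip (a u) v = ip u (a' v).
Proof.
elim=> [m hm u v|k {}a {}a' c c' _ IHa _ IHc u v]; first exact: fixproj_adj.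
by rewrite ipDl ipDr ipZl ipZr conjcK IHa IHc.
Qed.

Lemma comb_sym a a' : comb a a' -> comb a' a.
Proof.
elim=> [m hm|k {}a {}a' c c' _ IHa _ IHc]; first exact: comb_P.
by have := comb_lin k^*%C IHa IHc; rewrite conjcK.
Qed.

Lemma comb_block a a' : comb a a' -> forall S v, block S ->
  e (S (e (a v))) = a (e (S (e v))).
Proof.
elim=> [m hm S v hS|k {}a {}a' c c' _ IHa _ IHc S v hS]; first exact: block_P.
by rewrite el hS.1.1 el IHa// IHc.
Qed.

Lemma comb_comm a a' : comb a a' -> forall c c', comb c c' ->
  forall v, a (c (e v)) = c (a (e v)).
Proof.
elim=> [m hm|k {}a {}a' d d' ha IHa hd IHd] c c' hc' v.
  elim: hc' => [m' hm'|k {}c {}c' d d' ha IHa hd IHd].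
    rewrite !(corner_max hc)//; congr (fixproj _ (stab _ _) _).
    by apply/funext => j; rewrite /maxf maxC.
  by rewrite Pl IHa IHd.
by rewrite (IHa _ _ hc') (IHd _ _ hc') (comb_linear hc').1.
Qed.

Lemma comb_normal a a' v : comb a a' -> hn (a (e v)) = hn (a' (e v)).
Proof.
move=> ha; rewrite /hn /sqnorm (comb_adj ha) (comb_adj (comb_sym ha)).
by rewrite (comb_comm ha (comb_sym ha)).
Qed.

Lemma comb_sub a a' c c' : comb a a' -> comb c c' ->
  comb (fun v => - 1 *: c v + a v) (fun v => (- 1)^*%C *: c' v + a' v).
Proof. by move=> ha hc'; exact: comb_lin. Qed.

Definition cyc u : set V :=
  [set v | forall k : R, 0 < k -> exists2 s, (exists a a', comb a a' /\ s = a u) & hn (v - s) < k].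

Lemma cyc_closed u : closed_subspace (cyc u).
Proof.
apply: closure_subspace; split.
  have hr := comb_P (corner_spec hc).
  exists (fun v => - 1 *: P x r v + P x r v); eexists; split; first exact: (comb_sub hr hr).
  by rewrite scaleN1r addNr.
move=> k _ _ [a [a' [ha ->]]] [c [c' [hc' ->]]].
by exists (fun v => k *: a v + c v); eexists; split=> //; exact: (comb_lin k ha hc').
Qed.

Lemma cyc_P u m : spec m -> cyc u (P x m u).
Proof.
move=> hm k k0; exists (P x m u); last by rewrite subrr hn0.
by exists (P x m), (P x m); split=> //; exact: comb_P.
Qed.

(** The vectors all of whose translates have [e]-part in the cyclic subspace of [e u] form a closed
    invariant subspace containing [e u]; a block preserves it. *)
Lemma cyc_block S u : block S -> cyc (e u) (e (S (e u))).
Proof.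
move=> [bS hS]; have hK := cyc_closed (e u).
pose A := [set w | forall g, cyc (e u) (e (rho g w))].
have hA : closed_subspace A.
  apply: closed_subspace_bigcap => g.
  apply: (@closed_subspace_preim _ _ (e \o rho g) _ _ hK).
  by apply: bounded_op_comp; [exact: isproj_bounded|exact: rep_bounded].
have Ag g w : A w -> A (rho g w) by move=> hw h; rewrite -(repM hrho).
have Au : A (e u).
  move=> g; have [c [t ht ->]] := corner_rho_cases g.
  by apply: subspaceZ hK.2 _; exact: cyc_P.
have := hproj_in hA (S (e u)); rewrite -hS; last 2 first.
  - exact: isproj_hproj.
  - by move=> *; exact: hproj_invariant.
by rewrite (hproj_id hA Au) => /(_ 1%g); rewrite (rep1 hrho).
Qed.

Lemma cyc_ind (A : set V) u v : closed A -> (forall a a', comb a a' -> A (a u)) ->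
  cyc u v -> A v.
Proof.
move=> /closed_hn hA Aa uv; apply: hA => k k0; have [_ [a [a' [ha ->]]] va] := uv k k0.
by exists (a u) => //; exact: Aa ha.
Qed.

Lemma comb_bounded a a' : comb a a' -> bounded_op a.
Proof.
move=> ha; split; first exact: (comb_linear ha).1.
elim: ha => [m hm|k {}a {}a' c c' _ IHa _ IHc] v.
  exact: (isproj_bounded (isproj_hproj (fixed_closed hrho _))).2.
by apply: cvgD; [apply: cvgZr; exact: IHa|exact: IHc].
Qed.

Lemma cyc_comb a a' u v : comb a a' -> cyc (e u) v -> cyc (e u) (a v).
Proof.
have hK := cyc_closed (e u); elim=> [m hm|k {}a {}a' c c' _ IHa _ IHc] hv; last first.
  by apply: hK.2.2; [exact: IHa|exact: IHc].
have bP := comb_bounded (comb_P hm).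
apply: (cyc_ind (closed_subspace_preim bP hK).1) hv => c c' /=.
elim=> [m' hm'|k {}a {}a' d d' _ IHa _ IHd].
  by rewrite (corner_max hc)//; apply: cyc_P; exact: spec_maxf.
by rewrite Pl; exact: hK.2.2.
Qed.

Let W S v := e (S (e v)).

Lemma block_bounded S : block S -> bounded_op (W S).
Proof.
move=> hS; have be := isproj_bounded pe.
by apply: (bounded_op_comp be (bounded_op_comp hS.1 be)).
Qed.

Lemma cyc_invariant S u v : block S -> cyc (e u) v -> cyc (e u) (W S v).
Proof.
move=> hS; apply: (cyc_ind (closed_subspace_preim (block_bounded hS) (cyc_closed _)).1).
move=> a a' ha /=; rewrite /W (comb_block ha)// ee.
by apply: (cyc_comb ha); exact: cyc_block.
Qed.

Lemma bounded_hn (T : V -> V) : bounded_op T ->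
  exists2 M : R, 0 < M & forall v, hn (T v) <= M * hn v.
Proof.
move=> [Tl Tc].
have /nbhs_hn[k k0 hk] : nbhs (0 : V) [set w | hn (T w) < 1].
  by apply: (Tc 0 [set w | hn w < 1]); apply/nbhs_hn; exists 1 => // w /=; rewrite (lin0 Tl) sub0r hnN.
exists (2 / k) => [|v]; first by rewrite divr_gt0.
have [->|v0] := eqVneq v 0; first by rewrite (lin0 Tl) hn0 mulr0.
have hv : 0 < hn v by rewrite hn_gt0.
have c0 : 0 < k / 2 / hn v by rewrite !divr_gt0.
have := hk ((k / 2 / hn v)%:C%C *: v).
have cE (a : R) (w : V) : 0 < a -> hn (a%:C%C *: w) = a * hn w.
  by move=> a0; rewrite hnZ /cmod /= expr0n addr0 sqrtr_sqr gtr0_norm.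
rewrite sub0r hnN /= (linZ Tl) !cE// divfK ?gt_eqF// ltr_pdivrMr// ltr_pMr// ltr1n.
move=> /(_ isT) h; rewrite -(ler_pM2l c0); apply: le_trans (ltW h) _.
have -> : k / 2 / hn v * (2 / k * hn v) = 1 by field; rewrite !gt_eqF.
exact: lexx.
Qed.

(** With [u = e v], the vectors [W S u] and [W T u] are limits of [a u] and [a2 u] for combinations
    [a] and [a2], which commute with each other and with [W S] and [W T] on the corner. The
    difference [D] lies in the cyclic subspace of [u], so it suffices to pair it with vectors [c u];
    moving [a] across the inner product allows [W T] to be replaced by [a2]. *)
Lemma block_abelian S T v : block S -> block T -> W S (W T v) = W T (W S v).
Proof.
move=> hS hT.
have WE X w : W X w = W X (e w) by rewrite /W ee.
rewrite [W T v]WE [W S v]WE; set u := e v.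
have ub X : block X -> cyc u (W X u) by move=> hX; rewrite -WE; exact: cyc_block.
set D := W S (W T u) - W T (W S u).
suff D0 : D = 0 by apply/eqP; rewrite -subr_eq0 -/D D0.
have Dc : cyc u D.
  by apply: subspaceB (cyc_closed _).2 _ _; apply: cyc_invariant => //; exact: ub.
suff Dr c c' : comb c c' -> rip D (c u) = 0.
  apply: contrapT => /eqP; rewrite -hn_gt0 => D0.
  have [_ [c [c' [hc' ->]]] Dcu] := Dc _ D0.
  have := CauchySchwarz_hn D (D - c u); rewrite ripBr (Dr _ _ hc') subr0 -sqnorm_rip -hn_sqr.
  by rewrite ger0_norm ?sqr_ge0// expr2 ler_pM2l// leNgt Dcu.
move=> hcc; have [MS MS0 hMS] := bounded_hn (block_bounded hS).
have [MT MT0 hMT] := bounded_hn (block_bounded hT).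
have [Mc Mc0 hMc] := bounded_hn (comb_bounded hcc).
have bl X a a' w : block X -> comb a a' -> W X (a w) = a (W X w).
  by move=> hX ha; exact: comb_block ha _ _ hX.
pose k0 := MT * hn (c u) + Mc * (hn (W S u) + 1) + hn (c u) + MS * hn (c u).
suff h d : 0 < d -> d <= 1 -> `|rip D (c u)| <= d * k0.
  have k0p : 0 <= k0 by rewrite !addr_ge0 ?mulr_ge0 ?hn_ge0 ?addr_ge0 ?hn_ge0 ?ltW.
  apply/eqP; rewrite -normr_eq0 eq_le normr_ge0 andbT leNgt; apply/negP => x0.
  have k1 : 0 < k0 + 1 by rewrite ltr_wpDl.
  have := h (Num.min 1 (`|rip D (c u)| / (k0 + 1))).
  rewrite lt_min ge_min lexx divr_gt0// ltr01 => /(_ isT isT).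
  apply/negP; rewrite -ltNge; apply: (@le_lt_trans _ _ (`|rip D (c u)| / (k0 + 1) * k0)).
    by rewrite ler_wpM2r// ge_min lexx orbT.
  by rewrite mulrAC ltr_pdivrMr// ltr_pM2l// ltrDl.
move=> d0 d1.
(* [a2] is chosen before [a], since the approximation by [a] must also absorb the bound [Mb] of
   [a2]. The bound of [a] itself depends on [d]; instead normality gives [a' u] the norm of
   [a u]. *)
have [_ [a2 [a2' [hb ->]]] hTb] := ub T hT d d0.
have [Mb Mb0 hMb] := bounded_hn (comb_bounded hb).
have [|_ [a [a' [ha ->]]] hSa] := ub S hS (Num.min d (d / Mb)).
  by rewrite lt_min d0 divr_gt0.
move: hSa; rewrite lt_min => /andP[hSa1 hSa2].
have e1 : `|rip (W T (W S u) - W T (a u)) (c u)| <= d * (MT * hn (c u)).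
  apply: le_trans (CauchySchwarz_hn _ _) _.
  rewrite mulrA ler_wpM2r ?hn_ge0// -(linB (block_bounded hT).1) mulrC.
  by apply: le_trans (hMT _) _; rewrite ler_pM2l// ltW.
have e2 : `|rip (W T u - a2 u) (c (a' u))| <= d * (Mc * (hn (W S u) + 1)).
  apply: le_trans (CauchySchwarz_hn _ _) _; apply: ler_pM; rewrite ?hn_ge0 ?(ltW hTb)//.
  apply: le_trans (hMc _) _; rewrite ler_pM2l// -(comb_normal v ha).
  rewrite -[a _](subrK (W S u)) addrC; apply: le_trans (hnD _ _) _.
  by rewrite lerD2l hnB; apply: le_trans d1; exact: ltW.
have e3 : `|rip (a2 (a u) - a2 (W S u)) (c u)| <= d * hn (c u).
  apply: le_trans (CauchySchwarz_hn _ _) _; rewrite ler_wpM2r ?hn_ge0//.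
  rewrite -(linB (comb_linear hb).1); apply: le_trans (hMb _) _.
  by rewrite mulrC -ler_pdivlMr// hnB ltW.
have e4 : `|rip (W S (a2 u) - W S (W T u)) (c u)| <= d * (MS * hn (c u)).
  apply: le_trans (CauchySchwarz_hn _ _) _.
  rewrite mulrA ler_wpM2r ?hn_ge0// -(linB (block_bounded hS).1) mulrC.
  by apply: le_trans (hMS _) _; rewrite ler_pM2l// hnB ltW.
have q1 : rip (W T (a u)) (c u) = rip (W T u) (c (a' u)).
  rewrite (bl _ _ _ _ hT ha) /rip (comb_adj ha); congr (complex.Re (ip _ _)).
  exact: comb_comm (comb_sym ha) _ _ hcc _.
have q2 : rip (a2 u) (c (a' u)) = rip (a2 (a u)) (c u).
  rewrite (comb_comm hb ha) /rip (comb_adj ha); congr (complex.Re (ip _ _)).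
  by rewrite (comb_comm (comb_sym ha) hcc).
have q3 : W S (a2 u) = a2 (W S u) by exact: bl hb.
have -> : rip D (c u) = - rip (W T (W S u) - W T (a u)) (c u)
   - rip (W T u - a2 u) (c (a' u)) - rip (a2 (a u) - a2 (W S u)) (c u)
   - rip (W S (a2 u) - W S (W T u)) (c u).
  by rewrite /D !ripBl q1 q2 q3; ring.
rewrite /k0 (mulrDr d) (mulrDr d) (mulrDr d); do 3 (apply: le_trans (ler_normB _ _) _; apply: lerD => //).
by rewrite normrN.
Qed.

End abelian.

(** A nonzero central projection [z] commutes with the representation and so dominates a corner [e].
    The corner commutes with the commutant, hence lies in the algebra, and [block_abelian] makes it
    abelian. *)
Lemma rep_type_I : type_I_algebra (von_neumann_generated (range rho)).
Proof.
set M := von_neumann_generated _ => z [[Mz zz za] zc] z0.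
have rM : range rho `<=` M by move=> S rS N [_]; apply.
pose X := [set p | isproj p /\ forall g v, p (rho g v) = rho g (p v)].
have Xb : X `<=` @bounded_op R V by move=> p [/isproj_bounded].
have MX : M `<=` commutant X.
  move=> S; apply; split; first by apply: vN_commutant => // p [[_ _ pa] _].
  move=> _ [g _ <-]; split; first exact: rep_bounded.
  by move=> p [_ pg]; apply/funext => v; exact: pg.
have Mblock S : M S -> block S.
  move=> /MX[bS hS]; split=> // p pp pg v.
  by have /(congr1 (@^~ v)) /= -> := hS p (conj pp pg).
have hz : isproj z.
  have [bz _] := MX _ Mz; split; [exact: bz.1| |exact: za].
  by move=> v; rewrite -[in RHS]zz.
have zG g v : z (rho g v) = rho g (z v).
  have /(congr1 (@^~ v)) /= := zc (rho g) (rM _ (ex_intro2 _ _ g I erefl)).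
  by [].
have zn0 : exists v, z v <> 0.
  by apply: contrapT => h; apply: z0; apply/funext => v; apply: contrapT => hv; apply: h; exists v.
have [n [x [r [F [b [e hc]]]]]] := corner_exists Lpos LU hrho hz zG zn0.
have pe := corner_proj hc.
have Me : M e.
  move=> N [[Nb Na NN] rN]; rewrite -NN; split; first exact: isproj_bounded.
  move=> T [bT hT]; apply/funext => v /=; apply: (corner_commutant hc) => // [g w|w].
    by have /(congr1 (@^~ w)) /= := hT _ (rN _ (ex_intro2 _ _ g I erefl)).
  by have /(congr1 (@^~ w)) /= := hT z (Mz N (conj (And3 Nb Na NN) rN)).
exists e; split.
- split; first by split=> //; [apply/funext => v; exact: isproj_idem|case: pe].
  by move=> S T /Mblock hS /Mblock hT; apply/funext => v; exact: (block_abelian hc v hS hT).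
- by move=> e0; have [v] := corner_neq0 hc; rewrite e0.
- by apply/funext => v; exact: (corner_z hc).
Qed.

End type_I.

(** * Hilbert spaces from inner product data *)

Section hilbert_of_data.
Context {R : realType}.
Local Notation C := R[i].

(* A complete inner product on a linear subspace of a complex vector space;
   nothing is required outside of the subspace. *)
Record hilbert_data := HilbertData {
  hd_amb : lmodType C;
  hd_mem : set hd_amb;
  hd_ip : hd_amb -> hd_amb -> C;
  hd_mem0 : hd_mem 0;
  hd_memD : forall a u v, hd_mem u -> hd_mem v -> hd_mem (a *: u + v);
  hd_ipl : forall a u v w, hd_mem u -> hd_mem v -> hd_mem w ->
    hd_ip (a *: u + v) w = a * hd_ip u w + hd_ip v w;
  hd_ipC : forall u v, hd_mem u -> hd_mem v -> hd_ip u v = (hd_ip v u)^*%C;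
  hd_pos : forall u, hd_mem u -> u <> 0 -> 0 < complex.Re (hd_ip u u);
  hd_complete : forall u : nat -> hd_amb, (forall n, hd_mem (u n)) ->
    (forall e : R, 0 < e -> exists N, forall m n, (N <= m)%N -> (N <= n)%N ->
       complex.Re (hd_ip (u m - u n) (u m - u n)) < e) ->
    exists2 v, hd_mem v & forall e : R, 0 < e -> exists N, forall n, (N <= n)%N ->
       complex.Re (hd_ip (u n - v) (u n - v)) < e
}.

Variable D : hilbert_data.
Local Notation A := (hd_amb D).

Record hspace := HSpace { hval : A; hvalP : hd_mem hval }.

Lemma hval_inj : injective hval.
Proof. by move=> [u pu] [v pv] /= uv; case: _ / uv pv => pv; congr HSpace; exact: Prop_irrelevance. Qed.

HB.instance Definition _ := gen_eqMixin hspace.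
HB.instance Definition _ := gen_choiceMixin hspace.

Let memN u : hd_mem u -> hd_mem (- u : A).
Proof. by move=> mu; have := hd_memD (- 1) mu (hd_mem0 D); rewrite scaleN1r addr0. Qed.
Let memD u v : hd_mem u -> hd_mem v -> hd_mem (u + v : A).
Proof. by move=> mu mv; have := hd_memD 1 mu mv; rewrite scale1r. Qed.
Let memZ a u : hd_mem u -> hd_mem (a *: u : A).
Proof. by move=> mu; have := hd_memD a mu (hd_mem0 D); rewrite addr0. Qed.

Definition hs0 := HSpace (hd_mem0 D).
Definition hsN u := HSpace (memN (hvalP u)).
Definition hsD u v := HSpace (memD (hvalP u) (hvalP v)).
Definition hsZ a u := HSpace (memZ a (hvalP u)).

Let hsA : associative hsD. Proof. by move=> u v w; apply: hval_inj; exact: addrA. Qed.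
Let hsC : commutative hsD. Proof. by move=> u v; apply: hval_inj; exact: addrC. Qed.
Let hs0D : left_id hs0 hsD. Proof. by move=> u; apply: hval_inj; exact: add0r. Qed.
Let hsND : left_inverse hs0 hsN hsD. Proof. by move=> u; apply: hval_inj; exact: addNr. Qed.

HB.instance Definition _ := GRing.isZmodule.Build hspace hsA hsC hs0D hsND.

Let hsZA a b u : hsZ a (hsZ b u) = hsZ (a * b) u.
Proof. by apply: hval_inj; exact: scalerA. Qed.
Let hs1Z : left_id 1 hsZ. Proof. by move=> u; apply: hval_inj; exact: scale1r. Qed.
Let hsZDr : right_distributive hsZ +%R.
Proof. by move=> a u v; apply: hval_inj; exact: scalerDr. Qed.
Let hsZDl u : {morph hsZ^~ u : a b / a + b}.
Proof. by move=> a b; apply: hval_inj; exact: scalerDl. Qed.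

HB.instance Definition _ := GRing.Zmodule_isLmodule.Build C hspace hsZA hs1Z hsZDr hsZDl.

Definition hsip (u v : hspace) : C := hd_ip (hval u) (hval v).
Definition hsq (u : hspace) : R := complex.Re (hsip u u).

Let ipl a u v w : hsip (a *: u + v) w = a * hsip u w + hsip v w.
Proof. by apply: hd_ipl; exact: hvalP. Qed.
Let ipC u v : hsip u v = (hsip v u)^*%C.
Proof. by apply: hd_ipC; exact: hvalP. Qed.
Let ipr a u v w : hsip w (a *: u + v) = a^*%C * hsip w u + hsip w v.
Proof. by rewrite [LHS]ipC ipl rmorphD rmorphM (ipC w u) (ipC w v). Qed.

HB.instance Definition _ := bilinear_isBilinear.Build C hspace hspace C *%R
  (@Num.conj C \; *%R) hsip (conj (fun w a u v => ipl a u v w) (fun w a u v => ipr a u v w)).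

Let ip_herm u v : hsip u v = (-1) ^+ false * Num.conj (hsip v u).
Proof. by rewrite expr0 mul1r; exact: ipC. Qed.

HB.instance Definition _ := isHermitianSesquilinear.Build C hspace false (@Num.conj C) hsip ip_herm.

Let ip_self u : hsip u u = (hsq u)%:C%C.
Proof.
have := ipC u u; rewrite /hsq; case: (hsip u u) => a b [] /eqP.
by rewrite -addr_eq0 -mulr2n mulrn_eq0/= => /eqP ->.
Qed.

Let sq_gt0 u : u != 0 -> 0 < hsq u.
Proof.
move=> /eqP u0; apply: hd_pos; first exact: hvalP.
by move=> h; apply: u0; apply: hval_inj.
Qed.

Let ip_pos u : u != 0 -> 0 < hsip u u.
Proof. by move=> u0; rewrite ip_self ltcR sq_gt0. Qed.

HB.instance Definition _ := isDotProduct.Build C hspace hsip ip_pos.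

Let rp u v := complex.Re (hsip u v).
Let rpC u v : rp u v = rp v u. Proof. by rewrite /rp ipC; case: (hsip v u). Qed.
Let rpDl u v w : rp (u + v) w = rp u w + rp v w. Proof. by rewrite /rp linearDl raddfD. Qed.
Let rpZl (a : R) u w : rp (a%:C%C *: u) w = a * rp u w.
Proof.
rewrite /rp; have -> : hsip (a%:C%C *: u) w = a%:C%C * hsip u w by rewrite linearZl_LR.
by case: (hsip u w) => c d /=; rewrite mul0r subr0.
Qed.
Let rp0l w : rp 0 w = 0. Proof. by rewrite /rp linear0l. Qed.

Let sqD u v : hsq (u + v) = hsq u + 2 * rp u v + hsq v.
Proof. by rewrite -[LHS]/(rp _ _) rpDl !(rpC _ (u + v)) !rpDl (rpC v u) /hsq; rewrite /rp; ring. Qed.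

Let sq_ge0 u : 0 <= hsq u.
Proof.
have [->|u0] := eqVneq u 0; last by rewrite ltW// sq_gt0.
by rewrite -[hsq _]/(rp _ _) rp0l.
Qed.

Let CS u v : rp u v ^+ 2 <= hsq u * hsq v.
Proof.
have [->|v0] := eqVneq v 0.
  by rewrite rpC rp0l expr0n mulr_ge0.
have := sq_ge0 ((hsq v)%:C%C *: u + (- rp u v)%:C%C *: v).
rewrite sqD rpZl -![hsq (_ *: _)]/(rp _ _) !rpZl ![rp _ (_ *: _)]rpC !rpZl [rp v u]rpC.
rewrite -[rp u u]/(hsq u) -[rp v v]/(hsq v).
have -> : hsq v * (hsq v * hsq u) + 2 * (hsq v * (- rp u v * rp u v)) + - rp u v * (- rp u v * hsq v)
  = hsq v * (hsq u * hsq v - rp u v ^+ 2) by ring.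
by rewrite pmulr_rge0 ?sq_gt0// subr_ge0.
Qed.

Definition hsnorm u : C := (Num.sqrt (hsq u))%:C%C.

Let normD u v : hsnorm (u + v) <= hsnorm u + hsnorm v.
Proof.
rewrite -rmorphD lecR -ler_sqr ?nnegrE ?addr_ge0 ?sqrtr_ge0//.
rewrite sqrrD !sqr_sqrtr// sqD lerD2r lerD2l -sqrtrM//.
have : rp u v <= Num.sqrt (hsq u * hsq v).
  by apply: le_trans (ler_norm _) _; rewrite -sqrtr_sqr ler_sqrt ?CS// mulr_ge0.
by rewrite mulr2n; lra.
Qed.

Let normZ (l : C) u : hsnorm (l *: u) = `|l| * hsnorm u.
Proof.
rewrite normc_def -rmorphM -sqrtrM ?addr_ge0 ?sqr_ge0//; congr (Num.sqrt _)%:C%C.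
rewrite /hsq linearZl_LR linearZr_LR /= ip_self /hsq; case: l => a c /=; case: (hsip u u) => p q /=.
by ring.
Qed.

Let norm0 u : hsnorm u = 0 -> u = 0.
Proof.
move=> /(congr1 (@complex.Re R)) /= /eqP; rewrite sqrtr_eq0 => h; apply/eqP.
by apply: contraLR h => u0; rewrite -ltNge sq_gt0.
Qed.

HB.instance Definition _ := Lmodule_isNormed.Build C hspace normD normZ norm0.

Let ball_hsq (u v : hspace) (e : R) : ball u e%:C%C v <-> 0 < e /\ hsq (u - v) < e ^+ 2.
Proof.
rewrite -ball_normE /ball_ /= -[`|_|]/(hsnorm _) /hsnorm ltcR; split=> [h|[e0 h]].
  have e0 : 0 < e by apply: le_lt_trans h; exact: sqrtr_ge0.
  by split=> //; move: h; rewrite -ltr_sqr ?nnegrE ?sqrtr_ge0 ?(ltW e0)// sqr_sqrtr.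
by rewrite -ltr_sqr ?nnegrE ?sqrtr_ge0 ?(ltW e0)// sqr_sqrtr.
Qed.

Let hs_complete (F : set_system hspace) : ProperFilter F -> cauchy F -> cvg F.
Proof.
move=> FF /cauchyP Fc.
have Fc' n : exists x, F (ball x (n.+1%:R^-1)%:C%C).
  by apply: Fc; rewrite ltcR invr_gt0 ltr0n.
have [x hx] := choice Fc'.
have xx m n : hsq (x m - x n) < (m.+1%:R^-1 + n.+1%:R^-1) ^+ 2.
  have [y [ym yn]] := filter_ex (filterI (hx m) (hx n)).
  have := ball_triangle ym (ball_sym yn); rewrite -rmorphD => /ball_hsq[].
  by [].
have [||v mv hv] := @hd_complete D (fun n => hval (x n)).
- by move=> n; exact: hvalP.
- move=> e e0; have /invn_lt[N hN] : 0 < Num.sqrt e / 2 by rewrite divr_gt0// sqrtr_gt0.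
  exists N => m n mN nN; apply: lt_le_trans (xx m n) _.
  rewrite -[leRHS](sqr_sqrtr (ltW e0)) ler_sqr ?nnegrE ?addr_ge0 ?invr_ge0 ?sqrtr_ge0//.
  by rewrite [leRHS]splitr lerD// ltW// hN.
apply/cvg_ex; exists (HSpace mv); apply/cvg_ballP => e e0.
have eE : e = (complex.Re e)%:C%C by case: e e0 => a b; rewrite ltcE /= => /andP[/eqP -> _].
have e1 : 0 < complex.Re e by rewrite -ltcR -eE.
have [N1 hN1] := hv ((complex.Re e / 2) ^+ 2) (exprn_gt0 2 (divr_gt0 e1 (ltr0Sn _ 1))).
have [N2 hN2] := invn_lt (divr_gt0 e1 (ltr0Sn _ 1)).
pose n := maxn N1 N2; apply: filterS (hx n) => y xy.
rewrite [e](_ : _ = (complex.Re e / 2)%:C%C + (complex.Re e / 2)%:C%C); last first.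
  by rewrite -rmorphD -splitr.
apply: (@ball_triangle _ _ (x n)).
  apply: ball_sym; apply/ball_hsq; split; first by rewrite divr_gt0.
  exact: hN1 (leq_maxl _ _).
apply: le_ball xy; rewrite lecR ltW// hN2// leq_maxr.
by [].
Qed.

HB.instance Definition _ := Uniform_isComplete.Build hspace hs_complete.

Let hs_ip_norm (v : hspace) : `|v| ^+ 2 = hsip v v.
Proof. by rewrite -[`|_|]/(hsnorm _) /hsnorm -rmorphXn /= sqr_sqrtr// -ip_self. Qed.

HB.instance Definition _ := CompleteNormedModule_isHilbert.Build R hspace hs_ip_norm.

Definition hilbert_of : hilbertType R := hspace.

End hilbert_of_data.

(** * Labeled balls *)

Section labeled_balls.
Context {R : realType} {L : set R} {U : metricType R}.
Hypothesis (Lpos : forall r : R, L r -> 0 < r) (LU : is_urysohn L U).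
Local Notation d := (@mdist R U).
Local Notation max := Num.max.
Local Notation G := (isom U).
Implicit Types (B : labeled_set L U) (g h : G).

(** Treats both kinds of balls at once; by the ultrametric inequality any point of the ball may
    replace the centre ([label_ball_shift]). *)
Definition label_in B x (t : R) : Prop := match label_kind B x with
  | closed_ball_kind => (t%:E <= label_radius B x)%E
  | open_ball_kind => (t%:E < label_radius B x)%E
  end.

Lemma label_ballE B x y : label_ball B x y = label_in B x (d x y).
Proof. by rewrite /label_ball /label_in /kball; case: (label_kind B x). Qed.

Lemma label_in_le B x s t : s <= t -> label_in B x t -> label_in B x s.
Proof.
rewrite /label_in => st; case: (label_kind B x) => h; first exact: le_trans h.
exact: le_lt_trans h.
Qed.

Lemma label_in0 B x : label_support B x -> label_in B x 0.
Proof.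
move=> Bx; have := label_perfect Bx; rewrite /label_in.
case: (label_kind B x) => [[t [/Lpos/ltW t0|[-> _]] ->]//|[[t [u [iu Lu ut] ->]]|[_ ->]]]; last exact: ltry.
rewrite lte_fin; apply: lt_le_trans (Lpos (Lu 0)) _.
rewrite -(cvg_lim _ ut)//; apply: nondecreasing_cvgn_le; last by apply/cvg_ex; exists t.
by move=> m n mn; rewrite iu.
Qed.

Lemma label_ball_center B x : label_support B x -> label_ball B x x.
Proof. by move=> Bx; rewrite label_ballE (udxx LU); exact: label_in0. Qed.

Lemma label_sep B x x' : label_support B x -> label_support B x' -> x <> x' ->
  ~ label_in B x (d x x').
Proof.
move=> Bx Bx' xx'; have := label_lt Bx.
have le : (min_dist (label_support B) x <= (d x x')%:E)%E.
  by apply: ereal_inf_lbound; exists x' => //; split=> // /esym.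
rewrite /label_in; case: (label_kind B x) => h; apply/negP.
  by rewrite -ltNge; exact: lt_le_trans le.
by rewrite -leNgt; exact: le_trans le.
Qed.

Lemma label_ball_shift B x y z : label_ball B x y -> label_ball B x z <-> label_in B x (d y z).
Proof.
rewrite !label_ballE => xy; split=> [xz|yz].
  apply: label_in_le (ud_tri LU x y z) _; rewrite (udC LU y x).
  by case: leP.
by apply: label_in_le (ud_tri LU y x z) _; case: leP.
Qed.

Lemma label_ball_disjoint B x x' y : label_support B x -> label_support B x' ->
  label_ball B x y -> label_ball B x' y -> x = x'.
Proof.
move=> Bx Bx' xy x'y; apply: contrapT => xx'.
wlog le : x x' Bx Bx' xy x'y xx' / d x' y <= d x y.
  move=> wl; have [|/ltW] := leP (d x' y) (d x y); first exact: wl.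
  by apply: wl => // /esym.
apply: (label_sep Bx Bx' xx'); move: xy; rewrite label_ballE; apply: label_in_le.
by apply: (ud_tri_le LU (y := y)) => //; rewrite (udC LU).
Qed.

(** Distances all equal to [t] satisfy the ultrametric inequality, so [one_point] can add such
    points indefinitely. *)
Lemma equidistant x t k : L t -> exists ws : seq U, [/\ size ws = k, uniq ws &
  forall w, w \in ws -> d x w = t /\ forall w', w' \in ws -> w <> w' -> d w w' = t].
Proof.
move=> Lt; have t0 := Lpos Lt; elim: k => [|k [ws [sz uq hw]]]; first by exists [::].
have [||u hu] := one_point Lpos LU (S := [seq (w, t) | w <- x :: ws]).
- have le w w' : w \in x :: ws -> w' \in x :: ws -> d w w' <= t.
    rewrite !inE => /predU1P[->|/hw[wx ww]] /predU1P[->|w'ws].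
    + by rewrite (udxx LU) ltW.
    + by have [-> _] := hw _ w'ws.
    + by rewrite (udC LU) wx.
    + by have [->|/eqP] := eqVneq w w'; [rewrite (udxx LU) ltW|move=> /(ww _ w'ws) ->].
  move=> _ _ /mapP[w win ->] /mapP[w' w'in ->] /=.
  by rewrite !le_max lexx (le _ _ win w'in).
- by move=> _ /mapP[w _ ->]; right.
have hux w : w \in x :: ws -> d u w = t by move=> win; apply: (hu (w, t)); exact: map_f.
have uws : u \notin ws.
  apply/negP => uin; have := hux u; rewrite inE uin orbT (udxx LU) => /(_ isT) tE.
  by move: t0; rewrite -tE ltxx.
exists (u :: ws); split=> /=; rewrite ?sz// ?uws// => w; rewrite inE => /predU1P[->|win].
  split=> [|w']; first by rewrite (udC LU) hux// mem_head.
  by rewrite inE => /predU1P[->//|w'in _]; rewrite hux// inE w'in orbT.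
have [wx ww] := hw _ win; split=> // w'; rewrite inE => /predU1P[-> _|/ww//].
by rewrite (udC LU) hux// inE win orbT.
Qed.

(** The union of the closed balls about [y] inside [A]. It recovers a label ball from the union of
    all of them and commutes with isometries, so an isometry that preserves the union permutes the
    balls. *)
Definition ball_component (A : set U) y : set U := [set u | forall w, d y w <= d y u -> A w].

(* A ball larger than a label ball contains an infinite set of points at equal
   distances, two of which would lie in the same label ball. *)
Lemma ball_componentE B x y : label_support B x -> label_ball B x y ->
  ball_component (balls_union B) y = label_ball B x.
Proof.
move=> Bx xy; apply/seteqP; split=> u /=; last first.
  move=> xu w yw; exists x => //; apply/(label_ball_shift _ xy).
  by apply: label_in_le yw _; exact/(label_ball_shift _ xy).
move=> hu; apply/(label_ball_shift _ xy); apply: contrapT => nin.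
set t := d y u in hu nin.
have Lt : L t.
  have [t0|//] := ud_L0 LU y u; case: nin; rewrite /t t0; exact: label_in0.
have /finite_seqP[xs xsE] := support_finite B.
have [ws [sz uq hw]] := equidistant y (size xs).+1 Lt.
have ch w : exists x', w \in ws -> label_support B x' /\ label_ball B x' w.
  have [win|_] := boolP (w \in ws); last by exists x.
  have [|x' Bx' wx'] := hu w; last by exists x'.
  by have [-> _] := hw _ win.
have [f hf] := choice ch.
have : ~ {in ws &, injective f}.
  move=> inj; have := @uniq_leq_size _ (map f ws) xs; rewrite map_inj_in_uniq// uq.
  rewrite size_map sz ltnn => F0; apply: notF; apply: F0 => // _ /mapP[w /hf[Bw _] ->].
  by move: Bw; rewrite xsE.
apply=> w w' win w'in ff; apply: contrapT => ww'.
have [Bf fw] := hf _ win; have [_ fw'] := hf _ w'in; rewrite -ff in fw'.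
have := (hw _ win).2 _ w'in ww' => dt.
have int : label_in B (f w) t by rewrite -dt; exact/(label_ball_shift _ fw).
have fwx : label_ball B (f w) y.
  by apply/(label_ball_shift _ fw); rewrite (udC LU) (hw _ win).1.
by apply: nin; rewrite (label_ball_disjoint Bx Bf xy fwx).
Qed.

Lemma ball_component_image (A : set U) g y :
  g @` ball_component A y = ball_component (g @` A) (g y).
Proof.
apply/seteqP; split=> [_ [u hu <-] w|u hu].
  rewrite isom_dist => yw; exists (g^-1%g w); last exact: isomEV.
  by apply: hu; rewrite (udC LU) isom_distV (udC LU).
exists (g^-1%g u); last exact: isomEV.
move=> w yw; have [|w' Aw' /(congr1 (g^-1%g : G))] := hu (g w).
  by rewrite isom_dist (le_trans yw)// (udC LU) isom_distV (udC LU).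
by rewrite !isomVE => <-.
Qed.

Lemma image_label_ball B1 B2 g : g @` balls_union B1 = balls_union B2 ->
  forall x, label_support B1 x -> exists2 x', label_support B2 x' &
    g @` label_ball B1 x = label_ball B2 x'.
Proof.
move=> gB x Bx; have xx := label_ball_center Bx.
have [x' Bx' gx] : balls_union B2 (g x) by rewrite -gB; exists x => //; exists x.
exists x' => //; rewrite -(ball_componentE Bx xx) ball_component_image gB.
exact: ball_componentE.
Qed.

Lemma image1 (A : set U) : (1%g : G) @` A = A.
Proof. by apply/seteqP; split=> [_ [x Ax <-]|x Ax] //; exists x. Qed.

Lemma imageM g h (A : set U) : (g * h)%g @` A = g @` (h @` A).
Proof.
apply/seteqP; split=> [_ [x Ax <-]|_ [_ [x Ax <-] <-]]; last by exists x.
by exists (h x) => //; exists x.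
Qed.

Lemma imageVP g (A A' : set U) : g @` A = A' <-> A = g^-1%g @` A'.
Proof.
by split=> [<-|->]; rewrite -imageM ?mulVg ?mulgV image1.
Qed.

Lemma union_stabilizer_subgroup B : subgroup_set (union_stabilizer B).
Proof.
split=> [|g h gB hB|g gB]; rewrite /union_stabilizer /=; first exact: image1.
  by rewrite imageM hB gB.
by apply/esym/imageVP; exact: gB.
Qed.

Lemma ball_stabilizer_subgroup B : subgroup_set (ball_stabilizer B).
Proof.
split=> [x _|g h gB hB x Bx|g gB x Bx]; first exact: image1.
  by rewrite imageM hB// gB.
by apply/esym/imageVP; exact: gB.
Qed.

Lemma ball_union_stabilizer B : ball_stabilizer B `<=` union_stabilizer B.
Proof.
move=> g gB; apply/seteqP; split=> [_ [y [x Bx xy] <-]|y [x Bx xy]].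
  by exists x => //; rewrite -(gB _ Bx); exists y.
by move: xy; rewrite -(gB _ Bx) => -[y' xy' <-]; exists y' => //; exists x.
Qed.

Lemma ball_stabilizer_conj B1 B2 g h : g @` balls_union B1 = balls_union B2 ->
  ball_stabilizer B1 h -> ball_stabilizer B2 (g * h * g^-1)%g.
Proof.
move=> gB hB x Bx; have /esym gB' := (imageVP _ _ _).1 gB.
have [x' Bx' xx'] := image_label_ball gB' Bx.
by rewrite !imageM xx' hB// -xx' -imageM mulgV image1.
Qed.

Lemma label_ball_image B x g : label_in B x (d x (g x)) -> g @` label_ball B x = label_ball B x.
Proof.
rewrite -label_ballE => hx; apply/seteqP; split=> [_ [y xy <-]|y].
  by apply/(label_ball_shift _ hx); rewrite isom_dist -label_ballE.
move=> xy; exists (g^-1%g y); last exact: isomEV.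
by rewrite label_ballE (udC LU) isom_distV (udC LU); apply/(label_ball_shift _ hx).
Qed.

Lemma ball_stabilizerP B g : ball_stabilizer B g <->
  forall x, label_support B x -> label_in B x (d x (g x)).
Proof.
split=> h x Bx; last exact: label_ball_image (h x Bx).
by rewrite -label_ballE -(h x Bx); exists x => //; exact: label_ball_center.
Qed.

End labeled_balls.

Section finite_sums.
Context {R : realType} {T : choiceType} (S : set T) (a : T -> R).
Hypothesis a0 : forall t, 0 <= a t.
Local Notation esuma := (\esum_(t in S) (a t)%:E)%E.

Definition finite_part (l : seq T) := uniq l /\ forall t, t \in l -> S t.

Lemma esum_ge_seq l : finite_part l -> ((\sum_(t <- l) a t)%:E <= esuma)%E.
Proof.
move=> [ul lS]; apply: esum_ge; exists [set` l]; first by split; [exact: finite_seq|exact: lS].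
by rewrite -fsbig_seq// sumEFin.
Qed.

Lemma esum_le_seq (M : R) : (forall l, finite_part l -> \sum_(t <- l) a t <= M) -> (esuma <= M%:E)%E.
Proof.
move=> h; apply: ge_ereal_sup => _ [F [Ff FS] <-].
rewrite fsbig_finite//= sumEFin lee_fin; apply: h; split=> [|t]; first exact: finmap.fset_uniq.
by rewrite in_fset_set// => /set_mem; exact: FS.
Qed.

Lemma esum_approx (e : R) : (esuma < +oo)%E -> 0 < e -> exists2 l, finite_part l &
  forall l', finite_part l' -> \sum_(t <- l') a t < \sum_(t <- l) a t + e.
Proof.
move=> fin e0; have ge0 : (0 <= esuma)%E by apply: esum_ge0 => t _; rewrite lee_fin.
have fe : esuma \is a fin_num by rewrite ge0_fin_numE.
apply: contrapT => no; have : (esuma <= (fine esuma - e)%:E)%E.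
  apply: esum_le_seq => l hl; rewrite leNgt; apply/negP => lt; apply: no; exists l => // l' hl'.
  have := esum_ge_seq hl'; rewrite -(fineK fe) lee_fin => h; apply: le_lt_trans h _.
  by rewrite -ltrBlDr.
by rewrite -{1}(fineK fe) lee_fin leNgt ltrBlDr ltrDl e0.
Qed.

End finite_sums.

(** * Closed subspaces as Hilbert spaces *)

Section sub_hilbert.
Context {R : realType} {W : hilbertType R} (X : set W) (hX : closed_subspace X).
Local Notation C := R[i].

Let sub_pos (u : W) : X u -> u <> 0 -> 0 < complex.Re (ip u u).
Proof. by move=> _ /eqP u0; rewrite -/(sqnorm u) sqnorm_gt0. Qed.

Let sub_complete (u : nat -> W) : (forall n, X (u n)) ->
  (forall e : R, 0 < e -> exists N, forall m n, (N <= m)%N -> (N <= n)%N ->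
     complex.Re (ip (u m - u n) (u m - u n)) < e) ->
  exists2 v, X v & forall e : R, 0 < e -> exists N, forall n, (N <= n)%N ->
     complex.Re (ip (u n - v) (u n - v)) < e.
Proof.
have sq (v : W) (e : R) : 0 < e -> (complex.Re (ip v v) < e) = (hn v < Num.sqrt e).
  by move=> e0; rewrite /hn ltr_sqrt.
move=> Xu uc; have [e e0|v uv] := @seq_cauchy_lim _ _ u.
  have [N hN] := uc _ (exprn_gt0 2 e0); exists N => m n mN nN.
  by rewrite -[e](ger0_norm (ltW e0)) -sqrtr_sqr -sq ?exprn_gt0//; exact: hN.
exists v => [|e e0]; first exact: seq_lim_closed hX.1 Xu uv.
have [|N hN] := uv (Num.sqrt e); first by rewrite sqrtr_gt0.
by exists N => n nN; rewrite sq// hN.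
Qed.

Definition sub_data : hilbert_data := @HilbertData R W X (@ip R W) hX.2.1 hX.2.2
  (fun a u v w _ _ _ => etrans (ipDl (a *: u) v w) (congr1 (+%R^~ (ip v w)) (ipZl a u w)))
  (fun u v _ _ => ipC u v) sub_pos sub_complete.

Definition sub_hilbert : hilbertType R := hilbert_of sub_data.
Definition subval (v : sub_hilbert) : W := hval v.
Definition subproj (w : W) : sub_hilbert := @HSpace R sub_data _ (hproj_in hX w).

Lemma subval_in v : X (subval v). Proof. exact: hvalP v. Qed.
Lemma subval_ip u v : ip (subval u) (subval v) = ip u v. Proof. by []. Qed.
Lemma subval_sqnorm v : sqnorm (subval v) = sqnorm v. Proof. by []. Qed.
Lemma subval_hn v : hn (subval v) = hn v. Proof. by []. Qed.
Lemma subval_linear : linear subval. Proof. by []. Qed.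
Lemma subval_inj : injective subval. Proof. exact: hval_inj. Qed.
Lemma subprojK w : subval (subproj w) = hproj X w. Proof. by []. Qed.
Lemma subvalK v : subproj (subval v) = v.
Proof. by apply: subval_inj; rewrite subprojK hproj_id//; exact: subval_in. Qed.
Lemma subproj_linear : linear subproj.
Proof. by move=> a u v; apply: subval_inj; rewrite subprojK hproj_linear. Qed.
Lemma subproj_hn w : hn (subproj w) <= hn w.
Proof. by rewrite -subval_hn subprojK hn_hproj. Qed.

Lemma sub_separable : separable_space W -> separable_space sub_hilbert.
Proof.
move=> /separable_seq[s hs]; apply: (@separable_hn _ _ (fun n => subproj (s n))) => v e e0.
have [n hn] := hs (subval v) _ e0; exists n; apply: le_lt_trans hn.
by rewrite -[v in leLHS]subvalK -(linB subproj_linear) subproj_hn.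
Qed.

End sub_hilbert.

(** * A criterion for a representation to be induced *)

Section induction.
Context {R : realType} {G : topologicalGroupType} {W : hilbertType R}.
Context (rho : G -> W -> W) (hrho : unitary_rep setT rho).
Context (H : set G) (hH : subgroup_set H) (X : set W) (hX : closed_subspace X).
Hypothesis HX : forall h v, H h -> X v -> X (rho h v).
Local Notation pr := (hproj X).
Local Notation V := (sub_hilbert hX).
Let H1 : H 1%g. Proof. by case: hH. Qed.
Let HM g h : H g -> H h -> H (g * h)%g. Proof. by case: hH => _ + _; apply. Qed.
Let HV g : H g -> H g^-1%g. Proof. by case: hH => _ _; apply. Qed.

Lemma hproj_subgroup h w : H h -> pr (rho h w) = rho h (pr w).
Proof.
move=> hh; apply: hproj_unitary => //; first exact: rep_linear.
  by move=> *; exact: rep_rip.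
apply/seteqP; split=> [v Xv|_ [v Xv <-]]; last exact: HX.
by exists (rho h^-1%g v); [apply: HX => //; exact: HV|rewrite (repVK hrho)].
Qed.

(** The projection only serves to define the operator for all group elements; on [H] it has no
    effect ([subval_rep]). *)
Definition sub_rep (h : G) (v : V) : V := subproj hX (rho h (subval v)).

Lemma subval_rep h v : H h -> subval (sub_rep h v) = rho h (subval v).
Proof. by move=> hh; rewrite subprojK hproj_id//; apply: HX => //; exact: subval_in. Qed.

Lemma sub_unitary_rep : unitary_rep H sub_rep.
Proof.
split.
- by apply: sub_separable; case: hrho.
- move=> h hh; split=> [a u v||u v].
  + by rewrite /sub_rep -subproj_linear -(rep_linear hrho) subval_linear.
  + apply/seteqP; split=> // v _; exists (sub_rep h^-1%g v) => //; apply: subval_inj.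
    by rewrite !subval_rep//; [rewrite (repVK hrho)|exact: HV].
  + by rewrite -!subval_ip !subval_rep// (rep_ip hrho).
- by apply/funext => v; apply: subval_inj; rewrite subval_rep// (rep1 hrho).
- move=> g h hg hh; apply/funext => v; apply: subval_inj.
  by rewrite /comp !subval_rep//; [rewrite (repM hrho)|exact: HM].
- move=> v; apply: continuous_subspaceT => g A /nbhs_hn[e e0 eA].
  have hc : continuous (rho^~ (subval v)) by apply/continuous_subspace_setT; case: hrho.
  have hb : nbhs g [set h | hn (rho g (subval v) - rho h (subval v)) < e].
    by apply: (hc g [set w | hn (rho g (subval v) - w) < e]); apply/nbhs_hn; exists e.
  suff : nbhs g [set h | A (sub_rep h v)] by [].
  apply: filterS hb => h hh; apply: eA; apply: le_lt_trans hh.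
  by rewrite /sub_rep -(linB (subproj_linear hX)) subproj_hn.
Qed.

Hypothesis orth : forall g u v, ~ H g -> X u -> X v -> ip (rho g u) v = 0.
Hypothesis tot : forall w, (forall g, pr (rho g w) = 0) -> w = 0.

Let coset (K : set G) : G := xget 1%g K.

Let cosetP K : right_cosets H K -> forall k, K k -> H (k * (coset K)^-1)%g.
Proof.
move=> [g _ <-] k; rewrite /coset; case: xgetP => [_ -> [h hh <-] [h' hh' <-]|].
  by rewrite invMg mulgA -[(h' * g * g^-1)%g]mulgA mulgV mulg1; apply: HM => //; exact: HV.
by move=> /(_ g) []; exists 1%g; rewrite ?mul1g.
Qed.

Let coset_in K : right_cosets H K -> K (coset K).
Proof.
move=> [g _ <-]; rewrite /coset; case: xgetP => [_ -> //|].
by move=> /(_ g) []; exists 1%g; rewrite ?mul1g.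
Qed.

Let coset_eq K g : right_cosets H K -> H (g * (coset K)^-1)%g -> K = [set (h * g)%g | h in H].
Proof.
move=> hK; have cK := coset_in hK; have KP := cosetP hK.
case: hK KP cK => g' _ <- KP [h0 hh0 c0] hg.
rewrite -c0 invMg mulgA in hg.
apply/seteqP; split=> _ [h hh <-].
  exists (h * g' * g^-1)%g; last by rewrite -mulgA mulVg mulg1.
  have -> : (h * g' * g^-1 = h * h0^-1 * (g * g'^-1 * h0^-1)^-1)%g.
    by rewrite !invMg !invgK !mulgA -[(h * h0^-1 * h0)%g]mulgA mulVg mulg1.
  by apply: HM; [apply: HM => //; exact: HV|exact: HV].
exists (h * (g * g'^-1))%g; last by rewrite -!mulgA mulVg mulg1.
apply: HM => //; have -> : (g * g'^-1 = g * g'^-1 * h0^-1 * h0)%g by rewrite -mulgA mulVg mulg1.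
exact: HM.
Qed.

Section sums.
Variables (F : G -> W).
Hypotheses (FX : forall g, X (F g)) (FH : forall h g, H h -> F (h * g)%g = rho h (F g)).

Let part (l : seq (set G)) : W := \sum_(K <- l) rho (coset K)^-1%g (F (coset K)).
Let norm2 (K : set G) := sqnorm (F (coset K)).

Let pr_term g K : right_cosets H K -> pr (rho g (rho (coset K)^-1%g (F (coset K)))) =
  if `[< K = [set (h * g)%g | h in H] >] then F g else 0.
Proof.
move=> hK; rewrite -(repM hrho); case: asboolP => [Kg|nK].
  have Hg : H (g * (coset K)^-1)%g.
    by apply: cosetP => //; rewrite Kg; exists 1%g; rewrite ?mul1g.
  rewrite -FH// -[(g * _ * _)%g]mulgA mulVg mulg1; exact: hproj_id.
apply: hproj_eq0 => // v Xv; rewrite /rip orth//.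
by move=> /(coset_eq hK).
Qed.

Let pr_part l g : finite_part (right_cosets H) l ->
  pr (rho g (part l)) = if [set (h * g)%g | h in H] \in l then F g else 0.
Proof.
move=> [ul lH]; rewrite /part (lin_sum (rep_linear hrho g)) (lin_sum (hproj_linear hX)).
case: ifPn => [Kl|Kl].
  rewrite (bigD1_seq _ Kl ul)/= pr_term; last exact: lH.
  rewrite asboolT// big_seq_cond big1 ?addr0// => K /andP[/lH hK] Kg.
  by rewrite pr_term// asboolF// => KE; move: Kg; rewrite KE eqxx.
rewrite big_seq big1// => K Kin; rewrite pr_term; last exact: lH.
by rewrite asboolF// => KE; move: Kl; rewrite -KE Kin.
Qed.

Let ip_part l w : finite_part (right_cosets H) l ->
  rip (part l) w = \sum_(K <- l) rip (F (coset K)) (pr (rho (coset K) w)).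
Proof.
move=> _; rewrite /part rip_suml; apply: eq_bigr => K _.
by rewrite (rep_radj hrho) invgK ripC [RHS]ripC hproj_rip.
Qed.

Let ip_part2 l m : finite_part (right_cosets H) l -> finite_part (right_cosets H) m ->
  {subset l <= m} -> rip (part l) (part m) = \sum_(K <- l) norm2 K.
Proof.
move=> hl hm lm; rewrite ip_part// big_seq [RHS]big_seq; apply: eq_bigr => K Kl.
rewrite pr_part// /norm2 sqnorm_rip.
have hK := hl.2 K Kl; rewrite -(coset_eq (K := K) (g := coset K))//; first by rewrite lm.
by rewrite mulgV.
Qed.

Let sqnorm_part l : finite_part (right_cosets H) l -> sqnorm (part l) = \sum_(K <- l) norm2 K.
Proof. by move=> hl; rewrite sqnorm_rip ip_part2. Qed.

Let part_norm l w : finite_part (right_cosets H) l -> (forall g, pr (rho g w) = F g) ->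
  rip (part l) w = \sum_(K <- l) norm2 K.
Proof. by move=> hl prw; rewrite ip_part//; apply: eq_bigr => K _; rewrite prw -sqnorm_rip. Qed.

(** The translates of [X] by inverses of coset representatives are orthogonal, and [F] prescribes
    the component in each. Square summability makes the resulting series converge; its sum is the
    vector sought. *)
Lemma coset_sum : (coset_sqnorm H F < +oo)%E -> exists w, (forall g, pr (rho g w) = F g) /\
  ((sqnorm w)%:E <= coset_sqnorm H F)%E.
Proof.
move=> fin; have n0 K : 0 <= norm2 K by exact: sqnorm_ge0.
have ap n : exists l, finite_part (right_cosets H) l /\
    forall l', finite_part (right_cosets H) l' -> \sum_(K <- l') norm2 K <
      \sum_(K <- l) norm2 K + (n.+1%:R^-1) ^+ 2.
  have [|l hl h] := @esum_approx R _ _ norm2 n0 ((n.+1%:R^-1) ^+ 2) fin.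
    by rewrite exprn_gt0// invr_gt0.
  by exists l.
have [l hl] := choice ap.
have hnl n m : finite_part (right_cosets H) m -> {subset l n <= m} ->
    hn (part m - part (l n)) < n.+1%:R^-1.
  move=> hm lm; have hln := (hl n).1.
  rewrite -ltr_sqr ?nnegrE ?hn_ge0 ?invr_ge0// hn_sqr.
  rewrite sqnormB ripC ip_part2// !sqnorm_rip !ip_part2//.
  have := (hl n).2 m hm; move: (n.+1%:R^-1 ^+ 2) => c.
  by move: (\sum_(K <- m) _) (\sum_(K <- l n) _) => p q; lra.
have cauchy n m : hn (part (l n) - part (l m)) < n.+1%:R^-1 + m.+1%:R^-1.
  pose k := undup (l n ++ l m).
  have hk : finite_part (right_cosets H) k.
    split=> [|K]; first exact: undup_uniq.
    by rewrite mem_undup mem_cat => /orP[] /(hl _).1.2.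
  apply: le_lt_trans (hn_tri _ (part k) _) _; rewrite hnB ltrD// hnl// => K Kl.
    by rewrite mem_undup mem_cat Kl.
  by rewrite mem_undup mem_cat Kl orbT.
have [e e0|w hw] := @seq_cauchy_lim _ _ (fun n => part (l n)).
  have [N hN] := @invn_lt R (e / 2) (divr_gt0 e0 (ltr0Sn _ 1)); exists N => m n mN nN.
  by apply: lt_trans (cauchy _ _) _; rewrite [e]splitr ltrD// hN.
have prw g : pr (rho g w) = F g.
  apply/eqP; rewrite -subr_eq0; apply/eqP/hn_le_lt0 => e e0.
  have [N1 hN1] := hw e e0.
  (* Unless [F g] is 0, the coset of [g] belongs to [l n] for large [n]: a missing term would exceed
     the remainder that the choice of [l n] allows. *)
  have [N2 hN2] : exists N, forall n, (N <= n)%N -> pr (rho g (part (l n))) = F g.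
    have [Fg|Fg] := eqVneq (F g) 0.
      by exists 0 => n _; rewrite pr_part ?Fg; [case: ifP|exact: (hl n).1].
    have /invn_lt[N hN] : 0 < hn (F g) by rewrite hn_gt0.
    exists N => n nN; rewrite pr_part; last exact: (hl n).1.
    case: ifPn => // Kl; exfalso; set K := [set _ | _ in H] in Kl.
    have hK : right_cosets H K by exists g.
    have := (hl n).2 (K :: l n); rewrite big_cons addrC ltrD2l.
    have -> : norm2 K = hn (F g) ^+ 2.
      rewrite /norm2 hn_sqr; have := coset_in hK; rewrite /K => -[h hh <-].
      by rewrite FH// (rep_sqnorm hrho).
    rewrite ltr_sqr ?nnegrE ?hn_ge0 ?invr_ge0// ltNge ltW ?hN// => F0; apply: notF; apply: F0.
    by split=> [|t]; rewrite /= ?Kl ?(hl n).1.1// inE => /predU1P[->|/(hl n).1.2].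
  pose n := maxn N1 N2; rewrite -(hN2 n (leq_maxr _ _)) -(linB (hproj_linear hX)).
  rewrite -(linB (rep_linear hrho g)); apply: le_lt_trans (hn_hproj hX _) _.
  by rewrite (rep_hn hrho) hnB hN1// leq_maxl.
exists w; split=> //; apply/lee_addgt0Pr => e e0.
have [|N /(_ N (leqnn N)) hN] := hw (Num.sqrt e); first by rewrite sqrtr_gt0.
have -> : sqnorm w = sqnorm (w - part (l N)) + \sum_(K <- l N) norm2 K.
  by rewrite sqnormB ripC (part_norm (hl N).1 prw) (sqnorm_part (hl N).1); ring.
rewrite EFinD addeC leeD//; first exact: esum_ge_seq (hl N).1.
rewrite lee_fin -hn_sqr -(sqr_sqrtr (ltW e0)) ler_sqr ?nnegrE ?hn_ge0 ?sqrtr_ge0//.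
by rewrite hnB ltW.
Qed.

Lemma coset_bessel w : (forall g, pr (rho g w) = F g) ->
  (coset_sqnorm H F <= (sqnorm w)%:E)%E.
Proof.
move=> prw; apply: esum_le_seq => l hl.
have := sqnorm_ge0 (w - part l); rewrite sqnormB ripC (part_norm hl prw) sqnorm_part//.
by move: (\sum_(K <- l) _) => p; lra.
Qed.

End sums.

(** [w] is sent to the function whose value at [g] is the [X]-component of [rho g w]. Bessel's
    inequality bounds its norm from above, [coset_sum] provides a preimage with the opposite bound,
    and totality identifies that preimage with [w]. *)
Lemma sub_induced : is_induced H sub_rep rho.
Proof.
pose Phi w g := subproj hX (rho g w).
have sum (F : G -> V) : induced_space H sub_rep F -> exists w,
    (forall g, Phi w g = F g) /\ ((sqnorm w)%:E <= coset_sqnorm H F)%E.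
  move=> [FH fin]; have [g|h g hh|//|w [hw1 hw2]] := @coset_sum (fun g => subval (F g)).
  - exact: subval_in.
  - by rewrite FH// subval_rep.
  - by exists w; split=> // g; apply: subval_inj; rewrite subprojK hw1.
have PhiH w h g : H h -> Phi w (h * g)%g = sub_rep h (Phi w g).
  move=> hh; apply: subval_inj; rewrite subval_rep// !subprojK (repM hrho).
  exact: hproj_subgroup.
have bessel w : (coset_sqnorm H (Phi w) <= (sqnorm w)%:E)%E.
  apply: (@coset_bessel (fun g => subval (Phi w g))) => [g|h g hh|//]; first exact: subval_in.
  by rewrite PhiH// subval_rep.
have Phi_in w : induced_space H sub_rep (Phi w).
  by split=> [h g|]; [exact: PhiH|exact: le_lt_trans (bessel w) (ltry _)].
exists Phi; split.
- by move=> a u v; apply/funext => g; rewrite /Phi (rep_linear hrho) subproj_linear.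
- apply/seteqP; split=> [_ [w _ <-]|F /sum[w [hw _]]]; first exact: Phi_in.
  by exists w => //; apply/funext.
- move=> w; apply/le_anti/andP; split; first exact: bessel.
  have [w' [hw le]] := sum _ (Phi_in w).
  suff -> : w = w' by rewrite -[X in coset_sqnorm H X]/(Phi w') (_ : Phi w' = Phi w)//; apply/funext.
  apply/eqP; rewrite -subr_eq0; apply/eqP/tot => g.
  have /(congr1 (@subval _ _ _ hX)) := hw g; rewrite !subprojK (linB (rep_linear hrho g)).
  by rewrite (linB (hproj_linear hX)) => ->; rewrite subrr.
- by move=> g w x; rewrite /Phi (repM hrho).
Qed.

End induction.

(** * Ideals of radii and labelings *)

Section ideals.
Context {R : realType} {L : set R} {U : metricType R}.
Hypothesis (Lpos : forall r : R, L r -> 0 < r) (LU : is_urysohn L U).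
Local Notation d := (@mdist R U).
Local Notation G := (isom U).
Local Notation spec := (spec (L := L)).

Definition radius_ideal n (x : 'I_n.+1 -> U) (f : set ('I_n.+1 -> R)) :=
  [/\ f !=set0, forall m, f m -> spec m /\ sep x m,
      forall m m', f m -> f m' -> f (maxf m m') &
      forall m m', f m -> spec m' -> (forall i, m' i <= m i) -> f m'].

Definition below (k : ball_kind) (r : \bar R) (s : R) : Prop := match k with
  | closed_ball_kind => (s%:E <= r)%E
  | open_ball_kind => (s%:E < r)%E
  end.

(** The kinds of perfect pairs are the ways in which a set of radii can end: a greatest element
    gives a closed ball, a finite supremum that is not attained an open ball, an unbounded set the
    open ball of infinite radius. *)
Lemma perfect_pair_of_cut (I : set R) : I !=set0 -> I `<=` spectrum_with0 L ->
  exists k r, perfect_pair L k r /\ forall s, below k r s <-> exists2 t, I t & s <= t.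
Proof.
move=> [t0 It0] IL.
have [[t It tmax]|nomax] := pselect (exists2 t, I t & forall t', I t' -> t' <= t).
  exists closed_ball_kind, t%:E; split=> [|s]; first by exists t => //; exact: IL.
  rewrite /= lee_fin; split=> [st|[t' It' st']]; first by exists t.
  exact: le_trans (tmax _ It').
have up t : I t -> exists2 t', I t' & t < t'.
  move=> It; apply: contrapT => no; apply: nomax; exists t => // t' It'.
  by rewrite leNgt; apply/negP => tt'; apply: no; exists t'.
have pos t t' : I t -> I t' -> t < t' -> L t'.
  move=> It It' tt'; have [//|[t'0 _]] := IL _ It'.
  have [/Lpos t_gt0|[tz _]] := IL _ It; first by have := lt_trans t_gt0 tt'; rewrite t'0 ltxx.
  by move: tt'; rewrite tz t'0 ltxx.
have [ub|nub] := pselect (has_ubound I); last first.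
  exists open_ball_kind, +oo%E; split=> [|s]; last first.
    rewrite /= ltry; split=> // _; apply: contrapT => no; apply: nub; exists s => t It.
    by rewrite leNgt; apply/negP => st; apply: no; exists t => //; exact: ltW.
  right; split=> // -[b hb]; apply: nub; exists b => t It.
  have [t' It' tt'] := up _ It; exact: le_trans (ltW tt') (hb _ (pos _ _ It It' tt')).
have Is : has_sup I by split; [exists t0|].
have le_s t : I t -> t <= sup I by exact: sup_ubound.
have lt_s t : I t -> t < sup I.
  by move=> /up[t' It' tt']; exact: lt_le_trans tt' (le_s _ It').
exists open_ball_kind, (sup I)%:E; split=> [|s]; last first.
  rewrite /= lte_fin; split=> [ss|[t It st]]; last exact: le_lt_trans st (lt_s _ It).
  have [|t It] := sup_adherent (eps := sup I - s) _ Is; first by rewrite subr_gt0.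
  by rewrite subKr => /ltW st; exists t.
left; exists (sup I) => //.
(* From an element [p.2] of [I] and an index [p.1], a larger element within [1/(p.1 + 1)] of the
   supremum; iteration gives a strictly increasing sequence with limit [sup I]. *)
have ex (p : nat * R) : exists t', I p.2 -> [/\ I t', p.2 < t' & sup I - p.1.+1%:R^-1 < t'].
  have [Ip|nIp] := pselect (I p.2); last by exists 0.
  have [|t It ht] := sup_adherent (eps := p.1.+1%:R^-1) _ Is; first by rewrite invr_gt0.
  have [t' It' pt'] := up _ Ip; exists (Num.max t t') => _; split; first by case: leP.
    by rewrite lt_max pt' orbT.
  by rewrite lt_max ht.
have [nx hnx] := choice ex.
pose u := fix u n := nx (n, if n is k.+1 then u k else t0).
have Iu n : I (u n) by elim: n => [|n IH] /=; [have [] := hnx (0, t0) It0|have [] := hnx (n.+1, u n) IH].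
exists u; split.
- by apply/increasing_seqP => n /=; have [] := hnx (n.+1, u n) (Iu n).
- case=> [|n]; first by apply: (pos t0) => //; have [] := hnx (0, t0) It0.
  by apply: (pos (u n)) => //; have [] := hnx (n.+1, u n) (Iu n).
- apply/cvgrPdist_lt => e e0; have [N hN] := invn_lt e0; near=> n.
  rewrite gtr0_norm ?subr_gt0 ?lt_s// ltrBlDr -ltrBlDl.
  apply: lt_trans (_ : sup I - n.+1%:R^-1 < _).
    rewrite ltrD2l ltrN2; apply: hN; near: n; exact: nbhs_infty_ge.
  by case: (n) => [|k]; [have [] := hnx (0, t0) It0|have [] := hnx (k.+1, u k) (Iu k)].
Unshelve. all: by end_near. Qed.

Lemma gap_below (t : R) (s : seq R) : (forall y, y \in s -> t < y) ->
  exists2 b, t < b & forall y, y \in s -> b <= y.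
Proof.
elim: s => [|y s IH] h; first by exists (t + 1); rewrite ?ltrDl.
have [|b tb hb] := IH; first by move=> y' y's; apply: h; rewrite inE y's orbT.
exists (Num.min b y); first by rewrite lt_min tb h// mem_head.
move=> y'; rewrite inE => /predU1P[->|/hb by']; first by rewrite ge_min lexx orbT.
by rewrite ge_min by'.
Qed.

(** Each coordinate of the ideal is a cut in the radii and gives one perfect pair. That the members
    of the ideal are separated means that no ball reaches another centre. *)
Lemma labeled_of_ideal n (x : 'I_n.+1 -> U) f : radius_ideal x f ->
  exists B : labeled_set L U, (forall y, label_support B y <-> exists i, y = x i) /\
    forall i s, label_in B (x i) s <-> exists2 m, f m & s <= m i.
Proof.
move=> [[m0 fm0] fspec fmax fdown].
pose I i := [set t | exists2 m, f m & m i = t].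
have ex i : exists p : ball_kind * \bar R,
    perfect_pair L p.1 p.2 /\ forall s, below p.1 p.2 s <-> exists2 t, I i t & s <= t.
  have [||k [r [h1 h2]]] := @perfect_pair_of_cut (I i).
  - by exists (m0 i), m0.
  - by move=> _ [m /fspec[hm _] <-].
  - by exists (k, r).
have [p hp] := choice ex.
have x_inj i j : x i = x j -> i = j.
  move=> xij; apply/eqP; apply: contraT => ij; have [hm hs] := fspec _ fm0.
  by have := hs _ _ ij; rewrite xij (udxx LU) ltNge (spec_ge0 Lpos).
pose idx y := xget ord0 [set i | x i = y].
have idxx i : idx (x i) = i.
  by rewrite /idx; case: xgetP => [j _ /x_inj//|/(_ i)/(_ erefl)].
have below_sep i j : i != j -> ~ below (p i).1 (p i).2 (d (x i) (x j)).
  move=> ij /(hp i).2[_ [m fm <-]]; rewrite leNgt => /negP; apply.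
  by have [_ hs] := fspec _ fm; exact: hs.
pose X := range x.
have Xfin : finite_set X.
  by apply: finite_image; exact: finite_finset.
have Xn0 : X !=set0 by exists (x ord0), ord0.
have Xperf y : X y -> perfect_pair L (p (idx y)).1 (p (idx y)).2.
  by move=> _; exact: (hp _).1.
have Xlt y : X y -> match (p (idx y)).1 with
    | closed_ball_kind => ((p (idx y)).2 < min_dist X y)%E
    | open_ball_kind => ((p (idx y)).2 <= min_dist X y)%E
    end.
  move=> [i _ <-]; rewrite idxx; have bs := below_sep i; have := (hp i).1.
  have jX j : (X `\ x i) (x j) -> i != j by move=> [_ h]; apply: contra_notN h => /eqP ->.
  case: (p i) bs => -[] r /= bs.
    (* For a closed ball the inequality is strict; it survives the infimum because there are
       finitely many centres. *)
    move=> [t _ rt]; have [|b tb hb] := @gap_below t [seq d (x i) (x j) | j <- enum 'I_n.+1 & i != j].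
      move=> y' /mapP[j]; rewrite mem_filter => /andP[/bs bij _ ->].
      by move: bij; rewrite rt lee_fin => /negP; rewrite -ltNge.
    rewrite rt; apply: (@lt_le_trans _ _ b%:E); first by rewrite lte_fin.
    apply: le_ereal_inf_tmp => _ [_ [[j _ <-] Xj] <-]; rewrite lee_fin; apply: hb.
    apply/mapP; exists j => //; rewrite mem_filter mem_enum andbT; apply: jX; split=> //.
    by exists j.
  move=> _; apply: le_ereal_inf_tmp => _ [_ [[j _ <-] Xj] <-].
  rewrite leNgt; apply/negP; apply: bs; apply: jX; split=> //.
  by exists j.
exists (LabeledSet Xfin Xn0 Xperf Xlt); split=> [y|i s].
  by split=> [[i _ <-]|[i ->]]; exists i.
rewrite /label_in /= idxx -[X in X <-> _]/(below (p i).1 (p i).2 s); split=> [/(hp i).2[_ [m fm <-]]|[m fm sm]].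
  by exists m.
by apply/(hp i).2; exists (m i) => //; exists m.
Qed.

(** Closure under maxima makes bounds on single coordinates simultaneous, so the ideal is determined
    by its coordinates. *)
Lemma ideal_bigmax n (x : 'I_n.+1 -> U) f : radius_ideal x f ->
  forall s : 'I_n.+1 -> R, (forall i, exists2 m, f m & s i <= m i) ->
  exists2 m, f m & forall i, s i <= m i.
Proof.
move=> [[m0 fm0] fspec fmax fdown] s hs.
suff h (l : seq 'I_n.+1) : exists2 m, f m & forall i, i \in l -> s i <= m i.
  by have [m fm hm] := h (enum 'I_n.+1); exists m => // i; apply: hm; rewrite mem_enum.
elim: l => [|i l [m fm hm]]; first by exists m0.
have [m' fm' hm'] := hs i; exists (maxf m m'); first exact: fmax.
by move=> j; rewrite inE /maxf le_max => /predU1P[->|/hm ->//]; rewrite hm' orbT.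
Qed.

(** An isometry that preserves the balls displaces each centre by an admissible distance, and
    [ideal_bigmax] supplies one [m] for all centres. *)
Lemma ideal_stabilizer n (x : 'I_n.+1 -> U) f (B : labeled_set L U) : radius_ideal x f ->
  (forall y, label_support B y <-> exists i, y = x i) ->
  (forall i s, label_in B (x i) s <-> exists2 m, f m & s <= m i) ->
  forall g, ball_stabilizer B g <-> exists2 m, f m & stab x m g.
Proof.
move=> fI Bs Bi g; split=> [/(ball_stabilizerP Lpos LU) gB|[m fm gm]].
  have [i|m fm hm] := ideal_bigmax fI (s := fun i => d (x i) (g (x i))).
    by apply/Bi/gB/Bs; exists i.
  by exists m => // i; rewrite (udC LU).
apply/(ball_stabilizerP Lpos LU) => y /Bs[i ->]; apply/Bi; exists m => //.
by rewrite (udC LU).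
Qed.

End ideals.

(** * Irreducible representations are induced *)

Section subspaces.
Context {R : realType}.
Implicit Types V W : hilbertType R.

Lemma perp_closed V (v : V) : closed_subspace [set w | ip w v = 0].
Proof.
split; last by split=> /= [|a u w hu hw]; rewrite ?ip0l// ipDl ipZl hu hw mulr0 addr0.
apply/closed_hn => w hw.
have key u : (forall w', ip w' v = 0 -> rip w' u = 0) -> rip w u = 0.
  move=> hu; apply/eqP; rewrite -normr_eq0 eq_le normr_ge0 andbT.
  apply/ler_addgt0Pr => e e0; rewrite add0r.
  have u0 : 0 < hn u + 1 by rewrite ltr_wpDl ?hn_ge0.
  have [w' w'v ww'] := hw (e / (hn u + 1)) (divr_gt0 e0 u0).
  rewrite -[w](subrK w') ripDl (hu _ w'v) addr0; apply: le_trans (CauchySchwarz_hn _ _) _.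
  apply: (@le_trans _ _ (e / (hn u + 1) * hn u)); first by rewrite ler_wpM2r ?hn_ge0// ltW.
  by rewrite mulrAC ler_pdivrMr// ler_pM2l// lerDl.
have r1 : rip w v = 0 by apply: key => w' h; rewrite /rip h.
have r2 : rip w ('i%C *: v) = 0 by apply: key => w' h; rewrite /rip ipZr h mulr0.
by rewrite /=; move: r1 r2; rewrite -Im_ip /rip; case: (ip w v) => a b /= -> ->.
Qed.

Lemma closed_subspace_contraction V W (T : V -> W) (A : set W) : linear T ->
  (forall v, hn (T v) <= hn v) -> closed_subspace A -> closed_subspace [set v | A (T v)].
Proof.
move=> Tl Tc [Ac [A0 Al]]; split; last first.
  by split=> /= [|a u v Su Sv]; rewrite ?(lin0 Tl)// Tl; exact: Al.
by apply: (@closed_comp _ _ T A) => // v _; exact: contraction_continuous.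
Qed.

End subspaces.

Section irreducible.
Context {R : realType} {G : topologicalGroupType} {W : hilbertType R}.
Context (rho : G -> W -> W) (irr : irreducible_rep setT rho).
Let hrho : unitary_rep setT rho. Proof. by case: irr. Qed.

Lemma irreducible_closed (A : set W) : closed_subspace A -> (forall g v, A v -> A (rho g v)) ->
  (exists2 v, A v & v <> 0) -> forall w, A w.
Proof.
move=> [Ac Al] Ag [v Av v0] w; have [_ _ h] := irr.
have [|A0|->//] := h A Ac Al; first by move=> g u _; exact: Ag.
by move: Av; rewrite A0 => /v0.
Qed.

Lemma irreducible_orth u v : u <> 0 -> (forall g, ip (rho g u) v = 0) -> v = 0.
Proof.
move=> u0 uv; apply/eqP; rewrite -sqnorm_eq0 /sqnorm -[v in ip v](rep1 hrho).
suff all w : forall g, ip (rho g w) v = 0 by rewrite all.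
move: w; apply: (irreducible_closed (A := [set w | forall g, ip (rho g w) v = 0])).
- apply: closed_subspace_bigcap => g; apply: (closed_subspace_contraction _ _ (perp_closed v)).
    exact: rep_linear.
  by move=> w; rewrite (rep_hn hrho).
- by move=> g w hw h; rewrite -(repM hrho).
- by exists u.
Qed.

Context (H : set G) (hH : subgroup_set H) (X : set W) (hX : closed_subspace X).
Hypothesis HX : forall h v, H h -> X v -> X (rho h v).
Hypothesis orth : forall g u v, ~ H g -> X u -> X v -> ip (rho g u) v = 0.
Hypothesis X0 : exists2 v, X v & v <> 0.

(** For a nonzero invariant [S] inside [X], the vectors of [W] all of whose translates have
    [X]-component in [S] form a nonzero closed invariant subspace, hence everything. *)
Lemma sub_irreducible : irreducible_rep H (sub_rep (hX := hX) rho).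
Proof.
split; first exact: sub_unitary_rep.
  have [v Xv v0] := X0; exists (subproj hX v) => /(congr1 (@subval _ _ _ hX)).
  by rewrite subprojK hproj_id.
move=> S Sc Sl Sinv; have [S0|/existsNP[v /not_implyP[Sv v0]]] := pselect (forall v, S v -> v = 0).
  by left; apply/seteqP; split=> v; [exact: S0|move=> ->; exact: Sl.1].
right; suff all w : forall g, S (subproj hX (rho g w)).
  apply/seteqP; split=> // w _; have := all (subval w) 1%g.
  by rewrite (rep1 hrho) subvalK.
move: w; apply: (irreducible_closed (A := [set w | forall g, S (subproj hX (rho g w))])).
- apply: closed_subspace_bigcap => g.
  apply: (@closed_subspace_contraction _ _ _ (fun w => subproj hX (rho g w)) _ _ _ (conj Sc Sl)).
    by move=> a u w; rewrite (rep_linear hrho) subproj_linear.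
  by move=> w; apply: le_trans (subproj_hn _ _) _; rewrite (rep_hn hrho).
- by move=> g w hw h; rewrite -(repM hrho).
- exists (subval v); last by move=> h; apply: v0; apply: subval_inj; rewrite h.
  move=> g; have [Hg|Hg] := pselect (H g); first exact: Sinv.
  suff -> : subproj hX (rho g (subval v)) = 0 by exact: Sl.1.
  apply: subval_inj; rewrite subprojK; apply: hproj_eq0 => // w Xw.
  by rewrite /rip orth//; exact: subval_in.
Qed.

End irreducible.

Section irreducible_induced.
Context {R : realType} {L : set R} {U : metricType R}.
Hypothesis (Lpos : forall r : R, L r -> 0 < r) (LU : is_urysohn L U).
Local Notation d := (@mdist R U).
Local Notation G := (isom U).
Local Notation C := R[i].
Context {W : hilbertType R} (rho : G -> W -> W) (irr : irreducible_rep setT rho).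
Local Notation P x m := (fixproj rho (stab x m)).
Local Notation spec := (spec (L := L)).
Let hrho : unitary_rep setT rho. Proof. by case: irr. Qed.

Section one_corner.
Variables (n : nat) (x : 'I_n.+1 -> U) (r : 'I_n.+1 -> R) (F : {group 'S_n.+1}).
Variables (b : {ffun subg_of F -> C^o}) (e : W -> W).
Hypothesis (hc : corner (L := L) rho id x r b e).
Let pe := corner_proj hc.
Let el : linear e := isproj_linear pe.
Let ee v : e (e v) = e v. Proof. exact: isproj_idem. Qed.

(** [P x m] commutes with all [e rho(g) e] on the corner, so the translates of [P x m (e v1)] are
    orthogonal to [e v2 - P x m (e v2)]; if the former vector is nonzero, irreducibility makes the
    latter 0. *)
Lemma corner_dichotomy m : spec m ->
  (forall v, P x m (e v) = e v) \/ (forall v, P x m (e v) = 0).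
Proof.
move=> hm; have [|/existsNP[v1 h1]] := pselect (forall v, P x m (e v) = 0); first by right.
left=> v2; apply/eqP; rewrite eq_sym -subr_eq0; apply/eqP.
have Pl k : linear (P x k) by exact: fixproj_linear.
apply: (irreducible_orth irr h1) => g.
have eu : e (e v2 - P x m (e v2)) = e v2 - P x m (e v2).
  by rewrite (linB el) ee (corner_comm hc _ hm) ee.
rewrite -eu -(isproj_adj _ _ pe) (corner_comm hc _ hm).
have [c [t ht ->]] := corner_rho_cases Lpos LU hc g.
rewrite -(corner_comm hc _ hm) ipZl (corner_max hc)//.
have -> : maxf t m = maxf m t by apply/funext => j; rewrite /maxf maxC.
rewrite -(corner_max hc)// (fixproj_adj hrho) (linB (Pl m)).
have -> : P x m (P x m (e v2)) = P x m (e v2).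
  by rewrite (corner_max hc)//; congr (fixproj _ (stab _ _) _); apply/funext => j; exact: maxxx.
by rewrite subrr ip0r mulr0.
Qed.

Definition corner_ideal : set ('I_n.+1 -> R) := [set m | spec m /\ forall v, P x m (e v) = e v].

Lemma corner_ideal_ideal : radius_ideal (L := L) x corner_ideal.
Proof.
split.
- by exists r; split; [exact: corner_spec hc|exact: corner_r hc].
- move=> m [hm fm]; split=> //; apply: contrapT => ns.
  by have [v] := corner_neq0 hc; rewrite -fm (corner_nsep hc).
- move=> m m' [hm fm] [hm' fm']; split=> [|v]; first exact: spec_maxf.
  by rewrite -(corner_max hc)// fm' fm.
- move=> m m' [hm fm] hm' le; split=> // v; rewrite -{1}fm.
  by have [-> _] := @fixproj_sub _ _ _ _ hrho _ _ (e v) (@stab_mono _ _ _ x _ _ le); rewrite fm.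
Qed.

Lemma corner_ideal_perm s m : s \in F -> corner_ideal m -> corner_ideal (m \o s).
Proof.
move=> sF [hm fm]; split=> [|v]; first exact: spec_perm.
by rewrite -(corner_perm hc)// fm.
Qed.

Variable B : labeled_set L U.
Hypothesis Bs : forall y, label_support B y <-> exists i, y = x i.
Hypothesis Bi : forall i s, label_in B (x i) s <-> exists2 m, corner_ideal m & s <= m i.
Local Notation H := (union_stabilizer B).

(** If [e rho(g) e] is nonzero, the dichotomy puts the shift radii of [g] into the ideal. Then [g]
    carries the ball of [x i] onto that of [x (s^-1 i)], because the ideal is invariant under
    [F]. *)
Lemma corner_stabilizer g v : ~ H g -> e (rho g (e v)) = 0.
Proof.
move=> nHg; have [[s [sF ss ->]]|[_ ->//]] := corner_rho hc g.
set t := shift_radius _ _ _ _; have ht : spec t by exact: spec_shift (corner_spec hc).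
have [ft|->] := corner_dichotomy ht; last by rewrite scaler0.
exfalso; apply: nHg.
have Bperm i c : label_in B (x i) c <-> label_in B (x (s^-1%g i)) c.
  split=> /Bi[m fm hm]; apply/Bi.
    by exists (m \o s); [exact: corner_ideal_perm|rewrite /= permKV].
  by exists (m \o s^-1%g); [apply: corner_ideal_perm; rewrite ?groupV|].
have Bt i : label_in B (x i) (d (g (x i)) (x (s^-1%g i))).
  by apply/Bi; exists t; [split|rewrite /t /shift_radius !le_max lexx !orbT].
have tri i a y c : label_in B (x i) (d a c) -> label_in B (x i) (d c y) -> label_in B (x i) (d a y).
  by move=> h1 h2; apply: label_in_le (ud_tri LU c a y) _; case: leP.
have img i : g @` label_ball B (x i) = label_ball B (x (s^-1%g i)).
  apply/seteqP; split=> [_ [y xy <-]|y].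
    rewrite label_ballE; apply/(Bperm i); apply: (tri _ _ _ (g (x i))); first by rewrite (udC LU); exact: Bt.
    by rewrite isom_dist -label_ballE.
  rewrite label_ballE => /(Bperm i) xy; exists (g^-1%g y); last exact: isomEV.
  by rewrite label_ballE (udC LU) isom_distV (udC LU); apply: tri xy.
apply/seteqP; split=> [_ [y [_ /Bs[i ->] xy] <-]|y [_ /Bs[i ->] xy]].
  by exists (x (s^-1%g i)); [apply/Bs; eexists|rewrite -img; exists y].
move: xy; rewrite -{1}(permK s i) -img => -[y' xy' <-]; exists y' => //.
by exists (x (s i)) => //; apply/Bs; eexists.
Qed.

Variable xi : W.
Hypotheses (exi : e xi = xi) (xi0 : xi <> 0).

(** The closed span of the vectors [rho h xi] with [h] in [H], written as the orthogonal complement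
    of the other translates; [corner_space_xi] and [corner_space_ind] give the two inclusions. *)
Definition corner_space : set W := [set w | forall g, ~ H g -> ip w (rho g xi) = 0].
Local Notation X := corner_space.
Let hH : subgroup_set H. Proof. exact: union_stabilizer_subgroup. Qed.
Let HM g h : H g -> H h -> H (g * h)%g. Proof. by case: hH => _ + _; apply. Qed.
Let HV g : H g -> H g^-1%g. Proof. by case: hH => _ _; apply. Qed.

Lemma corner_space_closed : closed_subspace X.
Proof.
apply: (@closed_subspace_bigcap _ _ _ (fun g => [set w | ~ H g -> ip w (rho g xi) = 0])) => g.
have [Hg|nHg] := pselect (H g); last first.
  have -> : [set w | ~ H g -> ip w (rho g xi) = 0] = [set w | ip w (rho g xi) = 0].
    by apply/seteqP; split=> w /= h //; exact: h.
  exact: perp_closed.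
have -> : [set w | ~ H g -> ip w (rho g xi) = 0] = setT.
  by apply/seteqP; split=> // w _ /(_ Hg).
by split=> //; exact: closedT.
Qed.
Local Notation hX := corner_space_closed.

Lemma corner_spaceH h v : H h -> X v -> X (rho h v).
Proof.
move=> hh Xv g nHg; rewrite (rep_adj hrho) -(repM hrho); apply: Xv => k; apply: nHg.
by have := HM hh k; rewrite mulgA mulgV mul1g.
Qed.

Lemma corner_space_xi h : H h -> X (rho h xi).
Proof.
move=> hh g nHg; rewrite (rep_adj hrho) -(repM hrho) -{1}exi (isproj_adj _ _ pe).
rewrite -[in X in rho _ X]exi corner_stabilizer ?ip0r// => k; apply: nHg.
by have := HM hh k; rewrite mulgA mulgV mul1g.
Qed.

(** The vectors all of whose translates have [X]-component projecting into [Y] form a closed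
    invariant subspace that contains [xi], hence everything. *)
Lemma corner_space_ind (Y : set W) : closed_subspace Y ->
  (forall h, H h -> Y (rho h xi)) -> X `<=` Y.
Proof.
move=> hY Yxi w Xw.
suff all v : forall g, Y (hproj X (rho g v)).
  by have := all w 1%g; rewrite (rep1 hrho) (hproj_id hX Xw).
move: v; apply: (irreducible_closed irr (A := [set w | forall g, Y (hproj X (rho g w))])).
- apply: closed_subspace_bigcap => g.
  apply: (@closed_subspace_contraction _ _ _ (fun w => hproj X (rho g w)) _ _ _ hY).
    by move=> a u v; rewrite (rep_linear hrho) (hproj_linear hX).
  by move=> v; apply: le_trans (hn_hproj hX _) _; rewrite (rep_hn hrho).
- by move=> g v hv h; rewrite -(repM hrho).
- exists xi => // g; have [Hg|nHg] := pselect (H g).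
    by rewrite (hproj_id hX (corner_space_xi Hg)); exact: Yxi.
  rewrite (hproj_eq0 hX); first exact: hY.2.1.
  by move=> v Xv; rewrite ripC /rip Xv.
Qed.

Lemma corner_space_orth g u v : ~ H g -> X u -> X v -> ip (rho g u) v = 0.
Proof.
move=> nHg Xu Xv; rewrite ipC; apply/eqP; rewrite conjc_eq0; apply/eqP.
move: v Xv; apply: corner_space_ind; first exact: perp_closed.
move=> h hh; rewrite ipC (rep_adj hrho) -(repM hrho) Xu ?conjc0// => k; apply: nHg.
by rewrite -[g]invgK; apply: HV; have := HM k (HV hh); rewrite -mulgA mulgV mulg1.
Qed.

(** Elements of the ball stabilizer lie in some [stab x m] with [P x m] equal to 1 on the corner, so
    they fix [xi]; they fix its translates by [H] because the ball stabilizer is normal in [H]. *)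
Lemma corner_space_trivial h v : ball_stabilizer B h -> X v -> rho h v = v.
Proof.
have hxi k : ball_stabilizer B k -> rho k xi = xi.
  move=> /(ideal_stabilizer Lpos LU corner_ideal_ideal Bs Bi)[m [hm fm] km].
  by rewrite -exi -fm (fixproj_in hrho).
move=> hh Xv; move: v Xv h hh; apply: corner_space_ind; first exact: fixed_closed.
move=> k hk h hh /=; have kV : k^-1%g @` balls_union B = balls_union B by exact: HV.
have := hxi _ (ball_stabilizer_conj Lpos LU kV hh).
move=> /(congr1 (rho k)); rewrite invgK -!(repM hrho) !mulgA mulgV mul1g.
by [].
Qed.

Lemma corner_induced : exists (V : hilbertType R) (nu : G -> V -> V),
  ball_rep B nu /\ is_induced H nu rho.
Proof.
have X0 : X xi by rewrite -(rep1 hrho xi); apply: corner_space_xi; case: hH.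
exists (sub_hilbert hX), (sub_rep (hX := hX) rho); split; last first.
  apply: (@sub_induced _ _ _ _ hrho _ hH _ hX corner_spaceH corner_space_orth) => w hw.
  apply: contrapT => w0; apply: xi0; apply: (irreducible_orth irr w0) => g.
  by rewrite -(hproj_id hX X0) -(hproj_adj hX) hw ip0l.
split.
  by apply: (@sub_irreducible _ _ _ _ irr _ hH _ hX corner_spaceH corner_space_orth); exists xi.
move=> h hh; apply/funext => v; apply: subval_inj.
rewrite (subval_rep corner_spaceH); last exact: ball_union_stabilizer.
by rewrite corner_space_trivial//; exact: subval_in.
Qed.

End one_corner.

Theorem irreducible_is_induced : exists (B : labeled_set L U) (V : hilbertType R)
  (nu : G -> V -> V), ball_rep B nu /\ is_induced (union_stabilizer B) nu rho.
Proof.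
have [_ [v0 v00] _] := irr.
have hz : isproj (id : W -> W) by split.
have [n [x [r [F [b [e hc]]]]]] :=
  corner_exists Lpos LU hrho hz (fun _ _ => erefl) (ex_intro _ v0 v00).
have [B [Bs Bi]] := labeled_of_ideal Lpos LU (corner_ideal_ideal hc).
have [v ev0] := corner_neq0 hc; exists B.
by apply: (corner_induced hc Bs Bi _ ev0); exact: isproj_idem (corner_proj hc).
Qed.

End irreducible_induced.


(** * Equivalence of induced representations *)

Section ball_inclusions.
Context {R : realType} {L : set R} {U : metricType R}.
Hypothesis (Lpos : forall r : R, L r -> 0 < r) (LU : is_urysohn L U).
Local Notation d := (@mdist R U).
Local Notation max := Num.max.
Local Notation G := (isom U).
Implicit Types (B : labeled_set L U) (g h k : G).

Lemma image_sub g (A A' : set U) : g @` A `<=` g @` A' -> A `<=` A'.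
Proof.
move=> sub a Aa; have [|a' A'a' /(congr1 (g^-1%g : G))] := sub (g a); first by exists a.
by rewrite !isomVE => <-.
Qed.

Lemma label_ball_meet B y g : (g @` label_ball B y) y -> g @` label_ball B y = label_ball B y.
Proof.
move=> [q yq gq]; apply: (label_ball_image LU).
have -> : d y (g y) = d y q by rewrite -{1}gq isom_dist (udC LU).
by rewrite -label_ballE.
Qed.

(* A power of the permutation [pi] is trivial, and an isometry that takes a ball
   to a larger one does not exist. *)
Lemma label_ball_inclusions B g (pi : U -> U) :
  (forall y, label_support B y -> label_support B (pi y)) ->
  {in label_support B &, injective pi} ->
  (forall y, label_support B y -> label_ball B (pi y) `<=` g @` label_ball B y) ->
  forall y, label_support B y -> g @` label_ball B y = label_ball B (pi y) /\
    exists2 z, label_support B z & pi z = y.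
Proof.
move=> hpi inj sub y By.
have /finite_seqP[xs xsE] := support_finite B.
have suppE u : label_support B u <-> u \in xs by rewrite xsE.
pose T : finType := seq_sub xs.
pose f (t : T) : T := insubd t (pi (val t)).
have fE t : val (f t) = pi (val t).
  by rewrite val_insubd; case: ifP => // /negP[]; apply/suppE/hpi/suppE/ssvalP.
have finj : injective f.
  move=> t t' /(congr1 val); rewrite !fE => tt'; apply: val_inj.
  by apply: inj tt'; rewrite inE; apply/suppE/ssvalP.
have iterE t n : val (iter n f t) = iter n pi (val t).
  by elim: n => // n IH; rewrite iterS [LHS]fE /= -IH.
have chain n u : label_support B u ->
    label_support B (iter n pi u) /\ label_ball B (iter n pi u) `<=` (g ^+ n)%g @` label_ball B u.
  move=> Bu; elim: n => [|n [Bn IH]]; first by split=> // ; rewrite [(_ ^+ 0)%g]/1%g image1.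
  split; first exact: hpi.
  by rewrite expgS imageM; apply: subset_trans (sub _ Bn) _; exact: image_subset.
have yxs : y \in xs by apply/suppE.
pose t0 : T := SeqSub yxs.
have ord : iter (fingraph.order f t0) pi y = y.
  by rewrite -[X in iter _ _ X]/(val t0) -iterE iter_order.
have [n nE] : exists n, fingraph.order f t0 = n.+1.
  by case: (fingraph.order f t0) (fingraph.order_gt0 f t0) => // n; exists n.
rewrite nE in ord.
have [_ cy] := chain n.+1 y By; rewrite ord in cy.
have gy : (g ^+ n.+1)%g @` label_ball B y = label_ball B y.
  by apply: label_ball_meet; apply: cy; exact: (label_ball_center Lpos LU).
split; last by exists (iter n pi y) => //; case: (chain n y By).
apply/seteqP; split; last exact: sub.
apply: (@image_sub (g ^+ n)%g); rewrite -imageM -expgSr gy.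
have := (chain n (pi y) (hpi _ By)).2.
by rewrite -iterSr ord.
Qed.

(** If no ball of [B1] lies in the translated ball of [y], some [stab x r] inside the ball
    stabilizer contains an [h] that carries [g y] farther from a given finite set than the radius of
    that ball. But [h g] takes the configuration of [B2] to one of finitely many, so the ball about
    [h (g y)] contains one of finitely many centres. *)
Lemma finite_translates_contain B1 B2 g (l : seq G) :
  (forall h, ball_stabilizer B1 h -> exists2 k, k \in l &
     (h * g)%g @` balls_union B2 = (k * g)%g @` balls_union B2) ->
  forall y, label_support B2 y -> exists2 x, label_support B1 x &
    label_ball B1 x `<=` g @` label_ball B2 y.
Proof.
move=> fin y By; apply: contrapT => no.
have /finite_seqP[xs xsE] := support_finite B1.
have suppE u : label_support B1 u <-> u \in xs by rewrite xsE.
have [x0 Bx0] := support_nonempty B1; move/suppE: (Bx0) => x0xs.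
have [n xsn] : exists n, size xs = n.+1 by case: (xs) x0xs => // a s _; exists (size s).
pose x (i : 'I_n.+1) := nth x0 xs i.
have Bx i : label_support B1 (x i) by apply/suppE/mem_nth; rewrite xsn.
have suppI u : label_support B1 u -> exists i, u = x i.
  move=> /suppE uxs; have lt : (index u xs < n.+1)%N by rewrite -xsn index_mem.
  by exists (Ordinal lt); rewrite /x /= nth_index.
have in2 u w : label_ball B2 y (g^-1%g u) -> (g @` label_ball B2 y) w <-> label_in B2 y (d u w).
  move=> yu; rewrite -(isom_dist g^-1%g); apply: iff_trans (label_ball_shift LU _ yu).
  split=> [[w' yw' <-]|yw]; first by rewrite isomVE.
  by exists (g^-1%g w) => //; exact: isomEV.
(* [q] makes the maximum exceed the radius of the ball of [y]: it is the centre [x i], if that lies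
   outside the translated ball, and otherwise a point of the ball of [x i] outside it. *)
have pick i : exists q : U, label_ball B1 (x i) q /\
    ~ label_in B2 y (max (d (x i) q) (d (g y) (x i))).
  have [yx|yx] := pselect (label_in B2 y (d (g y) (x i))); last first.
    exists (x i); split; first exact: (label_ball_center Lpos LU).
    by move=> h; apply: yx; apply: label_in_le h; rewrite le_max lexx orbT.
  apply: contrapT => nq; apply: no; exists (x i) => // q xq.
  apply: contrapT => gq; apply: nq; exists q; split=> // h; apply: gq.
  have gy : label_ball B2 y (g^-1%g (g y)) by rewrite isomVE; exact: (label_ball_center Lpos LU).
  apply/(in2 (g y) q gy); apply: label_in_le h; rewrite maxC; exact: (ud_tri LU).
have [q hq] := choice pick; pose r i := d (x i) (q i).
have r0 i : L0 (L := L) (r i) by exact: (ud_L0 LU).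
have /finite_seqP[zs zsE] := support_finite B2.
pose P := [seq k (g z) | k <- l, z <- zs].
have [h hx hP] := stab_generic Lpos LU x (fun _ : 'I_1 => g y) r0 P.
have [|k kl hk] := fin h.
  apply/(ball_stabilizerP Lpos LU) => _ /suppI[i ->]; rewrite (udC LU).
  by apply: label_in_le (hx i) _; rewrite /r -label_ballE; case: (hq i).
have E : (k * g)^-1%g @` ((h * g)%g @` balls_union B2) = balls_union B2.
  by rewrite hk; apply/esym/imageVP.
rewrite -imageM in E; have [z Bz zE] := image_label_ball Lpos LU E By.
have : ((h * g)%g @` label_ball B2 y) (k (g z)).
  have : label_ball B2 z z by exact: (label_ball_center Lpos LU).
  rewrite -zE imageM => -[u hu] uz; rewrite -[k (g z)]/((k * g)%g z) -uz.
  by rewrite isomEV.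
move=> [w yw wE]; set a := k (g z) in wE.
have lab : label_in B2 y (d (h (g y)) a) by rewrite -wE isom_dist isom_dist -label_ballE.
case: (hq (closest x r (g y))) => _; apply; apply: label_in_le lab.
apply: (hP ord0); apply/allpairsP; exists (k, z); split=> //=.
by have : label_support B2 z by []; rewrite zsE.
Qed.

Lemma contained_balls_inj B1 B2 g (s : U -> U) :
  (forall y, label_support B2 y -> label_support B1 (s y) /\
     label_ball B1 (s y) `<=` g @` label_ball B2 y) ->
  {in label_support B2 &, injective s}.
Proof.
move=> hs y z; rewrite !inE => By Bz eq; have [B1y yin] := hs y By.
have [_ zin] := hs z Bz; have c := label_ball_center Lpos LU B1y.
have [u yu gu] := yin _ c; rewrite -eq in zin; have [v zv gv] := zin _ c.
move: gv; rewrite -gu => /(congr1 (g^-1%g : G)); rewrite !isomVE => vu.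
by apply: (label_ball_disjoint LU By Bz yu); rewrite -vu.
Qed.

(** The two families of inclusions compose to injective self-maps of the finite supports, to which
    [label_ball_inclusions] applies: every inclusion is an equality and every ball is reached. *)
Lemma mutual_containment B1 B2 g k :
  (forall y, label_support B2 y -> exists2 x, label_support B1 x &
    label_ball B1 x `<=` g @` label_ball B2 y) ->
  (forall x, label_support B1 x -> exists2 y, label_support B2 y &
    label_ball B2 y `<=` k @` label_ball B1 x) ->
  g @` balls_union B2 = balls_union B1.
Proof.
move=> h1 h2.
have pick (A A' : labeled_set L U) h : (forall y, label_support A y -> exists2 x,
    label_support A' x & label_ball A' x `<=` h @` label_ball A y) ->
  exists s : U -> U, forall y, label_support A y ->
    label_support A' (s y) /\ label_ball A' (s y) `<=` h @` label_ball A y.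
  move=> hA; have ch y : exists x, label_support A y ->
      label_support A' x /\ label_ball A' x `<=` h @` label_ball A y.
    by have [/hA[x]|ny] := pselect (label_support A y); [exists x|exists y].
  by have [s hs] := choice ch; exists s.
have [s hs] := pick _ _ _ h1; have [t ht] := pick _ _ _ h2.
have sE y : label_support B2 y -> g @` label_ball B2 y = label_ball B1 (s y).
  move=> By; have [B1y sy] := hs y By; apply/seteqP; split=> //.
  apply: (@image_sub k); rewrite -imageM.
  have [|||-> _] := @label_ball_inclusions B2 (k * g)%g (t \o s) _ _ _ y By.
  - by move=> z /hs[/ht[]].
  - move=> z w zB wB /(contained_balls_inj ht) eq; apply: (contained_balls_inj hs) => //.
    by apply: eq; rewrite inE; [case: (hs z)|case: (hs w)] => //; rewrite -inE.
  - move=> z /hs[/ht[_ sub] sz]; apply: subset_trans sub _.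
    by rewrite imageM; exact: image_subset.
  by case: (ht _ B1y).
apply/seteqP; split=> [_ [u [y By yu] <-]|u [x Bx xu]].
  have [B1y _] := hs y By; exists (s y) => //; rewrite -sE//; exact: imageP.
have [|||_ [z Bz zx]] := @label_ball_inclusions B1 (g * k)%g (s \o t) _ _ _ x Bx.
- by move=> z /ht[/hs[]].
- move=> z w zB wB /(contained_balls_inj hs) eq; apply: (contained_balls_inj ht) => //.
  by apply: eq; rewrite inE; [case: (ht z)|case: (ht w)] => //; rewrite -inE.
- move=> z /ht[/hs[_ sub] sz]; apply: subset_trans sub _.
  by rewrite imageM; exact: image_subset.
have [B2z _] := ht z Bz; move: xu; rewrite -zx /= -(sE (t z) B2z) => -[v tv <-].
by exists v => //; exists (t z).
Qed.
End ball_inclusions.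

Lemma isometry_ip (R : realType) (V W : hilbertType R) (T : V -> W) : linear T ->
  (forall v, sqnorm (T v) = sqnorm v) -> forall u v, ip (T u) (T v) = ip u v.
Proof.
move=> Tl Tn.
have r u v : rip (T u) (T v) = rip u v.
  have := Tn (u + v); rewrite (linD Tl) !sqnormD !Tn => /addIr/addrI.
  by move/mulfI; apply; rewrite pnatr_eq0.
by move=> u v; apply: ip_eq; rewrite -?(linZ Tl) r.
Qed.

(** * Functions on cosets and intertwiners of induced representations *)

Section right_cosets.
Context {G : topologicalGroupType} (H : set G) (hH : subgroup_set H).
Let H1 : H 1%g. Proof. by case: hH. Qed.
Let HM g h : H g -> H h -> H (g * h)%g. Proof. by case: hH => _ + _; apply. Qed.
Let HV g : H g -> H g^-1%g. Proof. by case: hH => _ _; apply. Qed.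

Definition right_coset (g : G) : set G := [set (h * g)%g | h in H].

Lemma right_coset_in g : right_coset g g.
Proof. by exists 1%g; rewrite ?mul1g. Qed.

Lemma right_coset_eq g g' : H (g * g'^-1)%g -> right_coset g = right_coset g'.
Proof.
move=> gg'; apply/seteqP; split=> _ [h hh <-].
  exists (h * (g * g'^-1))%g; first exact: HM.
  by rewrite -!mulgA mulVg mulg1.
exists (h * (g * g'^-1)^-1)%g; first by apply: HM => //; exact: HV.
by rewrite invMg invgK -!mulgA mulVg mulg1.
Qed.

Lemma right_coset_xget g : exists2 h, H h & xget 1%g (right_coset g) = (h * g)%g.
Proof. by have [h hh <-] := xgetI 1%g (right_coset_in g); exists h. Qed.

Context {R : realType} {V : hilbertType R} (F : G -> V).
Hypothesis FH : forall h g, H h -> sqnorm (F (h * g)%g) = sqnorm (F g).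

Lemma sqnorm_right_coset g : sqnorm (F (xget 1%g (right_coset g))) = sqnorm (F g).
Proof. by have [h hh ->] := right_coset_xget g; exact: FH. Qed.

Lemma coset_sqnorm_supp g : (forall g', ~ H (g' * g^-1)%g -> F g' = 0) ->
  coset_sqnorm H F = (sqnorm (F g))%:E.
Proof.
move=> supp; apply/eqP; rewrite eq_le; apply/andP; split; last first.
  have := @esum_ge_seq _ _ (right_cosets H) (fun K => sqnorm (F (xget 1%g K))) [:: right_coset g].
  rewrite big_seq1 sqnorm_right_coset; apply; split=> // K; rewrite inE => /eqP ->.
  by exists g.
apply: (@esum_le_seq _ _ (right_cosets H) (fun K => sqnorm (F (xget 1%g K)))) => l [ul lS].
have z K : K \in l -> K != right_coset g -> sqnorm (F (xget 1%g K)) = 0.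
  move=> /lS[g' _ <-] neq; rewrite -/(right_coset g') sqnorm_right_coset supp ?sqnorm0// => h.
  by case/eqP: neq; exact: right_coset_eq.
have [gl|gl] := boolP (right_coset g \in l).
  rewrite (big_rem (right_coset g))//= sqnorm_right_coset big_seq big1 ?addr0// => K.
  by rewrite mem_rem_uniq// inE => /andP[? ?]; exact: z.
rewrite big_seq big1 ?sqnorm_ge0// => K Kl; apply: z => //.
by apply: contraNneq gl => <-.
Qed.

(** Outside a suitable finite set of cosets the squared norms sum to less than [c]; representatives
    of that set form [l]. *)
Lemma coset_sqnorm_finite (c : R) : (coset_sqnorm H F < +oo)%E -> 0 < c ->
  exists l : seq G, forall g, c <= sqnorm (F g) -> exists2 k, k \in l & H (g * k^-1)%g.
Proof.
move=> fin c0.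
have [l [ul lS] lmax] := @esum_approx _ _ (right_cosets H)
  (fun K => sqnorm (F (xget 1%g K))) (fun _ => sqnorm_ge0 _) c fin c0.
exists [seq xget 1%g K | K <- l] => g cg.
have gl : right_coset g \in l.
  apply: contraT => gl; have := lmax (right_coset g :: l).
  rewrite big_cons sqnorm_right_coset addrC ltrD2l ltNge cg /=.
  apply; split=> /=; first by rewrite gl.
  by move=> K; rewrite inE => /predU1P[->|/lS//]; exists g.
exists (xget 1%g (right_coset g)); first exact: map_f.
have [h hh ->] := right_coset_xget g.
by rewrite invMg mulgA mulgV mul1g; exact: HV.
Qed.
End right_cosets.

Section induced_equivalence.
Context {R : realType} {G : topologicalGroupType}.
Implicit Types (V W : hilbertType R) (H : set G).

Lemma unitary_sqnorm V W (T : V -> W) v : unitary_op T -> sqnorm (T v) = sqnorm v.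
Proof. by case=> _ _ Tip; rewrite /sqnorm Tip. Qed.

Lemma unitary_inv V W (T : V -> W) : unitary_op T -> exists S : W -> V,
  [/\ unitary_op S, forall v, S (T v) = v & forall w, T (S w) = w].
Proof.
move=> uT; have [Tl Tr Tip] := uT.
have ch w : exists v, T v = w.
  have : (range T) w by rewrite Tr.
  by move=> [v _ <-]; exists v.
have [S TS] := choice ch.
have Tinj u v : T u = T v -> u = v.
  move=> Tuv; apply/eqP; rewrite -subr_eq0 -sqnorm_eq0 -(unitary_sqnorm _ uT) (linB Tl) Tuv.
  by rewrite subrr sqnorm0.
exists S; split=> // [|v]; last exact: Tinj.
split=> [a u v||u v]; last by rewrite -Tip !TS.
  by apply: Tinj; rewrite TS Tl !TS.
by apply/seteqP; split=> // v _; exists (T v) => //; exact: Tinj.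
Qed.

Definition extend_by0 (H : set G) V (nu : G -> V -> V) (g0 : G) v (g : G) : V :=
  if `[< H (g * g0^-1)%g >] then nu (g * g0^-1)%g v else 0.

Section one_induced.
Context {H : set G} (hH : subgroup_set H) {V W : hilbertType R} {nu : G -> V -> V}
  {rho : G -> W -> W} (hnu : unitary_rep H nu).
Context {Phi : W -> G -> V}.
Hypotheses (Pl : linear Phi) (Pr : range Phi = induced_space H nu)
  (Pn : forall w, coset_sqnorm H (Phi w) = (sqnorm w)%:E)
  (Pt : forall g w x, Phi (rho g w) x = Phi w (x * g)%g).

Lemma induced_equivariant w h g : H h -> Phi w (h * g)%g = nu h (Phi w g).
Proof.
have : induced_space H nu (Phi w) by rewrite -Pr; exists w.
by case=> + _; apply.
Qed.

Lemma equivariant_sqnorm (F : G -> V) : (forall h g, H h -> F (h * g)%g = nu h (F g)) ->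
  forall h g, H h -> sqnorm (F (h * g)%g) = sqnorm (F g).
Proof. by move=> FH h g hh; rewrite FH// unitary_sqnorm//; case: hnu => _ + _ _ _; apply. Qed.

Lemma induced_inj w w' : Phi w = Phi w' -> w = w'.
Proof.
move=> eq; apply/eqP; rewrite -subr_eq0 -sqnorm_eq0.
have := Pn (w - w'); rewrite (linB Pl) eq subrr.
rewrite (_ : coset_sqnorm H (0 : G -> V) = 0%E); first by move=> [<-].
by apply: esum1 => K _; rewrite /= sqnorm0.
Qed.

Lemma induced_surj F : induced_space H nu F -> exists w, Phi w = F.
Proof. by rewrite -Pr => -[w _ <-]; exists w. Qed.

Lemma induced_finite w (c : R) : 0 < c -> exists l : seq G, forall g,
  c <= sqnorm (Phi w g) -> exists2 k, k \in l & H (g * k^-1)%g.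
Proof.
apply: coset_sqnorm_finite => //; last by rewrite Pn ltry.
by apply: equivariant_sqnorm => h g; exact: induced_equivariant.
Qed.

Lemma extend_by0_in g0 v : induced_space H nu (extend_by0 H nu g0 v) /\
  coset_sqnorm H (extend_by0 H nu g0 v) = (sqnorm v)%:E.
Proof.
have [_ nuU nu1 nuM _] := hnu; have [H1 HM HV] := hH.
have eqv h g : H h -> extend_by0 H nu g0 v (h * g)%g = nu h (extend_by0 H nu g0 v g).
  move=> hh; rewrite /extend_by0 -mulgA; case: asboolP => Hg; case: asboolP => Hg'.
  - by rewrite (nuM _ _ hh Hg').
  - by case: Hg'; rewrite -[(g * _)%g]mul1g -(mulVg h) -mulgA; apply: HM => //; exact: HV.
  - by case: Hg; apply: HM.
  - by rewrite (lin0 (_ : linear (nu h)))//; case: (nuU h hh).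
have E : coset_sqnorm H (extend_by0 H nu g0 v) = (sqnorm v)%:E.
  rewrite (@coset_sqnorm_supp _ _ hH _ _ _ (equivariant_sqnorm eqv) g0).
    by rewrite /extend_by0 mulgV asboolT// nu1.
  by move=> g ng; rewrite /extend_by0 asboolF.
by split=> //; split=> //; rewrite E ltry.
Qed.

Lemma induced_base : exists io : V -> W, [/\ forall v, Phi (io v) = extend_by0 H nu 1%g v,
  forall v, sqnorm (io v) = sqnorm v & forall h v, H h -> rho h (io v) = io (nu h v)].
Proof.
have [_ _ _ nuM _] := hnu; have [H1 HM HV] := hH.
have ex v : exists w, Phi w = extend_by0 H nu 1%g v.
  by apply: induced_surj; case: (extend_by0_in 1%g v).
have [io ioE] := choice ex; exists io; split=> // [v|h v hh].
  by apply: EFin_inj; rewrite -Pn ioE; case: (extend_by0_in 1%g v).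
apply: induced_inj; apply/funext => x; rewrite Pt !ioE /extend_by0.
rewrite !invg1 !mulg1; case: asboolP => Hx; case: asboolP => Hx' //.
- by rewrite (nuM _ _ Hx' hh).
- by case: Hx'; rewrite -[x](mulgK h); apply: HM => //; exact: HV.
- by case: Hx; exact: HM.
Qed.

End one_induced.
End induced_equivalence.

Section configurations.
Context {R : realType} {L : set R} {U : metricType R}.
Hypothesis (Lpos : forall r : R, L r -> 0 < r) (LU : is_urysohn L U).
Local Notation G := (isom U).
Implicit Types (B : labeled_set L U) (g h : G) (V W : hilbertType R).

Let uH B := @union_stabilizer_subgroup R L U B.

(* A vector fixed by the ball stabilizer has a finite orbit of translated
   configurations in its support. *)
Lemma induced_fixed_contain B1 B2 V W (nu : G -> V -> V) (Phi : W -> G -> V) w g :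
  unitary_rep (union_stabilizer B2) nu -> range Phi = induced_space (union_stabilizer B2) nu ->
  (forall w, coset_sqnorm (union_stabilizer B2) (Phi w) = (sqnorm w)%:E) ->
  (forall h x, ball_stabilizer B1 h -> Phi w (x * h)%g = Phi w x) -> Phi w g <> 0 ->
  forall y, label_support B2 y -> exists2 x, label_support B1 x &
    label_ball B1 x `<=` g^-1%g @` label_ball B2 y.
Proof.
move=> hnu Pr Pn wfix /eqP; rewrite -sqnorm_gt0 => c0.
have [l hl] := induced_finite (uH B2) hnu Pr Pn w c0.
apply: (@finite_translates_contain R L U Lpos LU B1 B2 g^-1%g [seq (k^-1 * g)%g | k <- l]) => h hh.
have [|k kl hk] := hl (g * h^-1)%g.
  by rewrite wfix//; case: (ball_stabilizer_subgroup B1) => _ _; apply.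
exists (k^-1 * g)%g; first exact: (map_f (fun k => (k^-1 * g)%g)).
rewrite mulgK -[in LHS]hk -imageM; congr (_ @` _).
by rewrite -!mulgA mulKg ?mulKVg ?mulVKg.
Qed.

Section sufficient.
Variables (B1 B2 : labeled_set L U) (V1 V2 W1 W2 : hilbertType R).
Variables (nu1 : G -> V1 -> V1) (nu2 : G -> V2 -> V2).
Variables (rho1 : G -> W1 -> W1) (rho2 : G -> W2 -> W2).
Local Notation H1 := (union_stabilizer B1).
Local Notation H2 := (union_stabilizer B2).
Hypotheses (hnu1 : unitary_rep H1 nu1) (hnu2 : unitary_rep H2 nu2).
Variables (Phi1 : W1 -> G -> V1) (Phi2 : W2 -> G -> V2).
Hypotheses (Pl1 : linear Phi1) (Pr1 : range Phi1 = induced_space H1 nu1)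
  (Pn1 : forall w, coset_sqnorm H1 (Phi1 w) = (sqnorm w)%:E)
  (Pt1 : forall g w x, Phi1 (rho1 g w) x = Phi1 w (x * g)%g).
Hypotheses (Pl2 : linear Phi2) (Pr2 : range Phi2 = induced_space H2 nu2)
  (Pn2 : forall w, coset_sqnorm H2 (Phi2 w) = (sqnorm w)%:E)
  (Pt2 : forall g w x, Phi2 (rho2 g w) x = Phi2 w (x * g)%g).

Section transport.
Variables (g : G) (A : V1 -> V2).
Hypotheses (gB : g @` balls_union B1 = balls_union B2) (uA : unitary_op A).
Hypothesis Anu : forall h v, H1 h -> A (nu1 h v) = nu2 (g * h * g^-1)%g (A v).

Lemma union_stabilizer_conj h : H1 h <-> H2 (g * h * g^-1)%g.
Proof.
have E : (g * h * g^-1)%g @` balls_union B2 = g @` (h @` balls_union B1).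
  by rewrite -gB -!imageM mulgKV.
split=> hh; first by change ((g * h * g^-1)%g @` balls_union B2 = balls_union B2); rewrite E hh gB.
change (h @` balls_union B1 = balls_union B1).
have : g @` (h @` balls_union B1) = g @` balls_union B1 by rewrite -E hh gB.
by move=> eq; apply/seteqP; split; apply: (@image_sub _ _ g); rewrite eq.
Qed.

(** [g] conjugates [H1] to [H2], so left multiplication by [g] is a bijection from the right cosets
    of [H1] to those of [H2]. *)
Lemma transport_coset_sqnorm (F : G -> V1) : (forall h x, H1 h -> F (h * x)%g = nu1 h (F x)) ->
  coset_sqnorm H2 (fun x => A (F (g^-1 * x)%g)) = coset_sqnorm H1 F.
Proof.
move=> FH; have eqv h x : H2 h -> sqnorm (A (F (g^-1 * (h * x))%g)) = sqnorm (A (F (g^-1 * x)%g)).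
  move=> hh; have h1 : H1 (g^-1 * h * g)%g by apply/union_stabilizer_conj; rewrite !mulgA mulgV mul1g mulgK.
  rewrite !(unitary_sqnorm _ uA) -(equivariant_sqnorm hnu1 FH (g^-1 * x)%g h1).
  by congr (sqnorm (F _)); rewrite -!mulgA mulKVg.
pose f (K : set G) : set G := [set (g * k)%g | k in K].
have fE x : f (right_coset H1 x) = right_coset H2 (g * x)%g.
  apply/seteqP; split=> [_ [_ [h hh <-] <-]|_ [h hh <-]].
    exists (g * h * g^-1)%g; first exact/union_stabilizer_conj.
    by rewrite -!mulgA mulKg.
  exists (g^-1 * h * g * x)%g; last by rewrite !mulgA mulgV mul1g.
  by exists (g^-1 * h * g)%g => //; apply/union_stabilizer_conj; rewrite !mulgA mulgV mul1g mulgK.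
rewrite /coset_sqnorm (@reindex_esum _ _ _ (right_cosets H1) _ f).
  apply: eq_esum => _ [x _ <-]; rewrite -/(right_coset H1 x) fE.
  rewrite (sqnorm_right_coset (uH B2) eqv) (sqnorm_right_coset (uH B1) (equivariant_sqnorm hnu1 FH)).
  by rewrite (unitary_sqnorm _ uA) mulKg.
split=> [_ [x _ <-]|K K' _ _ ff|_ [x _ <-]].
- by exists (g * x)%g => //; rewrite -/(right_coset H1 x) fE.
- have fK (M : set G) : [set (g^-1 * k)%g | k in f M] = M.
    apply/seteqP; split=> [_ [_ [k Mk <-] <-]|k Mk]; first by rewrite mulKg.
    by exists (g * k)%g; [exists k|rewrite mulKg].
  by rewrite -(fK K) ff fK.
- exists (right_coset H1 (g^-1 * x)%g); first by exists (g^-1 * x)%g.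
  by rewrite fE mulKVg.
Qed.

Lemma transport_vector w1 : exists w2, Phi2 w2 = fun x => A (Phi1 w1 (g^-1 * x)%g).
Proof.
have FH := induced_equivariant Pr1 w1.
apply: (induced_surj Pr2); split; last by rewrite transport_coset_sqnorm ?Pn1 ?ltry.
move=> h x hh; have h1 : H1 (g^-1 * h * g)%g.
  by apply/union_stabilizer_conj; rewrite !mulgA mulgV mul1g mulgK.
have -> : (g^-1 * (h * x) = (g^-1 * h * g) * (g^-1 * x))%g by rewrite -!mulgA mulKVg.
by rewrite FH// Anu// !mulgA mulgV mul1g mulgK.
Qed.

Lemma transport_isometry : exists T : W1 -> W2, [/\ linear T,
  forall w, sqnorm (T w) = sqnorm w, forall x w, T (rho1 x w) = rho2 x (T w) &
  forall w, Phi2 (T w) = fun x => A (Phi1 w (g^-1 * x)%g)].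
Proof.
have [T TE] := choice transport_vector.
have [Al _ _] := uA; exists T; split=> // [a u v|w|x w].
- apply: (induced_inj Pl2 Pn2); rewrite Pl2 !TE Pl1; apply/funext => x.
  exact: Al.
- apply: EFin_inj; rewrite -Pn2 TE transport_coset_sqnorm ?Pn1//.
  exact: induced_equivariant Pr1 w.
- by apply: (induced_inj Pl2 Pn2); apply/funext => y; rewrite Pt2 !TE Pt1 mulgA.
Qed.
End transport.
End sufficient.

(** [io v] is fixed by the ball stabilizer of [B1], on which [nu1] is trivial; so is its image under
    the intertwiner, and [induced_fixed_contain] applies. *)
Lemma intertwined_contain B1 B2 V1 V2 W1 W2 (nu1 : G -> V1 -> V1) (nu2 : G -> V2 -> V2)
    (rho1 : G -> W1 -> W1) (rho2 : G -> W2 -> W2) (Phi2 : W2 -> G -> V2) (T : W1 -> W2)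
    (io : V1 -> W1) v g :
  ball_rep B1 nu1 -> ball_rep B2 nu2 ->
  range Phi2 = induced_space (union_stabilizer B2) nu2 ->
  (forall w, coset_sqnorm (union_stabilizer B2) (Phi2 w) = (sqnorm w)%:E) ->
  (forall g w x, Phi2 (rho2 g w) x = Phi2 w (x * g)%g) ->
  (forall g w, T (rho1 g w) = rho2 g (T w)) ->
  (forall h v, union_stabilizer B1 h -> rho1 h (io v) = io (nu1 h v)) ->
  Phi2 (T (io v)) g <> 0 ->
  forall y, label_support B2 y -> exists2 x, label_support B1 x &
    label_ball B1 x `<=` g^-1%g @` label_ball B2 y.
Proof.
move=> [_ tr1] [[hnu2 _ _] _] Pr2 Pn2 Pt2 Trho ioH; apply: (induced_fixed_contain hnu2 Pr2 Pn2).
move=> h x hh; rewrite -Pt2 -Trho ioH; last exact: ball_union_stabilizer.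
by rewrite tr1.
Qed.

Section classification.
Variables (B1 B2 : labeled_set L U) (V1 V2 W1 W2 : hilbertType R).
Variables (nu1 : G -> V1 -> V1) (nu2 : G -> V2 -> V2).
Variables (rho1 : G -> W1 -> W1) (rho2 : G -> W2 -> W2).
Local Notation H1 := (union_stabilizer B1).
Local Notation H2 := (union_stabilizer B2).
Hypotheses (br1 : ball_rep B1 nu1) (br2 : ball_rep B2 nu2).
Hypotheses (ind1 : is_induced H1 nu1 rho1) (ind2 : is_induced H2 nu2 rho2).
Let hnu1 : unitary_rep H1 nu1. Proof. by case: br1 => -[]. Qed.
Let hnu2 : unitary_rep H2 nu2. Proof. by case: br2 => -[]. Qed.

Lemma equivalent_of_configuration g : g @` balls_union B1 = balls_union B2 ->
  equivalent_rep H1 nu1 (fun h => nu2 (g * h * g^-1)%g) -> equivalent_rep setT rho1 rho2.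
Proof.
move=> gB [A [uA Anu]]; have [A' [uA' AK A'K]] := unitary_inv uA.
have [Phi1 [Pl1 Pr1 Pn1 Pt1]] := ind1; have [Phi2 [Pl2 Pr2 Pn2 Pt2]] := ind2.
have gB' : g^-1%g @` balls_union B2 = balls_union B1 by apply/esym/imageVP.
have Anu' h v : H2 h -> A' (nu2 h v) = nu1 (g^-1 * h * g^-1^-1)%g (A' v).
  move=> hh; have h1 : H1 (g^-1 * h * g^-1^-1)%g by apply/(union_stabilizer_conj gB').
  by rewrite -{1}[v]A'K -[in RHS](AK (nu1 _ _)) Anu// invgK -!mulgA mulgV mulg1 mulKVg.
have [T [Tl Tn Trho TE]] := transport_isometry hnu1 Pl1 Pr1 Pn1 Pt1 Pl2 Pr2 Pn2 Pt2 gB uA Anu.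
have [T' [_ _ _ TE']] := transport_isometry hnu2 Pl2 Pr2 Pn2 Pt2 Pl1 Pr1 Pn1 Pt1 gB' uA' Anu'.
exists T; split; last by move=> x w _; exact: Trho.
split=> //; last exact: isometry_ip.
apply/seteqP; split=> // w _; exists (T' w) => //.
apply: (induced_inj Pl2 Pn2); rewrite TE; apply/funext => x.
by rewrite TE' A'K invgK mulKVg.
Qed.

Lemma configuration_of_equivalent : equivalent_rep setT rho1 rho2 ->
  exists g : G, g @` balls_union B1 = balls_union B2 /\
    equivalent_rep H1 nu1 (fun h => nu2 (g * h * g^-1)%g).
Proof.
move=> [T [uT Trho0]]; have Trho g w : T (rho1 g w) = rho2 g (T w) by exact: Trho0.
have [S [uS TK SK]] := unitary_inv uT.
have Srho g w : S (rho2 g w) = rho1 g (S w) by rewrite -{1}[w]SK -Trho TK.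
have [Tl _ _] := uT; have [Sl _ _] := uS.
have [Phi1 [Pl1 Pr1 Pn1 Pt1]] := ind1; have [Phi2 [Pl2 Pr2 Pn2 Pt2]] := ind2.
have [_ _ nu11 _ _] := hnu1; have [_ nu2U nu21 _ _] := hnu2.
have [H11 H1M H1V] := uH B1; have [H21 H2M H2V] := uH B2.
have [io [ioE io_sq ioH]] := induced_base (uH B1) hnu1 Pl1 Pr1 Pn1 Pt1.
have [jo [joE jo_sq joH]] := induced_base (uH B2) hnu2 Pl2 Pr2 Pn2 Pt2.
have nz V V' W W' (nu : G -> V -> V) (B : labeled_set L U) (Phi : W -> G -> V') (Q : W' -> W)
    (f : V -> W') : linear Phi -> (forall w, coset_sqnorm (union_stabilizer B) (Phi w) = (sqnorm w)%:E) ->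
    (forall v, sqnorm (Q v) = sqnorm v) -> (forall v, sqnorm (f v) = sqnorm v) ->
    (exists v : V, v <> 0) -> exists v g, Phi (Q (f v)) g <> 0.
  move=> Pl Pn Qn fn [v v0]; exists v; apply: contrapT => no; apply: v0; apply/eqP.
  rewrite -sqnorm_eq0 -fn -Qn sqnorm_eq0; apply/eqP/(induced_inj Pl Pn)/funext => g.
  by rewrite (lin0 Pl); apply: contrapT => ne; apply: no; exists g.
have [v0 [g0 g00]] := nz _ _ _ _ nu1 B2 Phi2 T io Pl2 Pn2 (fun v => unitary_sqnorm v uT) io_sq
  (let: And3 _ h _ := br1.1 in h).
have [v0' [k0 k00]] := nz _ _ _ _ nu2 B1 Phi1 S jo Pl1 Pn1 (fun v => unitary_sqnorm v uS) jo_sq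
  (let: And3 _ h _ := br2.1 in h).
have sub2 := intertwined_contain br2 br1 Pr1 Pn1 Pt1 Srho joH k00.
(* Each [g] in the support of the image of [io v] gives containments in one direction, and [sub2],
   from the inverse intertwiner, those in the other; hence [g] carries one configuration exactly
   onto the other. *)
have key v g : Phi2 (T (io v)) g <> 0 -> g @` balls_union B1 = balls_union B2.
  move=> nz0; have sub1 := intertwined_contain br1 br2 Pr2 Pn2 Pt2 Trho ioH nz0.
  have /imageVP := mutual_containment Lpos LU sub1 sub2.
  by rewrite invgK => ->.
have gB := key _ _ g00.
pose A v := Phi2 (T (io v)) g0.
have iol : linear io.
  move=> a u v; apply: (induced_inj Pl1 Pn1); rewrite Pl1 !ioE; apply/funext => x.
  rewrite /extend_by0 -[RHS]/(a *: (if _ then _ else _) + (if _ then _ else _)).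
  case: asboolP => Hx; last by rewrite scaler0 addr0.
  by case: hnu1 => _ /(_ _ Hx)[nl _ _] _ _ _; exact: nl.
(* The support of [Phi2 (T (io v))] is thus a single coset of [H2], and the value at [g0] carries
   the whole norm. *)
have Asq v : sqnorm (A v) = sqnorm v.
  rewrite -io_sq -(unitary_sqnorm _ uT); apply: EFin_inj; rewrite -Pn2.
  apply/esym/(coset_sqnorm_supp (uH B2)) => [|g' ng].
    by apply: (equivariant_sqnorm hnu2) => h x; exact: (induced_equivariant Pr2).
  apply: contrapT => /key gB'; apply: ng.
  change ((g' * g0^-1)%g @` balls_union B2 = balls_union B2).
  by rewrite -{1}gB -imageM mulgKV.
have Al : linear A by move=> a u v; rewrite /A iol Tl Pl2.
exists g0; split=> //; exists A; split; last first.
  move=> h v hh; rewrite /A -ioH// Trho Pt2 -(induced_equivariant Pr2); first by rewrite mulgKV.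
  exact/(union_stabilizer_conj gB).
split=> //; last exact: isometry_ip.
apply/seteqP; split=> // v2 _.
(* Surjectivity: the function supported on the coset of [g0] with value [v2] there is pulled back by
   [S]. The result is fixed by the ball stabilizer of [B1], hence supported on [H1], and comes from
   a vector of [V1]. *)
have [w2 w2E] : exists w, Phi2 w = extend_by0 H2 nu2 g0 v2.
  by apply: (induced_surj Pr2); case: (extend_by0_in (uH B2) hnu2 g0 v2).
have supp x : Phi1 (S w2) x <> 0 -> H1 x.
  move=> nx; have := @induced_fixed_contain B1 B1 _ _ nu1 Phi1 (S w2) x hnu1 Pr1 Pn1 _ nx.
  have tr h y : ball_stabilizer B1 h -> Phi1 (S w2) (y * h)%g = Phi1 (S w2) y.
    move=> hh; rewrite -Pt1 -Srho; congr (Phi1 (S _) y).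
    apply: (induced_inj Pl2 Pn2); apply/funext => u; rewrite Pt2 w2E /extend_by0.
    have kk : ball_stabilizer B2 (g0 * h * g0^-1)%g by exact: (ball_stabilizer_conj Lpos LU gB).
    have H2k := ball_union_stabilizer kk.
    have uE : (u * h * g0^-1 = u * g0^-1 * (g0 * h * g0^-1))%g by rewrite -!mulgA mulKg.
    rewrite uE; case: asboolP => a; case: asboolP => b //.
    - have [_ _ _ nu2M _] := hnu2; by rewrite (nu2M _ _ b H2k) /= (br2.2 _ kk).
    - by case: b; rewrite -[(u * _)%g](mulgK (g0 * h * g0^-1)%g); apply: H2M => //; exact: H2V.
    - by case: a; exact: H2M.
  move=> /(_ tr) c; have := mutual_containment Lpos LU (k := 1%g) c.
  have c1 y : label_support B1 y -> exists2 z, label_support B1 z &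
      label_ball B1 z `<=` (1%g : G) @` label_ball B1 y by exists y => //; rewrite image1.
  by move=> /(_ c1)/imageVP; rewrite invgK => /esym.
exists (Phi1 (S w2) 1%g) => //; rewrite /A.
suff -> : io (Phi1 (S w2) 1%g) = S w2.
  by rewrite SK w2E /extend_by0 mulgV asboolT// nu21.
apply: (induced_inj Pl1 Pn1); rewrite ioE; apply/funext => x; rewrite /extend_by0 invg1 mulg1.
case: asboolP => Hx; first by rewrite -(induced_equivariant Pr1)// mulg1.
by apply: contrapT => ne; apply: Hx; apply: supp => e; apply: ne; rewrite e.
Qed.

End classification.
End configurations.

(** * Square summable functions *)

Section unordered_sums.
Context {R : realType} {T : choiceType}.
Implicit Types (a b : T -> R) (l : seq T).

(** Convergence along finite subsets of an arbitrary index type, since the square summable functions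
    used later are indexed by subsets of the group. *)
Definition has_sum a (s : R) := forall e : R, 0 < e -> exists l, uniq l /\
  forall l', uniq l' -> {subset l <= l'} -> `|\sum_(t <- l') a t - s| < e.

Definition rsum a : R := xget 0 [set s | has_sum a s].

Lemma has_sum_common a b s s' e : has_sum a s -> has_sum b s' -> 0 < e -> exists l, uniq l /\
  forall l', uniq l' -> {subset l <= l'} ->
    `|\sum_(t <- l') a t - s| < e /\ `|\sum_(t <- l') b t - s'| < e.
Proof.
move=> ha hb e0; have [l [ul hl]] := ha e e0; have [m [um hm]] := hb e e0.
exists (undup (l ++ m)); split=> [|l' ul' sub]; first exact: undup_uniq.
split; [apply: hl|apply: hm] => // t tl; apply: sub.
  by rewrite mem_undup mem_cat tl.
by rewrite mem_undup mem_cat tl orbT.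
Qed.

Lemma eq_near (x y : R) : (forall e, 0 < e -> `|x - y| < e) -> x = y.
Proof.
move=> h; apply/eqP; rewrite -subr_eq0 -normr_le0; apply/ler_addgt0Pl => e e0.
by rewrite addr0 ltW// h.
Qed.

Lemma has_sum_unique a s s' : has_sum a s -> has_sum a s' -> s = s'.
Proof.
move=> ha hb; apply: eq_near => e e0.
have [l [ul hl]] := has_sum_common ha hb (divr_gt0 e0 (ltr0Sn _ 1)).
have [h1 h2] := hl l ul (fun _ => id).
rewrite [e]splitr (le_lt_trans _ (ltrD h2 h1))//; set S := \sum_(t <- l) _.
have -> : s - s' = (S - s') + (s - S) by ring.
by rewrite [`|S - s|]distrC ler_normD.
Qed.

Lemma rsumE a s : has_sum a s -> rsum a = s.
Proof. by move=> h; apply: has_sum_unique (h); exact: (xgetI 0 (h : [set s | has_sum a s] s)). Qed.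

Lemma has_sumD a b s s' : has_sum a s -> has_sum b s' -> has_sum (fun t => a t + b t) (s + s').
Proof.
move=> ha hb e e0; have [l [ul hl]] := has_sum_common ha hb (divr_gt0 e0 (ltr0Sn _ 1)).
exists l; split=> // l' ul' sub; have [h1 h2] := hl l' ul' sub.
rewrite big_split /= opprD addrACA [e]splitr (le_lt_trans (ler_normD _ _))//.
exact: ltrD.
Qed.

Lemma has_sumZ (k : R) a s : has_sum a s -> has_sum (fun t => k * a t) (k * s).
Proof.
move=> ha e e0; have [l [ul hl]] := ha (e / (`|k| + 1)) (divr_gt0 e0 (ltr_wpDl (normr_ge0 _) ltr01)).
exists l; split=> // l' ul' sub; have := hl l' ul' sub.
rewrite -mulr_sumr -mulrBr normrM ltr_pdivlMr ?ltr_wpDl// => h.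
by apply: le_lt_trans h; rewrite [leRHS]mulrDr mulr1 mulrC lerDl.
Qed.

Lemma sum_subset a l l' : (forall t, 0 <= a t) -> uniq l -> uniq l' -> {subset l <= l'} ->
  \sum_(t <- l) a t <= \sum_(t <- l') a t.
Proof.
move=> a0 ul ul' sub; rewrite [leRHS](bigID (mem l))/=.
have p : perm_eq [seq t <- l' | t \in l] l.
  apply: uniq_perm; rewrite ?filter_uniq// => t; rewrite mem_filter /=.
  by apply/andP/idP => [[]|tl]; last by rewrite tl sub.
by rewrite -[X in X + _]big_filter (perm_big _ p) lerDl sumr_ge0.
Qed.

Lemma has_sum_nneg a (M : R) : (forall t, 0 <= a t) ->
  (forall l, uniq l -> \sum_(t <- l) a t <= M) -> exists s, has_sum a s.
Proof.
move=> a0 aM; pose E := [set s : R | exists2 l, uniq l & s = \sum_(t <- l) a t].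
have hE : has_sup E.
  split; first by exists 0, [::]; rewrite ?big_nil.
  by exists M => _ [l ul ->]; exact: aM.
exists (sup E) => e e0; have [_ [l ul ->] hl] := sup_adherent e0 hE.
exists l; split=> // l' ul' sub.
have le1 := sum_subset a0 ul ul' sub.
have le2 : \sum_(t <- l') a t <= sup E by apply: ub_le_sup; [case: hE|exists l'].
by rewrite distrC ger0_norm ?subr_ge0// ltrBlDr -ltrBlDl (lt_le_trans hl).
Qed.

Lemma has_sum_abs a (M : R) : (forall l, uniq l -> \sum_(t <- l) `|a t| <= M) ->
  exists s, has_sum a s.
Proof.
(* With [k = 1] and [k = -1] these are the positive and negative parts of [a]. *)
move=> aM; have part (k : R) : `|k| = 1 -> exists s, has_sum (fun t => (`|a t| + k * a t) / 2) s.
  move=> k1; apply: (@has_sum_nneg _ M) => [t|l ul].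
    rewrite divr_ge0// -[X in X + _]mul1r -k1 -normrM -lerBlDr add0r.
    by rewrite -normrN ler_norm.
  apply: le_trans (aM l ul); apply: ler_sum => t _.
  rewrite ler_pdivrMr// [leRHS]mulr_natr mulr2n lerD2l.
  by rewrite -[leRHS]mul1r -k1 -normrM ler_norm.
have [p hp] := part 1 (normr1 _); have [|q hq] := part (-1); first by rewrite normrN normr1.
exists (p + -1 * q).
suff -> : a = fun t => (`|a t| + 1 * a t) / 2 + -1 * ((`|a t| + -1 * a t) / 2).
  by apply: has_sumD => //; exact: has_sumZ.
by apply/funext => t; field.
Qed.

Lemma has_sum_le a s (M : R) : has_sum a s -> (forall l, uniq l -> \sum_(t <- l) a t <= M) -> s <= M.
Proof.
move=> ha aM; apply/ler_addgt0Pr => e e0; have [l [ul /(_ l ul (fun _ => id))]] := ha e e0.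
rewrite distrC ltr_distlC => /andP[h _].
by rewrite -lerBlDr (le_trans (ltW h)) ?aM.
Qed.

Lemma has_sum_ge a s l : (forall t, 0 <= a t) -> has_sum a s -> uniq l -> \sum_(t <- l) a t <= s.
Proof.
move=> a0 ha ul; apply/ler_addgt0Pr => e e0; have [m [um hm]] := ha e e0.
have sub : {subset m <= undup (l ++ m)}.
  by move=> t tm; rewrite mem_undup mem_cat tm orbT.
have := hm _ (undup_uniq _) sub; rewrite ltr_distl => /andP[_ h]; apply: le_trans (ltW h).
apply: sum_subset => //; first exact: undup_uniq.
by move=> t tl; rewrite mem_undup mem_cat tl.
Qed.

Lemma has_sum_single a t0 : (forall t, t != t0 -> a t = 0) -> has_sum a (a t0).
Proof.
move=> az e e0; exists [:: t0]; split=> // l ul sub.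
rewrite (big_rem t0) ?sub ?mem_head//= big_seq big1 ?addr0 ?subrr ?normr0// => t.
by rewrite mem_rem_uniq// inE => /andP[? _]; exact: az.
Qed.

Lemma has_sum_perm a s (f f' : T -> T) : cancel f f' -> cancel f' f ->
  has_sum a s -> has_sum (a \o f) s.
Proof.
move=> fK f'K ha e e0; have [l [ul hl]] := ha e e0.
exists (map f' l); split=> [|l' ul' sub]; first by rewrite map_inj_uniq//; exact: can_inj f'K.
have -> : \sum_(t <- l') (a \o f) t = \sum_(t <- map f l') a t by rewrite big_map.
apply: hl; first by rewrite map_inj_uniq//; exact: can_inj fK.
by move=> t tl; rewrite -[t]f'K map_f// sub// map_f.
Qed.

End unordered_sums.

Lemma real_cauchy_lim {R : realType} (u : nat -> R) :
  (forall e : R, 0 < e -> exists N, forall m n, (N <= m)%N -> (N <= n)%N -> `|u m - u n| < e) ->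
  exists v, forall e : R, 0 < e -> exists N, forall n, (N <= n)%N -> `|u n - v| < e.
Proof.
move=> h; have : cauchy (u @ \oo).
  apply/cauchy_ballP => e /= e0; rewrite near_simpl; have [N hN] := h _ e0.
  exists ([set n | (N <= n)%N], [set n | (N <= n)%N]); first by split; exists N.
  by move=> [m n] /= [hm hn']; rewrite -ball_normE; exact: hN.
move=> /cauchy_cvg /cvg_ex[v /= uv]; exists v => e e0.
by move/cvgrPdist_lt: uv => /(_ e e0)[N _ hN]; exists N => n Nn; rewrite distrC; exact: hN.
Qed.

Lemma sqr_lt_norm {R : realType} (x e : R) : 0 <= e -> (x ^+ 2 < e ^+ 2) = (`|x| < e).
Proof. by move=> e0; rewrite -[x ^+ 2]real_normK ?num_real// ltr_sqr ?nnegrE. Qed.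

Section square_summable.
Context {R : realType} (T : choiceType).
Local Notation C := R[i].
Local Notation A := (T -> C^o).
Implicit Types (f g u v : A).

Definition csq (c : C) : R := complex.Re c ^+ 2 + complex.Im c ^+ 2.

Lemma csq_ge0 c : 0 <= csq c. Proof. by rewrite addr_ge0 ?sqr_ge0. Qed.

Lemma csqD c d : csq (c + d) <= 2 * csq c + 2 * csq d.
Proof.
case: c d => a b [a' b']; rewrite /csq /= -subr_ge0.
have -> : 2 * (a ^+ 2 + b ^+ 2) + 2 * (a' ^+ 2 + b' ^+ 2) - ((a + a') ^+ 2 + (b + b') ^+ 2) =
  (a - a') ^+ 2 + (b - b') ^+ 2 by ring.
by rewrite addr_ge0 ?sqr_ge0.
Qed.

Lemma csqM (c d : C) : csq (c * d) = csq c * csq d.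
Proof. by case: c d => a b [a' b']; rewrite /csq /=; ring. Qed.

Lemma csqN c : csq (- c) = csq c.
Proof. by case: c => a b; rewrite /csq /= !sqrrN. Qed.

Definition l2_mem : set A := [set f | exists M, forall l, uniq l -> \sum_(t <- l) csq (f t) <= M].
Definition l2_ip f g : C :=
  (rsum (fun t => complex.Re (f t * (g t)^*%C)) +i* rsum (fun t => complex.Im (f t * (g t)^*%C)))%C.

Lemma l2_sum f g : l2_mem f -> l2_mem g ->
  has_sum (fun t => complex.Re (f t * (g t)^*%C)) (complex.Re (l2_ip f g)) /\
  has_sum (fun t => complex.Im (f t * (g t)^*%C)) (complex.Im (l2_ip f g)).
Proof.
move=> [M fM] [N gN].
have bnd c d : `|complex.Re (c * d^*%C)| <= csq c + csq d /\ `|complex.Im (c * d^*%C)| <= csq c + csq d.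
  case: c d => a b [a' b']; rewrite /csq /=.
  have h x y x' y' : `|x * x' + y * y'| <= x ^+ 2 + y ^+ 2 + (x' ^+ 2 + y' ^+ 2) :> R.
    rewrite ler_norml; apply/andP; split.
      rewrite -subr_ge0; have -> : x * x' + y * y' - - (x ^+ 2 + y ^+ 2 + (x' ^+ 2 + y' ^+ 2)) =
        ((x + x') ^+ 2 + (y + y') ^+ 2 + x ^+ 2 + y ^+ 2 + x' ^+ 2 + y' ^+ 2) / 2 by field.
      by rewrite divr_ge0// !addr_ge0 ?sqr_ge0.
    rewrite -subr_ge0; have -> : x ^+ 2 + y ^+ 2 + (x' ^+ 2 + y' ^+ 2) - (x * x' + y * y') =
      ((x - x') ^+ 2 + (y - y') ^+ 2 + x ^+ 2 + y ^+ 2 + x' ^+ 2 + y' ^+ 2) / 2 by field.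
    by rewrite divr_ge0// !addr_ge0 ?sqr_ge0.
  split; first by have := h a b a' b'; rewrite mulrN opprK.
  by have := h a b (- b') a'; rewrite sqrrN [b' ^+ 2 + _]addrC.
have ex (p : C -> R) : (forall c d, `|p (c * d^*%C)| <= csq c + csq d) ->
    has_sum (fun t => p (f t * (g t)^*%C)) (rsum (fun t => p (f t * (g t)^*%C))).
  move=> hp; have [|s hs] := @has_sum_abs _ _ (fun t => p (f t * (g t)^*%C)) (M + N).
    move=> l ul; apply: le_trans (lerD (fM l ul) (gN l ul)).
    by rewrite -big_split; apply: ler_sum => t _; exact: hp.
  by rewrite (rsumE hs).
by split; apply: ex => c d; case: (bnd c d).
Qed.

Lemma l2_ip_self f : l2_mem f -> has_sum (fun t => csq (f t)) (complex.Re (l2_ip f f)).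
Proof.
move=> hf; have [+ _] := l2_sum hf hf; congr has_sum; apply/funext => t.
by case: (f t) => a b; rewrite /csq /=; ring.
Qed.

Lemma l2_mem0 : l2_mem 0.
Proof. by exists 0 => l _; rewrite big1// => t _; rewrite /csq /= expr0n /= addr0. Qed.

Lemma l2_memD a u v : l2_mem u -> l2_mem v -> l2_mem (a *: u + v).
Proof.
move=> [M uM] [N vN]; exists (2 * (csq a * M) + 2 * N) => l ul.
apply: le_trans (lerD (ler_wpM2l _ (ler_wpM2l (csq_ge0 a) (uM l ul))) (ler_wpM2l _ (vN l ul))) => //.
rewrite !mulr_sumr -big_split; apply: ler_sum => t _.
by apply: le_trans (csqD _ _) _; rewrite -csqM.
Qed.

Lemma l2_ipl a u v w : l2_mem u -> l2_mem v -> l2_mem w ->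
  l2_ip (a *: u + v) w = a * l2_ip u w + l2_ip v w.
Proof.
move=> hu hv hw; have [h1 h2] := l2_sum (l2_memD a hu hv) hw.
have [u1 u2] := l2_sum hu hw; have [v1 v2] := l2_sum hv hw.
have e1 := has_sumD (has_sumD (has_sumZ (complex.Re a) u1) (has_sumZ (- complex.Im a) u2)) v1.
have e2 := has_sumD (has_sumD (has_sumZ (complex.Re a) u2) (has_sumZ (complex.Im a) u1)) v2.
have reE (c d d' : C) : complex.Re (c * d + d') =
    complex.Re c * complex.Re d + - complex.Im c * complex.Im d + complex.Re d'.
  by case: c d d' => [? ?] [? ?] [? ?] /=; ring.
have imE (c d d' : C) : complex.Im (c * d + d') =
    complex.Re c * complex.Im d + complex.Im c * complex.Re d + complex.Im d'.
  by case: c d d' => [? ?] [? ?] [? ?] /=; ring.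
have tE t : (a *: u + v) t * (w t)^*%C = a * (u t * (w t)^*%C) + v t * (w t)^*%C.
  by rewrite mulrA -mulrDl.
have E1 : complex.Re (l2_ip (a *: u + v) w) = complex.Re (a * l2_ip u w + l2_ip v w).
  rewrite reE; apply: (has_sum_unique h1); move: e1; congr has_sum.
  by apply/funext => t; rewrite tE reE.
have E2 : complex.Im (l2_ip (a *: u + v) w) = complex.Im (a * l2_ip u w + l2_ip v w).
  rewrite imE; apply: (has_sum_unique h2); move: e2; congr has_sum.
  by apply/funext => t; rewrite tE imE.
by apply/eqP; rewrite eq_complex E1 E2 !eqxx.
Qed.

Lemma l2_ipC u v : l2_mem u -> l2_mem v -> l2_ip u v = (l2_ip v u)^*%C.
Proof.
move=> hu hv; have [h1 h2] := l2_sum hu hv; have [k1 k2] := l2_sum hv hu.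
have E1 : complex.Re (l2_ip u v) = complex.Re (l2_ip v u).
  apply: (has_sum_unique h1); move: k1; congr has_sum; apply/funext => t.
  by case: (u t) (v t) => [? ?] [? ?] /=; ring.
have E2 : complex.Im (l2_ip u v) = - complex.Im (l2_ip v u).
  apply: (has_sum_unique h2); rewrite -mulN1r; move: (has_sumZ (-1) k2).
  congr has_sum; apply/funext => t; by case: (u t) (v t) => [? ?] [? ?] /=; ring.
by apply/eqP; rewrite eq_complex; case: (l2_ip v u) E1 E2 => a b /= -> ->; rewrite !eqxx.
Qed.

Lemma l2_ge u t : l2_mem u -> csq (u t) <= complex.Re (l2_ip u u).
Proof.
move=> hu; have := has_sum_ge (l := [:: t]) (fun t => csq_ge0 (u t)) (l2_ip_self hu) isT.
by rewrite big_seq1.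
Qed.

Lemma l2_pos u : l2_mem u -> u <> 0 -> 0 < complex.Re (l2_ip u u).
Proof.
move=> hu u0; rewrite ltNge; apply/negP => le0; apply: u0; apply/funext => t.
have := le_trans (l2_ge t hu) le0; rewrite /csq /=.
rewrite le_eqVlt ltNge addr_ge0 ?sqr_ge0// orbF paddr_eq0 ?sqr_ge0// !sqrf_eq0.
by case: (u t) => a b /= /andP[/eqP -> /eqP ->].
Qed.

(** The limit is pointwise; the norm estimate holds on every finite set of indices with a bound
    independent of the set, which is what [l2_mem] and [has_sum_le] ask for. *)
Lemma l2_complete (u : nat -> A) : (forall n, l2_mem (u n)) ->
  (forall e : R, 0 < e -> exists N, forall m n, (N <= m)%N -> (N <= n)%N ->
     complex.Re (l2_ip (u m - u n) (u m - u n)) < e) ->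
  exists2 v, l2_mem v & forall e : R, 0 < e -> exists N, forall n, (N <= n)%N ->
     complex.Re (l2_ip (u n - v) (u n - v)) < e.
Proof.
move=> hu cau.
have memB f g : l2_mem f -> l2_mem g -> l2_mem (f - g).
  by move=> hf hg; rewrite -scaleN1r addrC; exact: l2_memD.
have lim (p : C -> R) : (forall c d, p (c - d) = p c - p d) -> (forall c, p c ^+ 2 <= csq c) ->
    forall t, exists y : R, forall e : R, 0 < e -> exists N, forall n, (N <= n)%N -> `|p (u n t) - y| < e.
  move=> pB pq t; apply: real_cauchy_lim => e e0; have [N hN] := cau (e ^+ 2) (exprn_gt0 2 e0).
  exists N => m n Nm Nn; rewrite -pB -(sqr_lt_norm _ (ltW e0)).
  exact: le_lt_trans (pq _) (le_lt_trans (l2_ge t (memB _ _ (hu m) (hu n))) (hN m n Nm Nn)).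
have [||a ha] := choice (lim (@complex.Re R) _ _).
- by move=> [? ?] [? ?].
- by move=> c; rewrite lerDl sqr_ge0.
have [||b hb] := choice (lim (@complex.Im R) _ _).
- by move=> [? ?] [? ?].
- by move=> c; rewrite lerDr sqr_ge0.
pose v : A := fun t => (a t +i* b t)%C.
have ptw t (e : R) : 0 < e -> exists N, forall n, (N <= n)%N -> csq (u n t - v t) < e.
  move=> e0; have d0 : 0 < Num.sqrt (e / 2) by rewrite sqrtr_gt0 divr_gt0.
  have [N1 h1] := ha t _ d0; have [N2 h2] := hb t _ d0; exists (maxn N1 N2) => n.
  rewrite geq_max => /andP[/h1 + /h2]; rewrite -!sqr_lt_norm ?sqrtr_ge0//.
  rewrite sqr_sqrtr ?divr_ge0 ?ltW// => r1 r2.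
  by rewrite /csq; case: (u n t) r1 r2 => x y /= r1 r2; rewrite [e]splitr ltrD.
have ptws l (e : R) : 0 < e -> exists N, forall n, (N <= n)%N -> \sum_(t <- l) csq (u n t - v t) < e.
  elim: l e => [|t l IH] e e0; first by exists 0%N => n _; rewrite big_nil.
  have [N1 h1] := IH _ (divr_gt0 e0 (ltr0Sn _ 1)); have [N2 h2] := ptw t _ (divr_gt0 e0 (ltr0Sn _ 1)).
  exists (maxn N1 N2) => n; rewrite geq_max => /andP[/h1 r1 /h2 r2].
  by rewrite big_cons [e]splitr ltrD.
have est (e : R) : 0 < e -> exists N, forall n, (N <= n)%N -> forall l, uniq l ->
    \sum_(t <- l) csq (u n t - v t) <= e.
  move=> e0; have e4 : 0 < e / 2 / 2 by rewrite !divr_gt0.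
  have [N hN] := cau _ e4; exists N => n Nn l ul.
  (* [m] depends on the finite set [l], but the resulting bound does not. *)
  have [M hM] := ptws l _ e4; pose m := maxn M N.
  have r1 := hM m (leq_maxl _ _).
  have r2 := has_sum_ge (fun t => csq_ge0 ((u n - u m) t)) (l2_ip_self (memB _ _ (hu n) (hu m))) ul.
  have r3 := hN n m Nn (leq_maxr _ _).
  have -> : e = 2 * (e / 2 / 2) + 2 * (e / 2 / 2) by field.
  apply: le_trans (lerD (ler_wpM2l _ (ltW (le_lt_trans r2 r3))) (ler_wpM2l _ (ltW r1))) => //.
  rewrite !mulr_sumr -big_split; apply: ler_sum => t _ /=.
  apply: le_trans (csqD _ _); rewrite -[(u n - u m) t]/(u n t - u m t).
  by rewrite addrA subrK.
have mv : l2_mem v.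
  have [N /(_ N (leqnn _)) hN] := est 1 ltr01; have [M hM] := hu N.
  exists (2 * M + 2 * 1) => l ul; apply: le_trans (lerD (ler_wpM2l _ (hM l ul)) (ler_wpM2l _ (hN l ul))) => //.
  rewrite !mulr_sumr -big_split; apply: ler_sum => t _ /=.
  by rewrite -[csq (u N t - v t)]csqN; apply: le_trans (csqD _ _); rewrite opprB addrCA subrr addr0.
exists v => // e e0; have [N hN] := est _ (divr_gt0 e0 (ltr0Sn _ 1)); exists N => n Nn.
apply: (@le_lt_trans _ _ (e / 2)); last by rewrite ltr_pdivrMr// ltr_pMr// ltr1n.
exact: has_sum_le (l2_ip_self (memB _ _ (hu n) mv)) (hN n Nn).
Qed.

Definition l2_data : hilbert_data := HilbertData l2_mem0 l2_memD l2_ipl l2_ipC l2_pos l2_complete.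
Definition l2 : hilbertType R := hilbert_of l2_data.
Definition l2val (f : l2) : A := hval f.

Lemma delta_mem t : l2_mem (fun t' => (t' == t)%:R).
Proof.
exists 1 => l ul; case: (boolP (t \in l)) => tl; last first.
  rewrite big_seq big1// => t' t'l; case: eqP => [e|_]; first by rewrite -e t'l in tl.
  by rewrite /csq /= expr0n /= addr0.
rewrite (big_rem t)//= eqxx big_seq big1 ?addr0 => [|t']; first by rewrite /csq /= expr1n expr0n /= addr0.
rewrite mem_rem_uniq// inE => /andP[/negPf -> _].
by rewrite /csq /= expr0n /= addr0.
Qed.

Definition delta t : l2 := @HSpace R l2_data _ (delta_mem t).

Lemma l2_ext (f g : l2) : (forall t, l2val f t = l2val g t) -> f = g.
Proof. by move=> h; apply: hval_inj; exact/funext. Qed.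

Lemma l2valD (a : C) (f g : l2) t : l2val (a *: f + g) t = a * l2val f t + l2val g t.
Proof. by []. Qed.

Lemma ip_delta (f : l2) t : ip f (delta t) = l2val f t.
Proof.
have [h1 h2] := l2_sum (hvalP f) (delta_mem t).
have E (p : C -> R) : p 0 = 0 -> forall s, has_sum (fun t' => p (hval f t' * ((t' == t)%:R)^*%C)) s ->
    s = p (hval f t).
  move=> p0 s hs; apply: (has_sum_unique hs).
  have -> : p (hval f t) = p (hval f t * ((t == t)%:R)^*%C) by rewrite eqxx conjc1 mulr1.
  apply: (@has_sum_single _ _ (fun t' => p (hval f t' * ((t' == t)%:R)^*%C))) => t' /negPf ->.
  by rewrite conjc0 mulr0.
by apply/eqP; rewrite eq_complex -(E _ _ _ h1)// -(E _ _ _ h2)// !eqxx.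
Qed.

Section permutation.
Variables (s s' : T -> T).
Hypotheses (sK : cancel s s') (s'K : cancel s' s).

Lemma l2_perm_mem (f : l2) : l2_mem (l2val f \o s).
Proof.
have [M hM] := hvalP f; exists M => l ul.
have -> : \sum_(t <- l) csq ((l2val f \o s) t) = \sum_(t <- map s l) csq (hval f t) by rewrite big_map.
by apply: hM; rewrite map_inj_uniq//; exact: can_inj sK.
Qed.

Definition l2_perm (f : l2) : l2 := @HSpace R l2_data _ (l2_perm_mem f).

Lemma l2_perm_ip (f g : l2) : ip (l2_perm f) (l2_perm g) = ip f g.
Proof.
have [h1 h2] := l2_sum (hvalP f) (hvalP g).
have [k1 k2] := l2_sum (l2_perm_mem f) (l2_perm_mem g).
apply/eqP; rewrite eq_complex; apply/andP; split; apply/eqP.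
  exact: (has_sum_unique k1 (has_sum_perm sK s'K h1)).
exact: (has_sum_unique k2 (has_sum_perm sK s'K h2)).
Qed.

End permutation.
End square_summable.

(** * Cyclic representations *)

Section total_sequences.
Context {R : realType} {V : hilbertType R} (s : nat -> V).
Local Notation C := R[i].
Local Notation "a %:C" := (real_complex_def (Phant _) a) : ring_scope.

Lemma lspan_subspace : linear_subspace (lspan s).
Proof.
split=> [|a u v]; first by exists 0%N, (fun=> 0); rewrite big_ord0.
have widen n (c : nat -> C) N : (n <= N)%N ->
    \sum_(i < n) c i *: s i = \sum_(i < N) (if (i < n)%N then c i else 0) *: s i.
  move=> nN; rewrite (big_ord_widen N (fun i => c i *: s i) nN) big_mkcond /=.
  by apply: eq_bigr => i _; case: ifP => // _; rewrite scale0r.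
move=> [n [c ->]] [m [c' ->]]; exists (maxn n m).
exists (fun i => a * (if (i < n)%N then c i else 0) + (if (i < m)%N then c' i else 0)).
rewrite (widen n c _ (leq_maxl n m)) (widen m c' _ (leq_maxr n m)) scaler_sumr -big_split.
by apply: eq_bigr => i _; rewrite scalerDl scalerA.
Qed.

Lemma lspan_in n : lspan s (s n).
Proof.
exists n.+1, (fun i => (i == n)%:R).
rewrite big_ord_recr /= eqxx scale1r big1 ?add0r// => i _.
by rewrite ltn_eqF// scale0r.
Qed.

(** Coefficients in Q(i), so that countably many combinations are dense; they give separability, and
    later the measurability of norms of sections. *)
Definition rational_comb (l : seq (rat * rat * nat)) : V :=
  \sum_(t <- l) (ratr t.1.1 +i* ratr t.1.2)%C *: s t.2.

Lemma rational_approx (c : C) (v : V) (e : R) : 0 < e ->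
  exists p q : rat, hn (c *: v - (ratr p +i* ratr q)%C *: v) < e.
Proof.
move=> e0; pose k := e / (2 * (hn v + 1)).
have h0 : 0 < 2 * (hn v + 1) by rewrite mulr_gt0// ltr_wpDl// hn_ge0.
have k0 : 0 < k by rewrite divr_gt0.
have ap (x : R) : exists p : rat, `|x - ratr p| < k.
  have [|p] := @rat_in_itvoo R x (x + k); first by rewrite ltrDl.
  by rewrite in_itv /= => /andP[h1 h2]; exists p; rewrite ltr_norml; apply/andP; split; lra.
have [p hp] := ap (complex.Re c); have [q hq] := ap (complex.Im c); exists p, q.
rewrite -scalerBl hnZ; have : cmod (c - (ratr p +i* ratr q)%C) <= 2 * k.
  rewrite -[2 * k]ger0_norm; last by rewrite mulr_ge0 ?ltW.
  rewrite -sqrtr_sqr ler_wsqrtr//; case: c hp hq => a b /=; rewrite !ltr_norml.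
  by move=> /andP[? ?] /andP[? ?]; nra.
move=> h; apply: le_lt_trans (ler_wpM2r (hn_ge0 v) h) _.
by rewrite /k mulrA -mulf_div divff// mul1r mulrAC ltr_pdivrMr ?ltr_wpDl ?hn_ge0// ltr_pM2l// ltrDl.
Qed.

Hypothesis tot : forall A : set V, closed_subspace A -> (forall n, A (s n)) -> forall v, A v.

Lemma lspan_dense v (e : R) : 0 < e -> exists2 u, lspan s u & hn (v - u) < e.
Proof.
move=> e0; have := tot (closure_subspace lspan_subspace) _ v; apply=> // n d d0.
by exists (s n); [exact: lspan_in|rewrite subrr hn0].
Qed.

Lemma lspan_closure : closure (lspan s) = setT.
Proof.
apply/seteqP; split=> // v _ A /nbhs_hn[e e0 eA].
by have [u us vu] := lspan_dense v e0; exists u; split=> //; exact: eA.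
Qed.

Lemma rational_comb_dense v (e : R) : 0 < e -> exists l, hn (v - rational_comb l) < e.
Proof.
move=> e0; have e2 : 0 < e / 2 by rewrite divr_gt0.
have [_ [n [c ->]] vu] := lspan_dense v e2.
suff [l hl] : exists l, hn (\sum_(i < n) c i *: s i - rational_comb l) < e / 2.
  by exists l; apply: le_lt_trans (hn_tri _ _ _) _; rewrite [e]splitr; exact: ltrD vu hl.
elim: n {vu e0} (e / 2) e2 => [|n IH] d d0.
  by exists [::]; rewrite /rational_comb big_ord0 big_nil subrr hn0.
have [l hl] := IH _ (divr_gt0 d0 (ltr0Sn _ 1)).
have [p [q hpq]] := rational_approx (c n) (s n) (divr_gt0 d0 (ltr0Sn _ 1)).
exists ((p, q, n) :: l); rewrite /rational_comb big_cons big_ord_recr /= addrC opprD addrACA.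
by rewrite (le_lt_trans (hnD _ _))// [d]splitr ltrD.
Qed.

Lemma total_separable : separable_space V.
Proof.
apply: (@separable_hn _ _ (fun n => if unpickle n is Some l then rational_comb l else 0)) => v e e0.
by have [l hl] := rational_comb_dense v e0; exists (pickle l); rewrite pickleK.
Qed.

End total_sequences.

Section cyclic_representations.
Context {R : realType} {G : topologicalGroupType} {E : hilbertType R}.
Local Notation C := R[i].

(** A unitary action without continuity or separability, as on l^2 of the subsets of [G]; suitable
    cyclic subspaces regain both ([cyclic_unitary]). *)
Definition isometric_action (lam : G -> E -> E) : Prop :=
  [/\ forall g, linear (lam g), forall g u v, ip (lam g u) (lam g v) = ip u v,
      forall v, lam 1%g v = v & forall g h v, lam (g * h)%g v = lam g (lam h v)].

Context {lam : G -> E -> E} (hlam : isometric_action lam) (eps : E).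
Let lam_lin g : linear (lam g). Proof. by case: hlam. Qed.
Let lam_ip g u v : ip (lam g u) (lam g v) = ip u v. Proof. by case: hlam. Qed.
Let lam1 v : lam 1%g v = v. Proof. by case: hlam. Qed.
Let lamM g h v : lam (g * h)%g v = lam g (lam h v). Proof. by case: hlam. Qed.
Let lam_hn g v : hn (lam g v) = hn v. Proof. by rewrite /hn /sqnorm lam_ip. Qed.
Let lamK g v : lam g (lam g^-1%g v) = v. Proof. by rewrite -lamM mulgV lam1. Qed.

Definition cyclic_space : set E :=
  [set v | forall A, closed_subspace A -> (forall g, A (lam g eps)) -> A v].

Lemma cyclic_closed : closed_subspace cyclic_space.
Proof.
split=> [|]; last split=> [A hA _|a u v hu hv A hA Ag]; [|exact: subspace0 hA.2|].
  apply/closed_hn => v h A hA Ag; have /closed_hn cA := hA.1; apply: cA => e e0.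
  by have [s hs vs] := h e e0; exists s => //; exact: (hs A).
by apply: hA.2.2; [exact: hu|exact: hv].
Qed.

Lemma cyclic_in g : cyclic_space (lam g eps).
Proof. by move=> A _. Qed.

Lemma cyclic_invariant g v : cyclic_space v -> cyclic_space (lam g v).
Proof.
move=> hv A hA Ag; apply: (hv [set v | A (lam g v)]).
  by apply: closed_subspace_contraction => // u; rewrite lam_hn.
by move=> h /=; rewrite -lamM.
Qed.

Definition cyclic_hilbert : hilbertType R := sub_hilbert cyclic_closed.
Local Notation K := cyclic_hilbert.
Definition cyclic_rep (g : G) (v : K) : K := subproj cyclic_closed (lam g (subval v)).
Definition cyclic_vector : K := subproj cyclic_closed eps.

Lemma cyclic_repE g v : subval (cyclic_rep g v) = lam g (subval v).
Proof. by rewrite /cyclic_rep subprojK (hproj_id cyclic_closed)//; exact: (cyclic_invariant g (subval_in v)). Qed.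

Lemma cyclic_vectorE : subval cyclic_vector = eps.
Proof. by rewrite subprojK (hproj_id cyclic_closed)// -[eps]lam1; exact: (cyclic_in 1%g). Qed.

Lemma cyclic_total (A : set K) : closed_subspace A ->
  (forall g, A (cyclic_rep g cyclic_vector)) -> forall v, A v.
Proof.
move=> hA Ag v; suff : A (subproj cyclic_closed (subval v)) by rewrite subvalK.
apply: (subval_in v [set u | A (subproj cyclic_closed u)]).
  apply: closed_subspace_contraction => //; first exact: subproj_linear.
  exact: subproj_hn.
by move=> g; have := Ag g; rewrite /cyclic_rep cyclic_vectorE.
Qed.

Section representation.
Variable (D : nat -> G).
Hypothesis epsD : forall g, exists k, lam g eps = lam (D k) eps.
Hypothesis eps_open : nbhs 1%g [set g | lam g eps = eps].

Lemma cyclic_total_seq (A : set K) : closed_subspace A ->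
  (forall n, A (cyclic_rep (D n) cyclic_vector)) -> forall v, A v.
Proof.
move=> hA An; apply: cyclic_total => // g; have [k gk] := epsD g.
by rewrite /cyclic_rep cyclic_vectorE gk -cyclic_vectorE; exact: An.
Qed.

(** The orbit of [eps] is countable by [epsD], whence separability; the stabilizer of [eps] is open,
    whence continuity at orbit vectors, which extends to their closed span. *)
Lemma cyclic_unitary : unitary_rep setT cyclic_rep.
Proof.
split.
- exact: total_separable cyclic_total_seq.
- move=> g _; split=> [a u v||u v].
  + by apply: subval_inj; rewrite subval_linear !cyclic_repE -lam_lin subval_linear.
  + apply/seteqP; split=> // v _; exists (cyclic_rep g^-1%g v) => //.
    by apply: subval_inj; rewrite !cyclic_repE lamK.
  + by rewrite -[LHS]subval_ip !cyclic_repE lam_ip.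
- by apply/funext => v; apply: subval_inj; rewrite cyclic_repE lam1.
- by move=> g h _ _; apply/funext => v; apply: subval_inj; rewrite /comp !cyclic_repE lamM.
move=> v; apply: continuous_subspaceT => g A /nbhs_hn[e e0 eA].
have near1 u : cyclic_space u -> forall d : R, 0 < d -> nbhs 1%g [set h | hn (u - lam h u) < d].
  move=> hu; apply: (hu [set u | forall d : R, 0 < d -> nbhs 1%g [set h | hn (u - lam h u) < d]]) => [|h d d0]; last first.
    have c : (fun x => (h^-1 * x * h)%g) @ 1%g --> (1%g : G).
      rewrite -[X in _ --> X](mulVg h) -[X in (X * h)%g]mulg1 => B.
      move=> /(@mulg_continuous G ((h^-1 * 1)%g, h))[[A1 A2] /= [n1 n2] sub].
      have := @mulg_continuous G (h^-1%g, 1%g) A1 n1 => -[[B1 B2] /= [m1 m2] sub'].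
      apply: filterS m2 => x B2x; apply: (sub ((h^-1 * x)%g, h)); split=> /=.
        by apply: (sub' (h^-1%g, x)); split=> //; exact: nbhs_singleton.
      exact: nbhs_singleton.
    have hb : nbhs (1%g : G) [set x | lam (h^-1 * x * h)%g eps = eps] := c _ eps_open.
    apply: filterS hb => x /= hx.
    have -> : lam x (lam h eps) = lam h eps; last by rewrite subrr hn0.
    by rewrite -{2}hx -!lamM !mulgA mulgV mul1g.
  split=> [|]; last split=> [d d0|a v1 v2 h1 h2 d d0].
  - apply/closed_hn => w hw d d0; have d4 : 0 < d / 4 by rewrite divr_gt0.
    have [w' hw' ww'] := hw _ d4; apply: filterS (hw' _ d4) => h /= hh.
    have := hn_tri w w' (lam h w); have := hn_tri w' (lam h w') (lam h w).
    by rewrite -(linB (lam_lin h)) lam_hn (hnB w' w); lra.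
  - by apply: filterE => h /=; rewrite (lin0 (lam_lin h)) subrr hn0.
  have a0 : 0 < cmod a + 1 by rewrite ltr_wpDl// sqrtr_ge0.
  have d2 : 0 < d / 2 by rewrite divr_gt0.
  apply: filterS (filterI (h1 _ (divr_gt0 d2 a0)) (h2 _ d2)) => h /= [r1 r2].
  rewrite lam_lin opprD addrACA -scalerBr; apply: le_lt_trans (hnD _ _) _.
  rewrite hnZ; rewrite ltr_pdivlMr// in r1.
  have := hn_ge0 (v1 - lam h v1); have : 0 <= cmod a by exact: sqrtr_ge0.
  nra.
have hb := near1 (subval v) (subval_in v) _ e0.
have hc : nbhs g [set h | hn (subval v - lam (g^-1 * h)%g (subval v)) < e].
  have := @mulg_continuous G (g^-1%g, g) [set h | hn (subval v - lam h (subval v)) < e].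
  rewrite /= mulVg => /(_ hb) [[A1 A2] /= [/nbhs_singleton g1 n2] sub].
  by apply: filterS n2 => h A2h; exact: (sub (g^-1%g, h)).
suff : nbhs g [set h | A (cyclic_rep h v)] by [].
apply: filterS hc => h /= hh; apply: eA; apply: le_lt_trans hh.
rewrite -subval_hn (linB (@subval_linear _ _ _ cyclic_closed)) !cyclic_repE.
by rewrite -(lam_hn g (subval v - _)) (linB (lam_lin g)) -[lam g (lam _ _)]lamM mulVKg.
Qed.

(** The projection of [eps] onto an invariant subspace is fixed by every combination of group
    elements that fixes [eps]. If this makes it a multiple of [eps], the subspace contains [eps] or
    is orthogonal to its orbit. *)
Lemma cyclic_irreducible : eps <> 0 ->
  (forall f, cyclic_space f ->
    (forall l : seq (C * G), \sum_(t <- l) t.1 *: lam t.2 eps = eps ->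
       \sum_(t <- l) t.1 *: lam t.2 f = f) -> exists c : C, f = c *: eps) ->
  irreducible_rep setT cyclic_rep.
Proof.
move=> eps0 irr; have hrep := cyclic_unitary; pose ev := cyclic_vector.
have ev0 : ev <> 0 by move=> e; apply: eps0; rewrite -cyclic_vectorE -/ev e.
split=> //; first by exists ev.
move=> S Sc Sl Sinv; have hS : closed_subspace S by split.
have Sinv' g v : S v -> S (cyclic_rep g v) by exact: Sinv.
have [|l|c cE] := irr (subval (hproj S ev)); first exact: subval_in.
  move=> lE; rewrite -[RHS]/(subval (hproj S ev)).
  have E1 : \sum_(t <- l) t.1 *: cyclic_rep t.2 ev = ev.
    apply: subval_inj; rewrite (lin_sum (@subval_linear _ _ _ cyclic_closed)) [RHS]cyclic_vectorE.
    under eq_bigr => t _ do rewrite (linZ (@subval_linear _ _ _ cyclic_closed)) cyclic_repE cyclic_vectorE.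
    exact: lE.
  rewrite -[in RHS]E1 (lin_sum (hproj_linear hS)) (lin_sum (@subval_linear _ _ _ cyclic_closed)).
  apply: eq_bigr => t _; rewrite (linZ (hproj_linear hS)) (linZ (@subval_linear _ _ _ cyclic_closed)).
  by rewrite (hproj_invariant hrep _ _ hS Sinv') cyclic_repE.
have {}cE : hproj S ev = c *: ev.
  by apply: subval_inj; rewrite cE (linZ (@subval_linear _ _ _ cyclic_closed)) cyclic_vectorE.
have [c0|c0] := eqVneq c 0; [left|right].
  apply/seteqP; split=> v; last by move=> ->; exact: Sl.1.
  move=> Sv; apply/eqP; rewrite -sqnorm_eq0 /sqnorm.
  suff /(_ v) -> : forall w, ip w v = 0 by [].
  apply: (cyclic_total (perp_closed v)) => g; change (ip (cyclic_rep g ev) v = 0).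
  rewrite (rep_adj hrep) -(hproj_id hS (Sinv' g^-1%g _ Sv)) -(hproj_adj hS) cE c0 scale0r.
  exact: ip0l.
have Sev : S ev by rewrite -[ev](scalerK c0) -cE; apply: (subspaceZ _ Sl); exact: (hproj_in hS).
by apply/seteqP; split=> // v _; apply: cyclic_total => // g; exact: Sinv'.
Qed.

End representation.
End cyclic_representations.

Section translations.
Context {R : realType} {G : topologicalGroupType}.
Local Notation C := R[i].
Implicit Types (g h : G) (A B : set G).

Definition left_translate g A : set G := [set (g * a)%g | a in A].

Lemma left_translate1 A : left_translate 1%g A = A.
Proof. by apply/seteqP; split=> [_ [a Aa <-]|a Aa]; [rewrite mul1g|exists a; rewrite ?mul1g]. Qed.

Lemma left_translateM g h A : left_translate (g * h)%g A = left_translate g (left_translate h A).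
Proof.
apply/seteqP; split=> [_ [a Aa <-]|_ [_ [a Aa <-] <-]]; last by exists a; rewrite ?mulgA.
by exists (h * a)%g; [exists a|rewrite mulgA].
Qed.

Lemma left_translateK g : cancel (left_translate g) (left_translate g^-1%g).
Proof. by move=> A; rewrite -left_translateM mulVg left_translate1. Qed.

Lemma left_translateVK g : cancel (left_translate g^-1%g) (left_translate g).
Proof. by move=> A; rewrite -left_translateM mulgV left_translate1. Qed.

(** All subsets of [G] serve as indices, so that a single Hilbert space contains l^2 of the cosets
    for all subgroups, and the fibres of the direct integral can be taken inside it. *)
Definition translation g (f : @l2 R (set G)) : @l2 R (set G) :=
  l2_perm (left_translateVK g) f.

Lemma translationE g f A : l2val (translation g f) A = l2val f (left_translate g^-1%g A).
Proof. by []. Qed.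

Lemma translation_isometric : isometric_action translation.
Proof.
split=> [g a u v|g u v|v|g h v]; last first.
- by apply: l2_ext => A; rewrite !translationE invMg left_translateM.
- by apply: l2_ext => A; rewrite translationE invg1 left_translate1.
- exact: (l2_perm_ip _ (left_translateK g)).
by apply: l2_ext => A; rewrite l2valD !translationE l2valD.
Qed.

Lemma translation_delta g A : translation g (@delta R (set G) A) = @delta R (set G) (left_translate g A).
Proof.
apply: l2_ext => B; rewrite translationE /l2val /=; congr (_%:R).
by apply: f_equal; apply/eqP/eqP => [<-|->]; rewrite ?left_translateVK ?left_translateK.
Qed.

End translations.

Section dense_isometries.
Context {R : realType} {L : set R} {U : metricType R}.
Hypothesis (Lpos : forall r : R, L r -> 0 < r) (LU : is_urysohn L U).
Local Notation d := (@mdist R U).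
Local Notation G := (isom U).

Lemma isolated_radius (t : R) : spectrum_with0 L t -> exists2 e : R, 0 < e &
  forall x y : U, d x y < e -> d x y <= t.
Proof.
move=> [Lt|[-> nl]]; first by exists t; [exact: Lpos|move=> x y /ltW].
apply: contrapT => no; apply: nl => A /nbhs_ballP[e e0 eA].
apply: contrapT => none; apply: no; exists e => // x y xy.
have [->//|Lxy] := ud_L0 LU x y; case: none; exists (d x y).
by split; [rewrite gt_eqF// Lpos|exact: Lxy|apply: eA; rewrite /ball /= sub0r normrN ger0_norm// (ud_ge0 LU)].
Qed.

(** Every finite list of pairs from a dense sequence is realised by an isometry when possible. These
    countably many isometries meet every coset of every [stab x m]. *)
Lemma dense_isometries : exists D : nat -> G, forall (g : G) n (x : 'I_n -> U) m,
  spec (L := L) m -> exists k, forall i, d (D k (x i)) (g (x i)) <= m i.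
Proof.
have [q hq] := ud_dense_seq LU.
have ex (l : seq (nat * nat)) : exists h : G,
    (exists h : G, forall p, p \in l -> h (q p.1) = q p.2) -> forall p, p \in l -> h (q p.1) = q p.2.
  by have [[h hh]|no] := pselect (exists h : G, forall p, p \in l -> h (q p.1) = q p.2); [exists h|exists 1%g].
have [H hH] := choice ex.
exists (fun k => if unpickle k is Some l then H l else 1%g) => g n x m hm.
(* Distances below [e] are within every radius [m i], and [e] is at most the distance of distinct
   centres; replacing points by others nearer than [e] therefore preserves the distances between
   distinct centres. *)
have [e e0 [em ex2]] : exists2 e : R, 0 < e & (forall i u v, d u v < e -> d u v <= m i) /\
    forall i j, x i <> x j -> e <= d (x i) (x j).
  have [f hf] : exists f : 'I_n -> R, forall i, 0 < f i /\ forall u v, d u v < f i -> d u v <= m i.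
    have ex1 i : exists f : R, 0 < f /\ forall u v, d u v < f -> d u v <= m i.
      by have [e e0 h] := isolated_radius (hm i); exists e.
    by have [f hf] := choice ex1; exists f.
  pose s := [seq f i | i <- enum 'I_n] ++ [seq y <- [seq d (x p.1) (x p.2) | p <- enum ('I_n * 'I_n : finType)%type] | 0 < y].
  have [|e e0 he] := @gap_below R 0 s.
    move=> y; rewrite mem_cat mem_filter => /orP[/mapP[i _ ->]|/andP[]//].
    by case: (hf i).
  exists e => //; split=> [i u v uv|i j ij].
    by apply: (hf i).2; apply: lt_le_trans uv _; apply: he; rewrite mem_cat map_f// mem_enum.
  apply: he; rewrite mem_cat mem_filter; apply/orP; right; apply/andP; split.
    by rewrite lt_neqAle (ud_ge0 LU) andbT eq_sym; apply/eqP => /(ud_eq0 LU).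
  by apply/mapP; exists (i, j); rewrite ?mem_enum.
have [a ha] := choice (fun u => hq u e e0).
pose l := [seq (a (x i), a (g (x i))) | i <- enum 'I_n].
have hl i : (a (x i), a (g (x i))) \in l by apply: (map_f (fun i => (a (x i), a (g (x i))))); rewrite mem_enum.
have [|h hh] := extend_isom Lpos LU (S := [seq (q p.1, q p.2) | p <- l]).
  move=> _ _ /mapP[_ /mapP[i _ ->] ->] /mapP[_ /mapP[j _ ->] ->] /=.
  have [->|ij] := pselect (x i = x j); first by rewrite !(udxx LU).
  have near u v u' v' : e <= d u v -> d u u' < e -> d v v' < e -> d u' v' = d u v.
    move=> uv uu' vv'.
    have E : d u' v = d u v.
      rewrite (udC LU) (udC LU u); apply: esym; rewrite (udC LU v u) (udC LU v u').
      have lt := lt_le_trans uu' uv; rewrite (udC LU) in lt.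
      by rewrite (ud_iso LU lt).
    have lt : d v' v < d v u' by rewrite (udC LU v' v) (udC LU v u') E; exact: lt_le_trans vv' uv.
    by rewrite (udC LU u') (ud_iso LU lt) (udC LU v).
  have gij : e <= d (g (x i)) (g (x j)) by rewrite (isom_dist g) ex2.
  by rewrite (near _ _ _ _ (ex2 _ _ ij) (ha _) (ha _)) (near _ _ _ _ gij (ha _) (ha _)) isom_dist.
exists (pickle l) => i; rewrite pickleK /=; apply: em.
have Hl : forall p, p \in l -> H l (q p.1) = q p.2.
  by apply: hH; exists h => p pl; exact: (hh (q p.1, q p.2) (map_f (fun p => (q p.1, q p.2)) pl)).
apply: le_lt_trans (ud_tri LU (H l (q (a (x i)))) _ _) _.
by rewrite (isom_dist (H l)) (Hl _ (hl i)) gt_max ha (udC LU) ha.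
Qed.

End dense_isometries.

Lemma l2_large_finite (R : realType) (T : choiceType) (f : @l2 R T) (c : R) : 0 < c ->
  exists l : seq T, forall t, c <= csq (l2val f t) -> t \in l.
Proof.
move=> c0; have hs := l2_ip_self (hvalP f).
have [l [ul hl]] := hs _ (divr_gt0 c0 (ltr0Sn _ 1)).
exists l => t ct; apply: contraT => tl.
have := hl l ul (fun _ => id); have := hl (t :: l) _ _.
rewrite /= tl ul big_cons => /(_ isT) h; have {h} := h _.
have sub : {subset l <= t :: l} by move=> u ul'; rewrite inE ul' orbT.
move=> /(_ sub); rewrite !ltr_norml => /andP[_ h1] /andP[h2 _]; move: ct; rewrite leNgt => /negP[].
by rewrite /l2val; lra.
Qed.

(** * Representations attached to ideals of radii *)

Section ideal_representation.
Context {R : realType} {L : set R} {U : metricType R}.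
Hypothesis (Lpos : forall r : R, L r -> 0 < r) (LU : is_urysohn L U).
Local Notation d := (@mdist R U).
Local Notation max := Num.max.
Local Notation G := (isom U).
Local Notation C := R[i].
Variables (n : nat) (x : 'I_n.+1 -> U) (F : {group 'S_n.+1}) (b : {ffun subg_of F -> C^o}).
Variable I : set ('I_n.+1 -> R).
Hypotheses (hI : radius_ideal (L := L) x I) (hF : forall s, s \in F -> isoperm x s)
  (hFI : forall s m, s \in F -> I m -> I (m \o s))
  (hnF : forall s : 'S_n.+1, isoperm x s -> s \notin F -> exists m, spec (L := L) m /\
     ((I m /\ ~ I (m \o s)) \/ (~ I m /\ I (m \o s))))
  (hb : [/\ b <> 0, conv b b = b, astar b = b &
    forall s, conv b (ashift s b) = (b s^-1%g / b 1%g : C) *: b]).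
Variable hh : 'S_n.+1 -> G.
Hypothesis hhP : forall s, isoperm x s -> forall j, hh s (x j) = x (s^-1%g j).
Local Notation A := {ffun subg_of F -> C^o}.
Local Notation E := (@l2 R (set G)).
Implicit Types (g h k : G) (s t : 'S_n.+1) (m : 'I_n.+1 -> R).

(** The stabilizer of the balls of the ideal, by [ideal_stabilizer], described without choosing a
    labeling. *)
Definition ideal_group : set G := [set g | exists2 m, I m & stab x m g].
Local Notation Gam := ideal_group.
Local Notation lt := (@left_translate G).
Local Notation cs s := (lt (hh s) Gam).

Let I0 : exists m, I m. Proof. by case: hI. Qed.
Let Ispec m : I m -> spec (L := L) m. Proof. by case: hI => _ h _ _ Im; case: (h m Im). Qed.
Let Isep m : I m -> sep x m. Proof. by case: hI => _ h _ _ Im; case: (h m Im). Qed.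
Let Imax m m' : I m -> I m' -> I (maxf m m'). Proof. by case: hI => _ _ h _; exact: h. Qed.
Let Ile m m' : I m -> spec (L := L) m' -> (forall i, m' i <= m i) -> I m'.
Proof. by case: hI => _ _ _; apply. Qed.

Lemma ideal_group_subgroup : subgroup_set Gam.
Proof.
have sg m : I m -> subgroup_set (stab x m).
  by move=> Im; apply: (stab_subgroup LU) => i; exact: (spec_ge0 Lpos _ (Ispec Im)).
split=> [|g h [m Im gm] [m' Im' hm]|g [m Im gm]].
- by have [m Im] := I0; exists m => //; case: (sg m Im).
- exists (maxf m m'); first exact: Imax.
  have [_ + _] := sg _ (Imax Im Im'); apply.
    by apply: stab_mono gm => i; rewrite /maxf le_max lexx.
  by apply: stab_mono hm => i; rewrite /maxf le_max lexx orbT.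
- by exists m => //; case: (sg m Im) => _ _; apply.
Qed.
Let Gam1 : Gam 1%g. Proof. by case: ideal_group_subgroup. Qed.
Let GamM g h : Gam g -> Gam h -> Gam (g * h)%g. Proof. by case: ideal_group_subgroup => _ + _; apply. Qed.
Let GamV g : Gam g -> Gam g^-1%g. Proof. by case: ideal_group_subgroup => _ _; apply. Qed.

Lemma left_coset_eq g h : Gam (h^-1 * g)%g <-> lt g Gam = lt h Gam.
Proof.
split=> [gh|eq].
  apply/seteqP; split=> [_ [k Gk <-]|_ [k Gk <-]].
    by exists (h^-1 * g * k)%g; [exact: GamM|rewrite !mulgA mulgV mul1g].
  exists ((h^-1 * g)^-1 * k)%g; first by apply: GamM => //; exact: GamV.
  by rewrite invMg invgK !mulgA mulgV mul1g.
have : lt g Gam g by exists 1%g; rewrite ?mulg1.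
by rewrite eq => -[k Gk <-]; rewrite mulKg.
Qed.

Lemma same_action_coset g h : (forall j, g (x j) = h (x j)) -> lt g Gam = lt h Gam.
Proof.
move=> gh; apply/left_coset_eq; have [m Im] := I0; exists m => // i.
by rewrite isom_distV gh (udxx LU); exact: (spec_ge0 Lpos _ (Ispec Im)).
Qed.

(** Whether [g] lies in the coset of [hh s] is decided by a single tuple of radii; in the direct
    integral this is a single digit, which makes matrix coefficients measurable. *)
Lemma ideal_coset_shift g s r : I r -> s \in F ->
  Gam ((hh s)^-1 * g)%g <-> I (shift_radius x r g s).
Proof.
move=> Ir sF; have hs := hhP (hF sF).
have dE j : d ((((hh s)^-1 * g)%g : G) (x j)) (x j) = d (g (x j)) (x (s^-1%g j)).
  by rewrite isomME isom_distV hs.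
split=> [[m Im gm]|Ish]; last first.
  by exists (shift_radius x r g s) => // j; rewrite dE /shift_radius !le_max lexx !orbT.
have sV : (s^-1)%g \in F by rewrite groupV.
apply: (@Ile (maxf (maxf r (r \o s^-1%g)) m)).
- by apply: Imax => //; apply: Imax => //; exact: hFI.
- by apply: (spec_shift Lpos LU); exact: Ispec.
- move=> j; have := gm j; rewrite dE /shift_radius /maxf /= => h.
  by rewrite !ge_max !le_max !lexx h !orbT.
Qed.

Lemma ideal_coset_inj s t : s \in F -> t \in F -> cs s = cs t -> s = t.
Proof.
move=> sF tF /left_coset_eq [m Im st]; apply: invg_inj; apply/permP => j.
apply/eqP/contraT; rewrite eq_sym => ne.
have := Isep (hFI tF Im) ne; rewrite /= permKV => h; have := st j; rewrite isomME isom_distV (hhP (hF sF)) (hhP (hF tF)).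
by rewrite (udC LU) leNgt h.
Qed.

Lemma ideal_coset_mul g s t : Gam ((hh s)^-1 * g)%g -> s \in F -> t \in F ->
  lt g (cs t) = cs (s * t)%g.
Proof.
move=> gs sF tF; have stF : (s * t)%g \in F by rewrite groupM.
have [m Im gm] := gs.
rewrite -left_translateM -(@same_action_coset (hh s * hh t)%g (hh (s * t)%g)); last first.
  by move=> j; rewrite isomME (hhP (hF tF)) (hhP (hF sF)) (hhP (hF stF)) invMg permM.
apply/left_coset_eq; have tV : (t^-1)%g \in F by rewrite groupV.
exists (m \o t^-1%g); first exact: hFI.
move=> j; rewrite invMg !isomME isom_distV (hhP (hF tF)); exact: gm.
Qed.

(** The group algebra of [F] inside l^2 of the cosets; elements of the coset of [hh s] act on it as
    the shift by [s] ([translation_ideal_sum]). *)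
Definition ideal_sum (a : A) : E := \sum_s a s *: @delta R (set G) (cs (sgval s)).
Definition ideal_vector : E := ideal_sum b.
Local Notation lam := (@translation R G).

Lemma ideal_sum_val (a : A) (t : subg_of F) : l2val (ideal_sum a) (cs (sgval t)) = a t.
Proof.
rewrite -ip_delta /ideal_sum ip_suml (bigD1 t)// big1 => [|s st].
  by rewrite ipZl ip_delta /l2val /= eqxx mulr1 addr0.
rewrite ipZl ip_delta /l2val /=; case: eqP => [|_]; last by rewrite mulr0.
by move=> /(ideal_coset_inj (valP t) (valP s))/val_inj ts; rewrite ts eqxx in st.
Qed.

Lemma ideal_sum_supp (a : A) B : (forall s : subg_of F, B <> cs (sgval s)) ->
  l2val (ideal_sum a) B = 0.
Proof.
move=> nB; rewrite -ip_delta /ideal_sum ip_suml big1// => s _.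
rewrite ipZl ip_delta /l2val /=; case: eqP => [/nB//|_].
by rewrite mulr0.
Qed.

Lemma ideal_sum_eq (f : E) (a : A) : (forall s : subg_of F, l2val f (cs (sgval s)) = a s) ->
  (forall B, (forall s : subg_of F, B <> cs (sgval s)) -> l2val f B = 0) -> f = ideal_sum a.
Proof.
move=> h1 h0; apply: l2_ext => B.
have [[s ->]|no] := pselect (exists s : subg_of F, B = cs (sgval s)).
  by rewrite h1 ideal_sum_val.
by rewrite h0 ?ideal_sum_supp// => s e; apply: no; exists s.
Qed.

Lemma ideal_sum_ip (a a' : A) : ip (ideal_sum a) (ideal_sum a') = conv a (astar a') 1%g.
Proof.
rewrite {2}/ideal_sum ip_sumr /conv ffunE; apply: eq_bigr => s _.
by rewrite ipZr ip_delta ideal_sum_val /astar ffunE mulg1 invgK mulrC.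
Qed.

Lemma ideal_sumD (k : C) (a a' : A) : ideal_sum (k *: a + a') = k *: ideal_sum a + ideal_sum a'.
Proof.
rewrite /ideal_sum scaler_sumr -big_split; apply: eq_bigr => s _.
by rewrite !ffunE scalerDl scalerA.
Qed.

Lemma translation_ideal_sum g (s : subg_of F) (a : A) : Gam ((hh (sgval s))^-1 * g)%g ->
  lam g (ideal_sum a) = ideal_sum (ashift s a).
Proof.
move=> gs; have [ll _ _ _] := @translation_isometric R G.
rewrite /ideal_sum (lin_sum (ll g)) [RHS](reindex_inj (mulgI s)); apply: eq_bigr => t _.
by rewrite (linZ (ll g)) translation_delta (ideal_coset_mul gs (valP s) (valP t)) ffunE mulKg.
Qed.

(** Divided by [b 1] this is [corner_phi b s], the coefficient of [e rho(g) e] on a corner. *)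
Lemma ideal_vector_gram g (s : subg_of F) : Gam ((hh (sgval s))^-1 * g)%g ->
  ip (lam g ideal_vector) ideal_vector = b s^-1%g.
Proof.
move=> gs; have [_ bb bst _] := hb.
rewrite /ideal_vector (translation_ideal_sum b gs) ideal_sum_ip bst -ashift_conv bb.
by rewrite ffunE mulg1.
Qed.

Lemma ideal_coset_move g (s t : subg_of F) : lt g (cs (sgval s)) = cs (sgval t) ->
  Gam ((hh (sgval (t * s^-1)%g))^-1 * g)%g.
Proof.
rewrite -left_translateM => /left_coset_eq h.
have sV : (sgval s)^-1%g \in F by rewrite groupV; exact: (valP s).
apply/left_coset_eq; rewrite -[g](mulgK (hh (sgval s))) left_translateM.
rewrite (@same_action_coset (hh (sgval s))^-1%g (hh (sgval s)^-1%g)).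
  by rewrite (ideal_coset_mul h (valP t) sV).
move=> j; rewrite (hhP (hF sV)) invgK -{1}[j](permK (sgval s)) -(hhP (hF (valP s))).
exact: isomVE.
Qed.

Lemma ideal_translate0 g (a : A) (t : subg_of F) : (forall s : subg_of F, ~ Gam ((hh (sgval s))^-1 * g)%g) ->
  l2val (lam g (ideal_sum a)) (cs (sgval t)) = 0.
Proof.
move=> ng; rewrite translationE; apply: ideal_sum_supp => s e; apply: (ng (t * s^-1)%g).
by apply: ideal_coset_move; rewrite -e left_translateVK.
Qed.

Lemma ideal_vector_gram0 g : (forall s : subg_of F, ~ Gam ((hh (sgval s))^-1 * g)%g) ->
  ip (lam g ideal_vector) ideal_vector = 0.
Proof.
move=> ng; rewrite {2}/ideal_vector /ideal_sum ip_sumr big1// => t _.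
by rewrite ipZr ip_delta ideal_translate0// mulr0.
Qed.

Lemma ideal_vector_neq0 : ideal_vector <> 0.
Proof.
have [b0 _ _ _] := hb; move=> e; apply: b0; apply/ffunP => s.
by rewrite ffunE -ideal_sum_val -/ideal_vector e.
Qed.

(* A vector fixed by [Gam] is supported on the finite orbits, hence on the
   cosets of isometries that permute the balls of the configuration. *)
Lemma ideal_fixed_supp (f : E) a : (forall k, Gam k -> lam k f = f) -> l2val f (lt a Gam) <> 0 ->
  exists2 s, s \in F & Gam ((hh s)^-1 * a)%g.
Proof.
move=> ffix fa; have [B [Bs Bi]] := labeled_of_ideal Lpos LU hI.
have BG g : ball_stabilizer B g <-> Gam g by exact: (ideal_stabilizer Lpos LU hI Bs Bi g).
have Bx j : label_support B (x j) by apply/Bs; exists j.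
have c0 : 0 < csq (l2val f (lt a Gam)).
  rewrite lt_neqAle csq_ge0 andbT eq_sym; apply/eqP => e; apply: fa.
  move: e; rewrite /csq; case: (l2val f _) => u v /= /eqP.
  by rewrite paddr_eq0 ?sqr_ge0// !sqrf_eq0 => /andP[/eqP -> /eqP ->].
(* The coefficient of [f] is constant on the orbit of the coset of [a] under [Gam], and finitely
   many coefficients are that large; so the orbit is finite. *)
have [l hl] := l2_large_finite f c0.
have orb k : Gam k -> lt (k * a)%g Gam \in l.
  move=> Gk; apply: hl; rewrite -{1}(ffix _ (GamV Gk)) translationE invgK -left_translateM.
  exact: lexx.
have rep (A' : set G) : exists k, forall k', Gam k' -> A' = lt (k' * a)%g Gam -> Gam k /\ A' = lt (k * a)%g Gam.
  have [[k [Gk e]]|no] := pselect (exists k, Gam k /\ A' = lt (k * a)%g Gam); first by exists k.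
  by exists 1%g => k' Gk' e; case: no; exists k'.
have [kk hk] := choice rep.
have cont := @finite_translates_contain R L U Lpos LU B B a [seq kk A' | A' <- l].
have {}cont : forall y, label_support B y -> exists2 x', label_support B x' &
    label_ball B x' `<=` a @` label_ball B y.
  apply: cont => h /BG Gh; exists (kk (lt (h * a)%g Gam)); first exact/map_f/orb.
  have [_ /left_coset_eq Ge] := hk _ h Gh erefl.
  set k := kk _ in Ge *; have /BG/(@ball_union_stabilizer R L U B) Gu := Ge.
  have -> : (h * a = (k * a) * ((k * a)^-1 * (h * a)))%g by rewrite mulKVg.
  by rewrite imageM Gu.
have pick j : exists j', label_ball B (x j') `<=` a @` label_ball B (x j).
  by have [_ /Bs[j' ->] sub] := cont _ (Bx j); exists j'.
have [p0 hp0] := choice pick.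
have xinj : injective x.
  move=> i j xij; apply/eqP/contraT => ij; have [m Im] := I0; have := Isep Im ij.
  by rewrite xij (udxx LU) ltNge (spec_ge0 Lpos _ (Ispec Im)).
have p0inj : injective p0.
  move=> i j pij; apply: xinj; have cj := label_ball_center Lpos LU (Bx (p0 j)).
  have [v jv av] := hp0 j _ cj; have [u iu au] : (a @` label_ball B (x i)) (x (p0 j)).
    by apply: hp0; rewrite pij.
  have uv : u = v by rewrite -[u](isomVE a) au -av isomVE.
  by apply: (label_ball_disjoint LU (Bx i) (Bx j) iu); rewrite uv.
pose pi (y : U) := if pselect (exists i, y = x i) is left e then x (p0 (projT1 (cid e))) else y.
have piE i : pi (x i) = x (p0 i).
  rewrite /pi; case: pselect => [e|no]; last by case: no; exists i.
  by congr (x (p0 _)); apply: xinj; rewrite -(projT2 (cid e)).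
(* Each translated ball contains a ball of the same configuration; finiteness turns the inclusions
   into equalities, so [a] permutes the balls. *)
have ball j : a @` label_ball B (x j) = label_ball B (x (p0 j)).
  rewrite -piE; have [|||-> //] := @label_ball_inclusions R L U Lpos LU B a pi _ _ _ (x j) (Bx j).
  - by move=> _ /Bs[i ->]; rewrite piE.
  - by move=> y z; rewrite !inE => /Bs[i ->] /Bs[i' ->]; rewrite !piE => /xinj/p0inj ->.
  - by move=> _ /Bs[i ->]; rewrite piE.
have acen j : label_ball B (x (p0 j)) (a (x j)).
  by rewrite -ball; exists (x j) => //; exact: (label_ball_center Lpos LU).
pose p := perm p0inj; have pE i : p i = p0 i by rewrite permE.
have iso i j : d (x (p i)) (x (p j)) = d (x i) (x j).
  have [->|/eqP ij] := eqVneq i j; first by rewrite !(udxx LU).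
  rewrite -[RHS](isom_dist a) !pE.
  have sepb i' j' : i' <> j' -> d (x (p0 i')) (a (x i')) < d (x (p0 i')) (x (p0 j')).
    move=> ij'; rewrite ltNge; apply/negP => le.
    apply: (label_sep (Bx (p0 i')) (Bx (p0 j'))) => [/xinj/p0inj//|].
    by apply: label_in_le le _; rewrite -label_ballE.
  have h1 := sepb i j ij; have h2 := sepb j i (fun e => ij (esym e)).
  have h3 : d (a (x i)) (x (p0 j)) = d (x (p0 i)) (x (p0 j)).
    by apply: (ud_iso LU); rewrite (udC LU).
  have h4 : d (a (x j)) (a (x i)) = d (x (p0 j)) (a (x i)).
    by apply: (ud_iso LU); rewrite (udC LU) (udC LU (x (p0 j)) (a (x i))) h3 (udC LU (x (p0 i))).
  by rewrite (udC LU (a (x i))) h4 (udC LU (x (p0 j))) h3.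
(* The isometry [a] maps one ball onto the other, so both admit the same radii: every [t] in [L0] is
   realised as a distance from [x j]. *)
have labE j (t : R) : L0 (L := L) t -> label_in B (x j) t <-> label_in B (x (p0 j)) t.
  move=> t0; have [u ut] : exists u, d (x j) u = t.
    case: t0 => [->|Lt]; first by exists (x j); rewrite (udxx LU).
    have [ws [sz _ hw]] := equidistant Lpos LU (x j) 1 Lt; case: ws sz hw => // u ws _ hw.
    by exists u; case: (hw u (mem_head _ _)).
  have E1 : label_in B (x j) t <-> label_ball B (x j) u by rewrite label_ballE ut.
  have E2 : label_in B (x (p0 j)) t <-> label_ball B (x (p0 j)) (a u).
    by rewrite (label_ball_shift LU _ (acen j)) isom_dist ut.
  apply: iff_trans E1 (iff_trans _ (iff_sym E2)); rewrite -ball.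
  by split=> [ju|[v jv /(congr1 (a^-1%g : G))]]; [exists u|rewrite !isomVE => <-].
pose s := p^-1%g.
have siso : isoperm x s by move=> i j; rewrite -iso /s !permKV.
have IE m : spec (L := L) m -> I m <-> forall j, label_in B (x j) (m j).
  move=> hm; split=> [Im j|hj]; first by apply/Bi; exists m.
  have [|m' Im' le] := ideal_bigmax hI (s := m); first by move=> j; apply/Bi.
  exact: Ile Im' hm le.
(* The permutation preserves the ideal, whereas an isometric permutation outside [F] would be
   detected by some [m]. *)
have sF : s \in F.
  apply: contraT => /(hnF siso)[m [hm xor]].
  suff E1 : I m <-> I (m \o s) by case: xor => -[h1 h2]; [case: h2; exact/E1|case: h1; exact/E1].
  apply: iff_trans (IE m hm) (iff_trans _ (iff_sym (IE _ (spec_perm _ hm)))); split=> h j /=.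
    by have /labE := spec_L0 (s j) hm; move=> /(_ (s j))[+ _] => /(_ (h _)); rewrite -pE /s permKV.
  have := h (p j); rewrite /= /s permK pE => h'.
  by have /labE := spec_L0 j hm; move=> /(_ j)[_ +]; apply.
exists s => //; apply/BG/(ball_stabilizerP Lpos LU) => _ /Bs[j ->].
rewrite isomME (udC LU) isom_distV (hhP siso) /s invgK pE (udC LU).
have [_] := labE j _ (ud_L0 LU (x (p0 j)) (a (x j))); apply.
by rewrite -label_ballE; exact: acen.
Qed.

Let ll g : linear (lam g). Proof. by case: (@translation_isometric R G). Qed.

Lemma ideal_vector_fixed k : Gam k -> lam k ideal_vector = ideal_vector.
Proof.
move=> Gk; have h1 : Gam ((hh 1%g)^-1 * k)%g.
  apply: GamM => //; rewrite -[_^-1%g]mulg1; apply/left_coset_eq; apply: same_action_coset => j.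
  by rewrite (hhP (hF (group1 F))) invg1 perm1.
rewrite /ideal_vector (@translation_ideal_sum k 1%g b)//; congr ideal_sum.
by apply/ffunP => t; rewrite ffunE invg1 mul1g.
Qed.

Section cyclic.
Variables (kap : C) (D : nat -> G).
Hypothesis kap0 : kap != 0.
Hypothesis hD : forall (g : G) q (y : 'I_q -> U) (m : 'I_q -> R), spec (L := L) m ->
  exists j : nat, forall i, d (D j (y i)) (g (y i)) <= m i.
Local Notation eps := (kap *: ideal_vector).

Lemma ideal_eps_fixed k : Gam k -> lam k eps = eps.
Proof. by move=> Gk; rewrite (linZ (ll k)) ideal_vector_fixed. Qed.

Lemma ideal_epsD g : exists j : nat, lam g eps = lam (D j) eps.
Proof.
have [_ _ _ lM] := @translation_isometric R G.
have [m Im] := I0; have [j hj] := hD g x (Ispec Im); exists j.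
rewrite -[D j](mulVKg g) lM (@ideal_eps_fixed (g^-1 * D j)%g)//; exists m => // i.
by rewrite isomME isom_distV.
Qed.

Lemma ideal_eps_open : nbhs (1%g : G) [set g | lam g eps = eps].
Proof.
have [m Im] := I0; apply: filterS (stab_nbhs1 Lpos LU x (Ispec Im)) => g gm.
by apply: ideal_eps_fixed; exists m.
Qed.

Lemma ideal_cyclic_supp f B : @cyclic_space R G E lam eps f -> (forall g, B <> lt g Gam) -> l2val f B = 0.
Proof.
move=> cf nB; rewrite -ip_delta; apply: (cf _ (perp_closed (@delta R (set G) B))) => g.
change (ip (lam g eps) (@delta R (set G) B) = 0).
rewrite (linZ (ll g)) ipZl ip_delta translationE ideal_sum_supp ?mulr0// => s e.
by apply: (nB (g * hh (sgval s))%g); rewrite left_translateM -e left_translateVK.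
Qed.

(** On these cosets the orbit vectors restrict to 0 or to multiples of shifts of the idempotent [b].
    The equation at [t] is orthogonality to a vector [w], so it passes to the closed span. *)
Lemma ideal_cyclic_conv f (c : A) : @cyclic_space R G E lam eps f ->
  (forall t : subg_of F, c t = l2val f (cs (sgval t))) -> conv c b = c.
Proof.
move=> cf cE; apply/ffunP => t; have [_ bb _ _] := hb.
pose w : E := \sum_s (b (s^-1 * t)%g)^*%C *: @delta R (set G) (cs (sgval s)) - @delta R (set G) (cs (sgval t)).
have ipw u : ip u w = \sum_s l2val u (cs (sgval s)) * b (s^-1 * t)%g - l2val u (cs (sgval t)).
  rewrite ipBr ip_sumr ip_delta; congr (_ - _); apply: eq_bigr => s _.
  by rewrite ipZr ip_delta conjcK mulrC.
apply/eqP; rewrite -subr_eq0; apply/eqP.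
have -> : conv c b t - c t = ip f w.
  by rewrite ipw ffunE cE; congr (_ - _); apply: eq_bigr => s _; rewrite cE.
apply: (cf _ (perp_closed w)) => g; change (ip (lam g eps) w = 0); rewrite (linZ (ll g)) ipZl ipw.
have [[s gs]|no] := pselect (exists s : subg_of F, Gam ((hh (sgval s))^-1 * g)%g); last first.
  rewrite ideal_translate0; last by move=> s h; apply: no; exists s.
  rewrite big1 ?subrr ?mulr0// => s _; rewrite ideal_translate0 ?mul0r//.
  by move=> s' h; apply: no; exists s'.
rewrite (translation_ideal_sum b gs) ideal_sum_val.
have : conv (ashift s b) b t = ashift s b t by rewrite -ashift_conv bb.
rewrite ffunE => <-; apply/eqP; rewrite mulf_eq0 subr_eq0; apply/orP; right.
by apply/eqP/eq_bigr => u _; rewrite ideal_sum_val.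
Qed.

(** A vector [f] with the relations of [eps] is fixed by [Gam], so it is some [ideal_sum c].
    Membership in the cyclic space gives [conv c b = c], the relation expressing idempotence of [b]
    gives [conv b c = c], and minimality of [b] makes [c] a multiple of [b]. *)
Lemma ideal_irreducible : irreducible_rep setT (@cyclic_rep R G E lam eps).
Proof.
have [_ bb _ bmin] := hb.
apply: (cyclic_irreducible (@translation_isometric R G) ideal_epsD ideal_eps_open) => [e|f cf rel].
  have := scaler_eq0 kap ideal_vector; rewrite e eqxx (negPf kap0) => /esym/eqP.
  exact: ideal_vector_neq0.
have ffix k : Gam k -> lam k f = f.
  by move=> Gk; have := rel [:: (1, k)]; rewrite !big_seq1 /= !scale1r; apply; exact: ideal_eps_fixed.
pose c : A := [ffun t => l2val f (cs (sgval t))].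
have fE : f = ideal_sum c.
  apply: ideal_sum_eq => [s|B nB]; first by rewrite ffunE.
  apply: contrapT => fB; have [[a aB]|no] := pselect (exists a, B = lt a Gam); last first.
    by apply: fB; apply: (ideal_cyclic_supp cf) => g e; apply: no; exists g.
  rewrite aB in fB nB; have [s sF /left_coset_eq e] := ideal_fixed_supp ffix fB.
  by apply: (nB (subg F s)); rewrite e subgK.
have cb : conv c b = c by apply: (ideal_cyclic_conv cf) => t; rewrite ffunE.
have shift (a : A) : \sum_s b s *: lam (hh (sgval s)) (ideal_sum a) = ideal_sum (conv b a).
  rewrite conv_shift.
  have -> : ideal_sum (\sum_s b s *: ashift s a) = \sum_s b s *: ideal_sum (ashift s a).
    have il : linear ideal_sum by move=> k u v; exact: ideal_sumD.
    by rewrite (lin_sum il); apply: eq_bigr => s _; rewrite (linZ il).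
  apply: eq_bigr => s _; rewrite (@translation_ideal_sum _ s)// mulVg; exact: Gam1.
have bc : conv b c = c.
  pose l : seq (C * G) := map (fun s : subg_of F => (b s, hh (sgval s))) (index_enum (subg_of F)).
  have lE (u : E) : \sum_(p <- l) p.1 *: lam p.2 u = \sum_s b s *: lam (hh (sgval s)) u by rewrite big_map.
  have lk (a : A) : \sum_(p <- l) p.1 *: lam p.2 (kap *: ideal_sum a) = kap *: ideal_sum (conv b a).
    rewrite lE -shift [RHS]scaler_sumr; apply: eq_bigr => s _.
    by rewrite (linZ (ll _)) !scalerA mulrC.
  have := rel l; rewrite lk bb => /(_ erefl); rewrite lE fE shift => e.
  by apply/ffunP => t; rewrite -ideal_sum_val e ideal_sum_val.
have [lc cE] : exists lc : C, c = lc *: b.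
  exists (\sum_s c s * (b s^-1%g / b 1%g)).
  rewrite -[LHS]bc -[in LHS]cb [conv c b]conv_shift (lin_sum (@conv_linearr _ _ b)) scaler_suml.
  by apply: eq_bigr => s _; rewrite (linZ (@conv_linearr _ _ b)) bmin scalerA.
exists (lc / kap); rewrite scalerA divfK// fE cE.
have -> : lc *: b = lc *: b + 0 by rewrite addr0.
rewrite ideal_sumD /ideal_sum [X in _ + X]big1 ?addr0// => s _.
by rewrite ffunE scale0r.
Qed.
End cyclic.

End ideal_representation.

(** * Binary digits and spectral measures *)

Definition bit_sets : set (set (nat -> bool)) := [set [set z : nat -> bool | z j] | j in setT].
Definition bit_space := g_sigma_algebraType bit_sets.

Lemma measurable_bit j : measurable [set z : bit_space | z j].
Proof. by apply: sub_sigma_algebra; exists j. Qed.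

Section ternary_code.
Context {R : realType}.
Implicit Types (z w : nat -> bool) (x y : R).

(** Base 3 with the digits 0 and 2: comparison with 1/2 recovers the leading digit without ambiguity
    ([ternary_bitE]). *)
Definition ternary_part n z : R := \sum_(i < n) (z i)%:R * (2 / 3) * (3^-1) ^+ i.

Lemma ternary_partS n z :
  ternary_part n.+1 z = (2 * (z 0%N)%:R + ternary_part n (fun j => z j.+1)) / 3.
Proof.
rewrite /ternary_part big_ord_recl /= expr0 mulr1 [RHS]mulrDl; congr (_ + _).
  by rewrite mulrA [2 * _]mulrC.
by rewrite mulr_suml; apply: eq_bigr => i _; rewrite /bump /= exprSr !mulrA.
Qed.

Lemma ternary_part_bound n z : 0 <= ternary_part n z <= 1.
Proof.
elim: n z => [|n IH] z; first by rewrite /ternary_part big_ord0 lexx ler01.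
rewrite ternary_partS; have /andP[h0 h1] := IH (fun j => z j.+1).
by case: (z 0%N) => /=; apply/andP; split; lra.
Qed.

Lemma ternary_part_nd z : nondecreasing_seq (ternary_part ^~ z).
Proof.
apply/nondecreasing_seqP => n; rewrite /ternary_part big_ord_recr /= lerDl.
by rewrite !mulr_ge0 ?exprn_ge0 ?ler0n ?invr_ge0.
Qed.

Definition ternary z : R := limn (ternary_part ^~ z).

Lemma ternary_cvg z : ternary_part ^~ z @ \oo --> ternary z.
Proof.
apply: nondecreasing_is_cvgn; first exact: ternary_part_nd.
by exists 1 => _ [n _ <-]; case/andP: (ternary_part_bound n z).
Qed.

Lemma ternary_bound z : 0 <= ternary z <= 1.
Proof.
have cv : cvgn (ternary_part ^~ z) by apply/cvg_ex; exists (ternary z); exact: ternary_cvg.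
apply/andP; split.
  by apply: limr_ge => //; apply: nearW => n; case/andP: (ternary_part_bound n z).
by apply: limr_le => //; apply: nearW => n; case/andP: (ternary_part_bound n z).
Qed.

Lemma ternaryS z : ternary z = (2 * (z 0%N)%:R + ternary (fun j => z j.+1)) / 3.
Proof.
have h1 : (fun n => ternary_part n.+1 z) @ \oo --> ternary z.
  by rewrite (cvg_shiftS (ternary_part ^~ z)); exact: ternary_cvg.
have h2 : (fun n => (2 * (z 0%N)%:R + ternary_part n (fun j => z j.+1)) / 3) @ \oo -->
    (2 * (z 0%N)%:R + ternary (fun j => z j.+1)) / 3.
  by apply: cvgMl; apply: cvgD; [exact: cvg_cst|exact: ternary_cvg].
have E : (fun n => ternary_part n.+1 z) = fun n => (2 * (z 0%N)%:R + ternary_part n (fun j => z j.+1)) / 3.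
  by apply/funext => n; exact: ternary_partS.
by rewrite E in h1; exact: cvg_unique h1 h2.
Qed.

Definition ternary_bit y : bool := 2^-1 <= y.
Definition ternary_shift y : R := 3 * y - 2 * (ternary_bit y)%:R.
Definition ternary_bits y : nat -> bool := fun j => ternary_bit (iter j ternary_shift y).

Lemma ternary_bitE z : ternary_bit (ternary z) = z 0%N.
Proof.
rewrite /ternary_bit ternaryS; have /andP[h0 h1] := ternary_bound (fun j => z j.+1).
by case: (z 0%N) => /=; [apply/idP; lra|apply/negbTE; rewrite -ltNge; lra].
Qed.

Lemma ternary_shiftE z : ternary_shift (ternary z) = ternary (fun j => z j.+1).
Proof. by rewrite /ternary_shift ternary_bitE [in 3 * _]ternaryS; field. Qed.

Lemma ternary_iterE j z : iter j ternary_shift (ternary z) = ternary (fun i => z (i + j)%N).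
Proof.
elim: j => [|j IH] /=; first by congr ternary; apply/funext => i; rewrite addn0.
by rewrite IH ternary_shiftE; congr ternary; apply/funext => i; rewrite addSnnS.
Qed.

Lemma ternary_bitsK : cancel ternary ternary_bits.
Proof. by move=> z; apply/funext => j; rewrite /ternary_bits ternary_iterE ternary_bitE. Qed.

(** The Cantor set, as the points whose orbit under the digit shift stays in the unit interval; this
    exhibits it as a countable intersection of measurable sets. *)
Definition ternary_set : set R := [set y | forall j, 0 <= iter j ternary_shift y <= 1].

Lemma ternary_in z : ternary_set (ternary z).
Proof. by move=> j; rewrite ternary_iterE; exact: ternary_bound. Qed.

Lemma ternary_setK y : ternary_set y -> ternary (ternary_bits y) = y.
Proof.
move=> hy; have shiftS (z : R) : ternary_set z -> ternary_set (ternary_shift z) /\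
    ternary (ternary_bits z) = (2 * (ternary_bit z)%:R + ternary (ternary_bits (ternary_shift z))) / 3.
  move=> hz; split=> [j|]; first by have := hz j.+1; rewrite iterSr.
  rewrite ternaryS; congr ((_ + ternary _) / _); apply/funext => j.
  by rewrite /ternary_bits iterSr.
have near n (z : R) : ternary_set z -> `|ternary (ternary_bits z) - z| <= (3^-1) ^+ n.
  elim: n z => [|n IH] z hz.
    have := ternary_bound (ternary_bits z); have := hz 0%N; rewrite /= expr0 ler_norml.
    by move=> /andP[? ?] /andP[? ?]; apply/andP; split; lra.
  have [hz' ->] := shiftS z hz; have := IH _ hz'.
  have -> : (2 * (ternary_bit z)%:R + ternary (ternary_bits (ternary_shift z))) / 3 - z =
      (ternary (ternary_bits (ternary_shift z)) - ternary_shift z) / 3.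
    by rewrite /ternary_shift; field.
  by rewrite normrM exprSr => h; rewrite [`|3^-1|]ger0_norm// ler_wpM2r.
apply: eq_near => e e0; have [n hn] : exists n, (3^-1 : R) ^+ n < e.
  have : (fun n => (3^-1 : R) ^+ n) @ \oo --> (0 : R).
    by apply: cvg_expr; rewrite ger0_norm// invf_lt1// ltr1n.
  move=> /cvgrPdist_lt/(_ e e0)[N _ hN]; exists N; have := hN N (leqnn _).
  by rewrite sub0r normrN ger0_norm// exprn_ge0.
exact: le_lt_trans (near n y hy) hn.
Qed.

Lemma ternary_measurable : measurable_fun setT (ternary : bit_space -> R).
Proof.
apply: (measurable_fun_cvg (h := fun n (z : bit_space) => ternary_part n z)); last first.
  by move=> z _; exact: ternary_cvg.
move=> n; apply: measurable_sum => i; apply: measurable_funM; last exact: measurable_cst.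
apply: measurable_funM; last exact: measurable_cst.
have -> : (fun z : bit_space => (z i)%:R : R) = \1_[set z : bit_space | z i].
  by apply/funext => z; rewrite indicE; case: (boolP (z i)) => zi; [rewrite mem_set|rewrite memNset//; exact/negP].
exact: measurable_indic (measurable_bit i).
Qed.

Lemma ternary_shift_measurable j : measurable_fun setT (iter j ternary_shift : R -> R).
Proof.
elim: j => [|j IH]; first exact: measurable_id.
have -> : iter j.+1 ternary_shift = ternary_shift \o iter j ternary_shift by [].
apply: measurableT_comp => //; apply: measurable_funB; first exact: measurable_funM.
apply: measurable_funM; first exact: measurable_cst.
have -> : (fun y => (ternary_bit y)%:R : R) = \1_(`[2^-1, +oo[%classic).
  apply/funext => y; rewrite indicE /ternary_bit; case: (boolP (_ <= y)) => h; [rewrite mem_set|rewrite memNset] => //=.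
    by rewrite in_itv /= h.
  by rewrite in_itv /= (negPf h).
exact: measurable_indic.
Qed.

(** The coding is injective, so images commute with complements relative to the Cantor set; only the
    sets that prescribe one digit remain to be treated. *)
Lemma bit_space_standard : standard_borel R bit_space.
Proof.
have inj : injective (ternary : bit_space -> R) by apply: can_inj ternary_bitsK.
have mset : measurable ternary_set.
  have -> : ternary_set = \bigcap_j (iter j ternary_shift @^-1` `[0, 1]).
    by apply/seteqP; split=> y h j; [move=> _ /=; rewrite in_itv /=|have := h j I; rewrite /= in_itv].
  apply: bigcap_measurable => // j _; rewrite -[X in measurable X]setTI.
  exact: ternary_shift_measurable.
have imT : ternary @` [set: bit_space] = ternary_set.
  apply/seteqP; split=> [_ [z _ <-]|y hy]; first exact: ternary_in.
  by exists (ternary_bits y) => //; exact: ternary_setK.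
exists ternary; split=> //; first exact: ternary_measurable.
suff sub : <<s bit_sets >> `<=` [set A : set bit_space | measurable (ternary @` A)].
  by move=> A; exact: sub.
apply: smallest_sub.
- split=> [|B hB|F hF].
  + by rewrite /= image_set0.
  + rewrite /= setTD; have -> : ternary @` (~` B) = ternary_set `\` (ternary @` B).
      rewrite -imT; apply/seteqP; split=> [_ [z zB <-]|_ [[z _ <-] nz]].
        by split; [exists z|move=> [w Bw /inj wz]; apply: zB; rewrite -wz].
      by exists z => // Bz; apply: nz; exists z.
    exact: measurableD.
  + by rewrite /= image_bigcup; apply: bigcupT_measurable => i; exact: hF.
- move=> _ [j _ <-] /=.
  have -> : ternary @` [set z : nat -> bool | z j] =
      ternary_set `&` (iter j ternary_shift @^-1` `[2^-1, +oo[).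
    apply/seteqP; split=> [_ [z zj <-]|y [hy yj]].
      split; first exact: ternary_in.
      by rewrite /= ternary_iterE in_itv /= andbT; have := ternary_bitE (fun i => z (i + j)%N); rewrite /ternary_bit => ->.
    exists (ternary_bits y); last exact: ternary_setK.
    by move: yj; rewrite /= in_itv /= andbT.
  apply: measurableI => //; rewrite -[X in measurable X]setTI.
  exact: ternary_shift_measurable.
Qed.

End ternary_code.

Section words.
Context {R : realType} {V : hilbertType R} (Q : nat -> V -> V).
Hypotheses (Qp : forall j, isproj (Q j)) (Qc : forall i j v, Q i (Q j v) = Q j (Q i v)).
Variable xi : V.

Definition bit_op (b : bool) j v : V := if b then Q j v else v - Q j v.

Arguments bit_op : simpl never.

Let Ql j : linear (Q j). Proof. exact: isproj_linear (Qp j). Qed.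
Let QQ j v : Q j (Q j v) = Q j v. Proof. exact: isproj_idem (Qp j). Qed.

Lemma bit_op_comm b c i j v : bit_op b i (bit_op c j v) = bit_op c j (bit_op b i v).
Proof.
rewrite /bit_op; case: b c => [] []; rewrite ?(linB (Ql _)) ?(Qc j i)//.
by rewrite !opprB addrACA [RHS]addrACA [- Q j v - _]addrC.
Qed.

Lemma bit_op_idem b c j v : bit_op b j (bit_op c j v) = if b == c then bit_op c j v else 0.
Proof. by rewrite /bit_op; case: b c => [] [] /=; rewrite ?(linB (Ql _)) ?QQ ?subrr ?subr0. Qed.

Lemma bit_op_linear b j : linear (bit_op b j).
Proof.
rewrite /bit_op; case: b => [|a u v]; first exact: Ql.
by rewrite Ql scalerBr opprD addrACA.
Qed.

Lemma bit_op_sqnorm j v : sqnorm v = sqnorm (bit_op true j v) + sqnorm (bit_op false j v).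
Proof.
rewrite /bit_op sqnormB; have -> : rip v (Q j v) = sqnorm (Q j v).
  by rewrite sqnorm_rip (isproj_radj _ _ (Qp j)) QQ.
ring.
Qed.

(* The last digit of a word comes first. *)
Fixpoint word_vec (w : seq bool) : V :=
  if w is b :: w' then bit_op b (size w') (word_vec w') else xi.
(** Left end of the interval of a word. The interval of [w] has length [sqnorm (word_vec w)] and is
    divided into a left part for the digit [false] and a right part for [true]. *)
Fixpoint word_left (w : seq bool) : R :=
  if w is b :: w' then word_left w' + (if b then sqnorm (bit_op false (size w') (word_vec w')) else 0)
  else 0.
Definition word_itv w : set R := [set` `[word_left w, word_left w + sqnorm (word_vec w)[].
Definition word_digit (w : seq bool) j : bool := nth false (rev w) j.
Fixpoint words n : seq (seq bool) :=
  if n is n'.+1 then map (cons true) (words n') ++ map (cons false) (words n') else [:: [::]].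

Lemma word_digit_cons b w j : word_digit (b :: w) j = if j == size w then b else word_digit w j.
Proof.
rewrite /word_digit rev_cons nth_rcons size_rev; case: ltngtP => // h.
by rewrite nth_default// size_rev ltnW.
Qed.

Lemma size_words n w : w \in words n -> size w = n.
Proof.
elim: n w => [|n IH] w /=; first by rewrite inE => /eqP ->.
by rewrite mem_cat => /orP[] /mapP[w' /IH <- ->].
Qed.

Lemma bit_op_word b j w : (j < size w)%N ->
  bit_op b j (word_vec w) = if word_digit w j == b then word_vec w else 0.
Proof.
elim: w => //= c w IH; rewrite ltnS leq_eqVlt word_digit_cons => /predU1P[->|jw].
  by rewrite eqxx bit_op_idem eq_sym.
rewrite (ltn_eqF jw) bit_op_comm IH//; case: ifP => // _.
by rewrite (lin0 (bit_op_linear c _)).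
Qed.

Fixpoint cyl_op (l : seq (nat * bool)) v : V :=
  if l is p :: l' then bit_op p.2 p.1 (cyl_op l' v) else v.
Definition cyl (l : seq (nat * bool)) : set (nat -> bool) :=
  [set z | all (fun p => z p.1 == p.2) l].

Lemma cyl_op_comm l b j v : cyl_op l (bit_op b j v) = bit_op b j (cyl_op l v).
Proof. by elim: l => //= p l ->; rewrite bit_op_comm. Qed.

Lemma cyl_op_sum l n : sqnorm (cyl_op l xi) = \sum_(w <- words n) sqnorm (cyl_op l (word_vec w)).
Proof.
elim: n => [|n ->]; first by rewrite big_seq1.
rewrite [words n.+1]/= big_cat /= !big_map -big_split; apply: eq_bigr => w _ /=.
by rewrite !cyl_op_comm -bit_op_sqnorm.
Qed.

Lemma cyl_op_word l w : (forall p, p \in l -> (p.1 < size w)%N) ->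
  cyl_op l (word_vec w) = if all (fun p => word_digit w p.1 == p.2) l then word_vec w else 0.
Proof.
elim: l => //= p l IH hl; rewrite IH; last by move=> q ql; apply: hl; rewrite inE ql orbT.
case: ifP => _; last by rewrite andbF (lin0 (bit_op_linear _ _)).
by rewrite andbT bit_op_word// hl ?mem_head.
Qed.

Lemma word_itv_split w :
  word_itv (true :: w) `&` word_itv (false :: w) = set0 /\
  word_itv (true :: w) `|` word_itv (false :: w) = word_itv w.
Proof.
have s := bit_op_sqnorm (size w) (word_vec w).
have s1 := sqnorm_ge0 (bit_op true (size w) (word_vec w)).
have s2 := sqnorm_ge0 (bit_op false (size w) (word_vec w)).
rewrite /word_itv /=; split; apply/seteqP; split=> t //=; rewrite !in_itv /=.
- by move=> [/andP[h _] /andP[_ h']]; rewrite addr0 in h'; lra.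
- by case=> /andP[? ?]; apply/andP; split; lra.
- move=> /andP[h h']; have [h1|h1] := leP (word_left w + sqnorm (bit_op false (size w) (word_vec w))) t.
    by left; apply/andP; split; lra.
  by right; apply/andP; split; lra.
Qed.

Fixpoint word_of (t : R) n : seq bool :=
  if n is n'.+1 then
    (word_left (word_of t n') + sqnorm (bit_op false n' (word_vec (word_of t n'))) <= t) :: word_of t n'
  else [::].

Lemma size_word_of t n : size (word_of t n) = n.
Proof. by elim: n => //= n ->. Qed.

Lemma word_ofP w t : word_itv w t -> word_of t (size w) = w.
Proof.
elim: w => //= b w IH bw; have wt : word_itv w t.
  by rewrite -(word_itv_split w).2; case: b bw; [left|right].
rewrite IH//; congr (_ :: _); move: bw wt; rewrite /word_itv /= !in_itv /=.
by case: b => /andP[h1 h2] _; [apply/idP|apply/negbTE; rewrite -ltNge]; move: h1 h2; rewrite ?addr0.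
Qed.

Lemma word_of_digit t n j : (j < n)%N -> word_digit (word_of t n) j = word_digit (word_of t j.+1) j.
Proof.
elim: n => // n IH; rewrite ltnS leq_eqVlt => /predU1P[->//|jn].
by rewrite [word_of t n.+1]/= word_digit_cons size_word_of (ltn_eqF jn) IH.
Qed.

Lemma word_cover t n : word_itv [::] t -> exists2 w, w \in words n & word_itv w t.
Proof.
move=> t0; elim: n => [|n [w wn wt]]; first by exists [::].
move: wt; rewrite -(word_itv_split w).2 => -[] h.
  by exists (true :: w) => //=; rewrite mem_cat map_f.
by exists (false :: w) => //=; rewrite mem_cat (map_f _ wn) orbT.
Qed.

(** Outside the interval of the empty word all digits are [false] by convention; the measure below
    is restricted to that interval. *)
Definition digits (t : R) : bit_space :=
  fun j => `[< word_itv [::] t >] && word_digit (word_of t j.+1) j.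

Lemma digits_word w t j : word_itv w t -> word_itv [::] t -> (j < size w)%N ->
  digits t j = word_digit w j.
Proof.
by move=> wt t0 jw; rewrite /digits asboolT//= -(word_of_digit t jw) (word_ofP wt).
Qed.

Lemma word_itv_sub w : word_itv w `<=` word_itv [::].
Proof.
elim: w => // b w IH; apply: subset_trans IH; rewrite -(word_itv_split w).2 => t.
by case: b; [left|right].
Qed.

Lemma digits_measurable : measurable_fun setT (digits : R -> bit_space).
Proof.
apply: (@measurability _ _ _ bit_space setT digits bit_sets) => // _ [_ [j _ <-] <-]; rewrite setTI.
have -> : digits @^-1` [set z | z j] =
    \big[setU/set0]_(w <- words j.+1 | word_digit w j) word_itv w.
  apply/seteqP; split=> t /=; rewrite -bigcup_seq_cond.
    move=> dj; have t0 : word_itv [::] t by move: dj => /andP[/asboolP].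
    have [w wn wt] := word_cover j.+1 t0; exists w => //=; rewrite wn /=.
    have jw : (j < size w)%N by rewrite (@size_words j.+1 w wn).
    by rewrite -(digits_word wt t0 jw).
  move=> [w /= /andP[wn wj] wt]; have jw : (j < size w)%N by rewrite (@size_words j.+1 w wn).
  by rewrite (digits_word wt (word_itv_sub wt) jw).
by apply: bigsetU_measurable => w _; exact: measurable_itv.
Qed.

Lemma lebesgue_word_itv w : lebesgue_measure (word_itv w) = (sqnorm (word_vec w))%:E.
Proof.
rewrite /word_itv lebesgue_measure_itv /= lte_fin ltrDl; case: ifP => h.
  by rewrite -EFinD addrAC subrr add0r.
by move: h; rewrite lt_neqAle sqnorm_ge0 andbT => /negbFE/eqP <-.
Qed.

Lemma lebesgue_words (B : set R) n : measurable B ->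
  lebesgue_measure (B `&` word_itv [::]) =
    (\sum_(w <- words n) lebesgue_measure (B `&` word_itv w))%E.
Proof.
move=> mB; elim: n => [|n ->]; first by rewrite big_seq1.
rewrite [words n.+1]/= big_cat /= !big_map -big_split; apply: eq_bigr => w _ /=.
have [s0 sU] := word_itv_split w.
have mw u : measurable (B `&` word_itv u) by apply: measurableI => //; exact: measurable_itv.
rewrite -{1}sU setIUr measureU; [by []|exact: mw|exact: mw|]; by rewrite setIACA s0 setI0.
Qed.

Lemma cyl_measurable l : measurable (cyl l : set bit_space).
Proof.
elim: l => [|[j c] l IH].
  by have -> : cyl [::] = setT; [apply/seteqP; split|exact: measurableT].
have -> : cyl ((j, c) :: l) = (if c then [set z : bit_space | z j] else ~` [set z : bit_space | z j]) `&` cyl l.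
  apply/seteqP; split=> z; rewrite /cyl /=.
    by move=> /andP[/eqP <- h]; split=> //; case: ifP => // /negbT/negP.
  move=> [h ->]; rewrite andbT; case: c h => /=; first by move=> ->.
  by move=> /negP/negPf ->.
by apply: measurableI => //; case: c; [|apply: measurableC]; exact: measurable_bit.
Qed.

(** Dividing an interval of length [sqnorm xi] in proportion to the squared norms of the components
    of [xi] represents the joint distribution of the projections by Lebesgue measure, which the
    digit map pushes forward. *)
Lemma spectral_measure : exists mu : {measure set bit_space -> \bar R},
  forall l, mu (cyl l) = (sqnorm (cyl_op l xi))%:E.
Proof.
have mI : measurable (word_itv [::]) by exact: measurable_itv.
pose m := mrestr (@lebesgue_measure R) mI.
pose mu : {measure set bit_space -> \bar R} :=
  measure_function_pushforward__canonical__measure_function_Measure m digits_measurable.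
exists mu => l; rewrite -[LHS]/(lebesgue_measure (digits @^-1` cyl l `&` word_itv [::])).
have mc : measurable (digits @^-1` cyl l).
  by rewrite -[X in measurable X]setTI; apply: digits_measurable => //; exact: cyl_measurable.
have [n hn] : exists n, forall p, p \in l -> (p.1 < n)%N.
  exists (\max_(p <- l) p.1).+1 => p pl; rewrite ltnS (big_rem p)//=; exact: leq_maxl.
rewrite (lebesgue_words n mc) (cyl_op_sum l n) -sumEFin big_seq [RHS]big_seq.
apply: eq_bigr => w wn; have sw := size_words wn.
rewrite cyl_op_word; last by move=> p /hn; rewrite sw.
have dig t p : word_itv w t -> p \in l -> digits t p.1 = word_digit w p.1.
  by move=> wt pl; rewrite (digits_word wt (word_itv_sub wt))// sw hn.
case: ifP => h.
  rewrite setIidr ?lebesgue_word_itv// => t wt; rewrite /cyl /=.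
  by apply/allP => p pl; rewrite (dig t p wt pl); exact: (allP h).
rewrite sqnorm0 (_ : _ `&` _ = set0) ?measure0//; apply/seteqP; split=> // t [tl wt].
move/negP: h; apply; apply/allP => p pl; rewrite -(dig t p wt pl).
exact: (allP (tl : all _ _)).
Qed.

End words.

(** * Direct integrals *)

Section measurable_sections.
Context {R : realType} {d : measure_display} {Z : measurableType d}.
Local Notation C := R[i].
Variables (K : Z -> hilbertType R) (e : nat -> forall z, K z).
Hypothesis etot : forall z (A : set (K z)), closed_subspace A -> (forall n, A (e n z)) -> forall v, A v.
Hypothesis egram : forall i j, measurable_complex (fun z => ip (e i z) (e j z)).
Local Notation section := (forall z, K z).
Local Notation mfun f := (measurable_fun setT (f : Z -> R)).

Lemma measurable_complexD (a : C) (f g : Z -> C) : measurable_complex f -> measurable_complex g ->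
  measurable_complex (fun z => a * f z + g z).
Proof.
move=> [f1 f2] [g1 g2]; split.
  have -> : (fun z => complex.Re (a * f z + g z)) = fun z =>
      complex.Re a * complex.Re (f z) - complex.Im a * complex.Im (f z) + complex.Re (g z).
    by apply/funext => z; case: a (f z) (g z) => ? ? [? ?] [? ?].
  by apply: measurable_funD => //; apply: measurable_funB; exact: measurable_funM.
have -> : (fun z => complex.Im (a * f z + g z)) = fun z =>
    complex.Re a * complex.Im (f z) + complex.Im a * complex.Re (f z) + complex.Im (g z).
  by apply/funext => z; case: a (f z) (g z) => ? ? [? ?] [? ?].
by apply: measurable_funD => //; apply: measurable_funD; exact: measurable_funM.
Qed.

Lemma measurable_complex0 : measurable_complex (fun _ : Z => 0 : C).
Proof. by split; exact: measurable_cst. Qed.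

(** Measurability is tested on a total sequence with measurable Gram matrix; [measurable_section_ip]
    extends it to any two such sections. *)
Definition measurable_section : set section :=
  [set s | forall n, measurable_complex (fun z => ip (s z) (e n z))].
Local Notation S := measurable_section.

Lemma measurable_sectionD (a : C) s t : S s -> S t -> S (fun z => a *: s z + t z).
Proof.
move=> hs ht n.
have -> : (fun z => ip (a *: s z + t z) (e n z)) = fun z => a * ip (s z) (e n z) + ip (t z) (e n z).
  by apply/funext => z; rewrite ipDl ipZl.
exact: measurable_complexD.
Qed.

Lemma measurable_section_e n : S (e n).
Proof. by move=> m; exact: egram. Qed.

Lemma measurable_section0 : S (fun z => 0).
Proof.
move=> n; have -> : (fun z => ip (0 : K z) (e n z)) = fun=> 0 by apply/funext => z; rewrite ip0l.
exact: measurable_complex0.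
Qed.

Let comb l : section := fun z => rational_comb (e ^~ z) l.

Lemma measurable_section_comb l s : S s -> measurable_complex (fun z => ip (s z) (comb l z)).
Proof.
move=> hs; elim: l => [|t l IH].
  have -> : (fun z => ip (s z) (comb [::] z)) = fun=> 0.
    by apply/funext => z; rewrite /comb /rational_comb big_nil ip0r.
  exact: measurable_complex0.
have -> : (fun z => ip (s z) (comb (t :: l) z)) = fun z =>
    ((ratr t.1.1 +i* ratr t.1.2)%C)^*%C * ip (s z) (e t.2 z) + ip (s z) (comb l z).
  by apply/funext => z; rewrite /comb /rational_comb big_cons ipDr ipZr.
exact: measurable_complexD.
Qed.

Lemma measurable_comb l : S (comb l).
Proof.
elim: l => [|t l IH].
  have -> : comb [::] = fun=> 0 by apply: functional_extensionality_dep => z; rewrite /comb /rational_comb big_nil.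
  exact: measurable_section0.
have -> : comb (t :: l) = fun z => (ratr t.1.1 +i* ratr t.1.2)%C *: e t.2 z + comb l z.
  by apply: functional_extensionality_dep => z; rewrite /comb /rational_comb big_cons.
by apply: measurable_sectionD => //; exact: measurable_section_e.
Qed.

(* The squared norm is the supremum of [2 Re <s, u> - |u|^2] over the countably
   many rational combinations [u]. *)
Lemma measurable_sqnorm s : S s -> mfun (fun z => sqnorm (s z)).
Proof.
move=> hs; apply: (measurability (@RGenOInfty.G R)); first exact: RGenOInfty.measurableE.
move=> _ [_ [c ->] <-]; rewrite setTI.
pose phi l z : R := 2 * rip (s z) (comb l z) - rip (comb l z) (comb l z).
have mphi l : mfun (phi l).
  apply: measurable_funB; last by have [] := measurable_section_comb l (measurable_comb l).
  by apply: measurable_funM => //; have [] := measurable_section_comb l hs.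
have phiE l z : phi l z = sqnorm (s z) - sqnorm (s z - comb l z).
  by rewrite /phi sqnormB -sqnorm_rip; ring.
have [dec hdec] : exists dec : nat -> option (seq (rat * rat * nat)), forall l, exists n, dec n = Some l.
  by exists unpickle => l; exists (pickle l); exact: pickleK.
have -> : (fun z => sqnorm (s z)) @^-1` `]c, +oo[ =
    \bigcup_n (if dec n is Some l then phi l @^-1` `]c, +oo[ else set0).
  apply/seteqP; split=> [z|z [n _]] /=; rewrite in_itv /= andbT.
    move=> h; have e0 : 0 < Num.sqrt (sqnorm (s z) - c) by rewrite sqrtr_gt0 subr_gt0.
    have [l hl] := rational_comb_dense (@etot z) (s z) e0.
    have [n nl] := hdec l; exists n => //; rewrite nl /= in_itv /= andbT phiE.
    have : sqnorm (s z - comb l z) < sqnorm (s z) - c.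
      rewrite -hn_sqr -[ltRHS]sqr_sqrtr ?subr_ge0 1?ltW//.
      by rewrite ltr_sqr ?nnegrE ?hn_ge0 ?sqrtr_ge0.
    lra.
  case: (dec n) => // l /=; rewrite in_itv /= andbT phiE => h.
  by have := sqnorm_ge0 (s z - comb l z); lra.
apply: bigcupT_measurable => n; case: (dec n) => [l|]; last exact: measurable0.
by rewrite -[X in measurable X]setTI; exact: mphi.
Qed.

Lemma measurable_rip s t : S s -> S t -> mfun (fun z => rip (s z) (t z)).
Proof.
move=> hs ht; have -> : (fun z => rip (s z) (t z)) =
    fun z => 2^-1 * (sqnorm (1 *: s z + t z) - sqnorm (s z) - sqnorm (t z)).
  by apply/funext => z; rewrite scale1r sqnormD; field.
apply: measurable_funM => //; apply: measurable_funB; last exact: measurable_sqnorm.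
apply: measurable_funB; last exact: measurable_sqnorm.
by apply: measurable_sqnorm; exact: measurable_sectionD.
Qed.

Lemma measurable_section_ip s t : S s -> S t -> measurable_complex (fun z => ip (s z) (t z)).
Proof.
move=> hs ht; split; first exact: measurable_rip.
have -> : (fun z => complex.Im (ip (s z) (t z))) = fun z => rip (s z) ('i%C *: t z + 0).
  by apply/funext => z; rewrite Im_ip addr0.
by apply: measurable_rip => //; exact: (measurable_sectionD _ ht measurable_section0).
Qed.

Lemma measurable_section_field : measurable_field S.
Proof.
split.
- exact: measurable_sectionD.
- exact: measurable_sqnorm.
- by move=> t ht n; apply: ht; exact: measurable_section_e.
- by exists e; split=> [n|z]; [exact: measurable_section_e|exact: lspan_closure (@etot z)].
Qed.

Lemma measurable_section_indic s (A : set Z) : measurable A -> S s ->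
  S (fun z => if `[< A z >] then s z else 0).
Proof.
move=> mA hs n; have [h1 h2] := hs n.
have E (p : C -> R) : p 0 = 0 -> mfun (fun z => p (ip (s z) (e n z))) ->
    mfun (fun z => p (ip (if `[< A z >] then s z else 0) (e n z))).
  move=> p0 hp; have -> : (fun z => p (ip (if `[< A z >] then s z else 0) (e n z))) =
      fun z => \1_A z * p (ip (s z) (e n z)).
    apply/funext => z; rewrite indicE; case: asboolP => Az.
      by rewrite mem_set// mul1r.
    by rewrite memNset// mul0r ip0l.
  by apply: measurable_funM => //; exact: measurable_indic.
by split; apply: E.
Qed.

End measurable_sections.

(** A triangle inequality for squared norms that can be integrated pointwise; [approx_le] removes
    the constants in the limit. *)
Lemma weak_triangle (R : realType) (V : hilbertType R) (u v : V) (k : R) : 0 < k ->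
  sqnorm (u + v) <= (1 + k) * sqnorm u + (1 + k^-1) * sqnorm v.
Proof.
move=> k0; rewrite sqnormD -subr_ge0.
have -> : (1 + k) * sqnorm u + (1 + k^-1) * sqnorm v - (sqnorm u + 2 * rip u v + sqnorm v) =
    k^-1 * (k ^+ 2 * sqnorm u - 2 * (k * rip u v) + sqnorm v) by field; rewrite gt_eqF.
apply: mulr_ge0; first by rewrite invr_ge0 ltW.
by have := sqnorm_ge0 ((real_complex R k) *: u - v); rewrite sqnormB sqnormZr ripZl.
Qed.

(** Letting [e] and [k] tend to 0. The nested bound is what two successive uses of [weak_triangle]
    leave. *)
Lemma approx_le (R : realType) (x a : R) : 0 <= a ->
  (forall k e : R, 0 < k -> 0 < e -> x <= (1 + k) * ((1 + k) * a + e) + e) -> x <= a.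
Proof.
move=> a0 h.
have h1 k : 0 < k -> x <= (1 + k) * ((1 + k) * a).
  move=> k0; apply/ler_addgt0Pr => e e0.
  have k2 : 0 < 2 + k by rewrite addr_gt0.
  have := h k _ k0 (divr_gt0 e0 k2); congr (_ <= _).
  by field; rewrite gt_eqF.
apply/ler_addgt0Pr => e e0; pose k := Num.min 1 (e / (3 * a + 1)).
have p : 0 < 3 * a + 1 by rewrite ltr_wpDl// mulr_ge0.
have k0 : 0 < k by rewrite lt_min ltr01 divr_gt0.
have k1 : k <= 1 by rewrite ge_min lexx.
have k2 : k * (3 * a + 1) <= e by rewrite -ler_pdivlMr// ge_min lexx orbT.
apply: le_trans (h1 k k0) _.
have ka : 0 <= k * a by rewrite mulr_ge0// ltW.
have kka : 0 <= (1 - k) * (k * a) by rewrite mulr_ge0// subr_ge0.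
nra.
Qed.

Section isometric_extension.
Context {R : realType} {d : measure_display} {Z : measurableType d}.
Local Notation C := R[i].
Variables (mu : {measure set Z -> \bar R}) (K : Z -> hilbertType R) (e : nat -> forall z, K z).
Hypothesis etot : forall z (A : set (K z)), closed_subspace A -> (forall n, A (e n z)) -> forall v, A v.
Hypothesis egram : forall i j, measurable_complex (fun z => ip (e i z) (e j z)).
Local Notation section := (forall z, K z).
Local Notation S := (measurable_section e).
Local Notation mfun f := (measurable_fun setT (f : Z -> R)).
Implicit Types (s t : section).

Definition sq_int s : \bar R := (\int[mu]_z (sqnorm (s z))%:E)%E.

Let msq s : S s -> measurable_fun setT (fun z => (sqnorm (s z))%:E).
Proof. by move=> hs; apply/measurable_EFinP; exact: measurable_sqnorm etot egram _ hs. Qed.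

Lemma sq_int_ge0 s : (0 <= sq_int s)%E.
Proof. by apply: integral_ge0 => z _; rewrite lee_fin sqnorm_ge0. Qed.

Let ZE (q : R) s : 0 <= q -> S s ->
  (\int[mu]_z (q%:E * (sqnorm (s z))%:E) = q%:E * sq_int s)%E.
Proof.
move=> q0 hs; apply: ge0_integralZl_EFin => //; last exact: msq.
by move=> z _; rewrite lee_fin sqnorm_ge0.
Qed.

Lemma sq_intZ (c : C) s : S s -> sq_int (fun z => c *: s z) = ((csq c)%:E * sq_int s)%E.
Proof.
move=> hs; rewrite -ZE ?csq_ge0//; apply: eq_integral => z _.
by rewrite sqnormZ -EFinM.
Qed.

Lemma sq_intD s t (k a b : R) : S s -> S t -> 0 < k -> (sq_int s <= a%:E)%E -> (sq_int t <= b%:E)%E ->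
  (sq_int (fun z => (s z + t z)%R) <= ((1 + k) * a + (1 + k^-1) * b)%:E)%E.
Proof.
move=> hs ht k0 ha hb.
have c1 : 0 <= 1 + k by rewrite addr_ge0// ltW.
have c2 : 0 <= 1 + k^-1 by rewrite addr_ge0// invr_ge0 ltW.
have st : S (fun z => s z + t z).
  by have := measurable_sectionD 1 hs ht; congr S; apply: functional_extensionality_dep => z; rewrite scale1r.
have nn f : forall z, setT z -> (0 <= (sqnorm (f z : K z))%:E)%E by move=> z _; rewrite lee_fin sqnorm_ge0.
apply: (@le_trans _ _ (\int[mu]_z ((1 + k)%:E * (sqnorm (s z))%:E + (1 + k^-1)%:E * (sqnorm (t z))%:E))%E).
  apply: ge0_le_integral => //.
  - exact: nn.
  - exact: msq.
  - by apply: emeasurable_funD; apply: measurable_funeM; exact: msq.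
  - by move=> z _; rewrite -!EFinM -EFinD lee_fin; exact: weak_triangle.
have D : (\int[mu]_z ((1 + k)%:E * (sqnorm (s z))%:E + (1 + k^-1)%:E * (sqnorm (t z))%:E) =
    (1 + k)%:E * sq_int s + (1 + k^-1)%:E * sq_int t)%E.
  rewrite -!ZE//; apply: ge0_integralD => //.
  - by move=> z zT; rewrite mule_ge0 ?lee_fin// sqnorm_ge0.
  - by apply: measurable_funeM; exact: msq.
  - by move=> z zT; rewrite mule_ge0 ?lee_fin// sqnorm_ge0.
  - by apply: measurable_funeM; exact: msq.
by rewrite D [X in (_ <= X)%E]EFinD !EFinM; apply: leeD; apply: lee_wpmul2l; rewrite ?lee_fin.
Qed.

Lemma sq_int_ae0 s : S s -> sq_int s = 0%E -> {ae mu, forall z, s z = 0}.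
Proof.
move=> hs h0; have /(ae_eq_integral_abs mu measurableT (msq hs)) : (\int[mu]_z `|(sqnorm (s z))%:E|)%E = 0%E.
  by rewrite -[RHS]h0; apply: eq_integral => z _; rewrite gee0_abs// lee_fin sqnorm_ge0.
apply: filterS => z /(_ I) [] /eqP; rewrite sqnorm_eq0 => /eqP.
exact.
Qed.

Lemma geometric_cauchy (V : hilbertType R) (u : nat -> V) (c : R) : 0 <= c ->
  (forall n, hn (u n.+1 - u n) <= c * (2^-1) ^+ n) ->
  exists2 v, seq_lim u v & forall n, hn (v - u n) <= 2 * c * (2^-1) ^+ n.
Proof.
move=> c0 h.
have tel n p : hn (u (n + p)%N - u n) <= 2 * c * (2^-1) ^+ n - 2 * c * (2^-1) ^+ (n + p).
  elim: p => [|p IH]; first by rewrite addn0 !subrr hn0.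
  apply: le_trans (hn_tri _ (u (n + p)%N) _) _; have := h (n + p)%N.
  rewrite addnS exprS; move: IH; move: ((2^-1 : R) ^+ (n + p)) ((2^-1 : R) ^+ n) => X Y.
  have -> : 2 * c * (2^-1 * X) = c * X by field.
  lra.
have tel' n m : (n <= m)%N -> hn (u m - u n) <= 2 * c * (2^-1) ^+ n.
  move=> nm; rewrite -(subnKC nm); apply: le_trans (tel _ _) _.
  by rewrite gerBl !mulr_ge0 ?exprn_ge0.
have small (k : R) : 0 < k -> exists n, 2 * c * (2^-1) ^+ n < k.
  move=> k0; have : (fun n => (2 * c) * (2^-1 : R) ^+ n) @ \oo --> (2 * c) * 0.
    by apply: cvgMr; apply: cvg_expr; rewrite ger0_norm// invf_lt1// ltr1n.
  rewrite mulr0 => /cvgrPdist_lt/(_ k k0)[N _ hN]; exists N; have := hN N (leqnn _).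
  by rewrite sub0r normrN ger0_norm// !mulr_ge0 ?exprn_ge0.
have [v hv] : exists v, seq_lim u v.
  apply: seq_cauchy_lim => k k0; have [N hN] := small _ (divr_gt0 k0 (ltr0Sn _ 1)).
  exists N => m n Nm Nn; apply: le_lt_trans (hn_tri _ (u N) _) _.
  have := tel' _ _ Nm; have := tel' _ _ Nn; rewrite (hnB (u N)); lra.
exists v => // n; apply/ler_addgt0Pr => k k0; have [N hN] := hv k k0.
have := hN (maxn N n) (leq_maxl _ _); have := tel' n _ (leq_maxr N n).
have := hn_tri v (u (maxn N n)) (u n); rewrite (hnB v (u (maxn N n))); lra.
Qed.

(* A sequence that is Cauchy in mean with fast decay converges geometrically
   wherever the weighted sum of squared differences is finite. *)
Lemma riesz_fischer (s : nat -> section) : (forall n, S (s n)) ->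
  (forall n, (sq_int (fun z => (s n.+1 z - s n z)%R) <= ((8^-1) ^+ n)%:E)%E) ->
  exists2 t, S t & forall n, (sq_int (fun z => (t z - s n z)%R) <= (8 * (4^-1) ^+ n)%:E)%E.
Proof.
move=> hs fast.
have SB u v : S u -> S v -> S (fun z => u z - v z).
  move=> hu hv; have := measurable_sectionD (- 1) hv hu; congr S.
  by apply: functional_extensionality_dep => z; rewrite scaleN1r addrC.
(* The weight [4 ^ n] against the decay of order [8 ^ n] leaves summable integrals, and still makes
   the differences decay like [2^-n] wherever the sum is finite. *)
pose f n z : \bar R := (4 ^+ n * sqnorm (s n.+1 z - s n z))%:E.
have f0 n z : (0 <= f n z)%E by rewrite lee_fin mulr_ge0 ?exprn_ge0// sqnorm_ge0.
have mf n : measurable_fun setT (f n).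
  apply/measurable_EFinP; apply: measurable_funM => //.
  exact: measurable_sqnorm etot egram _ (SB _ _ (hs _) (hs _)).
pose g z := (\sum_(0 <= n <oo) f n z)%E.
have mg : measurable_fun setT g by apply: ge0_emeasurable_sum.
have g0 z : (0 <= g z)%E by apply: nneseries_ge0.
have intf n : (\int[mu]_z f n z <= (2 / (2 ^ n.+1)%:R)%:E)%E.
  rewrite (_ : (\int[mu]_z f n z = (4 ^+ n)%:E * sq_int (fun z => (s n.+1 z - s n z)%R))%E); last first.
    have c0 : 0 <= 4 ^+ n :> R by rewrite exprn_ge0.
    rewrite -(ZE c0 (SB _ _ (hs n.+1) (hs n))).
    by apply: eq_integral => z _; rewrite /f EFinM.
  apply: le_trans (lee_wpmul2l _ (fast n)) _; first by rewrite lee_fin exprn_ge0.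
  rewrite -EFinM lee_fin -exprMn natrX exprS invfM mulrA divff// mul1r -exprVn.
  by apply: lerXn2r; rewrite ?nnegrE; lra.
have intg : (\int[mu]_z g z <= 2%:E)%E.
  rewrite /g integral_nneseries//; apply: le_trans (epsilon_trick0 xpredT (ler0n R 2)).
  by apply: lee_nneseries => // n _ _; apply: integral_ge0.
pose cv := [set z | g z \is a fin_num].
have mcv : measurable cv by rewrite -[cv]setTI; exact: emeasurable_fin_num.
have step z n : cv z -> hn (s n.+1 z - s n z) <= Num.sqrt (fine (g z)) * (2^-1) ^+ n.
  move=> gz; have : (f n z <= g z)%E.
    apply: le_trans (nneseries_lim_ge n.+1 _) => //.
    by rewrite big_nat_recr//= leeDr// sume_ge0.
  rewrite -{1}(fineK gz) lee_fin => h.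
  have -> : hn (s n.+1 z - s n z) = Num.sqrt (4 ^+ n * sqnorm (s n.+1 z - s n z)) * (2^-1) ^+ n.
    rewrite sqrtrM ?exprn_ge0// (_ : 4 ^+ n = (2 ^+ n) ^+ 2).
      by rewrite sqrtr_sqr ger0_norm ?exprn_ge0// mulrAC -exprMn divff// expr1n mul1r.
    by rewrite -exprM mulnC exprM; congr (_ ^+ n); ring.
  by rewrite ler_wpM2r ?exprn_ge0// ler_wsqrtr.
(* The limit is set to 0 where the weighted sum is infinite; the final estimate holds trivially
   there. *)
have lim z : exists v : K z, (cv z -> seq_lim (s ^~ z) v /\
    forall n, hn (v - s n z) <= 2 * Num.sqrt (fine (g z)) * (2^-1) ^+ n) /\ (~ cv z -> v = 0).
  have [cz|cz] := pselect (cv z); last by exists 0; split.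
  have [v h1 h2] := geometric_cauchy (sqrtr_ge0 _) (fun n => step z n cz).
  by exists v; split.
have {lim} [t ht] : exists t : section, forall z, (cv z -> seq_lim (s ^~ z) (t z) /\
    forall n, hn (t z - s n z) <= 2 * Num.sqrt (fine (g z)) * (2^-1) ^+ n) /\ (~ cv z -> t z = 0).
  by exists (fun z => projT1 (cid (lim z))) => z; exact: (projT2 (cid (lim z))).
have limp z w : (fun m => rip (if `[< cv z >] then s m z else 0) w) @ \oo --> rip (t z) w.
  case: asboolP => cz; last by rewrite (ht z).2// rip0l; exact: cvg_cst.
  apply/cvgrPdist_lt => k k0; have [N hN] := seq_lim_rip w ((ht z).1 cz).1 k0.
  by exists N => // m Nm; rewrite distrC; exact: hN.
have mlim w : S w -> mfun (fun z => rip (t z) (w z)).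
  move=> hw; apply: (measurable_fun_cvg (h := fun m z => rip (if `[< cv z >] then s m z else 0) (w z))).
    by move=> m; apply: (measurable_rip etot egram) => //; exact: measurable_section_indic.
  by move=> z _; exact: limp.
have St : S t.
  move=> n; split; first exact: mlim (measurable_section_e egram n).
  have -> : (fun z => complex.Im (ip (t z) (e n z))) = fun z => rip (t z) ('i%C *: e n z + 0).
    by apply/funext => z; rewrite Im_ip addr0.
  apply: mlim; exact: (measurable_sectionD _ (measurable_section_e egram n) (measurable_section0 e)).
exists t => // n.
have -> : (8 * (4^-1) ^+ n)%:E = ((4 * (4^-1) ^+ n)%:E * 2%:E)%E :> \bar R by rewrite -EFinM; congr _%:E; ring.
have c0 : 0 <= 4 * (4^-1) ^+ n :> R by rewrite mulr_ge0// exprn_ge0.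
apply: le_trans (lee_wpmul2l _ intg); last by rewrite lee_fin.
rewrite -ge0_integralZl_EFin//; apply: ge0_le_integral => //.
- by move=> z _; rewrite lee_fin sqnorm_ge0.
- exact: msq (SB _ _ St (hs n)).
- exact: measurable_funeM.
move=> z _; have [cz|] := boolP (g z \is a fin_num); last first.
  move=> ninf; have -> : g z = +oo%E by apply/eqP; move: ninf; rewrite ge0_fin_numE// -leNgt leye_eq.
  by rewrite gt0_muley ?leey// lte_fin mulr_gt0// exprn_gt0.
rewrite -(fineK cz) -EFinM lee_fin -hn_sqr.
have h := ((ht z).1 cz).2 n.
apply: le_trans (lerXn2r 2 _ _ h) _; rewrite ?nnegrE ?hn_ge0// ?mulr_ge0 ?sqrtr_ge0 ?exprn_ge0//.
rewrite !exprMn sqr_sqrtr ?fine_ge0// -exprM mulnC exprM.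
have -> : (2^-1 : R) ^+ 2 = 4^-1 by field.
by have -> : 2 ^+ 2 * fine (g z) * 4^-1 ^+ n = 4 * 4^-1 ^+ n * fine (g z) :> R by ring.
Qed.

End isometric_extension.

Lemma total_combination (R : realType) (W : hilbertType R) (I : Type) (wv : I -> W) :
  (forall u, (forall i, ip (wv i) u = 0) -> u = 0) ->
  forall w (k : R), 0 < k -> exists l : seq (R[i] * I), hn (w - \sum_(p <- l) p.1 *: wv p.2) < k.
Proof.
move=> wtot w k k0; pose X := [set w | exists l : seq (R[i] * I), w = \sum_(p <- l) p.1 *: wv p.2].
have lX : linear_subspace X.
  split=> [|c u v [l ->] [m ->]]; first by exists [::]; rewrite big_nil.
  exists ([seq (c * p.1, p.2) | p <- l] ++ m); rewrite big_cat big_map scaler_sumr.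
  by congr (_ + _); apply: eq_bigr => p _; rewrite scalerA.
have hA := closure_subspace lX; set A := [set v | _] in hA.
have XA u : X u -> A u by move=> hu e e0; exists u; rewrite ?subrr ?hn0.
suff /(_ k k0) [_ [l ->] h] : A w by exists l.
suff -> : w = hproj A w by exact: hproj_in.
apply/eqP; rewrite -subr_eq0; apply/eqP/wtot => i; rewrite -(hproj_id hA (v := wv i)).
  by rewrite hproj_adj// hproj_eq0 ?ip0r// => s; exact: (hprojP w hA).2.
by apply: XA; exists [:: (1, i)]; rewrite big_seq1 scale1r.
Qed.

(** The vector of least norm on the hyperplane [f = 1] is orthogonal to the kernel of [f]; dividing
    it by its squared norm gives [w0]. *)
Lemma riesz_representation (R : realType) (W : hilbertType R) (f : W -> R) (M : R) :
  (forall u v, f (u + v) = f u + f v) -> (forall (a : R) u, f (a%:C%C *: u) = a * f u) ->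
  (forall u, `|f u| <= M * hn u) -> exists w0, forall w, f w = rip w w0.
Proof.
move=> fD fZ fM; have fN u : f (- u) = - f u by rewrite -scaleN1r (_ : -1 = (-1)%:C%C) ?fZ ?mulN1r// rmorphN1.
have fB u v : f (u - v) = f u - f v by rewrite fD fN.
have [[w1 fw1]|h0] := pselect (exists w, f w != 0); last first.
  by exists 0 => w; rewrite rip0r; apply/eqP; apply: contrapT => /negP h; apply: h0; exists w.
have M0 : 0 <= M + 1.
  have p : 0 < hn w1 by rewrite hn_gt0; apply: contra_neq fw1 => ->; have := fZ 0 0; rewrite scaler0 mul0r.
  by have := le_trans (normr_ge0 _) (fM w1); rewrite pmulr_lge0// => h; rewrite addr_ge0.
have fM1 u : `|f u| <= (M + 1) * hn u by apply: le_trans (fM u) _; rewrite ler_wpM2r ?hn_ge0// lerDl.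
have [|||m Sm hm] := @min_norm R W [set w | f w = 1].
- apply/closed_hn => v hv; apply/eqP; rewrite -subr_eq0 -normr_eq0 eq_le normr_ge0 andbT.
  apply/ler_addgt0Pr => e e0; rewrite add0r.
  have M1 : 0 < M + 1 + 1 by rewrite ltr_wpDl.
  have [s hs vs] := hv _ (divr_gt0 e0 M1); rewrite -hs -fB; apply: le_trans (fM1 _) _.
  apply: le_trans (ler_wpM2l M0 (ltW vs)) _.
  by rewrite mulrA ler_pdivrMr// mulrC ler_wpM2l ?lerDl// ltW.
- by exists ((f w1)^-1%:C%C *: w1); rewrite /= fZ mulVf.
- by move=> u v hu hv; rewrite /mid /= fZ fD hu hv; field.
have m0 : 0 < sqnorm m.
  rewrite sqnorm_gt0; apply: contraTneq isT => m0; move: Sm; rewrite /= m0.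
  by have := fZ 0 0; rewrite scaler0 mul0r => -> /eqP; rewrite eq_sym oner_eq0.
have ker u : f u = 0 -> rip m u = 0.
  move=> fu; have h (t : R) : 0 <= t * rip m u.
    have hf : f (m + t%:C%C *: u) = 1 by rewrite fD fZ fu mulr0 addr0.
    by have := hm _ hf; rewrite ripDr ripZr -sqnorm_rip lerDl.
  apply/eqP; rewrite -sqrf_eq0 eq_le sqr_ge0 andbT.
  by have := h (- rip m u); rewrite mulNr oppr_ge0 expr2.
exists ((sqnorm m)^-1%:C%C *: m) => w; rewrite ripZr.
have /eqP : rip m (w - (f w)%:C%C *: m) = 0 by apply: ker; rewrite fB fZ Sm mulr1 subrr.
rewrite ripBr ripZr -sqnorm_rip subr_eq0 ripC => /eqP ->.
by rewrite mulrCA mulVf ?mulr1// gt_eqF.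
Qed.

(** * Isometries given by matching Gram matrices *)

Section approximation.
Context {R : realType} {d : measure_display} {Z : measurableType d}.
Local Notation C := R[i].
Variables (mu : {measure set Z -> \bar R}) (K : Z -> hilbertType R) (e : nat -> forall z, K z).
Hypothesis etot : forall z (A : set (K z)), closed_subspace A -> (forall n, A (e n z)) -> forall v, A v.
Hypothesis egram : forall i j, measurable_complex (fun z => ip (e i z) (e j z)).
Local Notation section := (forall z, K z).
Local Notation S := (measurable_section e).
Local Notation sq_int := (sq_int mu).
Implicit Types (s t : section).
Hypothesis muT : (mu setT < +oo)%E.
Variables (W : hilbertType R) (I : Type) (wv : I -> W) (sv : I -> section).
Hypothesis Ssv : forall i, S (sv i).
Hypothesis gram : forall i j, exists (c : C) (B : set Z), [/\ measurable B,
  forall z, ip (sv i z) (sv j z) = c * (\1_B z)%:C%C & ip (wv i) (wv j) = c * (fine (mu B))%:C%C].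
Hypothesis wtot : forall u, (forall i, ip (wv i) u = 0) -> u = 0.

Let SB u v : S u -> S v -> S (fun z => u z - v z).
Proof.
move=> hu hv; have := measurable_sectionD (- 1) hv hu; congr S.
by apply: functional_extensionality_dep => z; rewrite scaleN1r addrC.
Qed.

Let mufin B : measurable B -> mu B \is a fin_num.
Proof.
move=> mB; rewrite ge0_fin_numE//; apply: le_lt_trans muT.
by apply: le_measure => //; rewrite inE//; exact: measurableT.
Qed.

Lemma integral_simple (J : Type) (l : seq J) (a : J -> R) (B : J -> set Z) :
  (forall j, measurable (B j)) ->
  mu.-integrable setT (fun z => (\sum_(j <- l) a j * \1_(B j) z)%:E) /\
  (\int[mu]_z (\sum_(j <- l) a j * \1_(B j) z)%:E = (\sum_(j <- l) a j * fine (mu (B j)))%:E)%E.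
Proof.
move=> mB; elim: l => [|j l [IH1 IH2]].
  have E : (fun z => (\sum_(j <- [::]) a j * \1_(B j) z)%:E) = (cst 0%E : Z -> \bar R).
    by apply/funext => z; rewrite big_nil.
  by rewrite E big_nil; split; [exact: integrable0|exact: integral0].
have E : (fun z => (\sum_(j <- j :: l) a j * \1_(B j) z)%:E) =
    (fun z => (a j)%:E * (\1_(B j) z)%:E + (\sum_(j <- l) a j * \1_(B j) z)%:E)%E.
  by apply/funext => z; rewrite big_cons EFinD EFinM.
have i1 : mu.-integrable setT (fun z => (\1_(B j) z)%:E).
  apply/integrableP; split; first exact/measurable_EFinP.
  rewrite (eq_integral (fun z => (\1_(B j) z)%:E)); last by move=> z _; rewrite gee0_abs// lee_fin.
  by rewrite integral_indic// setIT -ge0_fin_numE// mufin.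
rewrite E; split; first by apply: integrableD => //; exact: integrableZl.
rewrite integralD//; last exact: integrableZl.
by rewrite integralZl// integral_indic// setIT IH2 big_cons EFinD EFinM fineK// mufin.
Qed.

Definition wcomb (l : seq (C * I)) : W := \sum_(p <- l) p.1 *: wv p.2.
Definition scomb (l : seq (C * I)) : section := fun z => \sum_(p <- l) p.1 *: sv p.2 z.

Lemma wcomb_cat l m : wcomb (l ++ m) = wcomb l + wcomb m.
Proof. by rewrite /wcomb big_cat. Qed.

Lemma scomb_cat l m z : scomb (l ++ m) z = scomb l z + scomb m z.
Proof. by rewrite /scomb big_cat. Qed.

Lemma wcomb_scale (c : C) l : wcomb [seq (c * p.1, p.2) | p <- l] = c *: wcomb l.
Proof. by rewrite /wcomb big_map scaler_sumr; apply: eq_bigr => p _; rewrite scalerA. Qed.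

Lemma scomb_scale (c : C) l z : scomb [seq (c * p.1, p.2) | p <- l] z = c *: scomb l z.
Proof. by rewrite /scomb big_map scaler_sumr; apply: eq_bigr => p _; rewrite scalerA. Qed.

Lemma Sscomb l : S (scomb l).
Proof.
elim: l => [|p l IH].
  have -> : scomb [::] = fun=> 0 by apply: functional_extensionality_dep => z; rewrite /scomb big_nil.
  exact: measurable_section0.
have -> : scomb (p :: l) = fun z => p.1 *: sv p.2 z + scomb l z.
  by apply: functional_extensionality_dep => z; rewrite /scomb big_cons.
exact: measurable_sectionD.
Qed.

(** Inner products of generating sections are multiples of indicators whose integrals are the inner
    products of the generating vectors, so both sides expand into the same double sum. *)
Lemma sq_int_scomb l : sq_int (scomb l) = (sqnorm (wcomb l))%:E.
Proof.
have ch (q : I * I) : exists cB : C * set Z, [/\ measurable cB.2,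
    forall z, ip (sv q.1 z) (sv q.2 z) = cB.1 * (\1_(cB.2) z)%:C%C &
    ip (wv q.1) (wv q.2) = cB.1 * (fine (mu cB.2))%:C%C].
  by have [c [B h]] := gram q.1 q.2; exists (c, B).
have [f hf] := choice ch.
pose J := ((C * I) * (C * I))%type.
pose a (j : J) : R := complex.Re (j.1.1 * (j.2.1)^*%C * (f (j.1.2, j.2.2)).1).
pose B (j : J) := (f (j.1.2, j.2.2)).2.
have mB j : measurable (B j) by case: (hf (j.1.2, j.2.2)).
have reM (c : C) (x : R) : complex.Re (c * x%:C%C) = complex.Re c * x.
  by case: c => u v /=; rewrite mulr0 subr0.
have sE z : sqnorm (scomb l z) = \sum_(j <- [seq (p, q) | p <- l, q <- l]) a j * \1_(B j) z.
  rewrite big_allpairs_dep /= /sqnorm /scomb ip_suml raddf_sum; apply: eq_bigr => p _.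
  rewrite ip_sumr raddf_sum; apply: eq_bigr => q _.
  rewrite ipZl ipZr mulrA; have [_ -> _] := hf (p.2, q.2).
  by rewrite mulrA; exact: reM.
have wE : sqnorm (wcomb l) = \sum_(j <- [seq (p, q) | p <- l, q <- l]) a j * fine (mu (B j)).
  rewrite big_allpairs_dep /= /sqnorm /wcomb ip_suml raddf_sum; apply: eq_bigr => p _.
  rewrite ip_sumr raddf_sum; apply: eq_bigr => q _.
  rewrite ipZl ipZr mulrA; have [_ _ ->] := hf (p.2, q.2).
  by rewrite mulrA; exact: reM.
rewrite wE -(integral_simple [seq (p, q) | p <- l, q <- l] a mB).2.
by apply: eq_integral => z _; rewrite sE.
Qed.

(** The graph of the isometry from [W] to square integrable sections: both sides are approximated by
    the same combinations. It is a relation because sections are determined only almost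
    everywhere. *)
Definition approx (w : W) s : Prop := S s /\ forall k : R, 0 < k -> exists l,
  sqnorm (w - wcomb l) <= k /\ (sq_int (fun z => (s z - scomb l z)%R) <= k%:E)%E.

Lemma approx_comb l : approx (wcomb l) (scomb l).
Proof.
split=> [|k k0]; first exact: Sscomb.
exists l; rewrite subrr sqnorm0 ltW//; split=> //; rewrite (_ : sq_int _ = 0%E) ?lee_fin ?ltW//.
by rewrite /sq_int; under eq_integral do rewrite subrr sqnorm0; exact: integral0.
Qed.

Lemma approx_lin (c : C) u v s t : approx u s -> approx v t ->
  approx (c *: u + v) (fun z => c *: s z + t z).
Proof.
move=> [hs as_] [ht at_]; split=> [|k k0]; first exact: measurable_sectionD.
pose m := 2 * (csq c + 1).
have m0 : 0 < m by rewrite mulr_gt0// ltr_wpDl// csq_ge0.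
have k1 : 0 < k / m by rewrite divr_gt0.
have [l [l1 l2]] := as_ _ k1; have [q [q1 q2]] := at_ _ k1.
have bnd : (1 + 1) * (csq c * (k / m)) + (1 + 1^-1) * (k / m) = k.
  by rewrite /m invr1; field; rewrite gt_eqF// ltr_wpDl// csq_ge0.
exists ([seq (c * p.1, p.2) | p <- l] ++ q); rewrite wcomb_cat wcomb_scale; split.
  rewrite opprD addrACA -scalerBr; apply: le_trans (weak_triangle _ _ ltr01) _.
  rewrite sqnormZ -/(csq c) -[leRHS]bnd.
  by apply: lerD; apply: ler_wpM2l => //; apply: ler_wpM2l => //; exact: csq_ge0.
have -> : (fun z => c *: s z + t z - scomb ([seq (c * p.1, p.2) | p <- l] ++ q) z) =
    fun z => c *: (s z - scomb l z) + (t z - scomb q z).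
  by apply: functional_extensionality_dep => z; rewrite scomb_cat scomb_scale opprD addrACA -scalerBr.
have S1 := SB hs (Sscomb l).
have S2 : S (fun z => c *: (s z - scomb l z)).
  have := measurable_sectionD c S1 (measurable_section0 e); congr S.
  by apply: functional_extensionality_dep => z; rewrite addr0.
have h1 : (sq_int (fun z => (c *: (s z - scomb l z))%R) <= (csq c * (k / m))%:E)%E.
  by rewrite (sq_intZ mu etot egram _ S1) EFinM lee_wpmul2l// lee_fin csq_ge0.
by have := sq_intD etot egram S2 (SB ht (Sscomb q)) ltr01 h1 q2; rewrite bnd.
Qed.

Lemma approx_sq_int w s : approx w s -> sq_int s = (sqnorm w)%:E.
Proof.
move=> [hs ap].
have tri (b : R) (x y : section) k d0 : S x -> S y -> 0 < k -> 0 < d0 ->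
    (sq_int y <= b%:E)%E -> (sq_int (fun z => (x z - y z)%R) <= (d0 / (1 + k^-1))%:E)%E ->
    (sq_int x <= ((1 + k) * b + d0)%:E)%E.
  move=> hx hy k0 d00 yb xy.
  have kk : 1 + k^-1 != 0 by rewrite gt_eqF// addr_gt0// invr_gt0.
  have dE : (1 + k^-1) * (d0 / (1 + k^-1)) = d0 by rewrite mulrC divfK.
  have xE : x = fun z => y z + (x z - y z).
    by apply: functional_extensionality_dep => z; rewrite addrCA subrr addr0.
  by rewrite [in X in (X <= _)%E]xE -[in X in (_ <= X)%E]dE; exact: (sq_intD etot egram hy (SB hx hy) k0 yb xy).
have triw (u v : W) (k d0 : R) : 0 < k -> sqnorm (u - v) <= d0 / (1 + k^-1) ->
    sqnorm u <= (1 + k) * sqnorm v + d0.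
  move=> k0 uv; have kk : 0 < 1 + k^-1 by rewrite addr_gt0// invr_gt0.
  have := weak_triangle v (u - v) k0; rewrite addrC subrK => h; apply: le_trans h _.
  by rewrite lerD2l mulrC -ler_pdivlMr.
have up : (sq_int s <= (sqnorm w)%:E)%E.
  have fin0 : sq_int s \is a fin_num.
    have p11 : 0 < 1^-1 :> R by rewrite invr1.
    have [l [_ l2]] := ap (1 / (1 + 1^-1)) (divr_gt0 ltr01 (addr_gt0 ltr01 p11)).
    rewrite ge0_fin_numE ?sq_int_ge0//; apply: le_lt_trans (ltry _).
    by apply: (tri (sqnorm (wcomb l)) s (scomb l) 1 1) => //; [exact: Sscomb|rewrite sq_int_scomb].
  rewrite -(fineK fin0) lee_fin; apply: approx_le; first exact: sqnorm_ge0.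
  move=> k d0 k0 d00.
  have kk : 0 < 1 + k^-1 by rewrite addr_gt0// invr_gt0.
  have [l [l1 l2]] := ap _ (divr_gt0 d00 kk).
  rewrite -lee_fin (fineK fin0); apply: (tri _ s (scomb l)) => //; first exact: Sscomb.
  rewrite sq_int_scomb lee_fin; apply: triw => //.
  by rewrite -sqnormN opprB.
apply/eqP; rewrite eq_le up /=.
have fin0 : sq_int s \is a fin_num by rewrite ge0_fin_numE ?sq_int_ge0//; exact: le_lt_trans up (ltry _).
rewrite -(fineK fin0) lee_fin; apply: approx_le; first by rewrite fine_ge0// sq_int_ge0.
move=> k d0 k0 d00.
have kk : 0 < 1 + k^-1 by rewrite addr_gt0// invr_gt0.
have [l [l1 l2]] := ap _ (divr_gt0 d00 kk).
apply: (le_trans (triw w (wcomb l) k d0 k0 l1)); rewrite lerD2r ler_wpM2l//; first by rewrite addr_ge0// ltW.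
rewrite -lee_fin -sq_int_scomb; apply: (tri _ (scomb l) s) => //; [exact: Sscomb|by rewrite fineK|].
have -> : sq_int (fun z => scomb l z - s z) = sq_int (fun z => s z - scomb l z).
  by apply: eq_integral => z _; rewrite -sqnormN opprB.
exact: l2.
Qed.

Lemma approx_unique w s t : approx w s -> approx w t -> {ae mu, forall z, s z = t z}.
Proof.
move=> hs ht; have := approx_lin (- 1) ht hs; rewrite scaleN1r addNr => h.
have := sq_int_ae0 (mu := mu) etot egram h.1; have -> := approx_sq_int h; rewrite sqnorm0 => /(_ erefl).
by apply: filterS => z; rewrite scaleN1r addrC => /eqP; rewrite subr_eq0 => /eqP.
Qed.

Lemma approx_exists w : exists s, approx w s.
Proof.
(* The factor 4 leaves room for [weak_triangle] with [k = 1]: consecutive combinations then satisfy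
   the bound that [riesz_fischer] requires. *)
have ch n : exists l, sqnorm (w - wcomb l) <= 8^-1 ^+ n / 4.
  have p : 0 < 8^-1 ^+ n / 4 :> R by rewrite divr_gt0// exprn_gt0// invr_gt0.
  have q : 0 < Num.sqrt (8^-1 ^+ n / 4 : R) by rewrite sqrtr_gt0.
  have [l hl] := total_combination wtot w q; exists l.
  by rewrite -ler_sqrt ?ltW//; exact: ltW.
have [l hl] := choice ch.
have [|n|t St ht] := @riesz_fischer _ _ _ mu K e etot egram (fun n => scomb (l n)).
- by move=> n; exact: Sscomb.
- have -> : (fun z => scomb (l n.+1) z - scomb (l n) z) = scomb (l n.+1 ++ [seq (-1 * p.1, p.2) | p <- l n]).
    by apply: functional_extensionality_dep => z; rewrite scomb_cat scomb_scale scaleN1r.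
  rewrite sq_int_scomb wcomb_cat wcomb_scale lee_fin scaleN1r.
  have -> : wcomb (l n.+1) - wcomb (l n) = (w - wcomb (l n)) + (wcomb (l n.+1) - w).
    by rewrite [RHS]addrC addrA subrK.
  apply: le_trans (weak_triangle _ _ ltr01) _; rewrite -(sqnormN (wcomb _ - w)) opprB invr1.
  have := hl n; have := hl n.+1; rewrite exprS.
  have : 0 <= 8^-1 ^+ n :> R by rewrite exprn_ge0// invr_ge0.
  move: (8^-1 ^+ n) => X; lra.
exists t; split=> // k k0.
have [n hn] : exists n, 8 * 4^-1 ^+ n < k.
  have : (fun n => 8 * (4^-1 : R) ^+ n) @ \oo --> (8 * 0 : R).
    by apply: cvgMr; apply: cvg_expr; rewrite ger0_norm ?invr_ge0// invf_lt1// ltr1n.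
  rewrite mulr0 => /cvgrPdist_lt/(_ k k0)[N _ hN]; exists N; have := hN N (leqnn _).
  by rewrite sub0r normrN ger0_norm// mulr_ge0// exprn_ge0// invr_ge0.
exists (l n); split; last by apply: le_trans (ht n) _; rewrite lee_fin ltW.
apply: le_trans (hl n) _; apply: le_trans (ltW hn).
have h8 : (8^-1 : R) ^+ n <= 4^-1 ^+ n by apply: lerXn2r; rewrite ?nnegrE; lra.
have : 0 <= 8^-1 ^+ n :> R by rewrite exprn_ge0// invr_ge0.
by move: h8; move: (8^-1 ^+ n) (4^-1 ^+ n) => X Y; lra.
Qed.

Definition sq_finite s := S s /\ (sq_int s < +oo)%E.

Lemma integrable_rip s t : sq_finite s -> sq_finite t ->
  mu.-integrable setT (fun z => (rip (s z) (t z))%:E).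
Proof.
have isq u : sq_finite u -> mu.-integrable setT (fun z => (sqnorm (u z))%:E).
  move=> [hu fu]; apply/integrableP; split; first by apply/measurable_EFinP; exact: (measurable_sqnorm etot egram hu).
  rewrite (eq_integral (fun z => (sqnorm (u z))%:E))// => z _.
  by rewrite gee0_abs// lee_fin sqnorm_ge0.
move=> hs ht; apply: (le_integrable measurableT _ _ (integrableD measurableT (isq _ hs) (isq _ ht))).
  by apply/measurable_EFinP; exact: (measurable_rip etot egram hs.1 ht.1).
move=> z _; rewrite -EFinD lee_fin [leRHS]ger0_norm ?addr_ge0 ?sqnorm_ge0//.
have := sqnorm_ge0 (s z - t z); rewrite sqnormB; have := sqnorm_ge0 (s z + t z); rewrite sqnormD.
have := sqnorm_ge0 (s z); have := sqnorm_ge0 (t z).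
by move=> *; rewrite ler_norml; apply/andP; split; lra.
Qed.

Definition rip_int s t : R := fine (\int[mu]_z (rip (s z) (t z))%:E)%E.

Let fint s t : sq_finite s -> sq_finite t ->
  (\int[mu]_z (rip (s z) (t z))%:E)%E \is a fin_num.
Proof. by move=> hs ht; apply: integral_fune_fin_num => //; exact: integrable_rip. Qed.

Lemma rip_intC s t : rip_int s t = rip_int t s.
Proof. by rewrite /rip_int; under eq_integral do rewrite ripC. Qed.

Lemma rip_intD s t u : sq_finite s -> sq_finite t -> sq_finite u ->
  rip_int s (fun z => t z + u z) = rip_int s t + rip_int s u.
Proof.
move=> hs ht hu; rewrite /rip_int -fineD; try exact: fint.
rewrite -integralD//; try exact: integrable_rip.
by congr fine; apply: eq_integral => z _; rewrite ripDr EFinD.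
Qed.

Lemma rip_intZ s t (a : R) : sq_finite s -> sq_finite t ->
  rip_int s (fun z => a%:C%C *: t z) = a * rip_int s t.
Proof.
move=> hs ht; rewrite /rip_int -[a in RHS]/(fine a%:E) -fineM//; last exact: fint.
rewrite -integralZl//; last exact: integrable_rip.
by congr fine; apply: eq_integral => z _; rewrite ripZr EFinM.
Qed.

Lemma rip_int_ae s t u : sq_finite s -> sq_finite t -> sq_finite u ->
  {ae mu, forall z, t z = u z} -> rip_int s t = rip_int s u.
Proof.
move=> hs ht hu tu; congr fine; apply: ae_eq_integral => //.
- by apply/measurable_EFinP; exact: (measurable_rip etot egram hs.1 ht.1).
- by apply/measurable_EFinP; exact: (measurable_rip etot egram hs.1 hu.1).
- by apply: filterS tu => z -> _.
Qed.

Lemma sq_finiteD (c : C) s t : sq_finite s -> sq_finite t -> sq_finite (fun z => c *: s z + t z).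
Proof.
move=> [hs fs] [ht ft]; split; first exact: measurable_sectionD.
have S1 : S (fun z => c *: s z).
  have := measurable_sectionD c hs (measurable_section0 e); congr S.
  by apply: functional_extensionality_dep => z; rewrite addr0.
have fin (u : section) : (sq_int u < +oo)%E -> exists a : R, (sq_int u <= a%:E)%E.
  by move=> fu; exists (fine (sq_int u)); rewrite fineK// ge0_fin_numE// sq_int_ge0.
have [|a ha] := fin (fun z => c *: s z).
  rewrite (sq_intZ mu etot egram _ hs) -ge0_fin_numE; last by rewrite mule_ge0 ?sq_int_ge0// lee_fin csq_ge0.
  by rewrite fin_numM// ge0_fin_numE// sq_int_ge0.
have [b hb] := fin _ ft.
exact: le_lt_trans (sq_intD etot egram S1 ht ltr01 ha hb) (ltry _).
Qed.

(* A square integrable section defines a bounded functional on W, and the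
   difference from the section representing its Riesz vector is orthogonal to
   every generating section. *)
Lemma approx_surjective :
  (forall t, sq_finite t -> (forall i (c : C), rip_int t (fun z => c *: sv i z) = 0) ->
     {ae mu, forall z, t z = 0}) ->
  forall s, sq_finite s -> exists w, forall t, approx w t -> {ae mu, forall z, t z = s z}.
Proof.
move=> hperp s hs; have [Phi hPhi] := choice approx_exists.
have fP w : sq_finite (Phi w).
  by split; [exact: (hPhi w).1|rewrite (approx_sq_int (hPhi w)) ltry].
have PD (c : C) u v : {ae mu, forall z, Phi (c *: u + v) z = c *: Phi u z + Phi v z}.
  by apply: (approx_unique (hPhi _)); exact: approx_lin.
have PD1 u v : {ae mu, forall z, Phi (u + v) z = Phi u z + Phi v z}.
  by have := PD 1 u v; rewrite scale1r; apply: filterS => z ->; rewrite scale1r.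
have P0 : {ae mu, forall z, Phi 0 z = 0}.
  by have := PD (- 1) 0 0; rewrite scaler0 addr0; apply: filterS => z ->; rewrite scaleN1r addNr.
have PZ (c : C) u : {ae mu, forall z, Phi (c *: u) z = c *: Phi u z}.
  have := PD c u 0; rewrite addr0 => h.
  by apply: filterS2 h P0 => z -> ->; rewrite addr0.
have f0 : sq_finite (fun z => 0).
  by split; [exact: measurable_section0|rewrite /sq_int; under eq_integral do rewrite sqnorm0; rewrite integral0 ltry].
have fD t u : sq_finite t -> sq_finite u -> sq_finite (fun z => t z + u z).
  move=> ht hu; have := sq_finiteD 1 ht hu; congr sq_finite.
  by apply: functional_extensionality_dep => z; rewrite scale1r.
have fZ (c : C) t : sq_finite t -> sq_finite (fun z => c *: t z).
  move=> ht; have := sq_finiteD c ht f0; congr sq_finite.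
  by apply: functional_extensionality_dep => z; rewrite addr0.
pose f w := rip_int s (Phi w).
have JD t u v : sq_finite t -> rip_int t (Phi (u + v)) = rip_int t (Phi u) + rip_int t (Phi v).
  by move=> ht; rewrite (rip_int_ae ht (fP _) (fD _ _ (fP u) (fP v)) (PD1 u v)) rip_intD.
have JZ t (a : R) u : sq_finite t -> rip_int t (Phi (a%:C%C *: u)) = a * rip_int t (Phi u).
  by move=> ht; rewrite (rip_int_ae ht (fP _) (fZ _ _ (fP u)) (PZ _ u)) rip_intZ.
have Jself t : sq_finite t -> (rip_int t t)%:E = sq_int t.
  move=> ht; rewrite /rip_int fineK; last exact: fint.
  by apply: eq_integral => z _; rewrite sqnorm_rip.
have JP u v : rip_int (Phi u) (Phi v) = rip u v.
  have Js w : rip_int (Phi w) (Phi w) = sqnorm w by apply/EFin_inj; rewrite Jself// (approx_sq_int (hPhi w)).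
  have := Js (u + v); rewrite JD// ![rip_int (Phi (u + v)) _]rip_intC !JD// !Js sqnormD.
  by rewrite (rip_intC (Phi v)); lra.
(* From the positivity of the squared norms of [s + Phi u] and [s - Phi u]; homogeneity turns this
   into a bound linear in the norm of [u]. *)
have bound u : `|f u| <= (rip_int s s + sqnorm u) / 2.
  have pos t : sq_finite t -> 0 <= rip_int t t by move=> ht; rewrite -lee_fin Jself// sq_int_ge0.
  have J2 (c : R) : rip_int (fun z => s z + c%:C%C *: Phi u z) (fun z => s z + c%:C%C *: Phi u z) =
      rip_int s s + 2 * (c * f u) + c ^+ 2 * sqnorm u.
    have h1 := fZ c%:C%C _ (fP u); have h2 := fD _ _ hs h1.
    rewrite rip_intD// rip_intZ// ![rip_int (fun z => s z + _) _]rip_intC !rip_intD// !rip_intZ//.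
    by rewrite JP -sqnorm_rip (rip_intC (Phi u)) -/(f u); ring.
  have := pos _ (fD _ _ hs (fZ (1 : R)%:C%C _ (fP u))); rewrite J2.
  have := pos _ (fD _ _ hs (fZ (-1 : R)%:C%C _ (fP u))); rewrite J2 => *.
  by rewrite ler_norml; apply/andP; split; lra.
have [w0 hw0] : exists w0, forall w, f w = rip w w0.
  apply: (@riesz_representation _ _ f ((rip_int s s + 1) / 2)) => [u v|a u|u].
  - exact: JD.
  - exact: JZ.
  have [->|u0] := eqVneq u 0.
    by rewrite hn0 mulr0 (_ : f 0 = 0) ?normr0//; have := JZ s 0 0 hs; rewrite scaler0 mul0r.
  have p : 0 < hn u by rewrite hn_gt0.
  have uE : u = (hn u)%:C%C *: ((hn u)^-1%:C%C *: u).
    by rewrite scalerA -rmorphM divff ?gt_eqF// rmorph1 scale1r.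
  rewrite {1}uE /f JZ// normrM (ger0_norm (ltW p)) mulrC ler_wpM2r ?(ltW p)//.
  by apply: le_trans (bound _) _; rewrite sqnormZr -hn_sqr -exprMn mulVf ?gt_eqF// expr1n.
exists w0 => t ht.
have h1 : {ae mu, forall z, (s z - Phi w0 z) = 0}.
  have fN : sq_finite (fun z => s z - Phi w0 z).
    have := fD _ _ hs (fZ (- 1) _ (fP w0)); congr sq_finite.
    by apply: functional_extensionality_dep => z; rewrite scaleN1r.
  apply: hperp => // i c.
  have ap : approx (c *: wv i) (fun z => c *: sv i z).
    have := approx_comb [:: (c, i)]; congr approx; rewrite ?/wcomb ?big_seq1//.
    by apply: functional_extensionality_dep => z; rewrite /scomb big_seq1.
  have fs : sq_finite (fun z => c *: sv i z) by split; [exact: ap.1|rewrite (approx_sq_int ap) ltry].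
  rewrite -(rip_int_ae fN (fP _) fs (approx_unique (hPhi (c *: wv i)) ap)).
  have -> : (fun z => s z - Phi w0 z) = fun z => s z + (- 1)%:C%C *: Phi w0 z.
    by apply: functional_extensionality_dep => z; rewrite rmorphN1 scaleN1r.
  rewrite rip_intC rip_intD ?rip_intZ//; last exact: fZ.
  by rewrite rip_intC -/(f _) hw0 JP ripC; lra.
apply: filterS2 h1 (approx_unique ht (hPhi w0)) => z /eqP + ->.
by rewrite subr_eq0 => /eqP.
Qed.

End approximation.

(** * Direct integrals of cyclic representations *)

Section cyclic_fields.
Context {R : realType} {d : measure_display} {Z : measurableType d} {G : topologicalGroupType}.
Local Notation C := R[i].
Variables (mu : {measure set Z -> \bar R}) (K : Z -> hilbertType R).
Variables (pi : forall z, G -> K z -> K z) (ev : forall z, K z) (D : nat -> G).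
Arguments pi : clear implicits.
Variables (W : hilbertType R) (rho : G -> W -> W) (eta : nat -> W) (A : nat -> set Z).
Local Notation section := (forall z, K z).
Let e n : section := fun z => pi z (D n) (ev z).
Local Notation S := (measurable_section e).
Hypothesis muT : (mu setT < +oo)%E.
Hypothesis hpi : forall z, isometric_action (pi z).
Hypothesis hrho : isometric_action rho.
Hypothesis etot : forall z (X : set (K z)), closed_subspace X ->
  (forall n, X (pi z (D n) (ev z))) -> forall v, X v.
Hypothesis evm : forall g, measurable_complex (fun z => ip (pi z g (ev z)) (ev z)).
Hypothesis ev1 : forall z, sqnorm (ev z) <= 1.
Hypothesis mA : forall j, measurable (A j).
Hypothesis gram : forall g i j, exists (c : C) (B : set Z), [/\ measurable B,
  forall z, (if `[< A i z /\ A j z >] then ip (pi z g (ev z)) (ev z) else 0) = c * (\1_B z)%:C%C &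
  ip (rho g (eta i)) (eta j) = c * (fine (mu B))%:C%C].
Hypothesis wtot : forall u, (forall g j, ip (rho g (eta j)) u = 0) -> u = 0.
Hypothesis sep : forall f : Z -> R, mu.-integrable setT (EFin \o f) ->
  (forall j, (\int[mu]_(z in A j) (f z)%:E = 0)%E) -> {ae mu, forall z, f z = 0}.

Let actV (V : hilbertType R) (act : G -> V -> V) g h u v : isometric_action act ->
  ip (act g u) (act h v) = ip (act (h^-1 * g)%g u) v.
Proof. by move=> [_ hip h1 hM]; rewrite -(hip h _ v) -hM mulKVg. Qed.

Let egram i j : measurable_complex (fun z => ip (e i z) (e j z)).
Proof.
have -> : (fun z => ip (e i z) (e j z)) = fun z => ip (pi z ((D j)^-1 * D i)%g (ev z)) (ev z).
  by apply/funext => z; rewrite /e actV.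
exact: evm.
Qed.

Let Sev g : S (fun z => pi z g (ev z)).
Proof.
move=> n; have -> : (fun z => ip (pi z g (ev z)) (e n z)) = fun z => ip (pi z ((D n)^-1 * g)%g (ev z)) (ev z).
  by apply/funext => z; rewrite /e actV.
exact: evm.
Qed.

Let Spi g s : S s -> S (fun z => pi z g (s z)).
Proof.
move=> hs n; have -> : (fun z => ip (pi z g (s z)) (e n z)) = fun z => ip (s z) (pi z (g^-1 * D n)%g (ev z)).
  apply/funext => z; have [_ hip _ hM] := hpi z.
  by rewrite -(hip g (s z)) -hM mulKVg.
exact: (measurable_section_ip etot egram hs (Sev _)).
Qed.

Let wv (p : G * nat) := rho p.1 (eta p.2).
Let sv (p : G * nat) : section := fun z => if `[< A p.2 z >] then pi z p.1 (ev z) else 0.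

Let Ssv p : S (sv p).
Proof. exact: measurable_section_indic (mA _) (Sev _). Qed.

Let gram' i j : exists (c : C) (B : set Z), [/\ measurable B,
  forall z, ip (sv i z) (sv j z) = c * (\1_B z)%:C%C & ip (wv i) (wv j) = c * (fine (mu B))%:C%C].
Proof.
have [c [B [mB h1 h2]]] := gram (j.1^-1 * i.1)%g i.2 j.2; exists c, B; split=> // [z|]; last first.
  by rewrite /wv actV.
rewrite -h1 /sv; have [hi|hi] := pselect (A i.2 z); last first.
  by rewrite !(asboolF hi) ip0l asboolF// => -[].
have [hj|hj] := pselect (A j.2 z); last by rewrite !(asboolF hj) ip0r asboolF// => -[].
by rewrite !asboolT// actV.
Qed.

Let wtot' u : (forall i, ip (wv i) u = 0) -> u = 0.
Proof. by move=> h; apply: wtot => g j; exact: (h (g, j)). Qed.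

Local Notation apx := (approx mu e wv sv).

Let apx_rho g w s : apx w s -> apx (rho g w) (fun z => pi z g (s z)).
Proof.
move=> [hs hap]; split=> [|k k0]; first exact: Spi.
have [l [l1 l2]] := hap k k0; exists [seq (p.1, ((g * p.2.1)%g, p.2.2)) | p <- l].
have [lrho iprho _ Mrho] := hrho; split.
  have -> : wcomb wv [seq (p.1, ((g * p.2.1)%g, p.2.2)) | p <- l] = rho g (wcomb wv l).
    rewrite /wcomb big_map; elim: l {l1 l2} => [|p l IH]; first by rewrite !big_nil (lin0 (lrho g)).
    by rewrite !big_cons lrho -IH /wv /= Mrho.
  by rewrite -(linB (lrho g)) /sqnorm iprho.
congr (_ <= _)%E: l2; apply: eq_integral => z _; have [lpi ippi _ Mpi] := hpi z.
have -> : scomb sv [seq (p.1, ((g * p.2.1)%g, p.2.2)) | p <- l] z = pi z g (scomb sv l z).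
  rewrite /scomb big_map; elim: l {l1} => [|p l IH]; first by rewrite !big_nil (lin0 (lpi g)).
  rewrite !big_cons lpi -IH /sv /=; congr (_ *: _ + _).
  by case: asboolP => _; rewrite ?Mpi// (lin0 (lpi g)).
by rewrite -(linB (lpi g)) /sqnorm ippi.
Qed.

Let fin_ev (c : C) g : sq_finite mu e (fun z => c *: pi z g (ev z)).
Proof.
have hS : S (fun z => c *: pi z g (ev z)).
  have := measurable_sectionD c (Sev g) (measurable_section0 e); congr S.
  by apply: functional_extensionality_dep => z; rewrite addr0.
split=> //; apply: (@le_lt_trans _ _ (\int[mu]_z (cst (csq c)%:E z))%E).
  apply: ge0_le_integral => //.
  - by move=> z _; rewrite lee_fin sqnorm_ge0.
  - by apply/measurable_EFinP; exact: (measurable_sqnorm etot egram hS).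
  - move=> z _; rewrite lee_fin sqnormZ -/(csq c) -[leRHS]mulr1 ler_wpM2l ?csq_ge0//.
    by have [_ hip _ _] := hpi z; rewrite /sqnorm hip; exact: ev1.
by rewrite integral_cst// lte_mul_pinfty// lee_fin csq_ge0.
Qed.

(** Orthogonality to the generating sections says that certain scalar functions have integral 0 over
    every [A j]; [sep] makes them vanish, simultaneously for countably many [n], off a null set. *)
Let perp t : sq_finite mu e t ->
  (forall i (c : C), rip_int mu t (fun z => c *: sv i z) = 0) -> {ae mu, forall z, t z = 0}.
Proof.
move=> ht h0.
have key (c : C) n : {ae mu, forall z, rip (t z) (c *: e n z) = 0}.
  have hi := integrable_rip etot egram ht (fin_ev c (D n)).
  apply: sep => // j; rewrite integral_mkcond.
  have -> : (\int[mu]_z ((fun z => (rip (t z) (c *: e n z))%:E) \_ (A j)) z =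
      \int[mu]_z (rip (t z) (c *: sv (D n, j) z))%:E)%E.
    apply: eq_integral => z _; rewrite patchE /sv /=; case: asboolP => hz; first by rewrite mem_set.
    by rewrite memNset// scaler0 rip0r.
  have := h0 (D n, j) c; rewrite /rip_int => /eqP; rewrite fine_eq0 => [/eqP//|].
  apply: integral_fune_fin_num => //; apply: (integrable_rip etot egram ht).
  have := fin_ev c (D n) => -[h1 h2]; split.
    have := measurable_sectionD c (Ssv (D n, j)) (measurable_section0 e); congr S.
    by apply: functional_extensionality_dep => z; rewrite addr0.
  apply: le_lt_trans h2; apply: ge0_le_integral => //.
  - by move=> z _; rewrite lee_fin sqnorm_ge0.
  - apply/measurable_EFinP; apply: (measurable_sqnorm etot egram).
    have := measurable_sectionD c (Ssv (D n, j)) (measurable_section0 e); congr S.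
    by apply: functional_extensionality_dep => z; rewrite addr0.
  - by apply/measurable_EFinP; exact: (measurable_sqnorm etot egram h1).
  - move=> z _; rewrite lee_fin /sv /=; case: asboolP => // _.
    by rewrite scaler0 sqnorm0 sqnorm_ge0.
have : {ae mu, forall z, forall n, rip (t z) (1 *: e n z) = 0 /\ rip (t z) ('i%C *: e n z) = 0}.
  by apply/ae_foralln => n; apply: filterS2 (key 1 n) (key 'i%C n) => z.
apply: filterS => z hz; apply/eqP; rewrite -sqnorm_eq0 sqnorm_rip /rip.
suff -> : ip (t z) (t z) = 0 by [].
apply: (etot (perp_closed (t z))) => n /=; rewrite ipC; apply/eqP; rewrite conjc_eq0 eq_complex.
have [] := hz n; rewrite scale1r => h1 h2.
by rewrite Im_ip -/(rip (t z) (e n z)) h1 -/(e n z) h2 !eqxx.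
Qed.

Lemma cyclic_field_direct_integral : is_direct_integral mu S pi rho.
Proof.
split; [exact: measurable_section_field etot egram|exact: Spi|].
have [Phi hPhi] := choice (approx_exists etot egram muT Ssv gram' wtot').
have uniq w s : apx w s -> {ae mu, forall z, Phi w z = s z}.
  by move=> h; apply: (approx_unique etot egram muT Ssv gram' (hPhi w)).
have nP w : sq_int mu (Phi w) = (sqnorm w)%:E := approx_sq_int etot egram muT Ssv gram' (hPhi w).
exists Phi; split.
- by move=> w; split; [exact: (hPhi w).1|rewrite -/(sq_int mu (Phi w)) nP ltry].
- by move=> a u v; apply: uniq; exact: (approx_lin etot egram Ssv a (hPhi u) (hPhi v)).
- move=> s hs; have [w hw] := approx_surjective etot egram muT Ssv gram' wtot' perp hs.
  by exists w; exact: hw.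
- exact: nP.
- by move=> g w; apply: uniq; exact: apx_rho.
Qed.

End cyclic_fields.

(** * Decomposition into irreducible representations *)

Section spectra.
Context {R : realType} {V : hilbertType R} (Q : nat -> V -> V).
Hypotheses (Qp : forall j, isproj (Q j)) (Qc : forall i j v, Q i (Q j v) = Q j (Q i v)).
Variable xi : V.

(* The complement of the union of the cylinders that are null for the spectral
   measure of [xi]; a digit sequence in it satisfies, simultaneously, every
   relation between finitely many of the projections that holds on [xi]. *)
Definition spectrum : set bit_space := [set t | forall l, cyl l t -> cyl_op Q l xi <> 0].

Let Ql j : linear (Q j). Proof. exact: isproj_linear (Qp j). Qed.
Let QQ j v : Q j (Q j v) = Q j v. Proof. exact: isproj_idem (Qp j). Qed.

(** Digits that violate the relation would lie in a cylinder whose operator kills [xi]. *)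
Lemma spectrum_and i j l (t : bit_space) : Q i (Q j xi) = Q l xi -> spectrum t -> (t i : bool) && t j = t l.
Proof.
move=> h ht.
have no w : cyl w t -> cyl_op Q w xi = 0 -> False by move=> /ht.
have Qli : Q i (Q l xi) = Q l xi by rewrite -h QQ.
have Qlj : Q j (Q l xi) = Q l xi by rewrite -h Qc QQ.
case ti : (t i); case tj : (t j); case tl : (t l) => //; exfalso.
- apply: (no [:: (l, false); (i, true); (j, true)]) => /=; first by rewrite /cyl /= ti tj tl.
  by rewrite /bit_op /= h QQ subrr.
- apply: (no [:: (j, false); (l, true)]) => /=; first by rewrite /cyl /= tj tl.
  by rewrite /bit_op /= Qlj subrr.
- apply: (no [:: (i, false); (l, true)]) => /=; first by rewrite /cyl /= ti tl.
  by rewrite /bit_op /= Qli subrr.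
- apply: (no [:: (i, false); (l, true)]) => /=; first by rewrite /cyl /= ti tl.
  by rewrite /bit_op /= Qli subrr.
Qed.

Lemma spectrum_true j (t : bit_space) : Q j xi = xi -> spectrum t -> t j = true.
Proof.
move=> h ht; case tj : (t j) => //; exfalso; apply: (ht [:: (j, false)]); first by rewrite /cyl /= tj.
by rewrite /= /bit_op h subrr.
Qed.

Lemma spectrum_false j (t : bit_space) : Q j xi = 0 -> spectrum t -> t j = false.
Proof.
move=> h ht; case tj : (t j) => //; exfalso; apply: (ht [:: (j, true)]); first by rewrite /cyl /= tj.
by rewrite /= /bit_op h.
Qed.

Let null n : set bit_space :=
  if unpickle n is Some l then (if cyl_op Q l xi == 0 then cyl l else set0) else set0.

Let spectrumE : ~` spectrum = \bigcup_n null n.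
Proof.
apply/seteqP; split=> [t /existsNP[l /not_implyP[lt /contrapT l0]]|t [n _]].
  by exists (pickle l) => //; rewrite /null pickleK l0 eqxx.
rewrite /null; case: unpickle => // l; case: eqP => // l0 lt ht.
exact: (ht l lt).
Qed.

Let mnull n : measurable (null n).
Proof. by rewrite /null; case: unpickle => // l; case: ifP => // _; exact: cyl_measurable. Qed.

Lemma spectrum_measurable : measurable spectrum.
Proof. by rewrite -[spectrum]setCK; apply: measurableC; rewrite spectrumE; exact: bigcupT_measurable. Qed.

Lemma spectrum_full (mu : {measure set bit_space -> \bar R}) :
  (forall l, mu (cyl l) = (sqnorm (cyl_op Q l xi))%:E) -> mu (~` spectrum) = 0%E.
Proof.
move=> hmu; rewrite spectrumE; apply: measure_negligible; first exact: bigcupT_measurable.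
apply: negligible_bigcup => n; exists (null n); split=> //; rewrite /null.
by case: unpickle => // l; case: eqP => // l0; rewrite hmu l0 sqnorm0.
Qed.

End spectra.

Section corner_components.
Context {R : realType} {L : set R} {U : metricType R}.
Hypothesis (Lpos : forall r : R, L r -> 0 < r) (LU : is_urysohn L U).
Local Notation G := (isom U).
Local Notation C := R[i].
Local Notation E := (@l2 R (set G)).
Local Notation lam := (@translation R G).
Context {W : hilbertType R} (rho : G -> W -> W) (hrho : unitary_rep setT rho).
Local Notation P x m := (fixproj rho (stab x m)).
Local Notation spec := (spec (L := L)).
Variables (z : W -> W) (n : nat) (x : 'I_n.+1 -> U) (r : 'I_n.+1 -> R) (F : {group 'S_n.+1}).
Variables (b : {ffun subg_of F -> C^o}) (e : W -> W).
Hypothesis (hc : corner (L := L) rho z x r b e).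
Variable idx : ('I_n.+1 -> R) -> nat.
Hypothesis idx_inj : forall m m', spec m -> spec m' -> idx m = idx m' -> m = m'.
Let pe := corner_proj hc.
Let el : linear e := isproj_linear pe.
Let ee v : e (e v) = e v. Proof. exact: isproj_idem. Qed.
Let Pl m : linear (P x m). Proof. exact: fixproj_linear. Qed.

(** Numbers that code no radii give the zero operator, so the corresponding digits are [false] on
    the spectrum. *)
Definition corner_bit j (v : W) : W :=
  if pselect (exists m, spec m /\ idx m = j) is left h then P x (projT1 (cid h)) (e v) else 0.

Lemma corner_bitE m v : spec m -> corner_bit (idx m) v = P x m (e v).
Proof.
move=> hm; rewrite /corner_bit; case: pselect => [h|[]]; last by exists m.
by have [h1 h2] := projT2 (cid h); rewrite (idx_inj h1 hm h2).
Qed.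

Lemma corner_bit_cases j : (exists2 m, spec m & idx m = j) \/ forall v, corner_bit j v = 0.
Proof.
have [[m [h1 h2]]|h] := pselect (exists m, spec m /\ idx m = j); first by left; exists m.
by right=> v; rewrite /corner_bit; case: pselect.
Qed.

Lemma corner_bit_mul m m' v : spec m -> spec m' ->
  corner_bit (idx m) (corner_bit (idx m') v) = corner_bit (idx (maxf m m')) v.
Proof.
move=> hm hm'; rewrite !corner_bitE//; last exact: spec_maxf.
by rewrite -(corner_comm hc _ hm') ee (corner_max hc).
Qed.

Lemma corner_bit_proj j : isproj (corner_bit j).
Proof.
have [[m hm <-]|h] := corner_bit_cases j; last first.
  by split=> [a u v|v|u v]; rewrite !h ?scaler0 ?addr0 ?ip0l ?ip0r.
split=> [a u v|v|u v]; rewrite ?corner_bitE//.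
- by rewrite el Pl.
- rewrite -(corner_comm hc _ hm) ee (corner_max hc)//.
  by congr (fixproj _ (stab _ _) _); apply/funext => i; exact: maxxx.
- by rewrite (fixproj_adj hrho) (isproj_adj _ _ pe) (corner_comm hc _ hm).
Qed.

Lemma corner_bit_comm i j v : corner_bit i (corner_bit j v) = corner_bit j (corner_bit i v).
Proof.
have l0 k : corner_bit k 0 = 0 by exact: lin0 (isproj_linear (corner_bit_proj k)).
have [[m hm <-]|h] := corner_bit_cases i; last by rewrite !h l0.
have [[m' hm' <-]|h] := corner_bit_cases j; last by rewrite !h l0.
rewrite !corner_bit_mul//; congr (corner_bit (idx _) _).
by apply/funext => k; rewrite /maxf maxC.
Qed.

Lemma corner_bit_closed i j : exists l, forall v, corner_bit i (corner_bit j v) = corner_bit l v.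
Proof.
have [[m hm <-]|h] := corner_bit_cases i; last by exists i => v; rewrite !h.
have [[m' hm' <-]|h] := corner_bit_cases j.
  by exists (idx (maxf m m')) => v; rewrite corner_bit_mul.
by exists j => v; rewrite !h (lin0 (isproj_linear (corner_bit_proj _))).
Qed.

Variable xi : W.
Hypothesis exi : e xi = xi.
Local Notation T := (spectrum corner_bit xi).

Definition digit_ideal (t : bit_space) : set ('I_n.+1 -> R) := [set m | spec m /\ (t (idx m) : bool)].

Section one_point.
Variable t : bit_space.
Hypothesis Tt : T t.
Local Notation I := (digit_ideal t).

Let tmax m m' : spec m -> spec m' -> (t (idx m) : bool) && t (idx m') = t (idx (maxf m m')).
Proof.
move=> hm hm'; apply: (spectrum_and corner_bit_proj corner_bit_comm _ Tt).
exact: corner_bit_mul.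
Qed.

Let tr : t (idx r).
Proof.
have hr := corner_spec hc; apply: (spectrum_true (Q := corner_bit) (xi := xi)) => //.
by rewrite corner_bitE// exi -[in LHS]exi (corner_r hc) exi.
Qed.

(** Relations between the operators [P x m] on the corner are transferred to digits by
    [spectrum_and], [spectrum_true] and [spectrum_false]. *)
Lemma digit_ideal_ideal : radius_ideal (L := L) x I.
Proof.
split.
- by exists r; split; [exact: corner_spec hc|].
- move=> m [hm fm]; split=> //; apply: contrapT => ns; move: fm.
  by rewrite (spectrum_false (Q := corner_bit) (xi := xi))// corner_bitE// (corner_nsep hc).
- by move=> m m' [hm fm] [hm' fm']; split; [exact: spec_maxf|rewrite -tmax// fm].
- move=> m m' [hm fm] hm' le; split=> //; have := tmax hm hm'.
  have -> : maxf m m' = m by apply/funext => i; apply/max_idPl.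
  by rewrite fm.
Qed.

Lemma digit_ideal_perm s m : s \in F -> I m -> I (m \o s).
Proof.
move=> sF [hm fm]; have hs := spec_perm s hm; split=> //.
suff <- : (t (idx m) : bool) && t (idx m) = t (idx (m \o s)) by rewrite fm.
apply: (spectrum_and corner_bit_proj corner_bit_comm _ Tt).
by rewrite (isproj_idem _ (corner_bit_proj _)) !corner_bitE// (corner_perm hc _ sF hm).
Qed.

Lemma digit_ideal_nperm (s : 'S_n.+1) : isoperm x s -> s \notin F -> exists m, spec m /\
  ((I m /\ ~ I (m \o s)) \/ (~ I m /\ I (m \o s))).
Proof.
move=> hs sF; have [m [hm h]] := corner_nperm hc hs sF; exists m; split=> //.
have hms := spec_perm s hm.
case: h => h; have [h1 h2] := h xi; [left|right].
  split; first by split=> //; apply: (spectrum_true _ Tt); rewrite corner_bitE// h1.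
  by move=> [_]; rewrite (spectrum_false _ Tt)// corner_bitE.
split; last by split=> //; apply: (spectrum_true _ Tt); rewrite corner_bitE// h2.
by move=> [_]; rewrite (spectrum_false _ Tt)// corner_bitE.
Qed.

End one_point.

Variable D : nat -> G.
Hypothesis hD : forall (g : G) q (y : 'I_q -> U) (m : 'I_q -> R), spec m ->
  exists j, forall i, @mdist R U (D j (y i)) (g (y i)) <= m i.

Lemma corner_bit_e j v : e (corner_bit j v) = corner_bit j v.
Proof.
have [[m hm <-]|h] := corner_bit_cases j; last by rewrite h (lin0 el).
by rewrite corner_bitE// (corner_comm hc _ hm) ee.
Qed.

(** The same [c] and [l] describe [rho g] on the corner and the matrix coefficient of [eps t]:
    either [c] is [corner_phi b s] and [l] codes the shift radii of [g], or [c] is 0. The direct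
    integral rests on this agreement. *)
Lemma corner_component : exists eps : bit_space -> E,
  (forall t, T t -> [/\ irreducible_rep setT (@cyclic_rep R G E lam (eps t)),
     forall g, exists j, lam g (eps t) = lam (D j) (eps t) & sqnorm (eps t) = 1]) /\
  forall g, exists c : C, exists l, (forall i j v,
      ip (rho g (corner_bit i v)) (corner_bit j v) = c * ip (corner_bit l (corner_bit i v)) (corner_bit j v)) /\
    forall t, T t -> ip (lam g (eps t)) (eps t) = c * (t l : bool)%:R.
Proof.
have ch s : exists h : G, isoperm x s -> forall j, h (x j) = x (s^-1%g j).
  have [hs|no] := pselect (isoperm x s); last by exists 1%g.
  by have [h hh] := isoperm_exists Lpos LU hs; exists h.
have [hh hhP] := choice ch; have hF := corner_isoperm hc.
have hb := corner_b hc; have [b0 bb bst _] := hb; have hr := corner_spec hc.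
pose iv t := ideal_vector x b (digit_ideal t) hh.
(* On the spectrum the squared norm of [iv t] is [b 1], whatever [t] is; this factor makes it a unit
   vector. *)
pose kap : C := (Num.sqrt (complex.Re (b 1%g : C)))^-1%:C%C.
have hI t (Tt : T t) := digit_ideal_ideal Tt.
have hFI t (Tt : T t) s m := @digit_ideal_perm t Tt s m.
have hn t (Tt : T t) s := @digit_ideal_nperm t Tt s.
have b1 t : T t -> 0 < sqnorm (iv t) /\ b 1%g = (sqnorm (iv t))%:C%C.
  move=> Tt; split.
    by rewrite sqnorm_gt0; apply/eqP; exact: (ideal_vector_neq0 Lpos LU (hI t Tt) hF (hFI t Tt) hb hhP).
  by rewrite -ip_self (ideal_sum_ip Lpos LU (hI t Tt) hF (hFI t Tt) hhP) bst bb.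
have kapE t : T t -> [/\ kap != 0, kap * kap^*%C = (b 1%g : C)^-1 & (b 1%g : C) != 0].
  move=> /b1[p bE]; have q : 0 < Num.sqrt (sqnorm (iv t)) by rewrite sqrtr_gt0.
  have -> : kap = (Num.sqrt (sqnorm (iv t)))^-1%:C%C by rewrite /kap bE.
  rewrite bE; split.
  - by rewrite eq_complex /= eqxx andbT invr_eq0 gt_eqF.
  - rewrite conjc_real -rmorphM -invfM -expr2 sqr_sqrtr ?(ltW p)//.
    by rewrite (fmorphV (real_complex R)).
  - by rewrite eq_complex /= eqxx andbT gt_eqF.
have gramE t g : T t -> ip (lam g (kap *: iv t)) (kap *: iv t) = (b 1%g : C)^-1 * ip (lam g (iv t)) (iv t).
  move=> Tt; have [_ <- _] := kapE t Tt; have [ll _ _ _] := @translation_isometric R G.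
  by rewrite (linZ (ll g)) ipZl ipZr mulrA.
have Gam t g s : T t -> s \in F ->
    ideal_group x (digit_ideal t) ((hh s)^-1 * g)%g <-> digit_ideal t (shift_radius x r g s).
  move=> Tt sF; apply: (ideal_coset_shift Lpos LU (hI t Tt) hF (hFI t Tt) hhP) => //.
  by split=> //; apply: (spectrum_true _ Tt); rewrite corner_bitE// exi -[in LHS]exi (corner_r hc).
exists (fun t => kap *: iv t); split=> [t Tt|g].
  have [k0 k1 k2] := kapE t Tt; split.
  - exact: (ideal_irreducible Lpos LU (hI t Tt) hF (hFI t Tt) (hn t Tt) hb hhP k0 hD).
  - exact: (ideal_epsD Lpos LU _ (hI t Tt) hF (hFI t Tt) hhP _ hD).
  - have := gramE t 1%g Tt; have [_ _ l1 _] := @translation_isometric R G.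
    rewrite !l1 !ip_self; have [_ bE] := b1 t Tt; rewrite -bE mulVf//.
    by move=> [].
have eip u w : e u = u -> e w = w -> ip (rho g u) w = ip (e (rho g (e u))) w.
  by move=> hu hw; rewrite (isproj_adj _ _ pe) hu hw.
have [[s [sF ss hs]]|[ns h0]] := corner_rho hc g.
  exists (corner_phi b s), (idx (shift_radius x r g s)); have hsp := spec_shift Lpos LU x g s hr.
  split=> [i j v|t Tt].
    by rewrite (eip _ _ (corner_bit_e _ _) (corner_bit_e _ _)) hs ipZl (corner_bitE _ hsp) !corner_bit_e.
  rewrite gramE//; case ts : (t _); last first.
    rewrite (ideal_vector_gram0 Lpos LU b (hI t Tt) hF (hFI t Tt) hhP) ?mulr0// => s'.
    move=> /(Gam t g _ Tt (subgP s'))Is'; have [_ hsep _ _] := hI t Tt; have [_ ss'] := hsep _ Is'.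
    move: Is'; rewrite -(perm_unique LU (hF _ sF) (hF _ (subgP s')) ss ss') => -[_].
    by rewrite ts.
  have Gs : ideal_group x (digit_ideal t) ((hh (sgval (subg F s)))^-1 * g)%g.
    by rewrite subgK//; apply/Gam.
  rewrite (ideal_vector_gram Lpos LU (hI t Tt) hF (hFI t Tt) hb hhP Gs) mulr1.
  by rewrite /corner_phi mulrC.
exists 0, 0%N; split=> [i j v|t Tt].
  by rewrite (eip _ _ (corner_bit_e _ _) (corner_bit_e _ _)) h0 ip0l mul0r.
rewrite gramE// (ideal_vector_gram0 Lpos LU b (hI t Tt) hF (hFI t Tt) hhP) ?mulr0 ?mul0r// => s'.
move=> /(Gam t g _ Tt (subgP s'))Is'; have [_ hsep _ _] := hI t Tt; have [_] := hsep _ Is'.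
exact: ns (subgP s').
Qed.

End corner_components.

Section finite_copies.
Context {d : measure_display} {Z : measurableType d} {R : realType} (mu : {measure set Z -> \bar R}).
Hypothesis fmu : fin_num_fun mu.

(** A synonym of [mu] that carries a proof of finiteness, so that the structure of a finite measure
    can be attached to it. *)
Definition finite_copy of fin_num_fun mu : set Z -> \bar R := mu.
HB.instance Definition _ := Measure.copy (finite_copy fmu) (mu : set Z -> \bar R).
HB.instance Definition _ := Measure_isFinite.Build _ _ _ (finite_copy fmu) fmu.

End finite_copies.

Lemma sigma_finite_of_finite {d} {Z : measurableType d} {R : realType} (mu : {measure set Z -> \bar R}) :
  (mu setT < +oo)%E -> exists nu : {sigma_finite_measure set Z -> \bar R}, forall B, nu B = mu B.
Proof.
move=> fT; have h : fin_num_fun mu.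
  move=> B mB; rewrite ge0_fin_numE//; apply: le_lt_trans fT.
  by apply: le_measure => //; rewrite inE//; exact: measurableT.
by exists (finite_copy h).
Qed.

(** Sets over which the integral vanishes form a Dynkin system, so a generating family closed under
    intersections is enough. *)
Lemma integral0_ae {d} {Z : measurableType d} {R : realType} (mu : {measure set Z -> \bar R})
    (B : set (set Z)) (D : set Z) (f : Z -> R) :
  @measurable _ Z = <<s B >> -> setI_closed B -> measurable D -> mu.-integrable setT (EFin \o f) ->
  (\int[mu]_(z in D) (f z)%:E = 0)%E -> (forall S, B S -> \int[mu]_(z in S `&` D) (f z)%:E = 0)%E ->
  {ae mu, forall z, D z -> f z = 0}.
Proof.
move=> BE BI mD fi D0 B0.
have mf : measurable_fun setT (fun z => (f z)%:E) by exact: measurable_int fi.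
have int0 S : measurable S -> (\int[mu]_(z in S `&` D) (f z)%:E = 0)%E.
  rewrite BE; apply: (dynkin_induction (P := fun S => (\int[mu]_(z in S `&` D) (f z)%:E = 0)%E) BE BI) => //.
  - by rewrite setTI.
  - move=> A mA A0; have : (\int[mu]_(z in (A `&` D) `|` (~` A `&` D)) (f z)%:E = 0)%E.
      by rewrite -setIUl setUv setTI.
    rewrite integral_setU ?A0 ?add0e//.
    + exact: measurableI.
    + by apply: measurableI => //; exact: measurableC.
    + exact: measurable_funS mf.
    + by apply/disj_setPS => z [[h _] [h' _]].
  - move=> F mF tF F0; rewrite setI_bigcupl integral_bigcup.
    + by apply: eseries0 => n _ _; exact: F0.
    + apply/trivIsetP => i j _ _ ij; move/trivIsetP : tF => /(_ i j I I ij) h.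
      by rewrite setIACA h set0I.
    + by move=> n; exact: measurableI.
    + apply: (integrableS measurableT) => //; apply: bigcupT_measurable => n; exact: measurableI.
have h : ae_eq mu D (fun z => (f z)%:E) (cst 0%E).
  apply: integral_ae_eq => //; first by apply: (integrableS measurableT).
  move=> S SD mS; rewrite [RHS]integral0 -[S in LHS](setIidl SD); exact: int0.
by apply: filterS h => z hz Dz; have [] := hz Dz.
Qed.

Lemma rep_isometric {R : realType} {G : topologicalGroupType} {V : hilbertType R} (rho : G -> V -> V) :
  unitary_rep setT rho -> isometric_action rho.
Proof.
move=> hrho; split=> [g|g u v|v|g h v].
- exact: (rep_linear hrho).
- exact: (rep_ip hrho).
- exact: (rep1 hrho).
- exact: (repM hrho).
Qed.

(** * Assembling countably many components *)

Section assembly.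
Context {R : realType} {G : topologicalGroupType} {E W : hilbertType R}.
Local Notation C := R[i].
Variables (rho : G -> W -> W) (lam : G -> E -> E) (D : nat -> G) (eps0 : E).
Hypotheses (hrho : unitary_rep setT rho) (hlam : isometric_action lam).
Hypotheses (irr0 : irreducible_rep setT (@cyclic_rep R G E lam eps0)) (fix0 : forall g, lam g eps0 = eps0)
  (nrm0 : sqnorm eps0 = 1).
Variables (tag : nat -> nat) (Q : nat -> nat -> W -> W) (xi : nat -> W) (eps : nat -> bit_space -> E).
Hypotheses (Qp : forall k j, isproj (Q k j)) (Qc : forall k i j v, Q k i (Q k j v) = Q k j (Q k i v)).
Hypothesis Qcl : forall k i j, exists l, forall v, Q k i (Q k j v) = Q k l v.
Hypothesis Qunit : forall k, exists r, Q k r (xi k) = xi k.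
Hypothesis Qtag : forall k j, tag j <> k -> forall v, Q k j v = 0.
Hypothesis xin : forall k, sqnorm (xi k) <= 1 / (2 ^ k.+1)%:R.
Hypothesis orth : forall k k', k <> k' -> forall g i j, ip (rho g (Q k i (xi k))) (Q k' j (xi k')) = 0.
Hypothesis tot : forall u, (forall g k, ip (rho g (xi k)) u = 0) -> u = 0.
Local Notation T k := (spectrum (Q k) (xi k)).
Hypothesis heps : forall k t, T k t -> [/\ irreducible_rep setT (@cyclic_rep R G E lam (eps k t)),
  forall g, exists j, lam g (eps k t) = lam (D j) (eps k t) & sqnorm (eps k t) = 1].
Hypothesis hgram : forall k g, exists c : C, exists l, (forall i j v,
      ip (rho g (Q k i v)) (Q k j v) = c * ip (Q k l (Q k i v)) (Q k j v)) /\
    forall t, T k t -> ip (lam g (eps k t)) (eps k t) = c * (t l : bool)%:R.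

(** Each component has its own digits: a digit whose operator is the unit on [xi k] is [true] on the
    spectrum of [k] and [false] on every other. All components thus occupy disjoint parts of one
    digit space. *)
Let Tdisj k k' t : T k t -> T k' t -> k = k'.
Proof.
move=> h h'; apply: contrapT => kk'; have [r hr] := Qunit k.
have tr : t r by rewrite (spectrum_true hr h).
have xi0 : xi k <> 0 by move=> x0; have := h [::]; apply.
have tk : tag r = k by apply: contrapT => /Qtag tk; apply: xi0; rewrite -hr tk.
by move: tr; rewrite (spectrum_false (Qtag _ _) h')// tk.
Qed.

(** Outside all the spectra, a null set for the measure constructed below, [eps0] keeps the fibre
    irreducible. *)
Let et (t : bit_space) : E := if pselect (exists k, T k t) is left h then eps (projT1 (cid h)) t else eps0.

Let etE k t : T k t -> et t = eps k t.
Proof.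
move=> h; rewrite /et; case: pselect => [h'|[]]; last by exists k.
by rewrite (Tdisj (projT2 (cid h')) h).
Qed.

Let et0 t : ~ (exists k, T k t) -> et t = eps0.
Proof. by rewrite /et; case: pselect. Qed.

Let K t := @cyclic_hilbert R G E lam (et t).
Let pi t : G -> K t -> K t := @cyclic_rep R G E lam (et t).
Arguments pi : clear implicits.
Let ev t : K t := @cyclic_vector R G E lam (et t).

Let irr t : irreducible_rep setT (pi t).
Proof.
rewrite /pi /K; have [[k h]|h] := pselect (exists k, T k t); last by rewrite (et0 h).
by rewrite (etE h); case: (heps h).
Qed.

Let evip g t : ip (pi t g (ev t)) (ev t) = ip (lam g (et t)) (et t).
Proof. by rewrite -subval_ip /pi (cyclic_repE hlam) /ev (cyclic_vectorE hlam). Qed.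

Let mT k : measurable (T k). Proof. exact: spectrum_measurable. Qed.

Let AA k j : set bit_space := [set t | (t j : bool)] `&` T k.
Let A j := AA (tag j) j.
Let mAA k j : measurable (AA k j).
Proof. by apply: measurableI => //; exact: measurable_bit. Qed.

Let AAI k i j l : (forall v, Q k i (Q k j v) = Q k l v) -> AA k i `&` AA k j = AA k l.
Proof.
move=> h; apply/seteqP; split=> t.
  by move=> [[ti Tt] [tj _]]; split=> //=; rewrite -(spectrum_and (Qp k) (Qc k) (h _) Tt) ti.
by move=> [/= tl Tt]; move: tl; rewrite -(spectrum_and (Qp k) (Qc k) (h _) Tt) => /andP[].
Qed.

Let evm g : measurable_complex (fun t => ip (pi t g (ev t)) (ev t)).
Proof.
suff key (p : C -> R) : measurable_fun setT (fun t => p (ip (pi t g (ev t)) (ev t))) by split; exact: key.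
have -> : [set: bit_space] = (\bigcup_k T k) `|` ~` (\bigcup_k T k) by rewrite setUv.
have mB : measurable (\bigcup_k T k) by exact: bigcupT_measurable.
apply/measurable_funU => //; first exact: measurableC.
split; last first.
  apply: (eq_measurable_fun (cst (p (sqnorm eps0)%:C%C))); last exact: measurable_cst.
  move=> t; rewrite inE => ht; rewrite evip et0 ?fix0 ?ip_self//.
  by move=> [k hk]; apply: ht; exists k.
apply/measurable_fun_bigcup => // k; have [c [l [_ hl]]] := hgram k g.
apply: (eq_measurable_fun (fun t : bit_space => if (t l : bool) then p c else p 0)).
  by move=> t; rewrite inE => ht; rewrite evip (etE ht) hl//; case: (t l); rewrite ?mulr1 ?mulr0.
apply: (@measurable_funS _ _ _ _ setT) => //.
by apply: measurable_fun_ifT => //; apply: (measurable_fun_bool true); rewrite setTI; exact: measurable_bit.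
Qed.

Lemma assembled_direct_integral : direct_integral_of_irreducibles rho.
Proof.
have [m hm] := choice (fun k => spectral_measure (Qp k) (Qc k) (xi k)).
have mT0 k : m k (~` T k) = 0%E by apply: spectrum_full.
have mset k : (m k setT <= (1 / (2 ^ k.+1)%:R)%:E)%E.
  have -> : [set: bit_space] = cyl [::] by apply/seteqP; split.
  by rewrite hm lee_fin; exact: xin.
(* The measure is the sum of the spectral measures, finite by the bound on the norms of the [xi k];
   each of them is carried by its own spectrum. *)
have muT : (mseries m 0 setT < +oo)%E.
  apply: le_lt_trans (ltry 1); apply: le_trans (epsilon_trick0 xpredT (ler01 : 0 <= 1 :> R)).
  by apply: lee_nneseries => // n _ _; exact: mset.
have [mu hmu] := sigma_finite_of_finite muT.
have m0 k B : measurable B -> B `<=` ~` T k -> m k B = 0%E.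
  move=> mB hB; apply/eqP; rewrite eq_le measure_ge0 andbT -(mT0 k).
  by apply: le_measure => //; rewrite inE//; exact: measurableC.
have muE k B : measurable B -> B `<=` T k -> mu B = m k B.
  move=> mB hB; rewrite hmu; change (\sum_(0 <= i <oo) m i B = m k B)%E.
  rewrite (@nneseriesD1 R (fun i => m i B) k xpredT)//.
  rewrite eseries0 ?adde0// => i _ ik; apply: m0 => // t /hB h h'.
  by move/eqP: ik; apply; exact: Tdisj h' h.
have muAA k j : mu (AA k j) = (sqnorm (Q k j (xi k)))%:E.
  rewrite (muE _ _ (mAA k j) (@subIsetr _ _ _)) /AA.
  have := hm k [:: (j, true)]; rewrite /= /bit_op => <-.
  have -> : cyl [:: (j, true)] = [set t : bit_space | (t j : bool)].
    by apply/seteqP; split=> t; rewrite /cyl /= andbT eqb_id.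
  have mb : measurable [set t : bit_space | (t j : bool)] by exact: measurable_bit.
  set Bt := [set t : bit_space | _] in mb *.
  have -> : m k Bt = m k ((Bt `&` T k) `|` (Bt `\` T k)) by rewrite setUIDK.
  rewrite measureU//; last 3 first.
  - exact: measurableI.
  - exact: measurableD.
  - by apply/seteqP; split=> t // [[_ h] [_ h']].
  have mD : measurable (Bt `\` T k) by exact: measurableD.
  by rewrite [Y in (_ + Y)%E](m0 _ _ mD (fun t h => h.2)) adde0.
exists _, bit_space, mu, K, (measurable_section (fun n t => pi t (D n) (ev t))), pi; split.
- exact: bit_space_standard.
- exact: irr.
apply: (@cyclic_field_direct_integral _ _ _ _ mu K pi ev D W rho (fun j => Q (tag j) j (xi (tag j))) A).
- by rewrite [X in (X < _)%E]hmu.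
- by move=> t; apply: rep_isometric; case: (irr t).
- exact: rep_isometric.
- move=> t X hX hD; apply: (cyclic_total_seq hlam _ hX hD) => g.
  have [[k h]|h] := pselect (exists k, T k t); last by exists 0%N; rewrite (et0 h) !fix0.
  by rewrite (etE h); case: (heps h).
- exact: evm.
- move=> t; rewrite -subval_sqnorm /ev (cyclic_vectorE hlam).
  have [[k h]|h] := pselect (exists k, T k t); last by rewrite (et0 h) nrm0.
  by rewrite (etE h); case: (heps h) => _ _ ->.
- by move=> j; exact: mAA.
(* For equal tags the inner product is [c] times the squared norm of [Q k q (xi k)], where [Q k q]
   is the product of three of the projections; that squared norm is the measure of [AA k q]. *)
- move=> g i j; have [ij|ij] := eqVneq (tag i) (tag j); last first.
    exists 0, set0; split=> [//|t|]; last by rewrite mul0r orth//; exact/eqP.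
    rewrite mul0r asboolF// => -[[_ h] [_ h']]; move/eqP: ij; apply.
    exact: Tdisj h h'.
  rewrite /A -ij; set k := tag i; have [c [l [h1 h2]]] := hgram k g.
  have [p hp] := Qcl k l i; have [q hq] := Qcl k p j.
  exists c, (AA k q); split=> // [t|].
    have [[hi hj]|no] := pselect (AA k i t /\ AA k j t).
      rewrite asboolT//; have Tt := hi.2; rewrite evip (etE Tt) h2//; congr (c * _).
      have := spectrum_and (Qp k) (Qc k) (hp _) Tt; have := spectrum_and (Qp k) (Qc k) (hq _) Tt.
      rewrite (hi.1 : t i = true) (hj.1 : t j = true) !andbT indicE => tp tl; rewrite tl tp.
      have -> : (t \in AA k q) = t q by apply/idP/idP => [/set_mem[]//|tq]; rewrite mem_set//; split.
      by case: (t q).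
    rewrite asboolF// indicE memNset ?mulr0// => hq'; apply: no.
    have := hq'; rewrite -(AAI hq) => -[hpp hj]; split=> //.
    by move: hpp; rewrite -(AAI hp) => -[].
  rewrite [X in fine X]muAA h1 hp; congr (c * _); rewrite -ip_self -hq.
  have s u v r : ip (Q k r u) v = ip u (Q k r v) := isproj_adj u v (Qp k r).
  by rewrite [RHS]s (isproj_idem _ (Qp k p)) -[RHS]s Qc [RHS]s (isproj_idem _ (Qp k j)).
- move=> u hu; apply: tot => g k; have [r hr] := Qunit k.
  have [tk|tk] := pselect (tag r = k); first by have := hu g r; rewrite tk hr.
  by rewrite -hr Qtag// (lin0 (rep_linear hrho g)) ip0l.
move=> f fi fA.
have muS k j : (\int[mu]_(t in AA k j) (f t)%:E = 0)%E.
  have [tk|tk] := pselect (tag j = k); first by rewrite -tk; exact: fA.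
  have -> : AA k j = set0; last exact: integral_set0.
  by apply/seteqP; split=> t // [/= tj Tt]; move: tj; rewrite (spectrum_false (Qtag tk _) Tt).
(* Sets that require finitely many digits to be [true] are closed under intersection and generate
   the measurable sets. On a spectrum each of them is given by a single digit, because the
   projections are closed under products. *)
pose B : set (set bit_space) := [set [set t | all (fun j => t j : bool) J] | J in setT].
have aeT k : {ae mu, forall t, T k t -> f t = 0}.
  have [r hr] := Qunit k.
  have Tr : T k = AA k r by apply/seteqP; split=> [t Tt|t []//]; split=> //; exact: spectrum_true hr Tt.
  apply: (integral0_ae (B := B)) => //.
  - apply/seteqP; split; apply: smallest_sub.
    + exact: smallest_sigma_algebra.
    + move=> _ [j _ <-]; apply: sub_sigma_algebra; exists [:: j] => //.
      by apply/seteqP; split=> t /=; rewrite andbT.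
    + exact: smallest_sigma_algebra.
    + move=> _ [J _ <-]; elim: J => [|j J IH].
        have -> : [set t : bit_space | all (fun j => t j : bool) [::]] = setT by apply/seteqP.
        exact: (@measurableT _ bit_space).
      have -> : [set t : bit_space | all (fun j => t j : bool) (j :: J)] =
          [set t | (t j : bool)] `&` [set t | all (fun j => t j : bool) J].
        by apply/seteqP; split=> t /=; [move=> /andP|move=> [-> ->]].
      exact: (@measurableI _ bit_space _ _ (measurable_bit j) IH).
  - move=> _ _ [J _ <-] [J' _ <-]; exists (J ++ J') => //.
    by apply/seteqP; split=> t /=; rewrite all_cat; [move=> /andP|move=> [-> ->]].
  - by rewrite Tr.
  - move=> _ [J _ <-]; suff [l ->] : exists l, [set t | all (fun j => t j : bool) J] `&` T k = AA k l by [].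
    elim: J => [|j J [l IH]]; first by exists r; rewrite -Tr; apply/seteqP; split=> t // [].
    have [l' hl'] := Qcl k j l; exists l'; rewrite -(AAI hl') -IH.
    apply/seteqP; split=> t; first by move=> [/= /andP[h1 h2] h3].
    by move=> [[h1 h3] [h2 _]]; split=> //=; rewrite (h1 : t j = true).
have aeU : {ae mu, forall t, exists k, T k t}.
  exists (~` \bigcup_k T k); split.
  - by apply: measurableC; exact: bigcupT_measurable.
  - rewrite [LHS]hmu; apply: eseries0 => k _ _; apply: m0; first by apply: measurableC; exact: bigcupT_measurable.
    by move=> t h ht; apply: h; exists k.
  - by move=> t h [k _ hk]; apply: h; exists k.
have /ae_foralln aeA : forall k, {ae mu, forall t, T k t -> f t = 0} := aeT.
by apply: filterS2 aeA aeU => t h [k hk]; exact: h hk.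
Qed.

End assembly.

Section trivial_representation.
Context {R : realType} {G : topologicalGroupType}.
Local Notation E := (@l2 R (set G)).
Local Notation eps0 := (@delta R (set G) setT).

Lemma translation_deltaT g : translation g eps0 = eps0.
Proof.
rewrite translation_delta; congr delta; apply/seteqP; split=> // h _.
by exists (g^-1 * h)%g => //; rewrite mulKVg.
Qed.

Lemma sqnorm_deltaT : sqnorm eps0 = 1.
Proof. by rewrite /sqnorm ip_delta /l2val /=; case: eqP. Qed.

Lemma trivial_cyclic_irreducible : irreducible_rep setT (@cyclic_rep R G E (@translation R G) eps0).
Proof.
apply: (cyclic_irreducible (@translation_isometric R G) (D := fun=> 1%g)).
- by move=> g; exists 0%N; rewrite !translation_deltaT.
- by apply: filterS filterT => g _; exact: translation_deltaT.
- by move=> h; have := sqnorm_deltaT; rewrite h sqnorm0 => /eqP; rewrite eq_sym oner_eq0.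
move=> f hf _; pose p (u : E) := ip u eps0 *: eps0.
have e1 : ip eps0 eps0 = 1 by rewrite ip_self sqnorm_deltaT.
have hp : isproj p.
  split=> [a u v|v|u v]; rewrite /p.
  - by rewrite ipDl ipZl scalerDl scalerA.
  - by rewrite ipZl e1 mulr1.
  - by rewrite ipZl ipZr -ipC mulrC.
exists (ip f eps0); apply/esym.
apply: (hf _ (closed_subspace_eq (isproj_bounded hp))) => g /=.
by rewrite translation_deltaT /p e1 scale1r.
Qed.

End trivial_representation.

Section orthogonal_families.
Context {R : realType} {G : topologicalGroupType} {W : hilbertType R}.
Variables (rho : G -> W -> W) (hrho : unitary_rep setT rho).

Definition orth_orbit u v := forall g, ip (rho g u) v = 0.

Lemma orth_orbit_closed v : closed_subspace (orth_orbit^~ v).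
Proof.
apply: closed_subspace_bigcap => g; apply: (closed_subspace_contraction _ _ (perp_closed v)).
  exact: rep_linear.
by move=> w; rewrite (rep_hn hrho).
Qed.

Lemma orth_orbit_rho g u v : orth_orbit u v -> orth_orbit (rho g u) v.
Proof. by move=> h k; rewrite -(repM hrho). Qed.

Lemma orth_orbit_sym u v : orth_orbit u v -> orth_orbit v u.
Proof. by move=> h g; rewrite (rep_adj hrho) ipC h conjc0. Qed.

Variable good : set W.
Hypothesis good0 : forall v, good v -> v <> 0.
Hypothesis goodZ : forall (c : R[i]) v, c != 0 -> good v -> good (c *: v).
Hypothesis good_ex : forall p : W -> W, isproj p -> (forall g v, p (rho g v) = rho g (p v)) ->
  (exists v, p v <> 0) -> exists2 v, good v & p v = v.

(** By Zorn's lemma there is a maximal set of good vectors with orthogonal orbits. It is total,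
    since the complement of the orbits would otherwise contain another good vector; separability
    makes it countable, and indices left over carry the vector 0. *)
Lemma orthogonal_family : exists xi : nat -> W,
  [/\ forall k, xi k = 0 \/ good (xi k), forall k, sqnorm (xi k) <= 1 / (2 ^ k.+1)%:R,
      forall k k', k <> k' -> orth_orbit (xi k) (xi k') &
      forall u, (forall g k, ip (rho g (xi k)) u = 0) -> u = 0].
Proof.
pose fam (X : set W) := X `<=` good /\ forall u v, X u -> X v -> u <> v -> orth_orbit u v.
have [F Ffam Ftot|X [[Xg Xo] Xmax]] := @Zorn_bigcup W fam.
  split=> [u [Y FY Yu]|u v [Y FY Yu] [Y' FY' Yv]]; first exact: (Ffam _ FY).1.
  by have [YY|YY] := Ftot _ _ FY FY'; [apply: (Ffam _ FY').2 => //|apply: (Ffam _ FY).2 => //]; exact: YY.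
have Xtot u : (forall v, X v -> orth_orbit v u) -> u = 0.
  move=> hu; apply: contrapT => u0.
  pose B := [set w | forall v, X v -> orth_orbit w v].
  have hB : closed_subspace B.
    apply: (@closed_subspace_bigcap _ _ _ (fun v => [set w | X v -> orth_orbit w v])) => v.
    have [Xv|nXv] := pselect (X v).
      have -> : [set w | X v -> orth_orbit w v] = orth_orbit^~ v.
        by apply/seteqP; split=> w /=; [exact|move=> h _].
      exact: orth_orbit_closed.
    have -> : [set w | X v -> orth_orbit w v] = setT by apply/seteqP; split=> // w _ /nXv.
    by split; [exact: closedT|split].
  have BG g w : B w -> B (rho g w) by move=> hw v Xv; refine (orth_orbit_rho _ _); exact: hw.
  have [||v gv pv] := good_ex (isproj_hproj hB).
  - by move=> g v; exact: hproj_invariant.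
  - have Bu : B u by move=> v Xv; exact: (orth_orbit_sym (hu v Xv)).
    by exists u; rewrite (hproj_id hB Bu).
  have Bv : B v by have := hproj_in hB v; rewrite pv.
  have nXv : ~ X v.
    move=> /Bv/(_ 1%g); rewrite (rep1 hrho) ip_self => /eqP.
    rewrite eq_complex /= eqxx andbT sqnorm_eq0 => /eqP; exact: good0.
  apply: (Xmax (X `|` [set v])).
    by split=> [w Xw|h]; [left|apply/nXv/h; right].
  split=> [w [/Xg//|-> //]|w w' [Xw|->] [Xw'|->]]; [exact: Xo| | |by []] => _.
    by refine (orth_orbit_sym _); exact: Bv.
  exact: Bv.
have [s hs] : exists s : nat -> W, forall v e, 0 < e -> exists n, hn (v - s n) < e.
  by apply: separable_seq; case: hrho.
have ch v : exists n, v <> 0 -> hn (v - s n) < hn v / 2.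
  have [->|/eqP v0] := eqVneq v 0; first by exists 0%N.
  by have [|n hn'] := hs v (hn v / 2); [rewrite divr_gt0// hn_gt0; exact/eqP|exists n].
have [N hN] := choice ch.
(* Two nonzero orthogonal vectors cannot both be approximated by the same [s n] to within half of
   their norms. *)
have Ninj u v : X u -> X v -> N u = N v -> u = v.
  move=> Xu Xv Nuv; apply: contrapT => uv.
  have o : rip u v = 0 by have := Xo _ _ Xu Xv uv 1%g; rewrite (rep1 hrho) /rip => ->.
  have h1 := hN u (good0 (Xg _ Xu)); have h2 := hN v (good0 (Xg _ Xv)).
  have h3 := hn_tri u (s (N u)) v; rewrite -Nuv hnB in h2.
  have h4 := sqnormB u v; rewrite o -!hn_sqr in h4.
  have := hn_ge0 u; have := hn_ge0 v; have := hn_ge0 (u - v).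
  move: (hn (u - v)) (hn u) (hn v) h1 h2 h3 h4 => d a b h1 h2 h3 h4 d0 b0 a0.
  have : d < (a + b) / 2 by lra.
  have := sqr_ge0 (a - b); nra.
pose v k := xget 0 [set v | X v /\ N v = k].
have vP k : v k = 0 \/ (X (v k) /\ N (v k) = k) by rewrite /v; case: xgetP => [? -> []|_]; [right|left].
have vE u : X u -> v (N u) = u.
  move=> Xu; have [Xv Nv] : X (v (N u)) /\ N (v (N u)) = N u.
    by rewrite /v; case: xgetP => [? -> []//|/(_ u)[]].
  exact: Ninj.
(* Gives each nonzero [v k] the squared norm [1 / 2 ^ k.+1], so that the squared norms are
   summable. *)
pose c k : R := (Num.sqrt (2 ^ k.+1)%:R * hn (v k))^-1.
have p2 k : 0 < Num.sqrt ((2 ^ k.+1)%:R : R) by rewrite sqrtr_gt0 ltr0n expn_gt0.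
have c0 k : v k <> 0 -> (c k)%:C%C != 0.
  move=> v0; rewrite eq_complex /= eqxx andbT invr_eq0 gt_eqF// mulr_gt0// hn_gt0.
  exact/eqP.
have oZ (a : R[i]) u w : orth_orbit u w -> orth_orbit (a *: u) w.
  by move=> h g; rewrite (linZ (rep_linear hrho g)) ipZl h mulr0.
have o0 w : orth_orbit 0 w by move=> g; rewrite (lin0 (rep_linear hrho g)) ip0l.
exists (fun k => (c k)%:C%C *: v k); split=> [k|k|k k' kk'|u hu].
- have [->|[Xv _]] := vP k; first by left; rewrite scaler0.
  by right; apply: goodZ; [apply: c0; apply: good0|]; exact: Xg.
- rewrite sqnormZr /c; have [->|/eqP v0] := eqVneq (v k) 0; first by rewrite sqnorm0 mulr0.
  rewrite -hn_sqr exprVn exprMn invfM -mulrA mulVf ?mulr1 ?expf_neq0//; last by rewrite hn_eq0; exact/eqP.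
  by rewrite sqr_sqrtr// mul1r.
- refine (oZ _ _ _ (orth_orbit_sym (oZ _ _ _ (orth_orbit_sym _)))).
  have [->|[Xv Nv]] := vP k; first exact: o0.
  have [->|[Xv' Nv']] := vP k'; first exact: (orth_orbit_sym (o0 _)).
  by apply: Xo => // h; apply: kk'; rewrite -Nv -Nv' h.
apply: Xtot => w Xw g; have := hu g (N w); rewrite (linZ (rep_linear hrho g)) ipZl => /eqP.
rewrite mulf_eq0 (negbTE (c0 _ _)) ?vE//=; last exact/good0/Xg.
by move=> /eqP.
Qed.

End orthogonal_families.

Section decomposition.
Context {R : realType} {L : set R} {U : metricType R}.
Hypotheses (Lpos : forall r : R, L r -> 0 < r) (Lcount : countable L) (LU : is_urysohn L U).
Local Notation G := (isom U).
Local Notation C := R[i].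
Local Notation E := (@l2 R (set G)).
Local Notation lam := (@translation R G).
Context {W : hilbertType R} (rho : G -> W -> W) (hrho : unitary_rep setT rho).
Local Notation spec := (spec (L := L)).

Definition corner_vector : set W := [set v | v <> 0 /\
  exists (z : W -> W) n (x : 'I_n.+1 -> U) r (F : {group 'S_n.+1}) (b : {ffun subg_of F -> C^o}) e,
    corner (L := L) rho z x r b e /\ e v = v].

(* A digit index codes the number of a component together with a tuple of radii. *)
Definition digit_tag j : nat := if unpickle j is Some p then (p : nat * seq nat).1 else 0%N.

Variable D : nat -> G.
Hypothesis hD : forall (g : G) q (y : 'I_q -> U) (m : 'I_q -> R), spec m ->
  exists j, forall i, @mdist R U (D j (y i)) (g (y i)) <= m i.

(** The data of one summand in the form used by the assembly. The clause on closed invariant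
    subspaces carries orthogonality of orbits over from [xi] to the vectors [p.1 j xi]. *)
Definition component (k : nat) (xi : W) (p : (nat -> W -> W) * (bit_space -> E)) : Prop :=
  [/\ forall j, isproj (p.1 j), forall i j v, p.1 i (p.1 j v) = p.1 j (p.1 i v),
    forall i j, exists l, forall v, p.1 i (p.1 j v) = p.1 l v & exists r, p.1 r xi = xi] /\
  [/\ forall j, digit_tag j <> k -> forall v, p.1 j v = 0,
    forall B, closed_subspace B -> (forall g v, B v -> B (rho g v)) -> B xi -> forall j, B (p.1 j xi),
    forall t, spectrum p.1 xi t -> [/\ irreducible_rep setT (@cyclic_rep R G E lam (p.2 t)),
      forall g, exists j, lam g (p.2 t) = lam (D j) (p.2 t) & sqnorm (p.2 t) = 1] &
    forall g, exists c : C, exists l, (forall i j v,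
      ip (rho g (p.1 i v)) (p.1 j v) = c * ip (p.1 l (p.1 i v)) (p.1 j v)) /\
      forall t, spectrum p.1 xi t -> ip (lam g (p.2 t)) (p.2 t) = c * (t l : bool)%:R].

(** Countability of [L] enters here: radii are coded by numbers, and tuples of radii together with
    [k] by digit indices. *)
Lemma component_exists k xi : xi = 0 \/ corner_vector xi -> exists p, component k xi p.
Proof.
move=> [->|[xi0 [z [n [x [r [F [b [e [hc exi]]]]]]]]]].
  exists (fun _ _ => 0, fun=> 0); split; split => /=.
  - by move=> j; split=> [a u v|v|u v]; rewrite ?scaler0 ?addr0 ?ip0l ?ip0r.
  - by [].
  - by move=> i j; exists 0%N.
  - by exists 0%N.
  - by [].
  - by move=> B [_ [B0 _]].
  - by move=> t /(_ [::] isT).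
  - move=> g; exists 0, 0%N; split=> [i j v|t /(_ [::] isT)//].
    by rewrite ip0r mul0r.
have [f hf] : exists f : R -> nat, forall s s', spectrum_with0 L s -> spectrum_with0 L s' -> f s = f s' -> s = s'.
  have /countable_injP[f hf] := Lcount; exists (fun s => if s == 0 then 0%N else (f s).+1) => s s'.
  have nz u : spectrum_with0 L u -> u != 0 -> u \in L by move=> [Lu|[-> _]]; rewrite ?eqxx// inE.
  have [->|s0] := eqVneq s 0; have [->|s'0] := eqVneq s' 0 => // hs hs' [].
  by apply: hf; exact: nz.
pose idx (m : 'I_n.+1 -> R) : nat := pickle (k, [seq f (m i) | i <- enum 'I_n.+1]).
have idx_inj m m' : spec m -> spec m' -> idx m = idx m' -> m = m'.
  move=> hm hm' /(pcan_inj pickleK)[] /eq_in_map h; apply/funext => i.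
  by apply: hf => //; apply: h; rewrite mem_enum.
have [eps [h1 h2]] := corner_component Lpos LU hrho hc idx_inj exi hD.
exists (corner_bit (L := L) rho x e idx, eps); split; split => /=.
- by move=> j; exact: (corner_bit_proj hrho hc idx_inj).
- by move=> i j v; exact: (corner_bit_comm Lpos hrho hc idx_inj).
- by move=> i j; exact: (corner_bit_closed Lpos hrho hc idx_inj).
- exists (idx r); rewrite (corner_bitE rho x e idx_inj _ (corner_spec hc)) exi -[in LHS]exi.
  by rewrite (corner_r hc) exi.
- move=> j jk v; have [[m _ mj]|h] := corner_bit_cases (L := L) rho x e idx j; last exact: h.
  by case: jk; rewrite -mj /digit_tag /idx pickleK.
- move=> B hB BG Bxi j; have [[m hm <-]|h] := corner_bit_cases (L := L) rho x e idx j; last first.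
    by rewrite h; exact: hB.2.1.
  rewrite (corner_bitE rho x e idx_inj _ hm) exi -[xi in X in B X](hproj_id hB Bxi).
  have hs : subgroup_set (stab x m) by apply: (stab_subgroup LU) => i; exact: (spec_ge0 Lpos i hm).
  rewrite -(fixproj_comm hrho hs _ (isproj_bounded (isproj_hproj hB))); first exact: hproj_in.
  by move=> h u _; exact: hproj_invariant.
- exact: h1.
- exact: h2.
Qed.

End decomposition.

(** Every nonzero projection that commutes with the representation dominates a corner, so corner
    vectors can serve as the good vectors of [orthogonal_family]. *)
Lemma direct_integral_decomposition {R : realType} {L : set R} {U : metricType R} {W : hilbertType R}
    (rho : isom U -> W -> W) :
  (forall r : R, L r -> 0 < r) -> countable L -> is_urysohn L U -> unitary_rep setT rho ->
  direct_integral_of_irreducibles rho.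
Proof.
move=> Lpos Lcount LU hrho; have [D hD] := dense_isometries Lpos LU.
have [|c v c0 [v0 [z [n [x [r [F [b [e [hc ev]]]]]]]]]|p hp pG p0|xi [xig xin xio xit]] :=
    orthogonal_family hrho (good := corner_vector (L := L) rho).
- by move=> v [].
- split; first by move=> /eqP; rewrite scaler_eq0 (negbTE c0) => /eqP.
  exists z, n, x, r, F, b, e; split=> //; rewrite (linZ (isproj_linear (corner_proj hc))) ev//.
- have [n [x [r [F [b [e hc]]]]]] := corner_exists Lpos LU hrho hp pG p0.
  have [v ev0] := corner_neq0 hc; exists (e v); last exact: corner_z hc v.
  split=> //; exists p, n, x, r, F, b, e; split=> //.
  exact: isproj_idem (corner_proj hc).
have [q hq] := choice (fun k => component_exists Lpos Lcount LU hrho hD k (xig k)).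
apply: (@assembled_direct_integral _ _ _ _ rho _ D _ hrho (@translation_isometric R (isom U))
  trivial_cyclic_irreducible translation_deltaT sqnorm_deltaT digit_tag (fun k => (q k).1) xi (fun k => (q k).2)).
- by move=> k; have [[]] := hq k.
- by move=> k; have [[]] := hq k.
- by move=> k; have [[]] := hq k.
- by move=> k; have [[]] := hq k.
- by move=> k; have [_ []] := hq k.
- exact: xin.
- move=> k k' kk' g i j.
  have [_ [_ cyc _ _]] := hq k; have [_ [_ cyc' _ _]] := hq k'.
  have h1 := cyc _ (orth_orbit_closed hrho _) (fun h v => orth_orbit_rho hrho h (v := _)) (xio _ _ kk') i.
  have h2 := cyc' _ (orth_orbit_closed hrho _) (fun h v => orth_orbit_rho hrho h (v := _)) (orth_orbit_sym hrho h1) j.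
  exact: (orth_orbit_sym hrho h2 g).
- exact: xit.
- by move=> k; have [_ [_ _ h _]] := hq k; exact: h.
- by move=> k; have [_ [_ _ _ h]] := hq k; exact: h.
Qed.
Theorem theorem1p5 (R : realType) (L : set R) (U : metricType R)
    (Lpos : forall r : R, L r -> 0 < r) (Lcount : countable L)
    (LU : is_urysohn L U) :
  [/\ (forall (W : hilbertType R) (rho : isom U -> W -> W),
        irreducible_rep setT rho ->
        exists (B : labeled_set L U) (V : hilbertType R)
            (nu : isom U -> V -> V),
          ball_rep B nu /\ is_induced (union_stabilizer B) nu rho),
      (forall (B1 B2 : labeled_set L U) (V1 V2 W1 W2 : hilbertType R)
          (nu1 : isom U -> V1 -> V1) (nu2 : isom U -> V2 -> V2)
          (rho1 : isom U -> W1 -> W1) (rho2 : isom U -> W2 -> W2),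
        ball_rep B1 nu1 -> ball_rep B2 nu2 ->
        irreducible_rep setT rho1 -> irreducible_rep setT rho2 ->
        is_induced (union_stabilizer B1) nu1 rho1 ->
        is_induced (union_stabilizer B2) nu2 rho2 ->
        (equivalent_rep setT rho1 rho2 <->
         exists g : isom U, g @` balls_union B1 = balls_union B2 /\
           equivalent_rep (union_stabilizer B1) nu1
             (fun h => nu2 (g * h * g^-1)%g))),
      type_I_group R (isom U) &
      (forall (W : hilbertType R) (rho : isom U -> W -> W),
        unitary_rep setT rho -> direct_integral_of_irreducibles rho)].
Proof.
split.
- by move=> W rho irr; exact: (irreducible_is_induced Lpos LU irr).
- move=> B1 B2 V1 V2 W1 W2 nu1 nu2 rho1 rho2 br1 br2 _ _ ind1 ind2; split.
    exact: configuration_of_equivalent.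
  by move=> [g [gB eqv]]; exact: (equivalent_of_configuration br1 br2 ind1 ind2 gB).
- by move=> W rho hrho; exact: (rep_type_I Lpos LU hrho).
- by move=> W rho hrho; exact: (direct_integral_decomposition Lpos Lcount LU hrho).
Qed.
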